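(* Let $\rho_2>0$ and $0<\beta'<\beta$. Let $\{\mathcal{T}_1,\mathcal{T}_2,(\mathcal{E}^{0}_{h_1})_{0\le h_1\le \iota_1-1},(S^{0}_{d_{h_1}})_{0\le h_1\le \iota_1-1}\}$ be an admissible set. For every $0\le h_1\le \iota_1-1$ the function $$u_{d_{h_1}}(t_1,t_2,z,\epsilon)=\frac{1}{(2\pi)^{1/2}}\int_{-\infty}^{\infty}\int_{L_{\xi_{h_1}}}\omega_{d_{h_1}}(u,m,\epsilon)\exp\left(-\left(\frac{u}{\epsilon^{\lambda_1}t_1}\right)^{k_1}-\left(\frac{u}{\epsilon^{\lambda_2}t_2}\right)^{k_2}\right)e^{izm}\frac{du}{u}dm$$ defines a holomorphic and bounded function on $\mathcal{T}_1\times(\mathcal{T}_2\cap D(0,\rho_2))\times H_{\beta'}\times\mathcal{E}^0_{h_1}$, solving (E) (called an outer solution). Moreover, every two consecutive outer solutions, which are jointly defined on $\mathcal{T}_1\times(\mathcal{T}_2\cap D(0,\rho_2))\times H_{\beta'}\times(\mathcal{E}^0_{h_1}\cap\mathcal{E}^0_{h_1+1})$, satisfy $$\sup_{t_1\in\mathcal{T}_1,\,t_2\in\mathcal{T}_2\cap D(0,\rho_2),\,z\in H_{\beta'}}|u_{d_{h_1+1}}(t_1,t_2,z,\epsilon)-u_{d_{h_1}}(t_1,t_2,z,\epsilon)|\le\hat{C}\exp\left(-\frac{\hat{D}}{|\epsilon|^{\lambda_2k_2}}\right),\quad\epsilon\in\mathcal{E}^0_{h_1}\cap\mathcal{E}^0_{h_1+1},$$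 for two positive constants $\hat{C},\hat{D}>0$.
   Context: Notation: $D(0,r)$, $\overline{D}(0,r)$ are the open and closed discs in $\mathbb{C}$; $H_\beta=\{z\in\mathbb{C}:|\mathrm{Im}(z)|<\beta\}$. For $\beta,\mu\in\mathbb{R}$, $E_{(\beta,\mu)}$ is the Banach space of continuous $h:\mathbb{R}\to\mathbb{C}$ with $\|h\|_{(\beta,\mu)}=\sup_{m\in\mathbb{R}}(1+|m|)^{\mu}e^{\beta|m|}|h(m)|<\infty$. $\mathcal{F}^{-1}(f)(z)=(2\pi)^{-1/2}\int_{-\infty}^{\infty}f(m)e^{izm}dm$. $L_\gamma=[0,\infty)e^{\gamma\sqrt{-1}}$. Data. Let $1\le k_1<k_2$, $D_1,D_2\ge2$, $\lambda_1,\lambda_2\ge 1$ be integers, and $\delta_{\ell_1},\delta_{\ell_2},\Delta_{\ell_1\ell_2}$ ($1\le\ell_1\le D_1$, $1\le\ell_2\le D_2$) non-negative integers such that $\Delta_{D_1D_2}=\lambda_1k_1\delta_{D_1}+\lambda_2k_2\delta_{D_2}$, $\lambda_2k_2>\lambda_1k_1$, and, for $1\le\ell_1\le D_1-1$, $1\le\ell_2\le D_2-1$, $\Delta_{\ell_1\ell_2}>\lambda_1k_1\delta_{\ell_1}+\lambda_2k_2\delta_{\ell_2}$ and $k_1\delta_{D_1}+k_2\delta_{D_2}\ge k_1\delta_{\ell_1}+k_2\delta_{\ell_2}$. (The families $\delta_{\ell_1}$ and $\delta_{\ell_2}$ are two separate families, attached to $t_1$ and $t_2$ respectively.) Let $Q,R_{D_1D_2},R_{\ell_1\ell_2}\in\mathbb{C}[X]$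 with $\deg R_{\ell_1\ell_2}\le\deg R_{D_1D_2}$, $R_{D_1D_2}(im)\ne0$ for $m\in\mathbb{R}$, and $Q(im)/R_{D_1D_2}(im)\in A:=\{z: r^1\le|z|\le r^2,\ \arg z\in(\alpha,\alpha')\}$ for all $m\in\mathbb{R}$, for some $0<r^1<r^2$, $\alpha<\alpha'$. Let $\beta,\nu>0$, $\mu>1+\deg R_{\ell_1\ell_2}$ for all $1\le\ell_j\le D_j-1$, with $\mu>1$, and let $k'$ be an integer with $k_1<k'<k_2$. Let $\epsilon_0>0$. For $1\le\ell_j\le D_j-1$ let $C_{\ell_1\ell_2}(m,\epsilon)$ be such that $C_{\ell_1\ell_2}(\cdot,\epsilon)\in E_{(\beta,\mu)}$ with $\sup_{\epsilon\in D(0,\epsilon_0)}\|C_{\ell_1\ell_2}(\cdot,\epsilon)\|_{(\beta,\mu)}\le\mathcal{C}_{\ell_1\ell_2}<\infty$, and $c_{\ell_1\ell_2}(z,\epsilon)=\mathcal{F}^{-1}(m\mapsto C_{\ell_1\ell_2}(m,\epsilon))(z)$ holomorphic on $H_\beta\times D(0,\epsilon_0)$. Let $\psi:\mathbb{C}\times\mathbb{R}\times D(0,\epsilon_0)\to\mathbb{C}$ be entire in the first variable, continuous in the second, holomorphic in the third, with $|\psi(\tau,m,\epsilon)|\le C_\psi(1+|m|)^{-\mu}e^{-\beta|m|}e^{\nu|\tau|^{k'}}|\tau|$, $C_\psi>0$. Set $F(T_1,T_2,m,\epsilon)=\int_{L_\gamma}\psi(u,m,\epsilon)\exp(-(u/T_1)^{k_1}-(u/T_2)^{k_2})\frac{du}{u}$,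 where the direction $\gamma$ may be rotated with $(T_1,T_2)$ (analytic continuation), and $f(t_1,t_2,z,\epsilon)=\mathcal{F}^{-1}(m\mapsto F(\epsilon^{\lambda_1}t_1,\epsilon^{\lambda_2}t_2,m,\epsilon))(z)$. Main problem (E): $$Q(\partial_z)u=\epsilon^{\Delta_{D_1D_2}}(t_1^{k_1+1}\partial_{t_1})^{\delta_{D_1}}(t_2^{k_2+1}\partial_{t_2})^{\delta_{D_2}}R_{D_1D_2}(\partial_z)u+\sum_{1\le\ell_1\le D_1-1,\,1\le\ell_2\le D_2-1}\epsilon^{\Delta_{\ell_1\ell_2}}(t_1^{k_1+1}\partial_{t_1})^{\delta_{\ell_1}}(t_2^{k_2+1}\partial_{t_2})^{\delta_{\ell_2}}c_{\ell_1\ell_2}(z,\epsilon)R_{\ell_1\ell_2}(\partial_z)u+f,$$ $u=u(t_1,t_2,z,\epsilon)$, with initial data $u(0,t_2,z,\epsilon)\equiv u(t_1,0,z,\epsilon)\equiv0$. The function $\omega_d$. Let $P_m(\tau)=Q(im)-k_1^{\delta_{D_1}}k_2^{\delta_{D_2}}\tau^{k_1\delta_{D_1}+k_2\delta_{D_2}}R_{D_1D_2}(im)$ with roots $q_l(m)$, $0\le l\le k_1\delta_{D_1}+k_2\delta_{D_2}-1$. The aperture of $A$ is taken small enough so that the roots $q_l(m)$ stay in a union $\mathcal{U}$ of unbounded sectors with vertex 0 not covering a full neighborhood of $0$ in $\mathbb{C}^\star$; $\rho>0$ is such that $|q_l(m)|\ge2\rho$ for all $l,m$. A sector $S_d$ (open,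 unbounded, vertex $0$, bisecting direction $d\in\mathbb{R}$) is called suitable if $S_d\cap\mathcal{U}=\emptyset$ and there is $\mathfrak{m}>0$ with $|\tau-q_l(m)|\ge\mathfrak{m}(1+|\tau|)$ for all $l$, $m\in\mathbb{R}$, $\tau\in S_d\cup D(0,\rho)$. $\mathrm{Exp}^d_{(\nu,\beta,\mu,k')}$ is the Banach space of continuous $h:(S_d\cup\overline{D}(0,\rho))\times\mathbb{R}\to\mathbb{C}$, holomorphic in $\tau$ on $S_d\cup D(0,\rho)$, with finite norm $\|h\|=\sup_{\tau,m}(1+|m|)^\mu e^{\beta|m|}e^{-\nu|\tau|^{k'}}|\tau|^{-1}|h(\tau,m)|$. Fix $\varpi>0$; $\epsilon_0$ and $C_\psi$ are assumed small enough so that for each suitable sector considered and every $\epsilon\in D(0,\epsilon_0)$ the map $$\mathcal{H}_\epsilon(\omega)=\frac{1}{P_m(\tau)}\Big(\sum_{\ell_1,\ell_2}\epsilon^{\Delta_{\ell_1\ell_2}-\lambda_1k_1\delta_{\ell_1}-\lambda_2k_2\delta_{\ell_2}}(k_1\tau^{k_1})^{\delta_{\ell_1}}(k_2\tau^{k_2})^{\delta_{\ell_2}}\frac{1}{(2\pi)^{1/2}}\int_{-\infty}^\infty C_{\ell_1\ell_2}(m-m_1,\epsilon)R_{\ell_1\ell_2}(im_1)\omega(\tau,m_1)dm_1+\psi(\tau,m,\epsilon)\Big)$$ (sum over $1\le\ell_j\le D_j-1$) is a $\tfrac12$-contraction of the closed ball of radius $\varpi$ of $\mathrm{Exp}^d_{(\nu,\beta,\mu,k')}$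 into itself; $\omega_d(\tau,m,\epsilon)$ denotes its fixed point. Good covering. $(\mathcal{E}^0_{h_1})_{0\le h_1\le\iota_1-1}$, $\iota_1\ge2$, is a good covering of $\mathbb{C}^\star$ of opening $\pi/(\lambda_2k_2)$: open sectors with vertex $0$ contained in $D(0,\epsilon_0)$, with $\mathcal{E}^0_{h_1}\cap\mathcal{E}^0_{h_1+1}\neq\emptyset$ for all $h_1$ (indices cyclic, $\mathcal{E}^0_{\iota_1}:=\mathcal{E}^0_0$), the intersection of any three different elements is empty, the union covers a punctured disc centered at $0$, and each $\mathcal{E}^0_{h_1}$ has opening larger than $\pi/(\lambda_2k_2)$. Admissible set. $\mathcal{T}_1$ is a bounded sector and $\mathcal{T}_2$ an unbounded sector, both with vertex $0$; $S^0_{d_{h_1}}$ is a suitable infinite sector of bisecting direction $d_{h_1}$. $\{\mathcal{T}_1,\mathcal{T}_2,(\mathcal{E}^0_{h_1}),(S^0_{d_{h_1}})\}$ is admissible if there is $\delta>0$ such that for all $h_1$, all $t_j\in\mathcal{T}_j$ ($j=1,2$) and $\epsilon\in\mathcal{E}^0_{h_1}$ there is $\xi_{h_1}\in\mathbb{R}$ (possibly depending on $t_1,t_2,\epsilon$) with $e^{\sqrt{-1}\xi_{h_1}}\in S^0_{d_{h_1}}$ and $k_j\xi_{h_1}-k_j\arg(\epsilon^{\lambda_j}t_j)\in(-\frac{\pi}{2}+\delta,\frac{\pi}{2}-\delta)$ for $j=1,2$. This $\xi_{h_1}$ is the direction used in the integral defining $u_{d_{h_1}}$.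
   Formalization: Each sector S_{d_{h_1}} is assumed to have opening at most 2π − π/k_2; this is automatic if k_1δ_{D_1}+k_2δ_{D_2} ≥ 2, while otherwise the admissible directions may lie on both sides of a root of P_m and u_{d_{h_1}} can jump by a residue. *)

(* Defs.v *)
(* The complex numbers over [R : realType] are [R[i]]; the normed-module
   structure (over [R[i]]) is the one of the regular module [R[i]^o], and
   [normc] is the modulus with values in [R]. *)
From HB Require Import structures.
From mathcomp Require Import all_boot all_order all_algebra.
From mathcomp Require Import complex.
From mathcomp Require Import all_classical all_reals all_analysis.

Set Implicit Arguments.
Unset Strict Implicit.
Unset Printing Implicit Defensive.

Import Order.TTheory GRing.Theory Num.Theory numFieldNormedType.Exports.
Import Normc.

Local Open Scope classical_set_scope.
Local Open Scope ring_scope.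
Local Open Scope complex_scope.

Notation "'Cx' R" := (R[i]^o) (at level 10, R at level 9, only parsing).

Definition expi (R : realType) (theta : R) : Cx R := cos theta +i* sin theta.

Definition cexp (R : realType) (z : Cx R) : Cx R :=
  (expR (complex.Re z))%:C * expi (complex.Im z).

(* The argument is multivalued: [theta] is one of its determinations. *)
Definition is_arg (R : realType) (z : Cx R) (theta : R) : Prop :=
  z = (normc z)%:C * expi theta.

(* Complex (Frechet) differentiability; used on open sets only. *)
Definition holomorphic_on (R : realType) (V : normedModType R[i]) (A : set V)
    (f : V -> Cx R) : Prop :=
  forall x, A x -> differentiable f x.

Definition disc (R : realType) (r : R) : set (Cx R) := [set z | normc z < r].
Definition cdisc (R : realType) (r : R) : set (Cx R) := [set z | normc z <= r].
Definition strip (R : realType) (b : R) : set (Cx R) :=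
  [set z | `|complex.Im z| < b].

(* Open sector with vertex 0, bisecting direction [c], opening [a] and radius
   [r]; it is unbounded when [r = +oo]. *)
Definition sector (R : realType) (c a : R) (r : \bar R) : set (Cx R) :=
  [set z | exists s theta : R,
     [/\ 0 < s, (s%:E < r)%E, `|theta - c| < a / 2 & z = s%:C * expi theta]].

Definition bounded_sector (R : realType) (A : set (Cx R)) : Prop :=
  exists c a r : R,
    [/\ 0 < a, a <= 2 * pi, 0 < r & A = sector c a r%:E].

Definition unbounded_sector (R : realType) (A : set (Cx R)) : Prop :=
  exists c a : R, [/\ 0 < a, a <= 2 * pi & A = sector c a +oo%E].

Definition Cintegral (R : realType) (D : set R) (f : R -> Cx R) : Cx R :=
  Rintegral lebesgue_measure D (fun x => complex.Re (f x)) +i*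
  Rintegral lebesgue_measure D (fun x => complex.Im (f x)).

Definition Cintegrable (R : realType) (D : set R) (f : R -> Cx R) : Prop :=
  lebesgue_measure.-integrable D (fun x => (complex.Re (f x))%:E) /\
  lebesgue_measure.-integrable D (fun x => (complex.Im (f x))%:E).

(* The integral of [g u du] along the half-line [0, +oo[ e^{i gamma},
   parametrized by [u = r e^{i gamma}]. *)
Definition ray_integrand (R : realType) (gamma : R) (g : Cx R -> Cx R) (r : R)
    : Cx R :=
  g (r%:C * expi gamma) * expi gamma.

Definition ray_integral (R : realType) (gamma : R) (g : Cx R -> Cx R) : Cx R :=
  Cintegral `[0, +oo[ (ray_integrand gamma g).

Definition ray_integrable (R : realType) (gamma : R) (g : Cx R -> Cx R) : Prop :=
  Cintegrable `[0, +oo[ (ray_integrand gamma g).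

Definition fourier_cst (R : realType) : Cx R := ((Num.sqrt (2 * pi))^-1)%:C.

Definition inv_fourier (R : realType) (f : R -> Cx R) (z : Cx R) : Cx R :=
  fourier_cst R * Cintegral setT (fun m => f m * cexp ('i * z * m%:C)).

Definition E_norm (R : realType) (beta mu : R) (h : R -> Cx R) : \bar R :=
  ereal_sup (range (fun m : R =>
    ((1 + `|m|) `^ mu * expR (beta * `|m|) * normc (h m))%:E)).

Definition E_space (R : realType) (beta mu : R) (h : R -> Cx R) : Prop :=
  continuous h /\ (E_norm beta mu h < +oo)%E.

(* The point [tau = 0] is left out because of the weight |tau|^{-1}; finiteness
   of the norm and continuity force [h 0 m = 0]. *)
Definition Exp_norm (R : realType) (S : set (Cx R)) (rho nu beta mu : R)
    (k : nat) (h : Cx R -> R -> Cx R) : \bar R :=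
  ereal_sup [set x | exists (tau : Cx R) (m : R),
    [/\ (S `|` cdisc rho) tau, tau != 0 &
     x = ((1 + `|m|) `^ mu * expR (beta * `|m|) * expR (- nu * normc tau ^+ k)
          * (normc tau)^-1 * normc (h tau m))%:E]].

(* Elements are represented by total functions, only constrained on
   [(S `|` cdisc rho) `*` setT]. *)
Definition Exp_space (R : realType) (S : set (Cx R)) (rho nu beta mu : R)
    (k : nat) (h : Cx R -> R -> Cx R) : Prop :=
  [/\ {within (S `|` cdisc rho) `*` [set: R],
         continuous (fun x : Cx R * R => h x.1 x.2)},
      forall m, holomorphic_on (S `|` disc rho) (h ^~ m) &
      (Exp_norm S rho nu beta mu k h < +oo)%E].

Definition Exp_ball (R : realType) (S : set (Cx R)) (rho nu beta mu : R)
    (k : nat) (r : R) (h : Cx R -> R -> Cx R) : Prop :=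
  Exp_space S rho nu beta mu k h /\ (Exp_norm S rho nu beta mu k h <= r%:E)%E.

(* [dl1], [dl2] are the two families delta_{l1}, delta_{l2}, [Dl] is
   Delta_{l1 l2}, [Rl] is R_{l1 l2} and [Cl l1 l2 m eps] is
   C_{l1 l2}(m, eps); indices outside the stated ranges are never used. *)
Record problem (R : realType) := Problem {
  k1 : nat; k2 : nat;
  D1 : nat; D2 : nat;
  lam1 : nat; lam2 : nat;
  dl1 : nat -> nat; dl2 : nat -> nat;
  Dl : nat -> nat -> nat;
  Q : {poly R[i]};
  Rl : nat -> nat -> {poly R[i]};
  Cl : nat -> nat -> R -> Cx R -> Cx R;
  psi : Cx R -> R -> Cx R -> Cx R
}.

Definition ccoef (R : realType) (p : problem R) (l1 l2 : nat) (z eps : Cx R)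
    : Cx R :=
  inv_fourier (fun m => Cl p l1 l2 m eps) z.

Definition expkernel (R : realType) (p : problem R) (T1 T2 u : Cx R) : Cx R :=
  cexp (- (u / T1) ^+ k1 p - (u / T2) ^+ k2 p).

(* [k_j xi - k_j arg T_j] lies in (- pi/2 + delta, pi/2 - delta), j = 1, 2. *)
Definition decay_direction (R : realType) (p : problem R) (delta : R)
    (T1 T2 : Cx R) (xi : R) : Prop :=
  exists theta1 theta2 : R,
    [/\ is_arg T1 theta1, is_arg T2 theta2,
        `|(k1 p)%:R * xi - (k1 p)%:R * theta1| < pi / 2 - delta &
        `|(k2 p)%:R * xi - (k2 p)%:R * theta2| < pi / 2 - delta].

(* The direction of integration is rotated with (T1, T2): any [gamma] in which
   both exponentials decay may be used. The set of these directions is an arc of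
   the circle and psi is entire in u, so F does not depend on the one picked. *)
Definition forcing_direction (R : realType) (p : problem R) (T1 T2 : Cx R) : R :=
  xget 0 [set gamma | decay_direction p 0 T1 T2 gamma].

Definition F_forcing (R : realType) (p : problem R) (T1 T2 : Cx R) (m : R)
    (eps : Cx R) : Cx R :=
  ray_integral (forcing_direction p T1 T2)
    (fun u => psi p u m eps * expkernel p T1 T2 u / u).

Definition forcing (R : realType) (p : problem R) (t1 t2 z eps : Cx R) : Cx R :=
  inv_fourier
    (fun m => F_forcing p (eps ^+ lam1 p * t1) (eps ^+ lam2 p * t2) m eps) z.

Definition Cfun4 (R : realType) := Cx R -> Cx R -> Cx R -> Cx R -> Cx R.

Definition euler1 (R : realType) (k : nat) (u : Cfun4 R) : Cfun4 R :=
  fun t1 t2 z eps => t1 ^+ k.+1 * derive1 (fun s : Cx R => u s t2 z eps) t1.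

Definition euler2 (R : realType) (k : nat) (u : Cfun4 R) : Cfun4 R :=
  fun t1 t2 z eps => t2 ^+ k.+1 * derive1 (fun s : Cx R => u t1 s z eps) t2.

Definition partial_z (R : realType) (u : Cfun4 R) : Cfun4 R :=
  fun t1 t2 z eps => derive1 (fun s : Cx R => u t1 t2 s eps) z.

Definition poly_dz (R : realType) (A : {poly R[i]}) (u : Cfun4 R) : Cfun4 R :=
  fun t1 t2 z eps =>
    \sum_(i < size A) A`_i * iter i (@partial_z R) u t1 t2 z eps.

Definition solves_at (R : realType) (p : problem R) (u : Cfun4 R)
    (t1 t2 z eps : Cx R) : Prop :=
  poly_dz (Q p) u t1 t2 z eps =
    eps ^+ Dl p (D1 p) (D2 p) *
      iter (dl1 p (D1 p)) (@euler1 R (k1 p))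
        (iter (dl2 p (D2 p)) (@euler2 R (k2 p))
          (poly_dz (Rl p (D1 p) (D2 p)) u)) t1 t2 z eps
    + \sum_(1 <= l1 < D1 p) \sum_(1 <= l2 < D2 p)
        eps ^+ Dl p l1 l2 *
          iter (dl1 p l1) (@euler1 R (k1 p))
            (iter (dl2 p l2) (@euler2 R (k2 p))
              (fun s1 s2 x e =>
                 ccoef p l1 l2 x e * poly_dz (Rl p l1 l2) u s1 s2 x e))
            t1 t2 z eps
    + forcing p t1 t2 z eps.

Definition Npow (R : realType) (p : problem R) : nat :=
  (k1 p * dl1 p (D1 p) + k2 p * dl2 p (D2 p))%N.

(* The q_l(m) are the roots of this polynomial. *)
Definition Pm (R : realType) (p : problem R) (m : R) : {poly R[i]} :=
  ((Q p).['i * m%:C])%:P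
  - ((k1 p)%:R ^+ dl1 p (D1 p) * (k2 p)%:R ^+ dl2 p (D2 p)
     * (Rl p (D1 p) (D2 p)).['i * m%:C]) *: 'X^(Npow p).

Definition Hmap (R : realType) (p : problem R) (eps : Cx R)
    (w : Cx R -> R -> Cx R) : Cx R -> R -> Cx R :=
  fun tau m =>
    ((Pm p m).[tau])^-1 *
    (\sum_(1 <= l1 < D1 p) \sum_(1 <= l2 < D2 p)
       eps ^+ (Dl p l1 l2 - lam1 p * k1 p * dl1 p l1 - lam2 p * k2 p * dl2 p l2)%N
       * ((k1 p)%:R * tau ^+ k1 p) ^+ dl1 p l1
       * ((k2 p)%:R * tau ^+ k2 p) ^+ dl2 p l2
       * (fourier_cst R * Cintegral setT (fun m1 : R =>
            Cl p l1 l2 (m - m1) eps * (Rl p l1 l2).['i * m1%:C] * w tau m1))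
     + psi p tau m eps).

Definition half_contraction (R : realType) (p : problem R) (S : set (Cx R))
    (rho nu beta mu : R) (k : nat) (varpi : R) (eps : Cx R) : Prop :=
  (forall w, Exp_ball S rho nu beta mu k varpi w ->
     Exp_ball S rho nu beta mu k varpi (Hmap p eps w)) /\
  (forall w1 w2, Exp_ball S rho nu beta mu k varpi w1 ->
     Exp_ball S rho nu beta mu k varpi w2 ->
     (Exp_norm S rho nu beta mu k
        (fun tau m => Hmap p eps w1 tau m - Hmap p eps w2 tau m)%R
      <= (2^-1)%:E * Exp_norm S rho nu beta mu k
                       (fun tau m => w1 tau m - w2 tau m)%R)%E).

Definition is_Hfixpoint (R : realType) (p : problem R) (S : set (Cx R))
    (rho nu beta mu : R) (k : nat) (varpi : R) (eps : Cx R)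
    (w : Cx R -> R -> Cx R) : Prop :=
  Exp_ball S rho nu beta mu k varpi w /\
  (forall tau m, (S `|` cdisc rho) tau -> Hmap p eps w tau m = w tau m).

Definition union_of_unbounded_sectors (R : realType) (U : set (Cx R)) : Prop :=
  exists F : set (set (Cx R)),
    (forall A, F A -> unbounded_sector A) /\ U = \bigcup_(A in F) A.

Definition suitable (R : realType) (p : problem R) (U : set (Cx R)) (rho : R)
    (S : set (Cx R)) : Prop :=
  S `&` U = set0 /\
  exists2 mm : R, 0 < mm &
    forall (m : R) (q tau : Cx R), root (Pm p m) q -> (S `|` disc rho) tau ->
      mm * (1 + normc tau) <= normc (tau - q).

(* [ordS] is the cyclic successor on 'I_n. *)
Definition good_covering (R : realType) (eps0 opening : R) (n : nat)
    (E : 'I_n -> set (Cx R)) : Prop :=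
  [/\ forall h, exists c a r : R,
        [/\ opening < a, a <= 2 * pi, 0 < r & E h = sector c a r%:E],
      forall h, E h `<=` disc eps0,
      forall h, E h `&` E (ordS h) !=set0,
      forall h h' h'', h != h' -> h' != h'' -> h != h'' ->
        E h `&` E h' `&` E h'' = set0 &
      exists2 r : R, 0 < r &
        [set z | 0 < normc z < r] `<=` \bigcup_h E h].

(* [xi] is a selection of the directions required by admissibility. *)
Definition admissible (R : realType) (p : problem R) (T1 T2 : set (Cx R))
    (n : nat) (E S : 'I_n -> set (Cx R))
    (xi : 'I_n -> Cx R -> Cx R -> Cx R -> R) : Prop :=
  exists2 delta : R, 0 < delta &
    forall (h : 'I_n) (t1 t2 eps : Cx R), T1 t1 -> T2 t2 -> E h eps ->
      S h (expi (xi h t1 t2 eps)) /\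
      decay_direction p delta (eps ^+ lam1 p * t1) (eps ^+ lam2 p * t2)
        (xi h t1 t2 eps).

Definition outer_integrand (R : realType) (p : problem R)
    (w : Cx R -> R -> Cx R -> Cx R) (t1 t2 z eps : Cx R) (m : R) (u : Cx R)
    : Cx R :=
  w u m eps * expkernel p (eps ^+ lam1 p * t1) (eps ^+ lam2 p * t2) u
  * cexp ('i * z * m%:C) / u.

Definition outer_solution (R : realType) (p : problem R)
    (w : Cx R -> R -> Cx R -> Cx R) (xi : Cx R -> Cx R -> Cx R -> R) : Cfun4 R :=
  fun t1 t2 z eps =>
    fourier_cst R * Cintegral setT (fun m : R =>
      ray_integral (xi t1 t2 eps) (outer_integrand p w t1 t2 z eps m)).

Definition outer_defined (R : realType) (p : problem R)
    (w : Cx R -> R -> Cx R -> Cx R) (xi : Cx R -> Cx R -> Cx R -> R)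
    (t1 t2 z eps : Cx R) : Prop :=
  (forall m : R,
     ray_integrable (xi t1 t2 eps) (outer_integrand p w t1 t2 z eps m)) /\
  Cintegrable setT (fun m : R =>
     ray_integral (xi t1 t2 eps) (outer_integrand p w t1 t2 z eps m)).

(* Main.v *)
(* The outer solution is a Borel-Laplace-Fourier integral of omega.  Multiplying
   the integrand by k_j (u / eps^(lam_j))^(k_j) amounts to applying t_j^(k_j + 1) d/dt_j,
   multiplying it by i m to applying d/dz, and convolution in m to multiplying
   by c_(l1 l2)(z, eps); so P_m omega = sum + psi becomes equation (E).  Here
   the integration ray may be kept fixed near a given point, because the
   integral does not depend on the direction inside the set where both
   exponentials decay (Cauchy's theorem in polar coordinates); the same fact
   identifies the forcing term with the transform of psi.

   Holomorphy in eps needs omega to be holomorphic in eps: omega is the limit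
   of the iterates of H_eps from 0, which are holomorphic because the Fourier
   data C_(l1 l2)(m, .) are recovered from c_(l1 l2) by Poisson kernels.

   As these iterates do not depend on the sector, all the omega_(d_h) coincide
   on the disc of radius rho.  Two consecutive outer solutions therefore differ
   by integrals over an arc of radius rho / 2 and two tails beyond it, where
   exp(- (u / (eps^(lam2) t2))^(k2)) is exponentially small in
   1 / |eps|^(lam2 k2) since t2 is bounded by rho2. *)
Require Import Defs.
From HB Require Import structures.
From mathcomp Require Import all_boot all_order all_algebra.
From mathcomp Require Import complex.
From mathcomp Require Import all_classical all_reals all_analysis.
From mathcomp Require Import measurable_realfun ring lra.

Import Order.TTheory GRing.Theory Num.Theory numFieldNormedType.Exports.
Import Normc.

Local Open Scope classical_set_scope.
Local Open Scope ring_scope.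
Local Open Scope complex_scope.

Set Implicit Arguments.
Unset Strict Implicit.
Unset Printing Implicit Defensive.

(** * Complex numbers and norms *)

(** All contours used consist of rays and arcs around an origin: the Laplace rays, the arcs joining
    them, and the circles behind the Cauchy estimates. Goursat's theorem is therefore proved only
    for polar rectangles. From it comes a second-order remainder estimate whose bound is linear in a
    bound for the function. This linearity lets one integrable majorant of an integrand control its
    differential and its remainder as well, so differentiation under the integral sign needs no
    separate majorant of the derivatives. The admissible directions are an arbitrary selection, with
    no continuity in (t1, t2, eps), so no derivative is taken through them: a direction is frozen at
    the base point, at the price of replacing the margin [delta] by [delta / 2]. The growth exp (nu
    |u|^k') is beaten by the order [k2] factor of the kernel alone, since k1 < k' < k2; the [k1]
    factor is merely bounded by 1, or kept to produce a factor |T1|. Polynomials in m are paid for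
    by a small loss in the decay rate beta, which is possible because beta' < beta. *)

Section ComplexBasics.
Variable R : realType.
Local Notation C := (Cx R).
Implicit Types (x y z w : C) (a b r e : R).

Lemma cReD x y : complex.Re (x + y) = complex.Re x + complex.Re y.
Proof. by case: x y => ? ? [? ?]. Qed.
Lemma cImD x y : complex.Im (x + y) = complex.Im x + complex.Im y.
Proof. by case: x y => ? ? [? ?]. Qed.
Lemma cReN x : complex.Re (- x) = - complex.Re x.
Proof. by case: x. Qed.
Lemma cImN x : complex.Im (- x) = - complex.Im x.
Proof. by case: x. Qed.
Lemma cReB x y : complex.Re (x - y) = complex.Re x - complex.Re y.
Proof. by rewrite cReD cReN. Qed.
Lemma cImB x y : complex.Im (x - y) = complex.Im x - complex.Im y.
Proof. by rewrite cImD cImN. Qed.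
Lemma cReM x y : complex.Re (x * y) =
  complex.Re x * complex.Re y - complex.Im x * complex.Im y.
Proof. by case: x y => ? ? [? ?]. Qed.
Lemma cImM x y : complex.Im (x * y) =
  complex.Re x * complex.Im y + complex.Im x * complex.Re y.
Proof. by case: x y => ? ? [? ?]. Qed.
Lemma eq_C x y : complex.Re x = complex.Re y -> complex.Im x = complex.Im y -> x = y.
Proof. by case: x y => ? ? [? ?] /= -> ->. Qed.

Lemma normc_ge0 z : 0 <= normc z.
Proof. by case: z => a b /=; exact: sqrtr_ge0. Qed.
Lemma normcB x y : normc (x - y) <= normc x + normc y.
Proof. by apply: le_trans (le_normcD _ _) _; rewrite normcN. Qed.
Lemma normc_sym x y : normc (x - y) = normc (y - x).
Proof. by rewrite -normcN opprB. Qed.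
Lemma normc_tri x y z : normc (x - z) <= normc (x - y) + normc (y - z).
Proof. by apply: le_trans (le_normcD _ _); rewrite addrA subrK. Qed.
Lemma le_normcD2 x y a b : normc x <= a -> normc y <= b -> normc (x + y) <= a + b.
Proof. by move=> *; apply: le_trans (le_normcD _ _) _; rewrite lerD. Qed.
Lemma le_normcB2 x y a b : normc x <= a -> normc y <= b -> normc (x - y) <= a + b.
Proof. by move=> *; apply: le_trans (normcB _ _) _; rewrite lerD. Qed.
Lemma normc_real a : normc (a%:C : C) = `|a|.
Proof. by rewrite /= expr0n addr0 sqrtr_sqr. Qed.
Lemma le_Re_normc z : `|complex.Re z| <= normc z.
Proof. by rewrite -lecR; exact: normc_ge_Re. Qed.
Lemma le_Im_normc z : `|complex.Im z| <= normc z.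
Proof.
by case: z => a b /=; rewrite -sqrtr_sqr ler_wsqrtr// lerDr sqr_ge0.
Qed.
Lemma normc_le_ReIm z : normc z <= `|complex.Re z| + `|complex.Im z|.
Proof.
case: z => a b; rewrite [X in normc X](_ : _ = a%:C + 'i%C * b%:C :> C); last first.
  by rewrite [LHS]complexE.
apply: le_trans (le_normcD _ _) _; rewrite normcM !normc_real.
by rewrite {1}/normc/= expr0n expr1n/= add0r sqrtr1 mul1r.
Qed.
Lemma normc_i : normc ('i%C : C) = 1.
Proof. by rewrite /normc/= expr0n expr1n/= add0r sqrtr1. Qed.
Lemma normcX z n : normc (z ^+ n) = normc z ^+ n.
Proof. by elim: n => [|n IH]; rewrite ?normc1 ?expr0 // !exprS normcM IH. Qed.
Lemma normc_gt0 z : z != 0 -> 0 < normc z.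
Proof.
move=> z0; rewrite lt_neqAle normc_ge0 andbT eq_sym.
by apply: contra z0 => /eqP/eq0_normc ->.
Qed.
Lemma normc_sum (I : Type) (s : seq I) (P : pred I) (F : I -> C) :
  normc (\sum_(i <- s | P i) F i) <= \sum_(i <- s | P i) normc (F i).
Proof.
elim/big_ind2 : _ => //; first by rewrite normc0.
by move=> x a y b xa yb; apply: le_normcD2.
Qed.

Lemma expiD a b : expi (a + b) = expi a * expi b :> C.
Proof. by rewrite /expi cosD sinD; apply: eq_C; rewrite ?cReM ?cImM/=; ring. Qed.
Lemma expi0 : expi 0 = 1 :> C.
Proof. by rewrite /expi cos0 sin0. Qed.
Lemma normc_expi a : normc (expi a) = 1.
Proof. by rewrite /expi/= cos2Dsin2 sqrtr1. Qed.
Lemma expi_neq0 a : expi a != 0 :> C.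
Proof. by apply/eqP => h; have := normc_expi a; rewrite h normc0 => /eqP; rewrite eq_sym oner_eq0. Qed.
Lemma expiX a n : expi a ^+ n = expi (n%:R * a) :> C.
Proof.
elim: n => [|n IH]; first by rewrite mul0r expi0.
by rewrite exprS IH -expiD -natr1 mulrDl mul1r addrC.
Qed.
Lemma expiN a : expi (- a) = (expi a)^-1 :> C.
Proof.
apply: (mulfI (expi_neq0 a)); rewrite -expiD subrr expi0 divff //; exact: expi_neq0.
Qed.
Lemma expi_2pi : expi (2 * pi) = 1 :> C.
Proof. by rewrite /expi mulr_natl cos2pi sin2pi. Qed.
Lemma expi_periodZ a (n : int) : expi (a + 2 * pi * n%:~R) = expi a :> C.
Proof.
rewrite expiD [X in _ * X](_ : _ = 1) ?mulr1//.
case: n => n; first by rewrite mulrC -expiX expi_2pi expr1n.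
by rewrite NegzE mulrN expiN mulrC -expiX expi_2pi expr1n invr1.
Qed.

Lemma cexpD x y : cexp (x + y) = cexp x * cexp y.
Proof. by rewrite /cexp cReD cImD expRD expiD rmorphM/=; ring. Qed.
Lemma cexp0 : cexp 0 = 1 :> C.
Proof. by rewrite /cexp/= expR0 expi0 mul1r. Qed.
Lemma normc_cexp z : normc (cexp z) = expR (complex.Re z).
Proof. by rewrite /cexp normcM normc_real normc_expi mulr1 ger0_norm ?expR_ge0. Qed.
Lemma real_complexM' a b : (a * b)%:C = a%:C * b%:C :> C.
Proof. by rewrite rmorphM. Qed.

(** The difference of the angles is reduced modulo 2 pi to [e] in [0, 2 pi). Then cos e = 1 and the
    double-angle formula give sin (e / 2) = 0, and sin is positive on (0, pi), so e = 0. *)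
Lemma expi_inj a b : expi a = expi b :> C -> exists n : int, a = b + 2 * pi * n%:~R.
Proof.
move=> h.
have h1 : expi (a - b) = 1 :> C by rewrite expiD h expiN mulfV// expi_neq0.
set c := a - b in h1.
pose n := Num.floor (c / (2 * pi)).
have pi0 : 0 < 2 * pi :> R by rewrite mulr_gt0 ?pi_gt0.
have /andP[n1 n2] : n%:~R <= c / (2 * pi) < (n + 1)%:~R by exact: Num.Theory.floor_itv.
have n1' : 2 * pi * n%:~R <= c by rewrite mulrC -ler_pdivlMr.
have n2' : c < 2 * pi * n%:~R + 2 * pi.
  by rewrite -[X in _ < _ + X]mulr1 -mulrDr mulrC -ltr_pdivrMr// -intrD1.
exists n; set e := c - 2 * pi * n%:~R.
have e1 : expi e = 1 :> C.
  by rewrite -h1 /e -(@expi_periodZ (c - _) n) subrK.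
have /andP[e0 e2] : 0 <= e < 2 * pi by rewrite /e; apply/andP; split; lra.
have [ce se] : cos e = 1 /\ sin e = 0 by case: e1.
suff e00 : e = 0 by move: e00; rewrite /e /c => e00; lra.
have : sin (e / 2) = 0.
  have := cos_mulr2n (e/2); rewrite -[X in cos X]mulr_natr divfK ?pnatr_eq0// ce.
  have := cos2Dsin2 (e/2) => h2 h3.
  have : sin (e/2) ^+ 2 = 0 by lra.
  by move/eqP; rewrite sqrf_eq0 => /eqP.
move: e0; rewrite le_eqVlt => /predU1P[//|e0] s0.
have := @sin_gt0_pi R (e/2); rewrite s0 ltxx.
by rewrite divr_gt0//= ltr_pdivrMr// mulrC e2 => /(_ isT).
Qed.

End ComplexBasics.

(** * Neighbourhoods, limits and Frechet derivatives with real epsilons *)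

Section Topology.
Variable R : realType.
Local Notation C := (Cx R).

(* The norm of a normed module over R[i] has values in R[i]; [nv] is its real
   part. *)
Definition nv (V : normedModType R[i]) (v : V) : R := complex.Re `|v|.

Lemma nvE (V : normedModType R[i]) (v : V) : `|v| = (nv v)%:C.
Proof. by rewrite /nv RRe_real// normr_real. Qed.
Lemma nvC (z : C) : nv z = normc z. Proof. by []. Qed.
Lemma nv_ge0 (V : normedModType R[i]) (v : V) : 0 <= nv v.
Proof. by rewrite -lecR rmorph0 -nvE. Qed.
Lemma nvZ (V : normedModType R[i]) (a : C) (v : V) : nv ((a : R[i]) *: v) = normc a * nv v.
Proof. by rewrite /nv normrZ (nvE v) -[`|_| in X in complex.Re (X * _)]/((normc a)%:C) -rmorphM. Qed.
Lemma le_nvD (V : normedModType R[i]) (v w : V) : nv (v + w) <= nv v + nv w.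
Proof. by rewrite -lecR rmorphD/= -!nvE ler_normD. Qed.
Lemma nv0 (V : normedModType R[i]) : nv (0 : V) = 0.
Proof. by rewrite /nv normr0. Qed.
Lemma nv_eq0 (V : normedModType R[i]) (v : V) : nv v = 0 -> v = 0.
Proof. by move=> h; apply/normr0_eq0; rewrite nvE h. Qed.

(** The order of [R[i]] makes a positive element real; radii of balls, which live in [R[i]], thus
    become real radii. *)
Lemma gt0_complex (e : R[i]) : 0 < e -> exists2 r : R, 0 < r & e = r%:C.
Proof.
move=> e0; exists (complex.Re e).
  by move: e0; rewrite ltcE/= => /andP[].
by rewrite RRe_real// gtr0_real.
Qed.

Lemma nbhsVP (V : normedModType R[i]) (x : V) (A : set V) :
  nbhs x A <-> exists2 e : R, 0 < e & forall y, nv (y - x) < e -> A y.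
Proof.
split.
  move/nbhs_ballP => [e /gt0_complex[r r0 ->] eA]; exists r => // y xy.
  by apply: eA; rewrite -ball_normE/= -normrN opprB nvE ltcR.
move=> [e e0 eA]; apply/nbhs_ballP; exists e%:C; first by rewrite /= ltcR.
move=> y; rewrite -ball_normE/= -normrN opprB nvE ltcR; exact: eA.
Qed.

Lemma cvgCP (T : Type) (F : set_system T) (FF : Filter F) (f : T -> C) (l : C) :
  (f @ F --> l) <-> forall e, 0 < e -> \forall x \near F, normc (f x - l) < e.
Proof.
split=> [fl e e0|fl A].
  by have := fl [set y | normc (y - l) < e]; apply; apply/nbhsVP; exists e.
move/nbhsVP => [e e0 eA]; apply: filterS (fl _ e0) => x; exact: eA.
Qed.

Lemma continuous_Re : continuous (@complex.Re R : C -> R).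
Proof.
move=> z A /nbhs_ballP[e e0 eA]; apply/nbhsVP; exists e => // y yz.
apply: eA; rewrite /ball/= -cReB; apply: le_lt_trans (le_Re_normc _) _; rewrite normc_sym; exact: yz.
Qed.
Lemma continuous_Im : continuous (@complex.Im R : C -> R).
Proof.
move=> z A /nbhs_ballP[e e0 eA]; apply/nbhsVP; exists e => // y yz.
apply: eA; rewrite /ball/= -cImB; apply: le_lt_trans (le_Im_normc _) _; rewrite normc_sym; exact: yz.
Qed.

Lemma cvgC_ReIm (T : Type) (F : set_system T) (FF : Filter F) (f : T -> C) (l : C) :
  complex.Re (f x) @[x --> F] --> complex.Re l ->
  complex.Im (f x) @[x --> F] --> complex.Im l -> f @ F --> l.
Proof.
move=> h1 h2; apply/cvgCP => e e0.
have e2 : 0 < e / 2 by rewrite divr_gt0.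
near=> x; apply: le_lt_trans (normc_le_ReIm _) _; rewrite (splitr e) cReB cImB.
rewrite ltrD// distrC; near: x.
  by move/cvgrPdist_lt: h1; exact.
by move/cvgrPdist_lt: h2; exact.
Unshelve. all: by end_near. Qed.

(** Frechet differentiability with real epsilons. [L] is any function, so a candidate derivative can
    be handled before its linearity and continuity are established. *)
Definition has_diff (V : normedModType R[i]) (f : V -> C) (x : V) (L : V -> C) :=
  forall e, 0 < e -> exists2 d, 0 < d &
    forall h, nv h < d -> normc (f (x + h) - f x - L h) <= e * nv h.

Lemma differentiable_has_diff (V : normedModType R[i]) (f : V -> C) x :
  differentiable f x -> has_diff f x ('d f x).
Proof.
move=> fx e e0.
have /eqaddoP := diff_locally fx.
have e0' : 0 < e%:C :> R[i] by rewrite ltcR.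
move=> /(_ _ e0') /nbhsVP [d d0 H]; exists d => // h hd.
have := H h; rewrite subr0 => /(_ hd).
rewrite [X in X <= _]nvE nvE -rmorphM lecR nvC.
suff -> : f (x + h) - f x - 'd f x h = (f \o shift x - (cst (f x) + 'd f x)) h by [].
by rewrite -[RHS]/(f (h + x) - (f x + 'd f x h)) opprD addrA (addrC h).
Qed.

(** The operator bound [K] makes [L] continuous, which the uniqueness of the differential
    requires. *)
Lemma has_diff_differentiable (V : normedModType R[i]) (f : V -> C) x
    (L : {linear V -> C}) K :
  (forall h, normc (L h) <= K * nv h) -> has_diff f x L ->
  differentiable f x /\ 'd f x = L :> (V -> C).
Proof.
move=> LK fL.
have cL : continuous L.
  move=> z; apply/cvgCP => e e0; apply/nbhsVP.
  have K0 : 0 < `|K| + 1 by rewrite ltr_wpDl.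
  exists (e / (`|K| + 1)); first by rewrite divr_gt0.
  move=> y; rewrite ltr_pdivlMr// => yz; rewrite -linearB.
  apply: le_lt_trans (LK _) _; apply: le_lt_trans yz.
  rewrite mulrC ler_wpM2l ?nv_ge0//; have := ler_norm K; lra.
have fL' : f \o shift x = cst (f x) + L +o_ 0 id.
  apply/eqaddoP => e /gt0_complex[r r0 ->]; apply/nbhsVP.
  have [d d0 H] := fL _ r0; exists d => // h; rewrite subr0 => hd.
  rewrite [X in X <= _]nvE nvE -rmorphM lecR nvC.
  have := H _ hd; suff -> : f (x + h) - f x - L h = (f \o shift x - (cst (f x) + L)) h by [].
  by rewrite -[RHS]/(f (h + x) - (f x + L h)) opprD addrA (addrC h).
have E := diff_unique cL fL'.
split; last exact: E.
by apply/diff_locallyP; rewrite E; split.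
Qed.

End Topology.

(** * Integrals of complex-valued functions *)

Section RealIntegrals.
Variable R : realType.
Local Notation mu := (@lebesgue_measure R).
Implicit Types (a b c r : R) (f g : R -> R) (D : set R).

Definition Rintegrable D f := mu.-integrable D (EFin \o f).

Lemma RintegrableD D f g : measurable D ->
  Rintegrable D f -> Rintegrable D g -> Rintegrable D (fun x => f x + g x).
Proof. by move=> mD fi gi; apply: (@integrableD _ _ R mu D _ _ _ fi gi). Qed.

Lemma RintegrableZ D f a : measurable D ->
  Rintegrable D f -> Rintegrable D (fun x => a * f x).
Proof. by move=> mD fi; apply: (@integrableZl _ _ R mu D _ a _ fi). Qed.

Lemma Rintegrable_norm D f : Rintegrable D f -> Rintegrable D (fun x => `|f x|).
Proof. exact: integrable_norm. Qed.

Lemma is_derive_continuous (F f : R -> R) :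
  (forall x : R, is_derive x (1:R) F (f x)) -> continuous F.
Proof.
move=> h x; apply: differentiable_continuous; apply/derivable1_diffP.
by have [] := h x.
Qed.

Lemma Rintegral_FTC (F f : R -> R) a b : a <= b ->
  (forall x : R, is_derive x (1:R) F (f x)) -> continuous f ->
  Rintegral mu `[a, b] f = F b - F a.
Proof.
rewrite le_eqVlt => /predU1P[<-|ab] dF cf.
  by rewrite subrr set_itv1 Rintegral_set1.
have cF := is_derive_continuous dF.
rewrite /Rintegral (@continuous_FTC2 _ f F)//.
- exact: continuous_subspaceT.
- split; first by move=> x _; have [] := dF x.
  + by apply: cvg_at_right_filter; exact: cF.
  + by apply: cvg_at_left_filter; exact: cF.
- by move=> x _; rewrite derive1E; have [] := dF x.
Qed.

Lemma continuous_integrable_itv f a b : continuous f ->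
  Rintegrable `[a, b] f.
Proof.
move=> cf; apply: continuous_compact_integrable; first exact: segment_compact.
exact: continuous_subspaceT.
Qed.

Lemma integral_exp_tail c r : 0 < c ->
  (\int[mu]_(s in `[r, +oo[) (expR (- (c * s)))%:E = (expR (- (c * r)) / c)%:E)%E.
Proof.
move=> c0.
have dF (x : R) : is_derive x (1:R) (fun s => - (expR (- (c * s)) / c)) (expR (- (c * x))).
  have -> : (fun s => - (expR (- (c * s)) / c)) = (fun s => (- c^-1) *: expR (- (c * s))).
    by apply/funext => s; rewrite /GRing.scale/= mulNr mulrC.
  apply: is_derive_eq; rewrite /GRing.scale/=.
  by rewrite mulr1 mulrN mulNr mulrN opprK mulrCA mulVf ?mulr1 ?gt_eqF.
have cF := is_derive_continuous dF.
rewrite (@ge0_continuous_FTC2y _ _ (fun s => - (expR (- (c * s)) / c)) _ 0).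
- by rewrite sub0e -EFinN opprK.
- by move=> x _; exact: expR_ge0.
- apply: continuous_subspaceT; apply: (@is_derive_continuous _ (fun x => - c * expR (- (c * x)))).
  move=> x; apply: is_derive_eq; rewrite /GRing.scale/=; ring.
- rewrite -[X in _ --> X]oppr0 -(mul0r c^-1); apply: cvgN; apply: cvgMl.
  have -> : (fun x => expR (- (c * x))) = (fun y => expR (- y)) \o (fun x => c * x) by [].
  apply: (@cvg_comp _ _ _ _ _ _ +oo); last exact: cvgr_expR.
  by apply: gt0_cvgMry => //; exact: cvg_id.
- by move=> x _; have [] := dF x.
- by apply: cvg_at_right_filter; exact: cF.
- by move=> x _; rewrite derive1E; have [] := dF x.
Qed.

Lemma continuous_expRcN c : continuous (fun s : R => expR (- (c * s))).
Proof.
apply: (@is_derive_continuous _ (fun x => - c * expR (- (c * x)))).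
move=> x; apply: is_derive_eq; rewrite /GRing.scale/=; ring.
Qed.

Lemma Rintegral_exp_tail c r : 0 < c ->
  Rintegral mu `[r, +oo[ (fun s => expR (- (c * s))) = expR (- (c * r)) / c.
Proof. by move=> c0; rewrite /Rintegral integral_exp_tail. Qed.

Lemma integrable_exp_tail c r : 0 < c ->
  Rintegrable `[r, +oo[ (fun s => expR (- (c * s))).
Proof.
move=> c0; apply/integrableP; split.
  apply/measurable_EFinP; apply: measurable_funTS.
  apply: continuous_measurable_fun; exact: continuous_expRcN.
under eq_integral do rewrite /= ger0_norm ?expR_ge0//.
by rewrite integral_exp_tail// ltry.
Qed.

Lemma continuous_exp_abs c : continuous (fun s : R => expR (- (c * `|s|))).
Proof.
move=> x; apply: (@continuous_comp _ _ _ (fun s : R => `|s|) (fun s : R => expR (- (c * s)))); first exact: norm_continuous.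
exact: continuous_expRcN.
Qed.

Lemma integrable_exp_abs c : 0 < c ->
  Rintegrable [set: R] (fun s => expR (- (c * `|s|))).
Proof.
move=> c0; apply/integrableP; split.
  apply/measurable_EFinP; apply: continuous_measurable_fun; exact: continuous_exp_abs.
under eq_integral do rewrite /= ger0_norm ?expR_ge0//.
rewrite ge0_symfun_integralT.
- under eq_integral => x; first rewrite inE/= => x0.
    rewrite ger0_norm//.
    over.
  by rewrite -set_itvcy integral_exp_tail// -EFinM ltry.
- by move=> x; exact: expR_ge0.
- exact: continuous_exp_abs.
- by move=> x /=; rewrite normrN.
Qed.

Lemma ge0_integral_affine f a b : 0 < a -> continuous f -> (forall x, 0 <= f x) ->
  (\int[mu]_x (f x)%:E = \int[mu]_x (a * f (a * x + b))%:E)%E.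
Proof.
move=> a0 cf f0.
have dF (x : R) : is_derive x (1:R) (fun x => a * x + b) a.
  by apply: is_derive_eq; rewrite /GRing.scale/=; ring.
have F' : derive1 (fun x : R => a * x + b) = cst a :> (R -> R).
  by apply/funext => x; rewrite derive1E; have [] := dF x.
rewrite (@increasing_ge0_integration_by_substitutionT _ (fun x => a * x + b))//.
- by apply: eq_integral => x _; rewrite F' /= mulrC.
- by move=> x y xy; rewrite ltrD2r ltr_pM2l.
- by rewrite F'; exact: cst_continuous.
- by rewrite F'; exact: is_cvg_cst.
- by rewrite F'; exact: is_cvg_cst.
- apply/cvgrNyPle => A; exists ((A - b) / a); split; first exact: num_real.
  by move=> x; rewrite ltr_pdivlMr// mulrC => h; lra.
- apply/cvgryPge => A; exists ((A - b) / a); split; first exact: num_real.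
  by move=> x; rewrite ltr_pdivrMr// mulrC => h; lra.
Qed.

Lemma integrable_affine f a b : 0 < a -> continuous f ->
  Rintegrable [set: R] f ->
  Rintegrable [set: R] (fun x => f (a * x + b)).
Proof.
move=> a0 cf /integrableP[_ fi].
have caf : continuous (fun x => f (a * x + b)).
  move=> x; apply: (continuous_comp (f := fun x : R => a * x + b)); last exact: cf.
  by apply: cvgD; [apply: cvgMr; exact: cvg_id|exact: cvg_cst].
have nf : continuous (fun x => `|f x|).
  by move=> x; apply: (continuous_comp (cf x)); exact: norm_continuous.
suff : Rintegrable [set: R] (fun x => a^-1 * (a * f (a * x + b))).
  by under eq_fun do rewrite mulKf ?gt_eqF//.
apply: RintegrableZ => //; apply/integrableP; split.
  apply/measurable_EFinP; apply: continuous_measurable_fun => x.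
  by apply: cvgMr; exact: caf.
have := ge0_integral_affine b a0 nf (fun x => normr_ge0 _).
under [RHS]eq_integral do rewrite -{1}(gtr0_norm a0) -normrM.
by move=> h; apply: le_lt_trans fi; rewrite [leRHS]h.
Qed.

(** The substitution is available for nonnegative functions; it is applied to |f| + f and to |f|,
    and the two identities are subtracted. *)
Lemma Rintegral_affine f a b : 0 < a -> continuous f ->
  Rintegrable [set: R] f ->
  Rintegral mu setT f = a * Rintegral mu setT (fun x => f (a * x + b)).
Proof.
move=> a0 cf fi.
have fai := integrable_affine b a0 cf fi.
have nf : continuous (fun x => `|f x|).
  by move=> x; apply: (continuous_comp (cf x)); exact: norm_continuous.
have ni : Rintegrable [set: R] (fun x => `|f x|) by exact: Rintegrable_norm.
have nai : Rintegrable [set: R] (fun x => `|f (a * x + b)|) by exact: Rintegrable_norm.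
have H (g : R -> R) : continuous g -> (forall x, 0 <= g x) ->
   Rintegrable [set: R] (fun x => g (a * x + b)) ->
   Rintegral mu setT g = a * Rintegral mu setT (fun x => g (a * x + b)).
  by move=> cg g0 gi; rewrite -RintegralZl// /Rintegral (ge0_integral_affine b a0 cg g0).
have cp : continuous (fun x => `|f x| + f x) by move=> x; apply: cvgD; [exact: nf|exact: cf].
have := H _ cp; rewrite !RintegralD//= (H _ nf)// => e.
have := e (fun x => _) _; rewrite mulrDr => /(_ _ _)/addrI -> //.
- by move=> x; have := ler_norm (- f x); rewrite normrN; lra.
- exact: RintegrableD.
Qed.

(** The first argument is rounded down to the grid of mesh 1 / (n + 1). Each rounded function has
    preimages that are countable unions of rectangles, and continuity in the first argument gives
    pointwise convergence. *)
Lemma measurable_caratheodory (h : R -> R -> R) :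
  (forall m, continuous (h ^~ m)) -> (forall s, measurable_fun setT (h s)) ->
  measurable_fun setT (fun z : R * R => h z.1 z.2).
Proof.
move=> ch mh.
pose q (n : nat) (s : R) : R := (Num.floor (n.+1%:R * s))%:~R / n.+1%:R.
apply: (@measurable_fun_cvg _ _ R setT (fun n (z : R * R) => h (q n z.1) z.2)).
  move=> n _ Y mY; rewrite setTI.
  have -> : (fun z : R * R => h (q n z.1) z.2) @^-1` Y =
     \bigcup_(k in [set: int]) ([set s | Num.floor (n.+1%:R * s) = k] `*`
        (h (k%:~R / n.+1%:R) @^-1` Y)).
    apply/seteqP; split => -[s m] /=.
      by move=> H; exists (Num.floor (n.+1%:R * s)).
    by move=> [k _ [/= e H]]; rewrite /q e.
  apply: countable_bigcupT_measurable; first exact: countableP.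
  move=> k; apply: measurableX; last by rewrite -[X in measurable X]setTI; exact: mh.
  have -> : [set s | Num.floor (n.+1%:R * s) = k] =
     [set` `[(k%:~R / n.+1%:R : R), ((k+1)%:~R / n.+1%:R : R)[].
    apply/seteqP; split=> s /=; rewrite in_itv/= ler_pdivrMr ?ltr0n// ltr_pdivlMr ?ltr0n// [s * _]mulrC.
      by move=> <-; exact: Num.Theory.floor_itv.
    by move=> H; apply: Num.Theory.floor_def.
  exact: measurable_itv.
move=> [s m] _ /=.
apply: (cvg_comp (fun n => q n s) (h ^~ m)); last exact: ch.
have h0 : n.+1%:R^-1 @[n --> \oo] --> (0 : R) by exact: cvg_harmonic.
apply: (@squeeze_cvgr _ _ _ _ (fun n : nat => s - n.+1%:R^-1) (fun=> s)).
- apply: nearW => n; rewrite /q.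
  have n0 : 0 < n.+1%:R :> R by rewrite ltr0n.
  have /andP[h1 h2] := Num.Theory.floor_itv (n.+1%:R * s).
  rewrite ler_pdivrMr// [s * _]mulrC h1 andbT.
  rewrite ler_pdivlMr// mulrBl mulVf ?gt_eqF// [s * _]mulrC.
  by move: h2; rewrite intrD1 => /ltW; lra.
- by rewrite -[X in _ --> X]subr0; apply: cvgB => //; exact: cvg_cst.
- exact: cvg_cst.
Qed.

Lemma Rintegrable_dom D f (M : R -> R) : measurable D -> measurable_fun D f ->
  Rintegrable D M -> (forall x, D x -> `|f x| <= M x) -> Rintegrable D f.
Proof.
move=> mD mf iM fM; apply: (@le_integrable _ _ R mu D _ _ _ _ _ iM) => //; first exact/measurable_EFinP.
by move=> x Dx; rewrite /= lee_fin; apply: le_trans (fM _ Dx) (ler_norm _).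
Qed.

(** The majorant is a product, so it gives integrability on the plane and also of every slice: the
    inner integrals are finite everywhere and not only almost everywhere, which lets real-valued
    integrals replace the extended ones. *)
Lemma Rfubini (f : R -> R -> R) (a b : R -> R) :
  measurable_fun setT (fun z : R * R => f z.1 z.2) ->
  Rintegrable [set: R] a -> Rintegrable [set: R] b ->
  (forall x, 0 <= a x) -> (forall y, 0 <= b y) ->
  (forall x y, `|f x y| <= a x * b y) ->
  [/\ Rintegrable [set: R] (fun x => Rintegral mu setT (f x)),
      Rintegrable [set: R] (fun y => Rintegral mu setT (f ^~ y)) &
      Rintegral mu setT (fun x => Rintegral mu setT (f x)) =
      Rintegral mu setT (fun y => Rintegral mu setT (f ^~ y))].
Proof.
move=> mf ia ib a0 b0 fab.
pose F (z : R * R) : \bar R := (f z.1 z.2)%:E.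
have mF : measurable_fun setT F by exact/measurable_EFinP.
have m1 x : measurable_fun setT (f x).
  exact: (measurableT_comp mf (measurable_pair1 x)).
have m2 y : measurable_fun setT (f ^~ y).
  exact: (measurableT_comp mf (measurable_pair2 y)).
have i1 x : Rintegrable [set: R] (f x).
  apply: (@Rintegrable_dom setT _ (fun y => a x * b y)) => //.
  exact: RintegrableZ.
have i2 y : Rintegrable [set: R] (f ^~ y).
  apply: (@Rintegrable_dom setT _ (fun x => a x * b y)) => //.
  by under eq_fun do rewrite mulrC; exact: RintegrableZ.
have iF : (mu \x mu)%E.-integrable setT F.
  apply/integrable12ltyP => //.
  apply: (@le_lt_trans _ _ (\int[mu]_x ((a x)%:E * \int[mu]_y (b y)%:E))%E).
    apply: ge0_le_integral => //.
    - by move=> x _; exact: integral_ge0.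
    - have maF : measurable_fun setT (abse \o F) by exact: measurableT_comp.
      have aF0 z : (0 <= (abse \o F) z)%E by exact: abse_ge0.
      exact: (measurable_fun_fubini_tonelli_F (m2 := mu) _ maF aF0).
    - apply: emeasurable_funM; last exact: measurable_cst.
      by have /integrableP[] := ia.
    - move=> x _; rewrite -ge0_integralZl//.
      + apply: ge0_le_integral => //.
        * by have /integrableP[H _] := Rintegrable_norm (i1 x); exact: H.
        * apply: emeasurable_funM => //.
          by have /integrableP[] := ib.
        * by move=> y _; rewrite /F /= lee_fin.
      + by have /integrableP[] := ib.
      + by move=> y _; rewrite lee_fin.
      + by rewrite lee_fin.
  have bf : (\int[mu]_y (b y)%:E \is a fin_num)%E by exact: integrable_fin_num.
  rewrite -(fineK bf) ge0_integralZr//; last 3 first.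
  - by have /integrableP[] := ia.
  - by move=> x _; rewrite lee_fin.
  - by rewrite lee_fin fine_ge0// integral_ge0// => y _; rewrite lee_fin.
  have af : (\int[mu]_y (a y)%:E \is a fin_num)%E by exact: integrable_fin_num.
  by rewrite -(fineK af) -EFinM ltry.
have E1 x : (fubini_F mu F x = (Rintegral mu setT (f x))%:E)%E.
  by rewrite /fubini_F /Rintegral fineK//; apply: (@integrable_fin_num _ _ R mu setT) => //; exact: i1.
have E2 y : (fubini_G mu F y = (Rintegral mu setT (f ^~ y))%:E)%E.
  by rewrite /fubini_G /Rintegral fineK//; apply: (@integrable_fin_num _ _ R mu setT) => //; exact: i2.
split.
- have := integrable_fubini_F iF; congr (_.-integrable _ _).
  by apply/funext => x; exact: E1.
- apply: (@Rintegrable_dom setT _ (fun y => Rintegral mu setT a * b y)) => //.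
  + have mG := measurable_fubini_G iF.
    apply/measurable_EFinP; apply: (eq_measurable_fun (fubini_G mu F)) mG => y _.
    exact: E2.
  + exact: RintegrableZ.
  + move=> y _; apply: le_trans (@le_normr_Rintegral _ _ R mu setT _ measurableT (i2 y)) _.
    rewrite mulrC -(@RintegralZl _ _ R mu)//; apply: (@le_Rintegral _ _ R mu setT) => //.
    * exact: (Rintegrable_norm (i2 y)).
    * exact: (RintegrableZ (b y) measurableT ia).
    * by move=> x _; rewrite mulrC.
- have H := Fubini iF.
  have F1 : (fun x => (Rintegral mu setT (f x))%:E) = fubini_F mu F.
    by apply/funext => x; rewrite E1.
  have F2 : (fun y => (Rintegral mu setT (f ^~ y))%:E) = fubini_G mu F.
    by apply/funext => x; rewrite E2.
  apply: (congr1 fine (_ : (\int[mu]_x (Rintegral mu setT (f x))%:E =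
                           \int[mu]_y (Rintegral mu setT (f ^~ y))%:E)%E)).
  by rewrite F1 F2; exact: H.
Qed.

End RealIntegrals.

(** * Complex-valued integrands: measurability, domination, Fubini *)

Section ComplexIntegrals.
Variable R : realType.
Local Notation C := (Cx R).
Local Notation mu := (@lebesgue_measure R).
Implicit Types (D : set R) (f g : R -> C) (M : R -> R).

(** Measurability is taken by components, to match the definition of [Cintegral]; no sigma-algebra
    on [Cx R] is involved. *)
Definition measC d (T : measurableType d) (D : set T) (f : T -> C) :=
  measurable_fun D (fun x => complex.Re (f x)) /\
  measurable_fun D (fun x => complex.Im (f x)).

Section MeasC.
Context d (T : measurableType d).
Variable D : set T.
Implicit Types h k : T -> C.

Lemma measC_cst (c : C) : measC D (fun=> c).
Proof. by split; exact: measurable_cst. Qed.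

Lemma measC_eq h k : (forall x, D x -> h x = k x) -> measC D h -> measC D k.
Proof.
move=> hk [m1 m2]; split.
  by apply: eq_measurable_fun m1 => x /[!inE] Dx; rewrite hk.
by apply: eq_measurable_fun m2 => x /[!inE] Dx; rewrite hk.
Qed.

Lemma measCD h k : measC D h -> measC D k -> measC D (fun x => h x + k x).
Proof.
move=> [h1 h2] [k1 k2]; split.
  by under eq_fun do rewrite cReD; exact: measurable_funD.
by under eq_fun do rewrite cImD; exact: measurable_funD.
Qed.

Lemma measCN h : measC D h -> measC D (fun x => - h x).
Proof.
move=> [h1 h2]; split.
  by under eq_fun do rewrite cReN; exact: measurableT_comp.
by under eq_fun do rewrite cImN; exact: measurableT_comp.
Qed.

Lemma measCM h k : measC D h -> measC D k -> measC D (fun x => h x * k x).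
Proof.
move=> [h1 h2] [k1 k2]; split.
  by under eq_fun do rewrite cReM; apply: measurable_funB; exact: measurable_funM.
by under eq_fun do rewrite cImM; apply: measurable_funD; exact: measurable_funM.
Qed.

Lemma measC_real (a : T -> R) : measurable_fun D a -> measC D (fun x => (a x)%:C : C).
Proof. by move=> ma; split => //=; exact: measurable_cst. Qed.

Lemma measCX h n : measC D h -> measC D (fun x => h x ^+ n).
Proof.
move=> mh; elim: n => [|n IH]; first exact: measC_cst.
by under eq_fun do rewrite exprS; exact: measCM.
Qed.

Lemma measC_expi (a : T -> R) : measurable_fun D a -> measC D (fun x => expi (a x) : C).
Proof.
move=> ma; split => /=.
  by apply: measurableT_comp ma; apply: continuous_measurable_fun; exact: continuous_cos.
by apply: measurableT_comp ma; apply: continuous_measurable_fun; exact: continuous_sin.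
Qed.

Lemma measC_cexp h : measC D h -> measC D (fun x => cexp (h x)).
Proof.
move=> [h1 h2]; rewrite /cexp; apply: measCM; last exact: measC_expi.
apply: measC_real; apply: measurableT_comp h1.
by apply: continuous_measurable_fun; exact: continuous_expR.
Qed.

Lemma measC_sum (I : Type) (s : seq I) (F : I -> T -> C) :
  (forall i, measC D (F i)) -> measC D (fun x => \sum_(i <- s) F i x).
Proof.
move=> mF; elim: s => [|i s IH].
  by under eq_fun do rewrite big_nil; exact: measC_cst.
by under eq_fun do rewrite big_cons; exact: measCD.
Qed.

Lemma measC_poly (P : {poly R[i]}) h : measC D h -> measC D (fun x => P.[h x] : C).
Proof.
move=> mh; under eq_fun do rewrite horner_coef.
apply: measC_sum => i; apply: measCM; [exact: measC_cst|exact: measCX].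
Qed.

Lemma measC_lim (h : nat -> T -> C) (k : T -> C) :
  (forall n, measC D (h n)) -> (forall x, D x -> h ^~ x @ \oo --> k x) -> measC D k.
Proof.
move=> mh hk; split.
  apply: (@measurable_fun_cvg _ _ R D (fun n x => complex.Re (h n x))).
    by move=> n; have [] := mh n.
  move=> x Dx; apply: (cvg_comp (fun n => h n x) (@complex.Re R)); first exact: hk.
  exact: continuous_Re.
apply: (@measurable_fun_cvg _ _ R D (fun n x => complex.Im (h n x))).
  by move=> n; have [] := mh n.
move=> x Dx; apply: (cvg_comp (fun n => h n x) (@complex.Im R)); first exact: hk.
exact: continuous_Im.
Qed.

End MeasC.

Lemma measC_comp d d' (T : measurableType d) (T' : measurableType d')
    (h : T -> C) (p : T' -> T) :
  measC setT h -> measurable_fun setT p -> measC setT (fun x => h (p x)).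
Proof.
move=> [h1 h2] mp; split; [exact: (measurableT_comp h1 mp)|exact: (measurableT_comp h2 mp)].
Qed.

Lemma measC_sub d (T : measurableType d) (D D' : set T) (h : T -> C) :
  measurable D -> D' `<=` D -> measC D h -> measC D' h.
Proof. by move=> mD DD [h1 h2]; split; apply: measurable_funS DD _. Qed.

Lemma continuous_measC f : continuous f -> measC [set: R] f.
Proof.
move=> cf; split; apply: continuous_measurable_fun => x.
  by apply: (cvg_comp f (@complex.Re R)); [exact: cf|exact: continuous_Re].
by apply: (cvg_comp f (@complex.Im R)); [exact: cf|exact: continuous_Im].
Qed.

Lemma within_continuous_measC D f : measurable D ->
  {within D, continuous f} -> measC D f.
Proof.
move=> mD cf; split; apply: subspace_continuous_measurable_fun => // x.
  by apply: (cvg_comp f (@complex.Re R)); [exact: cf|exact: continuous_Re].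
by apply: (cvg_comp f (@complex.Im R)); [exact: cf|exact: continuous_Im].
Qed.

Lemma measC_caratheodory (h : R -> R -> C) :
  (forall m, continuous (h ^~ m)) -> (forall s, measC [set: R] (h s)) ->
  measC [set: R * R] (fun z : R * R => h z.1 z.2).
Proof.
move=> ch mh; split.
  apply: (@measurable_caratheodory R (fun s m => complex.Re (h s m))) => m.
    by move=> s; apply: (cvg_comp (h ^~ m) (@complex.Re R)); [exact: ch|exact: continuous_Re].
  by have [] := mh m.
apply: (@measurable_caratheodory R (fun s m => complex.Im (h s m))) => m.
  by move=> s; apply: (cvg_comp (h ^~ m) (@complex.Im R)); [exact: ch|exact: continuous_Im].
by have [] := mh m.
Qed.

Lemma Cintegrable_measC D f : measurable D -> Cintegrable D f -> measC D f.
Proof.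
by move=> mD [/integrableP[/measurable_EFinP m1 _] /integrableP[/measurable_EFinP m2 _]]; split.
Qed.

Lemma Cintegrable_dom D f M : measurable D -> measC D f -> Rintegrable D M ->
  (forall x, D x -> normc (f x) <= M x) -> Cintegrable D f.
Proof.
move=> mD [m1 m2] iM fM; split; apply: (Rintegrable_dom mD _ iM) => // x Dx.
  exact: le_trans (le_Re_normc _) (fM _ Dx).
exact: le_trans (le_Im_normc _) (fM _ Dx).
Qed.

(** The factor 2 comes from estimating the real and the imaginary part separately. It is the source
    of the factors 2 and 4 in the later bounds, where the value of the constant does not matter. *)
Lemma le_Cintegral D f M : measurable D -> measC D f -> Rintegrable D M ->
  (forall x, D x -> normc (f x) <= M x) ->
  normc (Cintegral D f) <= 2 * Rintegral mu D M.
Proof.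
move=> mD mf iM fM; have [i1 i2] := Cintegrable_dom mD mf iM fM.
apply: le_trans (normc_le_ReIm _) _; rewrite mulr_natl mulr2n /=.
apply: lerD.
  apply: le_trans (@le_normr_Rintegral _ _ R mu D _ mD i1) _.
  apply: (@le_Rintegral _ _ R mu D _ _ mD (Rintegrable_norm i1)) => // x Dx.
  exact: le_trans (le_Re_normc _) (fM _ Dx).
apply: le_trans (@le_normr_Rintegral _ _ R mu D _ mD i2) _.
apply: (@le_Rintegral _ _ R mu D _ _ mD (Rintegrable_norm i2)) => // x Dx.
exact: le_trans (le_Im_normc _) (fM _ Dx).
Qed.

Lemma eq_Cintegral D f g : (forall x, D x -> f x = g x) -> Cintegral D f = Cintegral D g.
Proof.
move=> fg; rewrite /Cintegral; congr (_ +i* _); apply: eq_Rintegral => x /[!inE] Dx;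
  by rewrite fg.
Qed.

Lemma eq_Cintegrable D f g : measurable D -> (forall x, D x -> f x = g x) ->
  Cintegrable D f -> Cintegrable D g.
Proof.
move=> mD fg [i1 i2]; split.
  by apply: eq_integrable i1 => // x /[!inE] Dx; rewrite fg.
by apply: eq_integrable i2 => // x /[!inE] Dx; rewrite fg.
Qed.

Lemma CintegrableD D f g : measurable D -> Cintegrable D f -> Cintegrable D g ->
  Cintegrable D (fun x => f x + g x).
Proof.
move=> mD [f1 f2] [g1 g2]; split.
  by under eq_fun do rewrite cReD; exact: (RintegrableD mD f1 g1).
by under eq_fun do rewrite cImD; exact: (RintegrableD mD f2 g2).
Qed.

Lemma CintegralD D f g : measurable D -> Cintegrable D f -> Cintegrable D g ->
  Cintegral D (fun x => f x + g x) = Cintegral D f + Cintegral D g.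
Proof.
move=> mD [f1 f2] [g1 g2]; apply: eq_C; rewrite ?cReD ?cImD /=.
  by under eq_Rintegral do rewrite cReD; rewrite RintegralD.
by under eq_Rintegral do rewrite cImD; rewrite RintegralD.
Qed.

Lemma CintegrableZ D f (a : C) : measurable D -> Cintegrable D f ->
  Cintegrable D (fun x => a * f x).
Proof.
move=> mD [f1 f2]; split.
  under eq_fun do rewrite cReM -mulNr.
  by apply: (RintegrableD mD); exact: RintegrableZ.
under eq_fun do rewrite cImM.
by apply: (RintegrableD mD); exact: RintegrableZ.
Qed.

Lemma CintegralZ D f (a : C) : measurable D -> Cintegrable D f ->
  Cintegral D (fun x => a * f x) = a * Cintegral D f.
Proof.
move=> mD [f1 f2].
have H b (h : R -> R) : Rintegrable D h -> Rintegrable D (fun x => b * h x).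
  exact: RintegrableZ.
apply: eq_C; rewrite ?cReM ?cImM /=.
  under eq_Rintegral do rewrite cReM.
  rewrite (@RintegralB _ _ R mu D _ _ mD (H _ _ f1) (H _ _ f2)).
  by rewrite !(@RintegralZl _ _ R mu).
under eq_Rintegral do rewrite cImM.
rewrite (@RintegralD _ _ R mu D _ _ mD (H _ _ f2) (H _ _ f1)).
by rewrite !(@RintegralZl _ _ R mu).
Qed.

Lemma CintegrableZr D f (a : C) : measurable D -> Cintegrable D f ->
  Cintegrable D (fun x => f x * a).
Proof. by move=> mD fi; under eq_fun do rewrite mulrC; exact: CintegrableZ. Qed.

Lemma CintegralZr D f (a : C) : measurable D -> Cintegrable D f ->
  Cintegral D (fun x => f x * a) = Cintegral D f * a.
Proof.
move=> mD fi; rewrite mulrC -CintegralZ//; apply: eq_Cintegral => x _.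
exact: mulrC.
Qed.

Lemma CintegrableN D f : measurable D -> Cintegrable D f ->
  Cintegrable D (fun x => - f x).
Proof. by move=> mD fi; under eq_fun do rewrite -mulN1r; exact: CintegrableZ. Qed.

Lemma CintegralN D f : measurable D -> Cintegrable D f ->
  Cintegral D (fun x => - f x) = - Cintegral D f.
Proof.
by move=> mD fi; rewrite -mulN1r -CintegralZ//; apply: eq_Cintegral => x _; rewrite mulN1r.
Qed.

Lemma CintegrableB D f g : measurable D -> Cintegrable D f -> Cintegrable D g ->
  Cintegrable D (fun x => f x - g x).
Proof. by move=> mD fi gi; apply: CintegrableD => //; exact: CintegrableN. Qed.

Lemma CintegralB D f g : measurable D -> Cintegrable D f -> Cintegrable D g ->
  Cintegral D (fun x => f x - g x) = Cintegral D f - Cintegral D g.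
Proof.
by move=> mD fi gi; rewrite CintegralD// ?CintegralN//; exact: CintegrableN.
Qed.

Lemma Cintegrable_sub D D' f : measurable D -> measurable D' -> D' `<=` D ->
  Cintegrable D f -> Cintegrable D' f.
Proof.
move=> mD mD' DD [f1 f2]; split.
  exact: (@integrableS _ _ R mu D D' _ mD mD' DD f1).
exact: (@integrableS _ _ R mu D D' _ mD mD' DD f2).
Qed.

Lemma Rintegral_itv_split (h : R -> R) (a b c : R) : a <= c -> c <= b ->
  Rintegrable `[a, b] h ->
  Rintegral mu `[a, b] h = Rintegral mu `[a, c] h + Rintegral mu `[c, b] h.
Proof.
move=> ac cb hi; have icb : Rintegrable `]c, b] h.
  by apply: integrableS hi => //; apply: subset_itvr; rewrite bnd_simp.
rewrite -(Rintegral_itv_obnd_cbnd icb) -(Rintegral_itvB (x := c) hi) ?bnd_simp//.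
by rewrite addrC subrK.
Qed.

Lemma Cintegral_itv_split f (a b c : R) : a <= c -> c <= b ->
  Cintegrable `[a, b] f ->
  Cintegral `[a, b] f = Cintegral `[a, c] f + Cintegral `[c, b] f.
Proof.
move=> ac cb [f1 f2]; apply: eq_C; rewrite ?cReD ?cImD /=;
  exact: Rintegral_itv_split.
Qed.

Lemma Rintegral_itvy_split (h : R -> R) (a c : R) : a <= c ->
  Rintegrable `[a, +oo[ h ->
  Rintegral mu `[a, +oo[ h = Rintegral mu `[a, c] h + Rintegral mu `[c, +oo[ h.
Proof.
move=> ac hi; have icb : Rintegrable `]c, +oo[ h.
  by apply: integrableS hi => //; apply: subset_itvr; rewrite bnd_simp.
rewrite -(Rintegral_itv_obnd_cbnd icb) -(Rintegral_itvB (x := c) hi) ?bnd_simp//.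
by rewrite addrC subrK.
Qed.

Lemma Cintegral_itvy_split f (a c : R) : a <= c ->
  Cintegrable `[a, +oo[ f ->
  Cintegral `[a, +oo[ f = Cintegral `[a, c] f + Cintegral `[c, +oo[ f.
Proof.
move=> ac [f1 f2]; apply: eq_C; rewrite ?cReD ?cImD /=;
  exact: Rintegral_itvy_split.
Qed.

Lemma Rintegrable_cst_itv (a b K : R) : Rintegrable `[a, b] (fun=> K).
Proof. by apply: continuous_integrable_itv => x; exact: cvg_cst. Qed.

Lemma Rintegral_cst_itv (a b K : R) : a <= b ->
  Rintegral mu `[a, b] (fun=> K) = K * (b - a).
Proof.
move=> ab; have dF (x : R) : is_derive x (1 : R) (fun x : R => K * x) K.
  by apply: is_derive_eq; rewrite /GRing.scale/= mulr1.
by rewrite (Rintegral_FTC ab dF) ?mulrBr// => x; exact: cvg_cst.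
Qed.

Lemma Cintegrable_itv_bnd f (a b K : R) : measC `[a, b] f ->
  (forall x, a <= x <= b -> normc (f x) <= K) -> Cintegrable `[a, b] f.
Proof.
move=> mf fK; apply: (@Cintegrable_dom _ _ (fun=> K)) => //; first exact: Rintegrable_cst_itv.
Qed.

Lemma le_Cintegral_itv f (a b K : R) : a <= b -> measC `[a, b] f ->
  (forall x, a <= x <= b -> normc (f x) <= K) ->
  normc (Cintegral `[a, b] f) <= 2 * (K * (b - a)).
Proof.
move=> ab mf fK; rewrite -Rintegral_cst_itv//; apply: le_Cintegral => //.
exact: Rintegrable_cst_itv.
Qed.

Lemma Cintegral_dominated_cvg D (f_ : nat -> R -> C) f M : measurable D ->
  (forall n, measC D (f_ n)) -> Rintegrable D M ->
  (forall n x, D x -> normc (f_ n x) <= M x) ->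
  (forall x, D x -> f_ ^~ x @ \oo --> f x) ->
  (fun n => Cintegral D (f_ n)) @ \oo --> Cintegral D f.
Proof.
move=> mD mf iM fM ff.
have mf' := measC_lim mf ff.
have H (h_ : nat -> R -> R) (h : R -> R) : (forall n, measurable_fun D (h_ n)) ->
    measurable_fun D h -> (forall n x, D x -> `|h_ n x| <= M x) ->
    (forall x, D x -> h_ ^~ x @ \oo --> h x) ->
    (fun n => Rintegral mu D (h_ n)) @ \oo --> Rintegral mu D h.
  move=> mh_ mh hM hh.
  have [|||||ih _ c] := @dominated_convergence _ _ R mu D mD
      (fun n x => (h_ n x)%:E) (fun x => (h x)%:E) (fun x => (M x)%:E).
  - by move=> n; apply/measurable_EFinP; exact: mh_.
  - by apply/measurable_EFinP; exact: mh.
  - by apply: aeW => x Dx; apply: cvg_EFin; [exact: nearW|exact: hh].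
  - exact: iM.
  - by apply: aeW => x n Dx; rewrite /= lee_fin; exact: hM.
  rewrite /Rintegral; apply: fine_cvg.
  by rewrite fineK//; exact: integrable_fin_num.
apply: cvgC_ReIm => /=.
  apply: (H (fun n x => complex.Re (f_ n x))).
  - by move=> n; have [] := mf n.
  - by have [] := mf'.
  - by move=> n x Dx; exact: le_trans (le_Re_normc _) (fM _ _ Dx).
  - move=> x Dx; apply: (cvg_comp (fun n => f_ n x) (@complex.Re R)); first exact: ff.
    exact: continuous_Re.
apply: (H (fun n x => complex.Im (f_ n x))).
- by move=> n; have [] := mf n.
- by have [] := mf'.
- by move=> n x Dx; exact: le_trans (le_Im_normc _) (fM _ _ Dx).
- move=> x Dx; apply: (cvg_comp (fun n => f_ n x) (@complex.Im R)); first exact: ff.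
  exact: continuous_Im.
Qed.

Lemma Cfubini (f : R -> R -> C) (a b : R -> R) :
  measC [set: R * R] (fun z : R * R => f z.1 z.2) ->
  Rintegrable [set: R] a -> Rintegrable [set: R] b ->
  (forall x, 0 <= a x) -> (forall y, 0 <= b y) ->
  (forall x y, normc (f x y) <= a x * b y) ->
  [/\ Cintegrable [set: R] (fun x => Cintegral [set: R] (f x)),
      Cintegrable [set: R] (fun y => Cintegral [set: R] (f ^~ y)) &
      Cintegral [set: R] (fun x => Cintegral [set: R] (f x)) =
      Cintegral [set: R] (fun y => Cintegral [set: R] (f ^~ y))].
Proof.
move=> [m1 m2] ia ib a0 b0 fab.
have [|r1 r2 r3] := @Rfubini R (fun x y => complex.Re (f x y)) a b m1 ia ib a0 b0.
  by move=> x y; exact: le_trans (le_Re_normc _) (fab _ _).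
have [|i1 i2 i3] := @Rfubini R (fun x y => complex.Im (f x y)) a b m2 ia ib a0 b0.
  by move=> x y; exact: le_trans (le_Im_normc _) (fab _ _).
by split; [split|split|rewrite /Cintegral/= r3 i3].
Qed.

Lemma Cintegral_mkcond D f : Cintegral D f = Cintegral [set: R] (f \_ D).
Proof.
rewrite /Cintegral; congr (_ +i* _); rewrite Rintegral_mkcond; apply: eq_Rintegral => x _;
  by rewrite /patch; case: ifP.
Qed.

Lemma Cintegral_affine f (a b : R) : 0 < a -> continuous f -> Cintegrable [set: R] f ->
  Cintegral [set: R] f = a%:C * Cintegral [set: R] (fun x => f (a * x + b)).
Proof.
move=> a0 cf [f1 f2].
have c1 : continuous (fun x => complex.Re (f x)).
  by move=> x; apply: (cvg_comp f (@complex.Re R)); [exact: cf|exact: continuous_Re].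
have c2 : continuous (fun x => complex.Im (f x)).
  by move=> x; apply: (cvg_comp f (@complex.Im R)); [exact: cf|exact: continuous_Im].
apply: eq_C; rewrite ?cReM ?cImM /= mul0r ?subr0 ?addr0.
  exact: (Rintegral_affine b a0 c1 f1).
exact: (Rintegral_affine b a0 c2 f2).
Qed.

End ComplexIntegrals.

(** * Cauchy's theorem on polar rectangles and Cauchy estimates *)

Section PathCalculus.
Variable R : realType.
Local Notation C := (Cx R).
Local Notation mu := (@lebesgue_measure R).
Implicit Types (F G : R -> C) (a b : R) (v w : C).

Lemma cvgC_Re (T : Type) (F : set_system T) (FF : Filter F) (f : T -> C) (l : C) :
  f @ F --> l -> complex.Re (f x) @[x --> F] --> complex.Re l.
Proof. by move=> fl; apply: (cvg_comp f (@complex.Re R) fl); exact: continuous_Re. Qed.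

Lemma cvgC_Im (T : Type) (F : set_system T) (FF : Filter F) (f : T -> C) (l : C) :
  f @ F --> l -> complex.Im (f x) @[x --> F] --> complex.Im l.
Proof. by move=> fl; apply: (cvg_comp f (@complex.Im R) fl); exact: continuous_Im. Qed.

Lemma cvgC_M (T : Type) (F : set_system T) (FF : Filter F) (f g : T -> C) (l k : C) :
  f @ F --> l -> g @ F --> k -> (fun x => f x * g x) @ F --> l * k.
Proof.
move=> fl gk; apply: cvgC_ReIm.
  under eq_fun do rewrite cReM; rewrite cReM.
  by apply: cvgB; apply: cvgM; [exact: cvgC_Re|exact: cvgC_Re|exact: cvgC_Im|exact: cvgC_Im].
under eq_fun do rewrite cImM; rewrite cImM.
by apply: cvgD; apply: cvgM; [exact: cvgC_Re|exact: cvgC_Im|exact: cvgC_Im|exact: cvgC_Re].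
Qed.

Lemma cvgC_D (T : Type) (F : set_system T) (FF : Filter F) (f g : T -> C) (l k : C) :
  f @ F --> l -> g @ F --> k -> (fun x => f x + g x) @ F --> l + k.
Proof. by move=> fl gk; exact: (cvgD fl gk). Qed.

Lemma cvgC_N (T : Type) (F : set_system T) (FF : Filter F) (f : T -> C) (l : C) :
  f @ F --> l -> (fun x => - f x) @ F --> - l.
Proof. by move=> fl; exact: (cvgN fl). Qed.

Lemma cvgC_real (T : Type) (F : set_system T) (FF : Filter F) (f : T -> R) (l : R) :
  f @ F --> l -> (fun x => (f x)%:C : C) @ F --> (l%:C : C).
Proof. by move=> fl; apply: cvgC_ReIm => //=; exact: cvg_cst. Qed.

Lemma cvgC_unique (T : Type) (F : set_system T) (FF : ProperFilter F) (f : T -> C) (l k : C) :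
  f @ F --> l -> f @ F --> k -> l = k.
Proof.
move=> fl fk; apply: eq_C.
  by rewrite -(cvg_lim (@Rhausdorff R) (cvgC_Re _ fl)) -(cvg_lim (@Rhausdorff R) (cvgC_Re _ fk)).
by rewrite -(cvg_lim (@Rhausdorff R) (cvgC_Im _ fl)) -(cvg_lim (@Rhausdorff R) (cvgC_Im _ fk)).
Qed.

Lemma is_derive_eps (g : R -> R) (x v : R) :
  (forall e, 0 < e -> exists2 d, 0 < d & forall h, `|h| < d ->
     `|g (x + h) - g x - h * v| <= e * `|h|) -> is_derive x (1 : R) g v.
Proof.
move=> H; have L : h^-1 *: ((g \o shift x) (h *: (1:R)) - g x) @[h --> 0^'] --> v.
  apply/cvgrPdist_le => e e0; have [d d0 Hd] := H _ e0.
  rewrite near_withinE; apply/nbhs_ballP; exists d => // h.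
  rewrite /ball /= sub0r normrN => hd h0.
  have := Hd _ hd; rewrite /GRing.scale/= mulr1 [h + x]addrC => K.
  rewrite -(ler_pM2l (_ : 0 < `|h|)) ?normr_gt0// -normrM mulrBr mulrA mulfV// mul1r.
  by rewrite distrC [leRHS]mulrC; exact: K.
by split; [apply/cvg_ex; exists v|exact/cvg_lim].
Qed.

(** [Cx R] is normed over [R[i]], so a path with a real parameter is differentiated through its two
    real components. *)
Definition pderiv F (x : R) v :=
  is_derive x (1 : R) (fun t => complex.Re (F t)) (complex.Re v) /\
  is_derive x (1 : R) (fun t => complex.Im (F t)) (complex.Im v).

Lemma pderiv_eq F x v w : v = w -> pderiv F x v -> pderiv F x w.
Proof. by move->. Qed.

Lemma pderiv_cst x w : pderiv (fun=> w) x 0.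
Proof. by split; apply: is_derive_cst. Qed.

Lemma pderivD F G x v w : pderiv F x v -> pderiv G x w ->
  pderiv (fun t => F t + G t) x (v + w).
Proof.
move=> [f1 f2] [g1 g2]; split.
  by under eq_fun do rewrite cReD; rewrite cReD; exact: is_deriveD.
by under eq_fun do rewrite cImD; rewrite cImD; exact: is_deriveD.
Qed.

Lemma pderivM F G x v w : pderiv F x v -> pderiv G x w ->
  pderiv (fun t => F t * G t) x (v * G x + F x * w).
Proof.
move=> [f1 f2] [g1 g2]; split.
  under eq_fun do rewrite cReM; apply: is_derive_eq; rewrite /GRing.scale/= !(cReD, cReM); ring.
under eq_fun do rewrite cImM; apply: is_derive_eq; rewrite /GRing.scale/= !(cImD, cImM); ring.
Qed.

Lemma pderiv_real x : pderiv (fun t => t%:C) x 1.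
Proof. by split => /=; [exact: is_derive_id|exact: is_derive_cst]. Qed.

Lemma pderiv_expi x : pderiv (fun t => expi t) x ('i%C * expi x).
Proof.
split => /=.
  by apply: is_derive_eq; rewrite mul0r sub0r mul1r.
by apply: is_derive_eq; rewrite mul0r add0r mul1r.
Qed.

Lemma pderiv_continuous F f : (forall x, pderiv F x (f x)) -> continuous F.
Proof.
move=> H x; apply: cvgC_ReIm.
  by apply: (is_derive_continuous (f := fun x => complex.Re (f x))) => y; have [] := H y.
by apply: (is_derive_continuous (f := fun x => complex.Im (f x))) => y; have [] := H y.
Qed.

Lemma continuousC_Re (F : R -> C) : continuous F -> continuous (fun x => complex.Re (F x)).
Proof. by move=> cF x; apply: cvgC_Re; exact: cF. Qed.
Lemma continuousC_Im (F : R -> C) : continuous F -> continuous (fun x => complex.Im (F x)).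
Proof. by move=> cF x; apply: cvgC_Im; exact: cF. Qed.

Lemma Cintegral_FTC F f a b : a <= b -> (forall x, pderiv F x (f x)) -> continuous f ->
  Cintegral `[a, b] f = F b - F a.
Proof.
move=> ab dF cf; apply: eq_C; rewrite ?cReB ?cImB /=.
  apply: (Rintegral_FTC ab (F := fun x => complex.Re (F x))) => [x|].
    by have [] := dF x.
  exact: continuousC_Re.
apply: (Rintegral_FTC ab (F := fun x => complex.Im (F x))) => [x|].
  by have [] := dF x.
exact: continuousC_Im.
Qed.

Lemma continuous_expi : continuous (@expi R).
Proof. exact: (pderiv_continuous pderiv_expi). Qed.

Lemma expi_lipschitz a b : normc (expi a - expi b : C) <= 2 * `|a - b|.
Proof.
wlog ab : a b / b <= a.
  by move=> H; have /orP[/H//|/H] := le_total b a; rewrite normc_sym distrC.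
have ci : continuous (fun x => 'i%C * expi x : C).
  by move=> x; apply: cvgC_M; [exact: cvg_cst|exact: continuous_expi].
rewrite -(Cintegral_FTC ab pderiv_expi)// ger0_norm ?subr_ge0// -[a - b]mul1r.
apply: le_Cintegral_itv => //.
  by apply: (measC_sub (D := setT)) => //; exact: continuous_measC.
by move=> x _; rewrite normcM normc_i mul1r normc_expi.
Qed.

Lemma Cintegrable_within f a b : {within `[a, b], continuous (f : R -> C)} -> Cintegrable `[a, b] f.
Proof.
move=> cf; split; apply: continuous_compact_integrable; try exact: segment_compact.
  by move=> x; apply: cvgC_Re; exact: cf.
by move=> x; apply: cvgC_Im; exact: cf.
Qed.

Lemma Cintegrable_itv f a b : (forall x, a <= x <= b -> {for x, continuous (f : R -> C)}) ->
  Cintegrable `[a, b] f.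
Proof.
move=> cf; apply: Cintegrable_within; apply: continuous_in_subspaceT => x.
by rewrite inE/= in_itv/=; exact: cf.
Qed.

Lemma cvgC_comp_at (T : topologicalType) (f : C -> C) (p : T -> C) (x : T) :
  {for x, continuous p} -> {for p x, continuous f} -> {for x, continuous (fun y => f (p y))}.
Proof. by move=> cp cf; exact: (continuous_comp cp cf). Qed.

Lemma contC_cst (T : topologicalType) (x : T) (c : C) : {for x, continuous (fun=> c)}.
Proof. exact: cst_continuous. Qed.

Lemma contC_id (x : C) : {for x, continuous (fun y : C => y)}.
Proof. by move=> A; apply. Qed.

Lemma contC_D (T : topologicalType) (x : T) (f g : T -> C) :
  {for x, continuous f} -> {for x, continuous g} -> {for x, continuous (fun y => f y + g y)}.
Proof. exact: cvgC_D. Qed.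

Lemma contC_N (T : topologicalType) (x : T) (f : T -> C) :
  {for x, continuous f} -> {for x, continuous (fun y => - f y)}.
Proof. exact: cvgC_N. Qed.

Lemma contC_M (T : topologicalType) (x : T) (f g : T -> C) :
  {for x, continuous f} -> {for x, continuous g} -> {for x, continuous (fun y => f y * g y)}.
Proof. exact: cvgC_M. Qed.

End PathCalculus.

(** * Goursat's theorem on polar rectangles *)

Section Goursat.
Variable R : realType.
Local Notation C := (Cx R).
Implicit Types (g r : C -> C).

Definition polar (s t : R) : C := s%:C * expi t.
(** With u = s e^(it), du is e^(it) ds on a radial side ([Hint]) and i u dt on an arc ([Vint]).
    [Jint] is the contour integral of g du around the image of the rectangle [s1, s2] x [t1, t2]. *)
Definition Hint g (s1 s2 t : R) := Cintegral `[s1, s2] (fun s => g (polar s t) * expi t).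
Definition Vint g (t1 t2 s : R) :=
  Cintegral `[t1, t2] (fun t => g (polar s t) * ('i%C * polar s t)).
Definition Jint g (s1 s2 t1 t2 : R) :=
  Hint g s1 s2 t1 + Vint g t1 t2 s2 - Hint g s1 s2 t2 - Vint g t1 t2 s1.

Definition cont_on g (s1 s2 t1 t2 : R) := forall s t, s1 <= s <= s2 -> t1 <= t <= t2 ->
  {for polar s t, continuous g}.

Lemma normc_polar s t : 0 <= s -> normc (polar s t) = s.
Proof. by move=> s0; rewrite /polar normcM normc_real normc_expi mulr1 ger0_norm. Qed.

Lemma pderiv_polar1 t s : pderiv (polar^~ t) s (expi t).
Proof.
apply: pderiv_eq (pderivM (pderiv_real s) (pderiv_cst s (expi t))).
by rewrite mulr0 addr0 mul1r.
Qed.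
Lemma pderiv_polar2 s t : pderiv (polar s) t ('i%C * polar s t).
Proof.
apply: pderiv_eq (pderivM (pderiv_cst t s%:C) (pderiv_expi t)).
by rewrite mul0r add0r mulrCA.
Qed.
Lemma continuous_polar1 t : continuous (polar^~ t).
Proof. exact: (pderiv_continuous (pderiv_polar1 t)). Qed.
Lemma continuous_polar2 s : continuous (polar s).
Proof. exact: (pderiv_continuous (pderiv_polar2 s)). Qed.

Lemma Hint_integrable g (s1 s2 t1 t2 t : R) : cont_on g s1 s2 t1 t2 -> t1 <= t <= t2 ->
  Cintegrable `[s1, s2] (fun s => g (polar s t) * expi t).
Proof.
move=> cg tt; apply: Cintegrable_itv => s ss; apply: cvgC_M; last exact: cvg_cst.
by apply: (@cvgC_comp_at _ _ g (polar^~ t)); [exact: continuous_polar1|exact: cg].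
Qed.

Lemma Vint_integrable g (s1 s2 t1 t2 s : R) : cont_on g s1 s2 t1 t2 -> s1 <= s <= s2 ->
  Cintegrable `[t1, t2] (fun t => g (polar s t) * ('i%C * polar s t)).
Proof.
move=> cg ss; apply: Cintegrable_itv => t tt; apply: cvgC_M; last first.
  by apply: cvgC_M; [exact: cvg_cst|exact: continuous_polar2].
by apply: (@cvgC_comp_at _ _ g (polar s)); [exact: continuous_polar2|exact: cg].
Qed.

Lemma cont_onW g (s1 s2 t1 t2 s1' s2' t1' t2' : R) : cont_on g s1 s2 t1 t2 ->
  s1 <= s1' -> s2' <= s2 -> t1 <= t1' -> t2' <= t2 -> cont_on g s1' s2' t1' t2'.
Proof.
move=> cg h1 h2 h3 h4 s t /andP[a1 a2] /andP[b1 b2]; apply: cg; apply/andP; split.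
- exact: le_trans a1.
- exact: le_trans h2.
- exact: le_trans b1.
- exact: le_trans h4.
Qed.

Lemma Jint_splits g (s1 s s2 t1 t2 : R) : s1 <= s -> s <= s2 -> t1 <= t2 -> cont_on g s1 s2 t1 t2 ->
  Jint g s1 s2 t1 t2 = Jint g s1 s t1 t2 + Jint g s s2 t1 t2.
Proof.
move=> h1 h2 tt cg; rewrite /Jint /Hint.
rewrite (Cintegral_itv_split h1 h2 (Hint_integrable cg _)) ?lexx ?tt//.
rewrite (Cintegral_itv_split h1 h2 (Hint_integrable cg _)) ?lexx ?tt//; ring.
Qed.

Lemma Jint_splitt g (s1 s2 t1 t t2 : R) : t1 <= t -> t <= t2 -> s1 <= s2 -> cont_on g s1 s2 t1 t2 ->
  Jint g s1 s2 t1 t2 = Jint g s1 s2 t1 t + Jint g s1 s2 t t2.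
Proof.
move=> h1 h2 tt cg; rewrite /Jint /Vint.
rewrite (Cintegral_itv_split h1 h2 (Vint_integrable cg _)) ?lexx ?tt//.
rewrite (Cintegral_itv_split h1 h2 (Vint_integrable cg _)) ?lexx ?tt//; ring.
Qed.

(** Two radial sides of length s2 - s1 and two arcs of length at most s2 (t2 - t1), each with the
    factor 2 of [le_Cintegral_itv]. *)
Lemma Jint_bound g s1 s2 t1 t2 (K : R) : 0 <= s1 -> s1 <= s2 -> t1 <= t2 -> cont_on g s1 s2 t1 t2 ->
  (forall s t, s1 <= s <= s2 -> t1 <= t <= t2 -> normc (g (polar s t)) <= K) ->
  normc (Jint g s1 s2 t1 t2) <= 4 * (K * ((s2 - s1) + s2 * (t2 - t1))).
Proof.
move=> s0 ss tt cg gK.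
have K0 : 0 <= K by apply: le_trans (gK s1 t1 _ _); rewrite ?normc_ge0 ?lexx.
have hH t : t1 <= t <= t2 -> normc (Hint g s1 s2 t) <= 2 * (K * (s2 - s1)).
  move=> ht; apply: le_Cintegral_itv => //.
    exact: Cintegrable_measC (Hint_integrable cg ht).
  by move=> s hs; rewrite normcM normc_expi mulr1; exact: gK.
have hV s : s1 <= s <= s2 -> normc (Vint g t1 t2 s) <= 2 * (K * s2 * (t2 - t1)).
  move=> hs; apply: le_Cintegral_itv => //.
    exact: Cintegrable_measC (Vint_integrable cg hs).
  move=> t ht; rewrite normcM [normc ('i%C * _)]normcM normc_i mul1r; have /andP[h1 h2] := hs.
  have s0' := le_trans s0 h1; rewrite (normc_polar _ s0').
  by apply: ler_pM; rewrite ?normc_ge0 ?gK.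
have e1 := hH t1; have e2 := hH t2; have e3 := hV s1; have e4 := hV s2.
rewrite ?lexx ?ss ?tt in e1 e2 e3 e4.
have -> : 4 * (K * (s2 - s1 + s2 * (t2 - t1))) = 2 * (K * (s2 - s1)) + 2 * (K * s2 * (t2 - t1))
    + 2 * (K * (s2 - s1)) + 2 * (K * s2 * (t2 - t1)) by ring.
apply: le_normcB2; last exact: e3.
apply: le_normcB2; last exact: e2.
by apply: le_normcD2; [exact: e1|exact: e4].
Qed.

Lemma JintD g r (s1 s2 t1 t2 : R) : s1 <= s2 -> t1 <= t2 ->
  cont_on g s1 s2 t1 t2 -> cont_on r s1 s2 t1 t2 ->
  Jint (fun u => g u + r u) s1 s2 t1 t2 = Jint g s1 s2 t1 t2 + Jint r s1 s2 t1 t2.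
Proof.
move=> ss tt cg cr; have hH t : t1 <= t <= t2 ->
    Hint (fun u => g u + r u) s1 s2 t = Hint g s1 s2 t + Hint r s1 s2 t.
  move=> ht; rewrite /Hint -CintegralD//; last 2 first.
  - exact: Hint_integrable cg ht.
  - exact: Hint_integrable cr ht.
  by apply: eq_Cintegral => s _; rewrite mulrDl.
have hV s : s1 <= s <= s2 ->
    Vint (fun u => g u + r u) t1 t2 s = Vint g t1 t2 s + Vint r t1 t2 s.
  move=> hs; rewrite /Vint -CintegralD//; last 2 first.
  - exact: Vint_integrable cg hs.
  - exact: Vint_integrable cr hs.
  by apply: eq_Cintegral => t _; rewrite mulrDl.
by rewrite /Jint !hH ?hV ?lexx ?ss ?tt//; ring.
Qed.

(** The primitive [G] integrates each of the four sides to a difference of its values at the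
    corners, and these differences cancel around the contour. *)
Lemma Jint_affine (a b : C) (s1 s2 t1 t2 : R) : s1 <= s2 -> t1 <= t2 ->
  Jint (fun u => a + b * u) s1 s2 t1 t2 = 0.
Proof.
move=> ss tt; pose G (u : C) := a * u + 2^-1 * b * (u * u).
have two : (2 : C) != 0 by rewrite pnatr_eq0.
have dG F x v : pderiv F x v -> pderiv (fun t => G (F t)) x ((a + b * F x) * v).
  move=> dF; apply: pderiv_eq; last first.
    apply: pderivD; first exact: (pderivM (pderiv_cst x a) dF).
    exact: (pderivM (pderiv_cst x (2^-1 * b)) (pderivM dF dF)).
  by rewrite /=; field.
have cc (F h : R -> C) : continuous F -> continuous h -> continuous (fun x => (a + b * F x) * h x).
  move=> cF ch x; apply: cvgC_M; last exact: ch.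
  by apply: cvgC_D; [exact: cvg_cst|apply: cvgC_M; [exact: cvg_cst|exact: cF]].
have hH t : Hint (fun u => a + b * u) s1 s2 t = G (polar s2 t) - G (polar s1 t).
  rewrite /Hint (Cintegral_FTC (F := fun s => G (polar s t)))//.
    by move=> s; apply: dG; exact: pderiv_polar1.
  by apply: cc; [exact: continuous_polar1|move=> x; exact: cvg_cst].
have hV s : Vint (fun u => a + b * u) t1 t2 s = G (polar s t2) - G (polar s t1).
  rewrite /Vint (Cintegral_FTC (F := fun t => G (polar s t)))//.
    by move=> t; apply: dG; exact: pderiv_polar2.
  apply: cc; first exact: continuous_polar2.
  by move=> x; apply: cvgC_M; [exact: cvg_cst|exact: continuous_polar2].
by rewrite /Jint !hH !hV; ring.
Qed.

Lemma polar_lipschitz (S s t s0 t0 : R) : 0 <= s0 <= S ->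
  normc (polar s t - polar s0 t0) <= `|s - s0| + 2 * S * `|t - t0|.
Proof.
move=> /andP[h1 h2].
have -> : polar s t - polar s0 t0 = (s - s0)%:C * expi t + s0%:C * (expi t - expi t0).
  by rewrite /polar rmorphB/=; ring.
apply: le_normcD2; rewrite normcM normc_real ?normc_expi ?mulr1// ger0_norm//.
rewrite [2 * S]mulrC -mulrA; apply: ler_pM => //; [exact: normc_ge0|exact: expi_lipschitz].
Qed.

(** The contour integrals of the four quarters add up to that of the whole, so one of them has at
    least a quarter of its modulus. Sides are written [s + a + a] so that the quarters have sides
    [a] and [b] without division. *)
Lemma Jint_quarter g (s t a b v : R) : 0 <= a -> 0 <= b ->
  cont_on g s (s + a + a) t (t + b + b) -> v * 4 <= normc (Jint g s (s + a + a) t (t + b + b)) ->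
  exists s' t', [/\ s <= s', s' + a <= s + a + a, t <= t', t' + b <= t + b + b &
    v <= normc (Jint g s' (s' + a) t' (t' + b))].
Proof.
move=> a0 b0 cg vJ.
have E : Jint g s (s + a + a) t (t + b + b) =
  Jint g s (s + a) t (t + b) + Jint g s (s + a) (t + b) (t + b + b) +
  (Jint g (s + a) (s + a + a) t (t + b) + Jint g (s + a) (s + a + a) (t + b) (t + b + b)).
  have [sa1 sa2] : s <= s + a /\ s + a <= s + a + a by rewrite !lerDl.
  have [tb1 tb2] : t <= t + b /\ t + b <= t + b + b by rewrite !lerDl.
  have tb3 := le_trans tb1 tb2.
  rewrite (Jint_splits sa1 sa2 tb3 cg).
  by congr (_ + _); apply: Jint_splitt => //; apply: (cont_onW cg).
apply: contrapT => H.
have H' s' t' : s <= s' -> s' + a <= s + a + a -> t <= t' -> t' + b <= t + b + b ->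
    normc (Jint g s' (s' + a) t' (t' + b)) < v.
  by move=> *; rewrite ltNge; apply/negP => h; apply: H; exists s', t'.
have : normc (Jint g s (s + a + a) t (t + b + b)) < v + v + (v + v).
  rewrite E; apply: le_lt_trans (le_normcD _ _) _; apply: ltrD;
    apply: le_lt_trans (le_normcD _ _) _; apply: ltrD; apply: H'; lra.
lra.
Qed.

End Goursat.

Section Goursat2.
Variable R : realType.
Local Notation C := (Cx R).
Implicit Types (g r : C -> C).

(** If the integral had modulus v > 0, repeated quartering would give nested rectangles carrying at
    least v / 4^n. At their common point g is affine up to an error [e] times the distance; the
    affine part integrates to 0, and the error contributes at most half of v / 4^n. *)
Lemma Jint_goursat g (s1 s2 t1 t2 : R) : 0 <= s1 -> s1 < s2 -> t1 < t2 ->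
  (forall s t, s1 <= s <= s2 -> t1 <= t <= t2 -> differentiable g (polar s t)) ->
  Jint g s1 s2 t1 t2 = 0.
Proof.
move=> s10 ss tt dg.
have cg : cont_on g s1 s2 t1 t2.
  by move=> s t hs ht; apply: differentiable_continuous; exact: dg.
apply: eq0_normc; apply: contrapT => /eqP v0.
set v := normc (Jint g s1 s2 t1 t2) in v0.
have {}v0 : 0 < v by rewrite lt_neqAle eq_sym v0 normc_ge0.
pose a (n : nat) := (s2 - s1) / 2 ^+ n; pose b (n : nat) := (t2 - t1) / 2 ^+ n.
have p2 n : 0 < 2 ^+ n :> R by rewrite exprn_gt0.
have a0 n : 0 < a n by rewrite divr_gt0// subr_gt0.
have b0 n : 0 < b n by rewrite divr_gt0// subr_gt0.
have aS n : a n = a n.+1 + a n.+1.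
  by rewrite /a exprS invfM; field; rewrite gt_eqF.
have bS n : b n = b n.+1 + b n.+1.
  by rewrite /b exprS invfM; field; rewrite gt_eqF.
pose P (x : nat * (R * R)) :=
  [/\ s1 <= x.2.1, x.2.1 + a x.1 <= s2, t1 <= x.2.2, x.2.2 + b x.1 <= t2 &
      v / 4 ^+ x.1 <= normc (Jint g x.2.1 (x.2.1 + a x.1) x.2.2 (x.2.2 + b x.1))].
(* A rectangle is kept together with the proof that it carries its share of [v], so that the choice
   of a quarter can be iterated. *)
pose T := {x | P x}.
pose rel (x y : nat * (R * R)) :=
  [/\ y.1 = x.1.+1, x.2.1 <= y.2.1, y.2.1 + a y.1 <= x.2.1 + a x.1, x.2.2 <= y.2.2 &
      y.2.2 + b y.1 <= x.2.2 + b x.1].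
have step (x : T) : {y : T | rel (sval x) (sval y)}.
  apply: cid; case: x => -[n [s t]] [/= h1 h2 h3 h4 h5].
  have cgn : cont_on g s (s + a n) t (t + b n) by exact: (cont_onW cg).
  have [||s' [t' [k1 k2 k3 k4 k5]]] := @Jint_quarter R g s t (a n.+1) (b n.+1) (v / 4 ^+ n.+1)
     (ltW (a0 _)) (ltW (b0 _)).
  - by rewrite -!addrA -aS -bS.
  - rewrite -!addrA -aS -bS; apply: le_trans h5.
    by rewrite exprSr invfM mulrA divfK.
  rewrite -!addrA -aS -bS in k2 k4.
  have k1' : s1 <= s' by exact: le_trans k1.
  have k2' : s' + a n.+1 <= s2 by exact: le_trans h2.
  have k3' : t1 <= t' by exact: le_trans k3.
  have k4' : t' + b n.+1 <= t2 by exact: le_trans h4.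
  have Py : P (n.+1, (s', t')) := And5 k1' k2' k3' k4' k5.
  by exists (exist _ _ Py); split.
have Px0 : P (0%N, (s1, t1)).
  have e1 : s1 + a 0%N = s2 by rewrite /a expr0 divr1 addrC subrK.
  have e2 : t1 + b 0%N = t2 by rewrite /b expr0 divr1 addrC subrK.
  by rewrite /P /= e1 e2 expr0 divr1; exact: (And5 (lexx _) (lexx _) (lexx _) (lexx _) (lexx _)).
pose x0 : T := exist _ _ Px0.
pose sq n := iter n (fun x => sval (step x)) x0.
have sqS n : rel (sval (sq n)) (sval (sq n.+1)) by exact: (svalP (step (sq n))).
have sqn n : (sval (sq n)).1 = n.
  by elim: n => [//|n IH]; have [-> _ _ _ _] := sqS n; rewrite IH.
pose S n := (sval (sq n)).2.1; pose U n := (sval (sq n)).2.2.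
have Pn n : [/\ s1 <= S n, S n + a n <= s2, t1 <= U n, U n + b n <= t2 &
      v / 4 ^+ n <= normc (Jint g (S n) (S n + a n) (U n) (U n + b n))].
  by have := svalP (sq n); rewrite /P sqn.
have Nn n : [/\ S n <= S n.+1, S n.+1 + a n.+1 <= S n + a n, U n <= U n.+1 &
     U n.+1 + b n.+1 <= U n + b n].
  by have [_ h1 h2 h3 h4] := sqS n; rewrite !sqn in h2 h4.
(* Nested intervals: the supremum of the left endpoints lies in all of them. This is used once for
   the radii and once for the angles. *)
have mon (X : nat -> R) (c : nat -> R) : (forall n, 0 < c n) ->
   (forall n, X n <= X n.+1) -> (forall n, X n.+1 + c n.+1 <= X n + c n) ->
   exists z, forall n, X n <= z <= X n + c n.
  move=> c0 X1 X2.
  have X1' n k : X n <= X (n + k)%N.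
    by elim: k => [|k IH]; rewrite ?addn0// addnS; exact: le_trans IH (X1 _).
  have X2' n k : X (n + k)%N + c (n + k)%N <= X n + c n.
    by elim: k => [|k IH]; rewrite ?addn0// addnS; exact: le_trans (X2 _) IH.
  have ub n k : X k <= X n + c n.
    have [nk|kn] := leqP n k.
      rewrite -(subnKC nk); apply: le_trans (X2' n (k - n)%N).
      by rewrite lerDl ltW.
    have h := X1' k (n - k)%N; rewrite subnKC ?(ltnW kn)// in h.
    by apply: le_trans h _; rewrite lerDl ltW.
  exists (sup (range X)) => n; apply/andP; split.
    apply: ub_le_sup; last by exists n.
    by exists (X 0%N + c 0%N) => _ [k _ <-]; exact: ub.
  by apply: ge_sup; [exists (X 0%N), 0%N|move=> _ [k _ <-]; exact: ub].
have [z zP] : exists z, forall n, S n <= z <= S n + a n.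
  by apply: mon => // n; have [] := Nn n.
have [w wP] : exists w, forall n, U n <= w <= U n + b n.
  by apply: mon => // n; have [] := Nn n.
have zs : s1 <= z <= s2.
  have [h1 h2 _ _ _] := Pn 0%N; have /andP[h3 h4] := zP 0%N; apply/andP; split; lra.
have wt : t1 <= w <= t2.
  have [_ _ h1 h2 _] := Pn 0%N; have /andP[h3 h4] := wP 0%N; apply/andP; split; lra.
have dz := differentiable_has_diff (dg _ _ zs wt).
set u0 := polar z w in dz.
(* [L / 2 ^+ n] bounds both the distance to [u0] inside the n-th rectangle and the factor (s2 - s1)
   + s2 (t2 - t1) of [Jint_bound] for that rectangle. *)
pose L := (s2 - s1) + 2 * s2 * (t2 - t1).
have s20 : 0 < s2 by lra.
have L0 : 0 < L by rewrite addr_gt0 ?subr_gt0// mulr_gt0 ?subr_gt0// mulr_gt0.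
(* Chosen so that 4 e (L / 2^n)^2 = (v / 2) / 4^n, half of what the n-th rectangle must carry. *)
pose e := v / (8 * L * L).
have e0 : 0 < e by rewrite divr_gt0// !mulr_gt0.
have [d d0 Hd] := dz _ e0.
have [n Ln] : exists n, L / 2 ^+ n < d.
  exists (Num.bound (L / d)); rewrite ltr_pdivrMr// mulrC -ltr_pdivrMr//.
  apply: lt_le_trans (archi_boundP _) _; first by rewrite divr_ge0 ?ltW.
  by rewrite -natrX ler_nat ltnW// ltn_expl.
have [h1 h2 h3 h4 h5] := Pn n.
have /andP[z1 z2] := zP n; have /andP[w1 w2] := wP n.
have an := a0 n; have bn := b0 n.
pose l := 'd g u0 1.
have dE h : 'd g u0 h = l * h.
  by rewrite -[in LHS](mulr1 h) -[h * 1]/(h *: (1 : C)) linearZ /= mulrC.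
(* The remainder of [g] after its first-order expansion at [u0]; the subtracted part is affine in
   [u] and does not contribute to the contour integral. *)
pose r u := g u - (g u0 - l * u0 + l * u).
have gE : g = (fun u => (g u0 - l * u0 + l * u) + r u).
  by apply/funext => u; rewrite /r [RHS]addrC subrK.
have cgn : cont_on g (S n) (S n + a n) (U n) (U n + b n) by exact: (cont_onW cg).
have clin : cont_on (fun u => g u0 - l * u0 + l * u) (S n) (S n + a n) (U n) (U n + b n).
  move=> s t _ _.
  apply: contC_D; first exact: contC_cst.
  by apply: contC_M; [exact: contC_cst|exact: contC_id].
have cr : cont_on r (S n) (S n + a n) (U n) (U n + b n).
  move=> s t hs ht.
  by apply: contC_D; [exact: cgn|apply: contC_N; exact: clin].
have JE : Jint g (S n) (S n + a n) (U n) (U n + b n) = Jint r (S n) (S n + a n) (U n) (U n + b n).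
  by rewrite {1}gE JintD// ?lerDl ?(ltW an) ?(ltW bn)// Jint_affine ?add0r// lerDl ltW.
have s2n : S n + a n <= s2 by [].
have Lab : L / 2 ^+ n = a n + 2 * s2 * b n by rewrite /L /a /b; ring.
have rK s t : S n <= s <= S n + a n -> U n <= t <= U n + b n ->
    normc (r (polar s t)) <= e * (L / 2 ^+ n).
  move=> /andP[hs1 hs2] /andP[ht1 ht2].
  have pd : normc (polar s t - u0) <= L / 2 ^+ n.
    have zz : 0 <= z <= s2 by apply/andP; split; lra.
    apply: le_trans (polar_lipschitz s t w zz) _; rewrite Lab.
    apply: lerD; first by rewrite ler_norml; apply/andP; split; lra.
    apply: ler_wpM2l; first by rewrite mulr_ge0 ?ltW.
    by rewrite ler_norml; apply/andP; split; lra.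
  have := Hd (polar s t - u0) (le_lt_trans pd Ln).
  rewrite [u0 + _]addrC subrK dE => H.
  have -> : r (polar s t) = g (polar s t) - g u0 - l * (polar s t - u0) by rewrite /r; ring.
  by apply: le_trans H _; rewrite ler_wpM2l// ltW.
have := Jint_bound _ _ _ cr rK; rewrite -JE => /(_ _ _ _)/(le_trans h5).
have -> : S n + a n - S n = a n by ring.
have -> : U n + b n - U n = b n by ring.
move=> H; have {H} : v / 4 ^+ n <= 4 * (e * (L / 2 ^+ n) * (L / 2 ^+ n)).
  apply: le_trans (H _ _ _) _; rewrite ?lerDl ?(ltW an) ?(ltW bn)//; first by lra.
  apply: ler_wpM2l => //; apply: ler_wpM2l.
    by rewrite mulr_ge0// ?(ltW e0)// divr_ge0// ltW.
  rewrite Lab lerD2l; apply: ler_wpM2r; first exact: ltW.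
  by lra.
have -> : 4 * (e * (L / 2 ^+ n) * (L / 2 ^+ n)) = (v / 2) / 4 ^+ n.
  rewrite /e (_ : 4 = 2 * 2 :> R) ?exprMn; last by ring.
  by field; rewrite gt_eqF//= gt_eqF.
rewrite ler_pM2r ?invr_gt0 ?exprn_gt0//; lra.
Qed.

End Goursat2.

(** * Cauchy estimates and second-order remainders *)

Section CauchyEstimates.
Variable R : realType.
Local Notation C := (Cx R).
Implicit Types (f g : C -> C).

Definition dC f (z : C) : C := 'd f z 1.

Lemma diff_dC f (z h : C) : 'd f z h = dC f z * h.
Proof.
by rewrite /dC -[in LHS](mulr1 h) -[h * 1]/(h *: (1 : C)) linearZ /= [RHS]mulrC.
Qed.

Lemma has_diff_dC f (z : C) : differentiable f z -> has_diff f z (fun h => dC f z * h).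
Proof.
move=> /differentiable_has_diff H e e0; have [d d0 Hd] := H e e0.
by exists d => // h /Hd; rewrite diff_dC.
Qed.

Lemma has_diff_C f (z l : C) : has_diff f z (fun h => l * h) ->
  differentiable f z /\ dC f z = l.
Proof.
move=> H.
have [||h1 h2] := @has_diff_differentiable R C f z ( *:%R (l : R[i])) (normc l).
- by move=> h; rewrite nvC -normcM.
- exact: H.
- by split=> //; rewrite /dC h2 -[RHS]mulr1.
Qed.

Lemma has_diff_slice (V : normedModType R[i]) (f : V -> C) (x h : V) (w0 : C) (L : {linear V -> C}) :
  has_diff f (x + w0 *: h) L ->
  has_diff (fun w : C => f (x + (w : R[i]) *: h)) w0 (fun w => L h * w).
Proof.
move=> H e e0.
have n1 : 0 < nv h + 1 by rewrite ltr_wpDl ?nv_ge0.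
have [d d0 Hd] := H (e / (nv h + 1)) (divr_gt0 e0 n1).
exists (d / (nv h + 1)); first exact: divr_gt0.
move=> k; rewrite nvC ltr_pdivlMr// => kd.
have kh : nv ((k : R[i]) *: h) <= normc k * (nv h + 1).
  by rewrite nvZ ler_wpM2l ?normc_ge0// lerDl.
have := Hd (k *: h) (le_lt_trans kh kd).
have -> : x + ((w0 + k : C) : R[i]) *: h = x + w0 *: h + k *: h.
  by rewrite -addrA -(scalerDl h (w0 : R[i]) (k : R[i])).
have -> : L h * k = L (k *: h) by rewrite linearZ /= mulrC.
move=> K; apply: le_trans K _; rewrite -mulrA ler_wpM2l ?(ltW e0)// mulrC ler_pdivrMr//.
Qed.

Lemma pderiv_segment f (z h : C) (t : R) : differentiable f (z + t%:C * h) ->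
  pderiv (fun t => f (z + t%:C * h)) t (dC f (z + t%:C * h) * h).
Proof.
move=> df; have H := has_diff_slice (differentiable_has_diff df).
have K e : 0 < e -> exists2 d, 0 < d & forall k : R, `|k| < d ->
   normc (f (z + (t + k)%:C * h) - f (z + t%:C * h) - k%:C * (dC f (z + t%:C * h) * h)) <= e * `|k|.
  move=> e0; have [d d0 Hd] := H e e0; exists d => // k kd.
  have := Hd k%:C; rewrite nvC normc_real => /(_ kd).
  rewrite diff_dC rmorphD; have -> : k%:C * (dC f (z + t%:C * h) * h) = dC f (z + t%:C * h) * h * k%:C.
    exact: mulrC.
  exact.
split; apply: is_derive_eps => e e0; have [d d0 Hd] := K e e0; exists d => // k kd.
  apply: le_trans (Hd k kd); apply: le_trans (le_Re_normc _).
  by rewrite !cReB (cReM k%:C) /= mul0r subr0.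
apply: le_trans (Hd k kd); apply: le_trans (le_Im_normc _).
by rewrite !cImB (cImM k%:C) /= mul0r addr0.
Qed.

(** The real mean value theorem is applied to the two components of t |-> f (z + t h) - c t h. The
    intermediate points of the components may differ, which costs the factor 2. *)
Lemma mvt_C f (z h c : C) (K : R) :
  (forall t : R, 0 <= t <= 1 -> differentiable f (z + t%:C * h)) ->
  (forall t : R, 0 <= t <= 1 -> normc (dC f (z + t%:C * h) - c) <= K) ->
  normc (f (z + h) - f z - c * h) <= 2 * K * normc h.
Proof.
move=> df dK.
pose F (t : R) : C := f (z + t%:C * h) - c * (t%:C * h).
have dF (t : R) : 0 <= t <= 1 -> pderiv F t ((dC f (z + t%:C * h) - c) * h).
  move=> ht; rewrite /F; apply: pderiv_eq; last first.
    apply: pderivD; first exact: pderiv_segment (df _ ht).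
    have -> : (fun t : R => - (c * (t%:C * h))) = (fun t : R => (- (c * h)) * t%:C).
      by apply/funext => t'; ring.
    exact: (pderivM (pderiv_cst t (- (c * h))) (pderiv_real t)).
  by rewrite /=; ring.
have E : f (z + h) - f z - c * h = F 1 - F 0.
  by rewrite /F !mul1r !mul0r mulr0 subr0 addr0; ring.
have half (p : C -> R) : (forall w, `|p w| <= normc w) ->
   (forall t : R, 0 <= t <= 1 -> is_derive t (1 : R) (fun t => p (F t)) (p ((dC f (z + t%:C * h) - c) * h))) ->
   `|p (F 1) - p (F 0)| <= K * normc h.
  move=> pn dp.
  have [||t ht ->] := @MVT_segment R (fun t => p (F t))
      (fun t => p ((dC f (z + t%:C * h) - c) * h)) 0 1 ler01.
  - by move=> t; rewrite in_itv/= => /andP[h1 h2]; apply: dp; rewrite !ltW.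
  - apply: derivable_within_continuous => t; rewrite in_itv/= => ht.
    by have [] := dp t ht.
  - rewrite subr0 mulr1; apply: le_trans (pn _) _; rewrite normcM.
    by rewrite ler_wpM2r ?normc_ge0// dK//; move: ht; rewrite in_itv.
rewrite E; apply: le_trans (normc_le_ReIm _) _; rewrite cReB cImB -mulrA mulr_natl mulr2n.
apply: lerD.
  by apply: (half (@complex.Re R)) => [w|t ht]; [exact: le_Re_normc|have [] := dF t ht].
by apply: (half (@complex.Im R)) => [w|t ht]; [exact: le_Im_normc|have [] := dF t ht].
Qed.

Lemma polar_neq0 (s t : R) : 0 < s -> polar s t != 0.
Proof.
by move=> s0; apply/eqP => h; have := normc_polar t (ltW s0); rewrite h normc0 => e; rewrite -e ltxx in s0.
Qed.

(** In the polar rectangle with angles 0 and 2 pi the two radial sides coincide and cancel, so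
    Goursat's theorem compares the two circles. [g] may be singular at 0. *)
Lemma Vint_circle g (rho s1 s2 : R) : 0 < s1 -> s1 < s2 -> s2 < rho ->
  (forall u : C, 0 < normc u < rho -> differentiable g u) ->
  Vint g 0 (2 * pi) s1 = Vint g 0 (2 * pi) s2.
Proof.
move=> s10 s12 s2r dg.
have pi0 : 0 < 2 * pi :> R by rewrite mulr_gt0 ?pi_gt0.
have := @Jint_goursat R g s1 s2 0 (2 * pi) (ltW s10) s12 pi0.
have -> : Jint g s1 s2 0 (2 * pi) = Vint g 0 (2 * pi) s2 - Vint g 0 (2 * pi) s1.
  have e : Hint g s1 s2 (2 * pi) = Hint g s1 s2 0 by rewrite /Hint /polar expi_2pi expi0.
  by rewrite /Jint e; ring.
move=> H; apply/esym/subr0_eq/H => s t /andP[h1 h2] _.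
by apply: dg; rewrite normc_polar ?(lt_le_trans s10 h1) ?(le_lt_trans h2)// ltW// (lt_le_trans s10).
Qed.

(** The integral of [g] over a small circle tends to 2 pi i times the derivative, and it does not
    depend on the radius; at radius rho / 2 it is estimated by the bound [M]. *)
Lemma cauchy_deriv f (z : C) (rho M : R) :
  (forall w : C, normc (w - z) < rho -> differentiable f w) ->
  (forall w : C, normc (w - z) < rho -> normc (f w) <= M) ->
  0 < rho -> normc (dC f z) <= 8 * M / rho.
Proof.
move=> df fM rho0.
have pi0 : 0 < 2 * pi :> R by rewrite mulr_gt0 ?pi_gt0.
(* Because f z is subtracted, g u times i u is i times the difference quotient: the limit at radius
   0 is read off from differentiability at z, without the Cauchy integral formula. *)
pose g (u : C) := (f (z + u) - f z) / (u * u).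
have zz : z + 0 - z = 0 by rewrite addr0 subrr.
have M0 : 0 <= M by apply: le_trans (fM z _); rewrite ?normc_ge0// subrr normc0.
have dfz : forall u : C, normc u < rho -> differentiable (fun u : C => f (z + u)) u.
  move=> u ur; have ur' : normc ((z + u) - z) < rho by rewrite addrC addKr.
  have := has_diff_slice (x := z) (h := (1 : C)) (w0 := u).
  move=> /(_ f ('d f (z + u))); rewrite -[u *: 1]/(u * 1) mulr1.
  move=> /(_ (differentiable_has_diff (df _ ur'))) /has_diff_C [].
  by under eq_fun do rewrite -[_ *: 1]/(_ * 1) mulr1.
have dg (u : C) : 0 < normc u < rho -> differentiable g u.
  move=> /andP[u0 ur]; have un0 : u != 0.
    by apply/eqP => u00; rewrite u00 normc0 ltxx in u0.
  apply: (@differentiableM _ _ (fun u : C => f (z + u) - f z) (fun u : C => (u * u)^-1)).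
    by apply: differentiableB => //; exact: dfz.
  apply: differentiableV; last by rewrite mulf_neq0.
  by apply: differentiableM.
have gE (s t : R) : 0 < s -> g (polar s t) * ('i%C * polar s t) =
    'i%C * ((f (z + polar s t) - f z) / polar s t).
  move=> s0; have p0 := polar_neq0 t s0.
  by rewrite /g invfM; field.
have Vbound (s K : R) : 0 < s -> s < rho -> (forall t, normc ((f (z + polar s t) - f z) / polar s t) <= K) ->
    normc (Vint g 0 (2 * pi) s) <= 2 * (K * (2 * pi)).
  move=> s0 sr HK; rewrite -[X in _ <= 2 * (K * X)]subr0.
  apply: le_Cintegral_itv; first exact: ltW.
    have cg : cont_on g s s 0 (2 * pi).
      move=> s' t /andP[h1 h2] _; apply: differentiable_continuous; apply: dg.
      by have -> : s' = s; [apply/eqP; rewrite eq_le h1 h2|rewrite normc_polar ?s0 ?sr// ltW].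
    by apply: (Cintegrable_measC _ (Vint_integrable cg _)) => //; rewrite lexx.
  by move=> t _; rewrite gE// normcM normc_i mul1r; exact: HK.
have Vz (e : R) : 0 < e -> exists2 d, 0 < d & forall s, 0 < s -> s < d ->
   normc (Vint g 0 (2 * pi) s - (2 * pi)%:C * 'i%C * dC f z) <= 2 * (e * (2 * pi)).
  move=> e0; have dz0 : differentiable f z by apply: df; rewrite subrr normc0.
  have [d d0 Hd] := has_diff_dC dz0 e0.
  exists (Num.min d rho) => [|s s0]; first by rewrite lt_min d0.
  rewrite lt_min => /andP[sd sr].
  have cg : cont_on g s s 0 (2 * pi).
    move=> s' t /andP[h1 h2] _; apply: differentiable_continuous; apply: dg.
    by have -> : s' = s; [apply/eqP; rewrite eq_le h1 h2|rewrite normc_polar ?s0 ?sr// ltW].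
  have Vi : Cintegrable `[0, 2 * pi] (fun t : R => g (polar s t) * ('i%C * polar s t)).
    by apply: (Vint_integrable cg); rewrite lexx.
  have ci : Cintegrable `[0, 2 * pi] (fun t : R => 'i%C * dC f z).
    by apply: Cintegrable_itv => t _; exact: contC_cst.
  have -> : (2 * pi)%:C * 'i%C * dC f z = Cintegral `[0, 2 * pi] (fun t : R => 'i%C * dC f z).
    rewrite (Cintegral_FTC (F := fun t => t%:C * ('i%C * dC f z))) ?mul0r ?subr0 ?mulrA//.
    - exact: ltW.
    - move=> t; apply: pderiv_eq (pderivM (pderiv_real t) (pderiv_cst t _)).
      by rewrite mulr0 addr0 mul1r.
    - by move=> t; exact: contC_cst.
  rewrite /Vint -CintegralB//.
  rewrite -[X in _ <= 2 * (e * X)]subr0.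
  apply: le_Cintegral_itv; first exact: ltW.
    exact: (Cintegrable_measC _ (CintegrableB _ Vi ci)).
  move=> t _; rewrite gE// -mulrBr normcM normc_i mul1r.
  have p0 := polar_neq0 t s0.
  have := Hd (polar s t); rewrite nvC normc_polar ?(ltW s0)// => /(_ sd) H.
  rewrite -(ler_pM2r s0) -[X in _ * X <= _](normc_polar t (ltW s0)) -normcM.
  by rewrite mulrBl divfK.
suff H (e : R) : 0 < e -> normc (dC f z) <= 8 * M / rho + 2 * e.
  apply/ler_addgt0Pr => e e0; have := H (e / 2) (divr_gt0 e0 (ltr0Sn R 1)).
  by rewrite [2 * _]mulrC divfK ?pnatr_eq0.
move=> e0; have [d d0 Hd] := Vz e e0.
(* Below [d] the limit estimate applies, and rho / 4 keeps [s1] strictly below rho / 2, the radius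
   at which the integral is bounded. *)
pose s1 := Num.min (d / 2) (rho / 4).
have s10 : 0 < s1 by rewrite lt_min !divr_gt0.
have s1d : s1 < d by rewrite /s1 gt_min ltr_pdivrMr// ltr_pMr// ltr1n.
have s1r : s1 < rho / 2.
  by rewrite /s1 gt_min ltr_pM2l// ltf_pV2 ?posrE// ltr_nat orbT.
have r2 : rho / 2 < rho by rewrite ltr_pdivrMr// ltr_pMr// ltr1n.
have E := Vint_circle s10 s1r r2 dg.
have r20 : 0 < rho / 2 by rewrite divr_gt0.
(* 4 M / rho is the quotient of 2 M, a bound for f (z + u) - f z, by the radius rho / 2. *)
have B : normc (Vint g 0 (2 * pi) (rho / 2)) <= 2 * ((4 * M / rho) * (2 * pi)).
  apply: (Vbound _ _ r20 r2) => t; rewrite normcM normcV (normc_polar t (ltW r20)) ler_pdivrMr//.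
  have -> : 4 * M / rho * (rho / 2) = M + M by field; rewrite gt_eqF.
  apply: le_normcB2; apply: fM; last by rewrite subrr normc0.
  by rewrite addrC addKr (normc_polar t (ltW r20)).
have := Hd s1 s10 s1d; rewrite E => D.
have : normc ((2 * pi)%:C * 'i%C * dC f z) <= 2 * ((4 * M / rho) * (2 * pi)) + 2 * (e * (2 * pi)).
  have -> : (2 * pi)%:C * 'i%C * dC f z = Vint g 0 (2 * pi) (rho / 2) -
     (Vint g 0 (2 * pi) (rho / 2) - (2 * pi)%:C * 'i%C * dC f z) by ring.
  exact: le_normcB2.
rewrite !normcM normc_i normc_real mulr1 gtr0_norm// => H.
rewrite -(ler_pM2l pi0); apply: le_trans H _; rewrite le_eqVlt; apply/orP; left; apply/eqP.
by field; rewrite gt_eqF.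
Qed.

(* 2048 / rho ^ 2: twice (mean value inequality on a segment) 8 / (rho / 4)
   (Cauchy estimate for the derivative of w |-> f (w + h) - f w) times 32 / rho
   (Lipschitz constant of f). *)
Definition quad_cst (rho : R) : R := 2 * (8 * (32 / rho) / (rho / 4)).

Lemma quad_cst_ge0 rho : 0 < rho -> 0 <= quad_cst rho.
Proof. by move=> r0; rewrite /quad_cst !mulr_ge0// ?invr_ge0 ?divr_ge0// ltW. Qed.

(** No second derivative is formed: the increment of [dC f] by a step [k] is the derivative of w |->
    f (w + k) - f w, to which the Cauchy estimate applies on the smaller disc of radius rho / 4. *)
Lemma quad_remainder1 f (z h : C) (rho M : R) : 0 < rho ->
  (forall w : C, normc (w - z) < rho -> differentiable f w) ->
  (forall w : C, normc (w - z) < rho -> normc (f w) <= M) ->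
  normc h < rho / 8 ->
  normc (f (z + h) - f z - dC f z * h) <= quad_cst rho * M * normc h ^+ 2.
Proof.
move=> rho0 df fM hr.
have M0 : 0 <= M by apply: le_trans (fM z _); rewrite ?normc_ge0// subrr normc0.
have d1 (w : C) : normc (w - z) < rho / 2 -> normc (dC f w) <= 8 * M / (rho / 2).
  move=> wz; have H (v : C) : normc (v - w) < rho / 2 -> normc (v - z) < rho.
    move=> vw; apply: le_lt_trans (normc_tri v w z) _; rewrite (splitr rho); exact: ltrD.
  by apply: cauchy_deriv; rewrite ?divr_gt0// => v /H; [exact: df|exact: fM].
have seg (w k : C) (t : R) : 0 <= t <= 1 -> normc (w + t%:C * k - z) <= normc (w - z) + normc k.
  move=> /andP[t0 t1]; rewrite addrAC; apply: le_normcD2 => //.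
  by rewrite normcM normc_real ger0_norm// ler_piMl ?normc_ge0.
have lip (w k : C) : normc (w - z) + normc k < rho / 2 ->
    normc (f (w + k) - f w) <= 32 * M / rho * normc k.
  move=> wk; have := @mvt_C f w k 0 (8 * M / (rho / 2)).
  rewrite mul0r subr0 => H; apply: le_trans (H _ _) _.
  - move=> t ht; apply: df; apply: le_lt_trans (seg w k t ht) (lt_trans wk _).
    by rewrite ltr_pdivrMr// ltr_pMr// ltr1n.
  - by move=> t ht; rewrite subr0; apply: d1; apply: le_lt_trans (seg w k t ht) wk.
  - rewrite le_eqVlt; apply/orP; left; apply/eqP; by field; rewrite gt_eqF.
have d2 (k : C) : normc k < rho / 8 -> normc (dC f (z + k) - dC f z) <= 2^-1 * quad_cst rho * M * normc k.
  move=> kr; pose F (w : C) := f (w + k) - f w.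
  have wk (w : C) : normc (w - z) < rho / 4 -> normc (w - z) + normc k < rho / 2 /\ normc (w + k - z) < rho.
    move=> wz; have H : normc (w - z) + normc k < rho / 2 by lra.
    split=> //; rewrite addrAC; apply: le_lt_trans (le_normcD _ _) _; lra.
  have wz4 (w : C) : normc (w - z) < rho / 4 -> normc (w - z) < rho by move=> ?; lra.
  have hdF (w : C) : normc (w - z) < rho / 4 -> has_diff F w (fun h => (dC f (w + k) - dC f w) * h).
    move=> wz e e0.
    have [e1 e1p H1] := has_diff_dC (df _ (wk _ wz).2) (divr_gt0 e0 (ltr0Sn R 1)).
    have [e2 e2p H2] := has_diff_dC (df _ (wz4 _ wz)) (divr_gt0 e0 (ltr0Sn R 1)).
    exists (Num.min e1 e2) => [|l]; first by rewrite lt_min e1p.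
    rewrite lt_min => /andP[/H1 k1 /H2 k2].
    have -> : F (w + l) - F w - (dC f (w + k) - dC f w) * l =
       (f (w + k + l) - f (w + k) - dC f (w + k) * l) - (f (w + l) - f w - dC f w * l).
      have e1' : w + l + k = w + k + l by ring.
      rewrite /F e1'; move: (f (w + k + l)) (f (w + k)) (f (w + l)) (f w) (dC f (w + k)) (dC f w).
      by move=> a1 a2 a3 a4 a5 a6; ring.
    by rewrite (splitr e) mulrDl; apply: (le_normcB2 k1 k2).
  have zz : normc (z - z) < rho / 4 by rewrite subrr normc0 divr_gt0.
  rewrite -(has_diff_C (hdF z zz)).2.
  have -> : 2^-1 * quad_cst rho * M * normc k = 8 * (32 * M / rho * normc k) / (rho / 4).
    by rewrite /quad_cst; field; rewrite gt_eqF.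
  have r4 : 0 < rho / 4 by rewrite divr_gt0.
  apply: (cauchy_deriv (z := z) _ _ r4).
  - by move=> w wz; exact: (has_diff_C (hdF w wz)).1.
  - by move=> w wz; apply: lip; exact: (wk _ wz).1.
have q0 := quad_cst_ge0 rho0.
have H : normc (f (z + h) - f z - dC f z * h) <= 2 * (2^-1 * quad_cst rho * M * normc h) * normc h.
  apply: mvt_C.
    move=> t ht; apply: df; apply: le_lt_trans (seg z h t ht) _; rewrite subrr normc0; lra.
  move=> t /andP[t0 t1]; have th : normc (t%:C * h) <= normc h.
    by rewrite normcM normc_real ger0_norm// ler_piMl ?normc_ge0.
  apply: le_trans (d2 _ (le_lt_trans th hr)) _; apply: ler_wpM2l th.
  by rewrite mulr_ge0// mulr_ge0// invr_ge0.
by apply: le_trans H _; rewrite le_eqVlt; apply/orP; left; apply/eqP; field.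
Qed.

(** Reduction to one variable along the complex line w |-> x + w h: the slice is holomorphic and
    bounded by [M] for |w| < rho / |h|. Both conclusions are linear in [M], so they can be
    integrated with respect to a parameter. *)
Lemma quad_remainder (V : normedModType R[i]) (f : V -> C) (x h : V) (rho M : R) : 0 < rho ->
  (forall y, nv (y - x) < rho -> differentiable f y) ->
  (forall y, nv (y - x) < rho -> normc (f y) <= M) ->
  nv h < rho / 8 ->
  normc (f (x + h) - f x - 'd f x h) <= quad_cst rho * M * nv h ^+ 2 /\
  normc ('d f x h) <= 8 * M / rho * nv h.
Proof.
move=> rho0 df fM hr.
have [h0|h0] := eqVneq (nv h) 0.
  rewrite (nv_eq0 h0) addr0 linear0 subr0 subrr normc0 nv0; split; lra.
have {h0} h0 : 0 < nv h by rewrite lt_neqAle eq_sym h0 nv_ge0.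
pose phi (w : C) := f (x + (w : R[i]) *: h).
have wr (w : C) : normc (w - 0) < rho / nv h -> nv (x + (w : R[i]) *: h - x) < rho.
  by rewrite subr0 [x + _]addrC addrK nvZ ltr_pdivlMr.
have hd (w : C) : normc (w - 0) < rho / nv h -> has_diff phi w (fun k => 'd f (x + (w : R[i]) *: h) h * k).
  by move=> /wr wh; apply: has_diff_slice; apply: differentiable_has_diff; exact: df.
have dphi (w : C) : normc (w - 0) < rho / nv h -> differentiable phi w.
  by move=> wh; exact: (has_diff_C (hd w wh)).1.
have phiM (w : C) : normc (w - 0) < rho / nv h -> normc (phi w) <= M by move=> /wr /fM.
have r0 : 0 < rho / nv h by rewrite divr_gt0.
have z0 : normc (0 - 0 : C) < rho / nv h by rewrite subr0 normc0.
have dE : dC phi 0 = 'd f x h.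
  by rewrite (has_diff_C (hd 0 z0)).2 scale0r addr0.
split; last first.
  rewrite -dE; apply: le_trans (cauchy_deriv dphi phiM r0) _.
  by rewrite invfM invrK mulrA.
have := @quad_remainder1 phi 0 1 (rho / nv h) M r0 dphi phiM.
rewrite /phi normc1 add0r scale1r scale0r addr0 dE mulr1 expr1n mulr1 => H.
apply: le_trans (H _) _.
  by rewrite mulrAC ltr_pdivlMr// mul1r.
rewrite le_eqVlt; apply/orP; left; apply/eqP; rewrite /quad_cst.
by field; rewrite !gt_eqF.
Qed.

End CauchyEstimates.

(** * Limits and parameter integrals of holomorphic functions *)

Section ParameterIntegrals.
Variable R : realType.
Local Notation C := (Cx R).
Local Notation mu := (@lebesgue_measure R).
Implicit Types (V : normedModType R[i]).

Lemma normc_lim_le (r_ : nat -> C) (r : C) (B : R) :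
  r_ @ \oo --> r -> (forall n, normc (r_ n) <= B) -> normc r <= B.
Proof.
move=> rr rB; apply/ler_addgt0Pr => e e0.
have [N _ HN] := (cvgCP _ _ _).1 rr e e0.
have -> : r = r_ N - (r_ N - r) by ring.
by apply: le_normcB2 => //; rewrite ltW//; apply: HN => /=.
Qed.

Lemma cauchy_seq_cvg (a : nat -> R) :
  (forall e, 0 < e -> exists N, forall n, (N <= n)%N -> `|a N - a n| < e) ->
  exists l : R, a @ \oo --> l.
Proof.
move=> H; apply/cvg_ex; apply: cauchy_cvg; apply/cauchy_exP => e e0.
by have [N HN] := H e e0; exists (a N), N.
Qed.

Lemma cauchy_seqC_cvg (a : nat -> C) :
  (forall e, 0 < e -> exists N, forall n, (N <= n)%N -> normc (a N - a n) < e) ->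
  exists l : C, a @ \oo --> l.
Proof.
move=> H.
have [x xP] : exists l : R, (fun n => complex.Re (a n)) @ \oo --> l.
  apply: cauchy_seq_cvg => e /H[N HN]; exists N => n /HN; apply: le_lt_trans.
  by rewrite -cReB le_Re_normc.
have [y yP] : exists l : R, (fun n => complex.Im (a n)) @ \oo --> l.
  apply: cauchy_seq_cvg => e /H[N HN]; exists N => n /HN; apply: le_lt_trans.
  by rewrite -cImB le_Im_normc.
by exists (x +i* y); exact: cvgC_ReIm.
Qed.

(** Pointwise convergence with a common bound is enough. The quadratic remainder is uniform in n, so
    comparing the increments of two functions of the sequence over one fixed small step [t] shows
    that their derivatives at z form a Cauchy sequence. *)
Lemma hol_lim (f_ : nat -> C -> C) (f : C -> C) (z : C) (rho M : R) : 0 < rho ->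
  (forall n (w : C), normc (w - z) < rho -> differentiable (f_ n) w) ->
  (forall n (w : C), normc (w - z) < rho -> normc (f_ n w) <= M) ->
  (forall w : C, normc (w - z) < rho -> (fun n => f_ n w) @ \oo --> f w) ->
  differentiable f z.
Proof.
move=> rho0 df fM ff.
have aux (x y p : R) : x < p / 2 - p / 8 -> y < p / 2 - p / 8 -> 0 < p -> x + y < p.
  by clear; lra.
have aux2 (x y r e t : R) : r <= x + y + e / 4 * t -> x < e * t / 16 -> y < e * t / 16 ->
   r < e * t / 2 - e * t / 8.
  by clear; lra.
pose q := quad_cst rho * M.
have zz : normc (z - z) < rho by rewrite subrr normc0.
have M0 : 0 <= M by apply: le_trans (fM 0%N z zz); exact: normc_ge0.
have q0 : 0 <= q by rewrite mulr_ge0 ?quad_cst_ge0.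
have Q n (h : C) : normc h < rho / 8 ->
    normc (f_ n (z + h) - f_ n z - dC (f_ n) z * h) <= q * normc h ^+ 2.
  by move=> hr; apply: quad_remainder1 => // w wz; [exact: df|exact: fM].
have r8 : rho / 8 < rho by rewrite ltr_pdivrMr// ltr_pMr// ltr1n.
have [l lP] : exists l : C, (fun n => dC (f_ n) z) @ \oo --> l.
  apply: cauchy_seqC_cvg => e e0.
  have q1 : 0 < q + 1 by rewrite ltr_wpDl.
  (* With q t <= e / 4 the remainder is at most e t / 4; the values at z + t and at z each
     contribute less than e t / 16. The total, 3 e t / 8 for each index, stays below e t when
     doubled. *)
  pose t := Num.min (rho / 16) (e / (4 * (q + 1))).
  have t0 : 0 < t by rewrite lt_min !divr_gt0// mulr_gt0.
  have tr : t < rho / 8.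
    by rewrite /t gt_min ltr_pM2l// ltf_pV2 ?posrE// ltr_nat.
  have qt : q * t <= e / 4.
    apply: le_trans (_ : (q + 1) * (e / (4 * (q + 1))) <= _); last first.
      by rewrite le_eqVlt; apply/orP; left; apply/eqP; field; rewrite gt_eqF.
    apply: ler_pM => //; [exact: ltW|by rewrite lerDl|by rewrite ge_min lexx orbT].
  have nt : normc (t%:C : C) = t by rewrite normc_real gtr0_norm.
  have zt : normc (z + t%:C - z) < rho by rewrite addrC addKr nt (lt_trans tr).
  have et : 0 < e * t / 16 by rewrite divr_gt0// mulr_gt0.
  have [N1 _ H1] := (cvgCP _ _ _).1 (ff _ zt) _ et.
  have [N2 _ H2] := (cvgCP _ _ _).1 (ff _ zz) _ et.
  exists (maxn N1 N2) => n Nn.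
  pose A k := f_ k (z + t%:C) - f (z + t%:C); pose B k := f_ k z - f z.
  pose r k := f_ k (z + t%:C) - f_ k z - dC (f_ k) z * t%:C.
  have small k : (maxn N1 N2 <= k)%N -> normc (A k - B k - r k) < e * t / 2 - e * t / 8.
    rewrite geq_max => /andP[k1 k2].
    have a1 := H1 k k1; have a2 := H2 k k2.
    have a3 : normc (r k) <= e / 4 * t.
      have := Q k t%:C; rewrite nt => /(_ tr) a3; apply: le_trans a3 _.
      by rewrite expr2 mulrA ler_wpM2r// ltW.
    exact: (aux2 _ _ _ _ _ (le_normcB2 (le_normcB2 (lexx (normc (A k))) (lexx (normc (B k)))) a3) a1 a2).
  have E : (dC (f_ (maxn N1 N2)) z - dC (f_ n) z) * t%:C =
      (A (maxn N1 N2) - B (maxn N1 N2) - r (maxn N1 N2)) - (A n - B n - r n).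
    rewrite /A /B /r; move: (f_ _ (z + t%:C)) (f_ _ z) (dC _ z) (f_ n (z + t%:C)) (f_ n z) (dC (f_ n) z) => *; ring.
  rewrite -(ltr_pM2r t0) -[X in _ * X < _]nt -normcM E.
  apply: le_lt_trans (normcB _ _) _.
  exact: (aux _ _ _ (small _ (leqnn _)) (small _ Nn) (mulr_gt0 e0 t0)).
suff : has_diff f z (fun h => l * h) by move=> /has_diff_C[].
(* The quadratic estimate passes to the limit at each fixed h, and it identifies [l] as the
   derivative of f at z. *)
have QL (h : C) : normc h < rho / 8 -> normc (f (z + h) - f z - l * h) <= q * normc h ^+ 2.
  move=> hr; apply: (@normc_lim_le (fun n => f_ n (z + h) - f_ n z - dC (f_ n) z * h)).
    apply: cvgC_D; last by apply: cvgC_N; apply: cvgC_M; [exact: lP|exact: cvg_cst].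
    apply: cvgC_D; last by apply: cvgC_N; exact: ff.
    by apply: ff; rewrite addrC addKr (lt_trans hr).
  by move=> n; exact: Q.
move=> e e0; have q1 : 0 < q + 1 by rewrite ltr_wpDl.
exists (Num.min (rho / 8) (e / (q + 1))).
  by rewrite lt_min !divr_gt0.
move=> h; rewrite lt_min => /andP[h1 h2]; apply: le_trans (QL h h1) _.
rewrite expr2 mulrA ler_wpM2r ?normc_ge0//.
move: h2; rewrite nvC ltr_pdivlMr// => /ltW; apply: le_trans.
by rewrite mulrC ler_wpM2l ?normc_ge0// lerDl.
Qed.

Lemma diff_scaleE V (f : V -> C) (x h : V) (k : C) :
  'd f x ((k : R[i]) *: h) = k * 'd f x h.
Proof. exact: linearZ. Qed.

Section HolInt.
Variables (V : normedModType R[i]) (D : set R) (mD : measurable D).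
Variables (f : V -> R -> C) (x0 : V) (rho : R) (M : R -> R).
Hypothesis rho0 : 0 < rho.
Hypothesis iM : Rintegrable D M.
Hypothesis df : forall y s, nv (y - x0) < rho -> D s -> differentiable (f ^~ s) y.
Hypothesis fM : forall y s, nv (y - x0) < rho -> D s -> normc (f y s) <= M s.
Hypothesis mf : forall y, nv (y - x0) < rho -> measC D (f y).

Let x0r : nv (x0 - x0) < rho. Proof. by rewrite subrr nv0. Qed.
Let Q s h : D s -> nv h < rho / 8 ->
  normc (f (x0 + h) s - f x0 s - 'd (f ^~ s) x0 h) <= quad_cst rho * M s * nv h ^+ 2 /\
  normc ('d (f ^~ s) x0 h) <= 8 * M s / rho * nv h.
Proof.
by move=> Ds hr; apply: (@quad_remainder R V (f ^~ s)) => // y yx; [exact: df|exact: fM].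
Qed.

Let M0 s : D s -> 0 <= M s.
Proof. by move=> Ds; apply: le_trans (fM x0r Ds); exact: normc_ge0. Qed.

(** The remainder estimate covers small h only; by homogeneity of the differential, a rescaled h
    gives the bound and the measurability for every h. *)
Let shrink (h : V) : exists2 k : R, 0 < k & nv ((k%:C : R[i]) *: h) < rho / 8.
Proof.
have h1 : 0 < nv h + 1 by rewrite ltr_wpDl ?nv_ge0.
exists (rho / 8 / (nv h + 1)); first by rewrite !divr_gt0.
rewrite nvZ normc_real ger0_norm; last by rewrite !divr_ge0// ltW.
rewrite mulrAC ltr_pdivrMr// ltr_pM2l ?divr_gt0//; lra.
Qed.

Let bnd s h : D s -> normc ('d (f ^~ s) x0 h) <= 8 * M s / rho * nv h.
Proof.
move=> Ds; have [k k0 kh] := shrink h.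
have [_] := Q Ds kh; rewrite diff_scaleE nvZ normcM normc_real gtr0_norm//.
by rewrite mulrCA ler_pM2l.
Qed.

(** The differential applied to h is the pointwise limit of n (f (x0 + h / n) - f x0), hence
    measurable in the parameter. *)
Let meas_small h : nv h < rho / 8 -> measC D (fun s => 'd (f ^~ s) x0 h).
Proof.
move=> hr.
have r8 : rho / 8 < rho by rewrite ltr_pdivrMr// ltr_pMr// ltr1n.
have n0 (n : nat) : 0 < n.+1%:R :> R by rewrite ltr0n.
have hn (n : nat) : nv (((n.+1%:R^-1)%:C : R[i]) *: h) = n.+1%:R^-1 * nv h.
  by rewrite nvZ normc_real gtr0_norm// invr_gt0.
have hnr (n : nat) : nv (((n.+1%:R^-1)%:C : R[i]) *: h) < rho / 8.
  rewrite hn; apply: le_lt_trans hr; rewrite ler_piMl ?nv_ge0// invf_le1//.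
  by rewrite ler1n.
apply: (@measC_lim _ _ _ D (fun n s => (n.+1%:R)%:C *
    (f (x0 + ((n.+1%:R^-1)%:C : R[i]) *: h) s - f x0 s))).
  move=> n; apply: measCM; first exact: measC_cst.
  apply: measCD; first by apply: mf; rewrite addrC addKr (lt_trans (hnr n)).
  by apply: measCN; exact: mf.
move=> s Ds; apply/cvgCP => e e0.
pose c := quad_cst rho * M s * nv h ^+ 2.
have c0 : 0 <= c.
  apply: mulr_ge0; last exact: exprn_ge0 (nv_ge0 h).
  by apply: mulr_ge0; [exact: quad_cst_ge0|exact: M0].
near=> n.
have -> : (n.+1%:R)%:C * (f (x0 + ((n.+1%:R^-1)%:C : R[i]) *: h) s - f x0 s) - 'd (f ^~ s) x0 h
   = (n.+1%:R)%:C * (f (x0 + ((n.+1%:R^-1)%:C : R[i]) *: h) s - f x0 s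
       - 'd (f ^~ s) x0 (((n.+1%:R^-1)%:C : R[i]) *: h)).
  rewrite diff_scaleE [RHS]mulrBr mulrA -rmorphM mulfV ?mul1r//; exact: lt0r_neq0.
rewrite normcM normc_real gtr0_norm//.
have [H _] := Q Ds (hnr n); rewrite hn in H.
apply: (@le_lt_trans _ _ (c * n.+1%:R^-1)).
  rewrite -ler_pdivlMl//; apply: le_trans H _; rewrite le_eqVlt; apply/orP; left; apply/eqP.
  by rewrite /c; field; rewrite gt_eqF.
rewrite ltr_pdivrMr// mulrC -ltr_pdivrMr//.
apply: lt_le_trans (archi_boundP _) _; first by rewrite divr_ge0// ltW.
by rewrite ler_nat ltnW//; near: n; exists (Num.bound (c / e)).
Unshelve. all: by end_near. Qed.

Lemma hol_int_dint (h : V) : Cintegrable D (fun s => 'd (f ^~ s) x0 h).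
Proof.
have [k k0 kh] := shrink h.
apply: (@Cintegrable_dom _ _ _ (fun s => (8 / rho * nv h) * M s)) => //.
- apply: (measC_eq (h := fun s => (k^-1)%:C * 'd (f ^~ s) x0 ((k%:C : R[i]) *: h))).
    move=> s Ds; rewrite diff_scaleE mulrA -rmorphM mulVf ?mul1r//; exact: lt0r_neq0.
  by apply: measCM; [exact: measC_cst|exact: meas_small].
- exact: RintegrableZ.
- move=> s Ds; apply: le_trans (bnd h Ds) _; rewrite le_eqVlt; apply/orP; left; apply/eqP.
  ring.
Qed.

(** Differentiation under the integral from a majorant of the integrand alone: by [quad_remainder]
    the differential is bounded by a multiple of [M s] and the second-order remainder by a multiple
    of M s |h|^2, so both integrate. *)
Lemma hol_int : differentiable (fun y => Cintegral D (f y)) x0 /\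
  forall h, 'd (fun y => Cintegral D (f y)) x0 h = Cintegral D (fun s => 'd (f ^~ s) x0 h).
Proof.
pose L (h : V) : C := Cintegral D (fun s => 'd (f ^~ s) x0 h).
have Llin : linear L.
  move=> a u v; have -> : a *: L u = (a : C) * L u by [].
  rewrite /L -CintegralZ//; last exact: hol_int_dint.
  rewrite -CintegralD//; [|apply: CintegrableZ => //; exact: hol_int_dint|exact: hol_int_dint].
  by apply: eq_Cintegral => s _; rewrite linearP.
pose L' : {linear V -> C} := HB.pack L (GRing.isLinear.Build _ _ _ _ L Llin).
have fi y : nv (y - x0) < rho -> Cintegrable D (f y).
  by move=> yx; apply: (Cintegrable_dom mD (mf yx) iM) => s; exact: fM.
have [||h1 h2] := @has_diff_differentiable R V (fun y => Cintegral D (f y)) x0 L'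
   (2 * (8 / rho * Rintegral mu D M)).
- move=> h; rewrite /= /L.
  have -> : 2 * (8 / rho * Rintegral mu D M) * nv h =
      2 * Rintegral mu D (fun s => (8 / rho * nv h) * M s).
    by rewrite (@RintegralZl _ _ R mu)//; ring.
  apply: le_Cintegral => //; first exact: Cintegrable_measC (hol_int_dint h).
    exact: RintegrableZ.
  move=> s Ds; apply: le_trans (bnd h Ds) _; rewrite le_eqVlt; apply/orP; left; apply/eqP.
  ring.
- pose I := Rintegral mu D M.
  have I0 : 0 <= I by apply: Rintegral_ge0.
  pose q := 2 * (quad_cst rho * I).
  have q0 : 0 <= q by rewrite mulr_ge0// mulr_ge0// quad_cst_ge0.
  have q1 : 0 < q + 1 by rewrite ltr_wpDl.
  move=> e e0; exists (Num.min (rho / 8) (e / (q + 1))); first by rewrite lt_min !divr_gt0.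
  move=> h; rewrite lt_min => /andP[h1 h2].
  have r8 : rho / 8 < rho by rewrite ltr_pdivrMr// ltr_pMr// ltr1n.
  have xh : nv (x0 + h - x0) < rho by rewrite addrC addKr (lt_trans h1).
  have -> : Cintegral D (f (x0 + h)) - Cintegral D (f x0) - L' h =
     Cintegral D (fun s => f (x0 + h) s - f x0 s - 'd (f ^~ s) x0 h).
    rewrite CintegralB// ?CintegralB//; [exact: fi|exact: fi| |exact: hol_int_dint].
    by apply: CintegrableB => //; exact: fi.
  apply: (@le_trans _ _ (q * nv h ^+ 2)).
    have -> : q * nv h ^+ 2 = 2 * Rintegral mu D (fun s => (quad_cst rho * nv h ^+ 2) * M s).
      by rewrite (@RintegralZl _ _ R mu)// /q /I; ring.
    apply: le_Cintegral => //.
    + apply: measCD; last by apply: measCN; exact: Cintegrable_measC (hol_int_dint h).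
      by apply: measCD; [exact: mf|apply: measCN; exact: mf].
    + exact: RintegrableZ.
    + move=> s Ds; have [H _] := Q Ds h1; apply: le_trans H _.
      rewrite le_eqVlt; apply/orP; left; apply/eqP; ring.
  rewrite expr2 mulrA ler_wpM2r ?nv_ge0//.
  move: h2; rewrite ltr_pdivlMr// => /ltW; apply: le_trans.
  by rewrite mulrC ler_wpM2l ?nv_ge0// lerDl.
- split; [exact: h1|move=> h; exact: (congr1 (fun g : V -> C => g h) h2)].
Qed.

End HolInt.

Lemma CfubiniD (f : R -> R -> C) (D : set R) (a b : R -> R) : measurable D ->
  measC [set: R * R] (fun z : R * R => f z.1 z.2) ->
  Rintegrable [set: R] a -> Rintegrable D b ->
  (forall x, 0 <= a x) -> (forall y, D y -> 0 <= b y) ->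
  (forall x y, D y -> normc (f x y) <= a x * b y) ->
  [/\ Cintegrable [set: R] (fun x => Cintegral D (f x)),
      Cintegrable D (fun y => Cintegral [set: R] (f ^~ y)) &
      Cintegral [set: R] (fun x => Cintegral D (f x)) =
      Cintegral D (fun y => Cintegral [set: R] (f ^~ y))].
Proof.
move=> mD mf ia ib a0 b0 fab.
pose g x y : C := (\1_D y)%:C * f x y.
pose b' := b \_ D.
have gD x y : D y -> g x y = f x y by move=> Dy; rewrite /g indicE mem_set// mul1r.
have gN x y : ~ D y -> g x y = 0 by move=> Dy; rewrite /g indicE memNset// mul0r.
have mg : measC [set: R * R] (fun z : R * R => g z.1 z.2).
  apply: measCM => //; apply: measC_real.
  apply: (measurableT_comp (f := (\1_D : R -> R))); last exact: measurable_snd.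
  exact: measurable_indic.
have ib' : Rintegrable [set: R] b'.
  have := (@integrable_mkcond _ _ R mu D (EFin \o b) mD).1 ib.
  by rewrite /Rintegrable /b' restrict_EFin.
have nin y : (y \in D) = false -> ~ D y by move=> h Dy; rewrite mem_set in h.
have b'0 y : 0 <= b' y.
  by rewrite /b' /patch; case: ifP => [/set_mem|_]; [exact: b0|exact: lexx].
have gab x y : normc (g x y) <= a x * b' y.
  rewrite /b' /patch; case: ifP => [/set_mem Dy|/nin Dy].
    by rewrite (gD x y Dy); exact: fab.
  by rewrite (gN x y Dy) normc0 mulr0.
have [h1 h2 h3] := Cfubini mg ia ib' a0 b'0 gab.
have E x : Cintegral [set: R] (g x) = Cintegral D (f x).
  rewrite [RHS]Cintegral_mkcond; apply: eq_Cintegral => y _; rewrite /patch.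
  by case: ifP => [/set_mem Dy|/nin Dy]; [exact: gD|exact: gN].
have E2 : (fun x => Cintegral [set: R] (g x)) = (fun x => Cintegral D (f x)).
  by apply/funext => x; exact: E.
have E3 y : D y -> Cintegral [set: R] (g ^~ y) = Cintegral [set: R] (f ^~ y).
  by move=> Dy; apply: eq_Cintegral => x _; exact: gD.
split.
- by move: h1; rewrite E2; apply.
- apply: (eq_Cintegrable mD E3); exact: (Cintegrable_sub measurableT mD (@subsetT _ D) h2).
- rewrite -E2 h3 [RHS]Cintegral_mkcond; apply: eq_Cintegral => y _; rewrite /patch.
  case: ifP => [/set_mem Dy|/nin Dy]; first exact: E3.
  rewrite (eq_Cintegral (g := fun=> 0)); last by move=> x _; exact: gN.
  by rewrite /Cintegral /= /Rintegral integral0.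
Qed.

(** [hol_int] is applied twice. The radius is halved in between because the outer application needs
    the inner integral to be differentiable on a whole ball and not only at [x0]. *)
Lemma hol_int2 V (D : set R) (f : V -> R -> R -> C) (x0 : V) (rho : R) (a b : R -> R) :
  measurable D -> 0 < rho ->
  Rintegrable [set: R] a -> Rintegrable D b ->
  (forall m, 0 <= a m) -> (forall s, D s -> 0 <= b s) ->
  (forall y m s, nv (y - x0) < rho -> D s -> differentiable (fun y => f y m s) y) ->
  (forall y m s, nv (y - x0) < rho -> D s -> normc (f y m s) <= a m * b s) ->
  (forall y, nv (y - x0) < rho -> measC [set: R * R] (fun z : R * R => f y z.1 z.2)) ->
  let F y := Cintegral [set: R] (fun m => Cintegral D (f y m)) in
  [/\ differentiable F x0,
      forall h m, Cintegrable D (fun s => 'd (fun y => f y m s) x0 h) ,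
      forall h, Cintegrable [set: R] (fun m => Cintegral D (fun s => 'd (fun y => f y m s) x0 h)) &
      forall h, 'd F x0 h =
        Cintegral [set: R] (fun m => Cintegral D (fun s => 'd (fun y => f y m s) x0 h))].
Proof.
move=> mD rho0 ia ib a0 b0 df fab mf F.
have x0r : nv (x0 - x0) < rho by rewrite subrr nv0.
have mfm y m : nv (y - x0) < rho -> measC D (f y m).
  move=> /mf my; have := measC_comp my (measurable_pair1 m).
  by apply: measC_sub.
have iab m : Rintegrable D (fun s => a m * b s) by exact: RintegrableZ.
have sub (y : V) : nv (y - x0) < rho / 2 -> forall w, nv (w - y) < rho / 2 -> nv (w - x0) < rho.
  move=> yx w wy; have -> : w - x0 = (w - y) + (y - x0) by rewrite addrA subrK.
  by apply: le_lt_trans (le_nvD _ _) _; rewrite (splitr rho) ltrD.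
have r2 : 0 < rho / 2 by rewrite divr_gt0.
have inner y m : nv (y - x0) < rho / 2 -> differentiable (fun y => Cintegral D (f y m)) y.
  move=> yx; apply: (hol_int mD r2 (iab m) _ _ _).1.
  - by move=> w s wy Ds; apply: df => //; exact: (sub y).
  - by move=> w s wy Ds; apply: fab => //; exact: (sub y).
  - by move=> w wy; apply: mfm; exact: (sub y).
have inner2 m := hol_int mD rho0 (iab m) (fun w s wy Ds => df w m s wy Ds)
  (fun w s wy Ds => fab w m s wy Ds) (fun w wy => mfm w m wy).
pose B := 2 * Rintegral mu D b.
have B0 : 0 <= B by rewrite mulr_ge0// Rintegral_ge0.
have iaB : Rintegrable [set: R] (fun m => B * a m) by exact: RintegrableZ.
have half y : nv (y - x0) < rho / 2 -> nv (y - x0) < rho.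
  by move=> h; apply: lt_trans h _; rewrite ltr_pdivrMr// ltr_pMr// ltr1n.
have o1 y m : nv (y - x0) < rho / 2 -> [set: R] m ->
    differentiable (fun y => Cintegral D (f y m)) y by move=> yx _; exact: inner.
have o2 y m : nv (y - x0) < rho / 2 -> [set: R] m -> normc (Cintegral D (f y m)) <= B * a m.
  move=> /half yx _; have -> : B * a m = 2 * Rintegral mu D (fun s => a m * b s).
    by rewrite (@RintegralZl _ _ R mu)// /B; ring.
  by apply: le_Cintegral => //; [exact: mfm|move=> s Ds; exact: fab].
have o3 y : nv (y - x0) < rho / 2 -> measC [set: R] (fun m => Cintegral D (f y m)).
  move=> /half yx; have [h1 _ _] := CfubiniD mD (mf _ yx) ia ib a0 b0 (fun m s => fab y m s yx).
  exact: Cintegrable_measC h1.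
have [d1 d2] := hol_int measurableT r2 iaB o1 o2 o3.
have E h : (fun m => 'd (fun y => Cintegral D (f y m)) x0 h) =
    (fun m => Cintegral D (fun s => 'd (fun y => f y m s) x0 h)).
  by apply/funext => m; have [_ H] := inner2 m; exact: H.
split; first exact: d1.
- move=> h m; apply: (hol_int_dint mD rho0 (iab m)).
  + by move=> w s wy Ds; apply: df.
  + by move=> w s wy Ds; apply: fab.
  + by move=> w wy; apply: mfm.
- by move=> h; rewrite -E; exact: (hol_int_dint measurableT r2 iaB o1 o2 o3).
- by move=> h; rewrite -E; exact: d2.
Qed.

End ParameterIntegrals.

(** * Integrals along rays *)

Section Rays.
Variable R : realType.
Local Notation C := (Cx R).
Local Notation mu := (@lebesgue_measure R).
Implicit Types (g : C -> C).

(** Continuity is required only away from 0, where the integrands may be singular; adding the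
    endpoint to the open half-line does not affect measurability. *)
Lemma ray_measC g (t : R) : (forall s, 0 < s -> {for polar s t, continuous g}) ->
  measC `[(0 : R), +oo[ (ray_integrand t g).
Proof.
move=> cg.
have cr (s : R) : 0 < s -> {for s, continuous (ray_integrand t g)}.
  move=> s0; suff : {for s, continuous (fun s : R => g (polar s t) * expi t)} by [].
  apply: contC_M; last exact: contC_cst.
  exact: (cvg_comp (fun s : R => polar s t) g (@continuous_polar1 R t s) (cg s s0)).
have H (q : C -> R) : continuous q -> measurable_fun `[(0 : R), +oo[ (fun s => q (ray_integrand t g s)).
  move=> cq; apply/measurable_fun_itv_obnd_cbndP.
  apply: open_continuous_measurable_fun => // s; rewrite inE/= in_itv/= andbT => s0.
  by apply: (@continuous_comp _ _ _ (ray_integrand t g) q); [exact: cr|exact: cq].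
by split; apply: H; [exact: continuous_Re|exact: continuous_Im].
Qed.

Lemma ray_integrable_exp g (t A c : R) : 0 < c -> (forall s, 0 < s -> {for polar s t, continuous g}) ->
  (forall s, 0 <= s -> normc (g (polar s t)) <= A * expR (- (c * s))) -> ray_integrable t g.
Proof.
move=> c0 cg gA; apply: (@Cintegrable_dom _ _ _ (fun s => A * expR (- (c * s)))) => //.
- exact: ray_measC.
- by apply: RintegrableZ => //; exact: integrable_exp_tail.
- move=> s /=; rewrite in_itv/= andbT => s0; rewrite /ray_integrand normcM normc_expi mulr1.
  exact: gA.
Qed.

Lemma le_ray_integral g (t A c : R) : 0 < c -> (forall s, 0 < s -> {for polar s t, continuous g}) ->
  (forall s, 0 <= s -> normc (g (polar s t)) <= A * expR (- (c * s))) ->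
  normc (ray_integral t g) <= 2 * (A / c).
Proof.
move=> c0 cg gA.
have -> : A / c = Rintegral mu `[0, +oo[ (fun s => A * expR (- (c * s))).
  rewrite (@RintegralZl _ _ R mu)//; last exact: integrable_exp_tail.
  by rewrite Rintegral_exp_tail// mulr0 oppr0 expR0 mul1r.
apply: le_Cintegral => //.
- exact: ray_measC.
- by apply: RintegrableZ => //; exact: integrable_exp_tail.
- move=> s /=; rewrite in_itv/= andbT => s0; rewrite /ray_integrand normcM normc_expi mulr1.
  exact: gA.
Qed.

(** [g] is bounded near 0 but need not be differentiable there. Goursat's theorem is applied for
    radii between [s1] and [r]; the parts below [s1] and the inner arc are of size s1, and [s1] is
    arbitrarily small. *)
Lemma ray_arc g (r a b A K : R) : 0 < r -> a < b ->
  (forall s t, 0 < s <= r -> a <= t <= b -> differentiable g (polar s t)) ->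
  (forall s t, 0 <= s <= r -> a <= t <= b -> normc (g (polar s t)) <= A) ->
  (forall t, a <= t <= b -> normc (g (polar r t)) <= K) ->
  normc (Cintegral `[0, r] (ray_integrand a g) - Cintegral `[0, r] (ray_integrand b g))
    <= 2 * (K * r * (b - a)).
Proof.
move=> r0 ab dg gA gK.
have aa : a <= a <= b by rewrite lexx ltW.
have bb : a <= b <= b by rewrite lexx ltW.
have A0 : 0 <= A by apply: le_trans (gA r a _ aa); [exact: normc_ge0|rewrite lexx ltW].
have meas t : a <= t <= b -> measC `[0, r] (ray_integrand t g).
  move=> tab.
  have cr (s : R) : 0 < s <= r -> {for s, continuous (ray_integrand t g)}.
    move=> s0; suff : {for s, continuous (fun s : R => g (polar s t) * expi t)} by [].
    apply: contC_M; last exact: contC_cst.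
    have cgs : {for polar s t, continuous g} by apply: differentiable_continuous; exact: dg.
    exact: (cvg_comp (fun s : R => polar s t) g (@continuous_polar1 R t s) cgs).
  have cw : {within `]0, r], continuous (ray_integrand t g)}.
    by apply: continuous_in_subspaceT => s; rewrite inE/= in_itv/=; exact: cr.
  have [m1 m2] := within_continuous_measC (measurable_itv _) cw.
  by split; apply/measurable_fun_itv_obnd_cbndP; [exact: m1|exact: m2].
have bd t s : a <= t <= b -> 0 <= s <= r -> normc (ray_integrand t g s) <= A.
  by move=> tab sr; rewrite /ray_integrand normcM normc_expi mulr1; exact: gA.
have int t : a <= t <= b -> Cintegrable `[0, r] (ray_integrand t g).
  by move=> tab; apply: Cintegrable_itv_bnd; [exact: meas|move=> s; exact: bd].
apply/ler_addgt0Pr => e e0.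
have c0 : 0 < 4 * A + 2 * (A * (b - a)) + 1.
  rewrite ltr_wpDl// addr_ge0// mulr_ge0// mulr_ge0// subr_ge0 ltW//.
(* The two inner segments and the inner arc contribute at most s1 (4 A + 2 A (b - a)); the added 1
   keeps the denominator positive. *)
pose s1 := Num.min (r / 2) (e / (4 * A + 2 * (A * (b - a)) + 1)).
have s10 : 0 < s1 by rewrite lt_min !divr_gt0.
have s1r : s1 < r by rewrite /s1 gt_min ltr_pdivrMr// ltr_pMr// ltr1n.
have s1e : s1 * (4 * A + 2 * (A * (b - a)) + 1) <= e.
  by rewrite -ler_pdivlMr// /s1 ge_min lexx orbT.
have dg' s t : s1 <= s <= r -> a <= t <= b -> differentiable g (polar s t).
  by move=> /andP[h1 h2]; apply: dg; rewrite h2 (lt_le_trans s10 h1).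
have cg : cont_on g s1 r a b.
  by move=> s t hs ht; apply: differentiable_continuous; exact: dg'.
have J := Jint_goursat (ltW s10) s1r ab dg'.
have spl t : a <= t <= b -> Cintegral `[0, r] (ray_integrand t g) =
    Cintegral `[0, s1] (ray_integrand t g) + Hint g s1 r t.
  by move=> tab; apply: Cintegral_itv_split; [exact: ltW|exact: ltW|exact: int].
have sm t : a <= t <= b -> normc (Cintegral `[0, s1] (ray_integrand t g)) <= 2 * (A * s1).
  move=> tab; rewrite -[X in A * X]subr0; apply: le_Cintegral_itv; first exact: ltW.
    apply: measC_sub (meas t tab) => //; apply: subset_itvl; rewrite bnd_simp; exact: ltW.
  by move=> s /andP[h1 h2]; apply: bd => //; rewrite h1 (le_trans h2)// ltW.
have V1 : normc (Vint g a b s1) <= 2 * (A * s1 * (b - a)).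
  apply: le_Cintegral_itv; first exact: ltW.
    by apply: (Cintegrable_measC _ (Vint_integrable cg _)) => //; rewrite lexx ltW.
  move=> t tab; rewrite normcM [normc ('i%C * _)]normcM normc_i mul1r (normc_polar _ (ltW s10)).
  by rewrite ler_wpM2r ?(ltW s10)// gA// !ltW.
have V2 : normc (Vint g a b r) <= 2 * (K * r * (b - a)).
  apply: le_Cintegral_itv; first exact: ltW.
    by apply: (Cintegrable_measC _ (Vint_integrable cg _)) => //; rewrite lexx ltW.
  move=> t tab; rewrite normcM [normc ('i%C * _)]normcM normc_i mul1r (normc_polar _ (ltW r0)).
  by rewrite ler_wpM2r ?(ltW r0)// gK.
have E : Cintegral `[0, r] (ray_integrand a g) - Cintegral `[0, r] (ray_integrand b g) =
   Cintegral `[0, s1] (ray_integrand a g) - Cintegral `[0, s1] (ray_integrand b g)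
   + Vint g a b s1 - Vint g a b r.
  rewrite !spl//; move: J; rewrite /Jint.
  move: (Hint g s1 r a) (Hint g s1 r b) (Vint g a b r) (Vint g a b s1) => h1 h2 v1 v2 J.
  have -> : h1 = h2 + v2 - v1 by rewrite -[RHS]addr0 -J; ring.
  ring.
rewrite E; apply: le_trans (le_normcB2 (le_normcD2 (le_normcB2 (sm a aa) (sm b bb)) V1) V2) _.
move: s1e s10; clear; move=> s1e s10.
have -> : 2 * (A * s1) + 2 * (A * s1) + 2 * (A * s1 * (b - a)) = s1 * (4 * A + 2 * (A * (b - a)) + 1) - s1.
  ring.
lra.
Qed.

(* On the disc of radius r both rays are moved, by Cauchy's theorem, to the arc
   of radius r between them; the tails are estimated separately. *)
Lemma ray_jump g1 g2 (r a b A K T : R) : 0 < r ->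
  (forall s t, 0 < s <= r -> Num.min a b <= t <= Num.max a b -> differentiable g1 (polar s t)) ->
  (forall s t, 0 <= s <= r -> Num.min a b <= t <= Num.max a b -> g1 (polar s t) = g2 (polar s t)) ->
  (forall s t, 0 <= s <= r -> Num.min a b <= t <= Num.max a b -> normc (g1 (polar s t)) <= A) ->
  (forall t, Num.min a b <= t <= Num.max a b -> normc (g1 (polar r t)) <= K) ->
  (forall s, r <= s -> normc (g1 (polar s a)) <= T * expR (- s)) ->
  (forall s, r <= s -> normc (g2 (polar s b)) <= T * expR (- s)) ->
  ray_integrable a g1 -> ray_integrable b g2 ->
  normc (ray_integral a g1 - ray_integral b g2) <=
    2 * (K * r * `|b - a|) + 4 * (T * expR (- r)).
Proof.
move=> r0 dg g12 gA gK ga gb ia ib.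
have aab : Num.min a b <= a <= Num.max a b by rewrite ge_min le_max lexx.
have bab : Num.min a b <= b <= Num.max a b by rewrite ge_min le_max lexx !orbT.
have tail t (g : C -> C) : ray_integrable t g -> (forall s, r <= s -> normc (g (polar s t)) <= T * expR (- s)) ->
    ray_integral t g = Cintegral `[0, r] (ray_integrand t g) + Cintegral `[r, +oo[ (ray_integrand t g)
    /\ normc (Cintegral `[r, +oo[ (ray_integrand t g)) <= 2 * (T * expR (- r)).
  move=> it gt; split; first by apply: Cintegral_itvy_split; [exact: ltW|exact: it].
  have -> : T * expR (- r) = Rintegral mu `[r, +oo[ (fun s => T * expR (- (1 * s))).
    rewrite (@RintegralZl _ _ R mu)//; last exact: integrable_exp_tail.
    by rewrite Rintegral_exp_tail// mul1r divr1.
  have sub : `[r, +oo[ `<=` `[(0 : R), +oo[ by apply: subset_itvr; rewrite bnd_simp ltW.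
  apply: le_Cintegral => //.
  - by apply: (measC_sub _ sub); [|exact: Cintegrable_measC it].
  - by apply: RintegrableZ => //; exact: integrable_exp_tail.
  - move=> s /=; rewrite in_itv/= andbT mul1r => rs.
    by rewrite /ray_integrand normcM normc_expi mulr1; exact: gt.
have [-> t1] := tail a g1 ia ga; have [-> t2] := tail b g2 ib gb.
have eb : Cintegral `[0, r] (ray_integrand b g2) = Cintegral `[0, r] (ray_integrand b g1).
  apply: eq_Cintegral => s /=; rewrite in_itv/= => sr; rewrite /ray_integrand.
  by congr (_ * _); apply/esym; exact: g12.
rewrite eb.
have M : normc (Cintegral `[0, r] (ray_integrand a g1) - Cintegral `[0, r] (ray_integrand b g1))
    <= 2 * (K * r * `|b - a|).
  have [ab|ba|<-] := ltgtP a b.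
  - rewrite gtr0_norm ?subr_gt0//; rewrite (min_idPl (ltW ab)) (max_idPr (ltW ab)) in dg gA gK.
    exact: (ray_arc r0 ab dg gA gK).
  - rewrite ltr0_norm ?subr_lt0// opprB normc_sym.
    rewrite (min_idPr (ltW ba)) (max_idPl (ltW ba)) in dg gA gK.
    exact: (ray_arc r0 ba dg gA gK).
  - by rewrite !subrr normc0 normr0 mulr0 mulr0.
have -> : 4 * (T * expR (- r)) = 2 * (T * expR (- r)) + 2 * (T * expR (- r)) by ring.
move: (Cintegral _ _) (Cintegral _ _) M (Cintegral _ _) (Cintegral _ _) t1 t2 => x y xy z w zx wx.
have -> : y + w - (x + z) = (y - x) + (w - z) by ring.
by apply: le_normcD2 => //; exact: le_normcB2.
Qed.

(** [ray_jump] with both functions equal to [g], as the radius tends to infinity: the arc costs r |b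
    - a| exp (- r) and the tails cost exp (- r). *)
Lemma ray_rotate g (a b A : R) :
  (forall s t, 0 < s -> Num.min a b <= t <= Num.max a b -> differentiable g (polar s t)) ->
  (forall s t, 0 <= s -> Num.min a b <= t <= Num.max a b -> normc (g (polar s t)) <= A * expR (- s)) ->
  ray_integral a g = ray_integral b g.
Proof.
move=> dg gA.
have aab : Num.min a b <= a <= Num.max a b by rewrite ge_min le_max lexx.
have bab : Num.min a b <= b <= Num.max a b by rewrite ge_min le_max lexx !orbT.
have int t : Num.min a b <= t <= Num.max a b -> ray_integrable t g.
  move=> tab; apply: (@ray_integrable_exp g t A 1) => //.
    by move=> s s0; apply: differentiable_continuous; exact: dg.
  by move=> s s0; rewrite mul1r; exact: gA.
have A0 : 0 <= A.
  have := gA 0 a (lexx _) aab; rewrite oppr0 expR0 mulr1; apply: le_trans; exact: normc_ge0.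
apply/subr0_eq/eq0_normc/eqP; rewrite eq_le normc_ge0 andbT.
apply/ler_addgt0Pr => e e0; rewrite add0r.
(* Each of the two contributions is at most a constant over r, and [B] collects these constants so
   that their sum is at most 4 B / r, which is at most e for the chosen r. *)
pose B := 2 * (A * `|b - a| * 2) + 4 * A.
have B0 : 0 <= B by rewrite addr_ge0 ?mulr_ge0.
pose r := 4 * B / e + 1.
have r1 : 1 <= r by rewrite lerDr divr_ge0 ?mulr_ge0// ltW.
have r0 : 0 < r by apply: lt_le_trans r1.
have := @ray_jump g g r a b A (A * expR (- r)) A r0.
move=> H; apply: le_trans (H _ _ _ _ _ _ (int _ aab) (int _ bab)) _.
- by move=> s t /andP[s0 _]; exact: dg.
- by [].
- move=> s t /andP[s0 _] ht; apply: le_trans (gA s t s0 ht) _.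
  by rewrite ler_piMr// -expR0 ler_expR oppr_le0.
- by move=> t ht; apply: gA => //; exact: ltW.
- by move=> s rs; apply: gA => //; rewrite (le_trans (ltW r0)).
- by move=> s rs; apply: gA => //; rewrite (le_trans (ltW r0)).
have er : expR (- r) <= 1 / r.
  rewrite expRN div1r lef_pV2 ?posrE ?expR_gt0//; apply: le_trans (expR_ge1Dx r); lra.
(* exp (- r) is the square of exp (- r / 2), and each factor is at most 2 / r; this gains the extra
   power of r needed for the arc. *)
have rer : r * expR (- r) <= 4 / r.
  have h : expR (- (r / 2)) <= 1 / (r / 2).
    rewrite expRN div1r lef_pV2 ?posrE ?expR_gt0 ?divr_gt0//; apply: le_trans (expR_ge1Dx (r / 2)); lra.
  have -> : expR (- r) = expR (- (r / 2)) * expR (- (r / 2)) by rewrite -expRD; congr expR; field.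
  have -> : 4 / r = r * (1 / (r / 2) * (1 / (r / 2))) by field; rewrite gt_eqF.
  by rewrite ler_pM2l//; apply: ler_pM; rewrite ?expR_ge0.
have Br : 4 * B / r <= e.
  rewrite ler_pdivrMr//; have -> : e * r = 4 * B + e by rewrite /r; field; rewrite gt_eqF.
  by rewrite lerDl ltW.
apply: le_trans _ Br.
have -> : 2 * (A * expR (- r) * r * `|b - a|) + 4 * (A * expR (- r)) =
   2 * (A * `|b - a|) * (r * expR (- r)) + 4 * A * expR (- r) by ring.
have -> : 4 * B / r = 2 * (A * `|b - a|) * (4 / r) + 2 * (A * `|b - a|) * (4 / r) + 16 * A * (1 / r).
  by rewrite /B; field; rewrite gt_eqF.
have h1 : 2 * (A * `|b - a|) * (r * expR (- r)) <= 2 * (A * `|b - a|) * (4 / r).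
  by apply: ler_wpM2l => //; rewrite !mulr_ge0.
have h2 : 4 * A * expR (- r) <= 16 * A * (1 / r).
  apply: ler_pM; rewrite ?expR_ge0 ?mulr_ge0//; move: A0; clear; lra.
have h3 : 0 <= 2 * (A * `|b - a|) * (4 / r) by rewrite !mulr_ge0// invr_ge0 ltW.
move: h1 h2 h3; clear; lra.
Qed.

End Rays.

(** * The complex exponential and its derivative *)

Section ComplexExponential.
Variable R : realType.
Local Notation C := (Cx R).

Lemma pderiv_cexp_line (w : C) (t : R) :
  pderiv (fun t => cexp (t%:C * w)) t (w * cexp (t%:C * w)).
Proof.
have E (u : R) : cexp (u%:C * w) = (expR (u * complex.Re w))%:C * expi (u * complex.Im w).
  by rewrite /cexp cReM cImM /= !mul0r subr0 addr0.
have -> : (fun t => cexp (t%:C * w)) =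
    (fun t => (expR (t * complex.Re w))%:C * expi (t * complex.Im w)) by apply/funext.
rewrite E; apply: pderiv_eq; last first.
  apply: (@pderivM R _ _ t ((complex.Re w * expR (t * complex.Re w))%:C)
     ((complex.Im w)%:C * ('i%C * expi (t * complex.Im w)))).
    split => /=; last exact: is_derive_cst.
    by apply: is_derive_eq; rewrite /GRing.scale/=; ring.
  split => /=; apply: is_derive_eq; rewrite /GRing.scale/=; ring.
by apply: eq_C; rewrite ?(cReD, cImD, cReM, cImM) /=; ring.
Qed.

Lemma normc_cexp_le (w : C) : normc (cexp w) <= expR (normc w).
Proof.
by rewrite normc_cexp ler_expR; apply: le_trans (ler_norm _) _; exact: le_Re_normc.
Qed.

Lemma cexp_lip (w : C) : normc w <= 1 -> normc (cexp w - 1) <= 2 * expR 1 * normc w.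
Proof.
move=> w1; have cc : continuous (fun t : R => w * cexp (t%:C * w)).
  move=> t; apply: cvgC_M; first exact: cvg_cst.
  exact: (pderiv_continuous (pderiv_cexp_line w)).
have := Cintegral_FTC (ler01 : (0 : R) <= 1) (pderiv_cexp_line w) cc.
rewrite mul1r mul0r cexp0 => <-.
have -> : 2 * expR 1 * normc w = 2 * (normc w * expR 1 * (1 - 0)) by rewrite subr0; ring.
apply: le_Cintegral_itv => //; first by apply: (measC_sub (D := setT)) => //; exact: continuous_measC.
move=> t /andP[t0 t1]; rewrite normcM ler_wpM2l ?normc_ge0//.
apply: le_trans (normc_cexp_le _) _; rewrite ler_expR normcM normc_real ger0_norm//.
by apply: mulr_ile1 => //; exact: normc_ge0.
Qed.

(** The left side is the integral over [0, 1] of w (cexp (t w) - 1), and [cexp_lip] bounds the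
    integrand. *)
Lemma cexp_quad (w : C) : normc w <= 1 -> normc (cexp w - 1 - w) <= 4 * expR 1 * normc w ^+ 2.
Proof.
move=> w1; have cc : continuous (fun t : R => w * cexp (t%:C * w) - w).
  move=> t; apply: cvgC_D; last exact: cvg_cst.
  apply: cvgC_M; first exact: cvg_cst.
  exact: (pderiv_continuous (pderiv_cexp_line w)).
have dd (t : R) : pderiv (fun t => cexp (t%:C * w) - t%:C * w) t (w * cexp (t%:C * w) - w).
  apply: pderivD; first exact: pderiv_cexp_line.
  have -> : (fun t : R => - (t%:C * w)) = (fun t : R => t%:C * (- w)) by apply/funext => s; ring.
  apply: pderiv_eq (pderivM (pderiv_real t) (pderiv_cst t (- w))).
  by rewrite mulr0 addr0 mul1r.
have := Cintegral_FTC (ler01 : (0 : R) <= 1) dd cc.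
rewrite !mul1r !mul0r cexp0 subr0 => e.
have -> : cexp w - 1 - w = cexp w - w - 1 by ring.
rewrite -e.
have -> : 4 * expR 1 * normc w ^+ 2 = 2 * (normc w * (2 * expR 1 * normc w) * (1 - 0)).
  by rewrite subr0; ring.
apply: le_Cintegral_itv => //; first by apply: (measC_sub (D := setT)) => //; exact: continuous_measC.
move=> t /andP[t0 t1]; have -> : w * cexp (t%:C * w) - w = w * (cexp (t%:C * w) - 1) by ring.
rewrite normcM ler_wpM2l ?normc_ge0//.
have tw : normc (t%:C * w) <= normc w.
  by rewrite normcM normc_real ger0_norm// ler_piMl ?normc_ge0.
apply: le_trans (cexp_lip (le_trans tw w1)) _; rewrite ler_wpM2l// mulr_ge0 ?expR_ge0//.
Qed.

(** By the functional equation an expansion at 0 suffices, and this is [cexp_quad]. *)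
Lemma diff_cexp (z : C) : differentiable (@cexp R) z /\ dC (@cexp R) z = cexp z.
Proof.
apply: has_diff_C => e e0.
have c0 : 0 < normc (cexp z) * (4 * expR 1) + 1.
  by rewrite ltr_wpDl// mulr_ge0 ?normc_ge0// mulr_ge0 ?expR_ge0.
exists (Num.min 1 (e / (normc (cexp z) * (4 * expR 1) + 1))).
  by rewrite lt_min ltr01 divr_gt0.
move=> h; rewrite nvC lt_min => /andP[h1 h2].
have -> : cexp (z + h) - cexp z - cexp z * h = cexp z * (cexp h - 1 - h).
  by rewrite cexpD; ring.
rewrite normcM; apply: le_trans (ler_wpM2l (normc_ge0 _) (cexp_quad (ltW h1))) _.
rewrite expr2 !mulrA ler_wpM2r ?normc_ge0//.
move: h2; rewrite ltr_pdivlMr// => /ltW; apply: le_trans.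
by rewrite -(mulrA (normc _)) mulrC ler_wpM2l ?normc_ge0// lerDl.
Qed.

Lemma differentiable_cexp (V : normedModType R[i]) (f : V -> C) x :
  differentiable f x -> differentiable (fun y => cexp (f y)) x.
Proof. by move=> df; apply: (differentiable_comp df); exact: (diff_cexp _).1. Qed.

Lemma diff_cexp_comp (V : normedModType R[i]) (f : V -> C) x h :
  differentiable f x -> 'd (fun y => cexp (f y)) x h = cexp (f x) * 'd f x h.
Proof.
move=> df; have H := diff_comp df (diff_cexp (f x)).1.
rewrite -(diff_cexp (f x)).2 -diff_dC.
exact: (congr1 (fun g : V -> C => g h) H).
Qed.

End ComplexExponential.

(** * Powers and polynomials against exponentials *)

Section Growth.
Variable R : realType.

(** With y = c x / (n + 1), y <= exp y gives y^n <= exp (y)^(n + 1) = exp (c x). Dividing by n + 1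
    and not by n includes the case n = 0. *)
Lemma pow_le_exp (c x : R) (n : nat) : 0 < c -> 0 <= x ->
  x ^+ n <= (n.+1%:R / c) ^+ n * expR (c * x).
Proof.
move=> c0 x0.
have n0 : 0 < n.+1%:R :> R by rewrite ltr0n.
have h : c * x / n.+1%:R <= expR (c * x / n.+1%:R).
  by apply: le_trans (expR_ge1Dx _); rewrite lerDr.
have -> : x ^+ n = (n.+1%:R / c) ^+ n * (c * x / n.+1%:R) ^+ n.
  by rewrite -exprMn; congr (_ ^+ _); field; rewrite !gt_eqF.
apply: ler_wpM2l; first by rewrite exprn_ge0// divr_ge0// ltW.
apply: (@le_trans _ _ (expR (c * x / n.+1%:R) ^+ n.+1)).
  have e1 : 1 <= expR (c * x / n.+1%:R).
    by rewrite -expR0 ler_expR divr_ge0// ?mulr_ge0// ltW.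
  apply: (@le_trans _ _ (expR (c * x / n.+1%:R) ^+ n)).
    by apply: lerXn2r; rewrite ?nnegrE ?expR_ge0// divr_ge0 ?mulr_ge0// ltW.
  by apply: ler_weXn2l.
by rewrite -expRM_natl -mulr_natl mulrC divfK// gt_eqF.
Qed.

(** The higher power wins beyond [S0], and on [0, S0] everything is bounded. In the applications the
    two exponents are k' and k2, and [nu] is the growth rate in the Borel plane. *)
Lemma growth (nu c : R) (k k' N : nat) : 0 < c -> (k < k')%N -> (1 < k')%N -> 0 <= nu ->
  exists2 A : R, 0 <= A & forall s, 0 <= s ->
    s ^+ N * expR (nu * s ^+ k - c * s ^+ k') <= A * expR (- s).
Proof.
move=> c0 kk k1 nu0.
pose B := (N.+1%:R / 1) ^+ N : R.
have B0 : 0 <= B by rewrite exprn_ge0// divr_ge0.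
(* For s >= S0 one has c s >= nu + 2, so c s^k' dominates (nu + 2) s^(k' - 1), which covers both nu
   s^k and 2 s. *)
pose S0 := (nu + 2) / c + 1.
have nu2 : 0 <= nu + 2 by rewrite addr_ge0.
have S1 : 1 <= S0 by rewrite lerDr; exact: divr_ge0 nu2 (ltW c0).
pose K := (nu + 2) * S0 ^+ k'.
exists (B * expR K); first by rewrite mulr_ge0// expR_ge0.
move=> s s0.
(* One of the two units of exponential decay absorbs s^N, the other remains as exp (- s). *)
have key : nu * s ^+ k - c * s ^+ k' + 2 * s <= K.
  have [s1|s1] := leP s 1.
    have a1 : s ^+ k <= 1 by rewrite exprn_ile1.
    have a2 : 0 <= c * s ^+ k' by rewrite mulr_ge0 ?exprn_ge0// ltW.
    have a3 : nu * s ^+ k <= nu by rewrite ler_piMr.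
    have a4 : nu + 2 <= K by rewrite /K ler_peMr ?addr_ge0// exprn_ege1.
    move: a2 a3 a4 s1; clear; lra.
  have sk : s ^+ k <= s ^+ k'.-1 by rewrite ler_weXn2l// ?ltW// -ltnS prednK// ltnW.
  have s1k : s <= s ^+ k'.-1.
    by rewrite -[X in X <= _]expr1 ler_weXn2l// ?ltW// -ltnS prednK// ltnW.
  have ek : s ^+ k' = s * s ^+ k'.-1 by rewrite -exprS prednK// ltnW.
  have [sS|sS] := leP s S0.
    have b1 : s ^+ k'.-1 <= S0 ^+ k'.
      apply: le_trans (_ : s ^+ k' <= _).
        by rewrite ler_weXn2l ?ltW// leq_pred.
      by rewrite lerXn2r ?nnegrE// (le_trans _ S1).
    have b2 : nu * s ^+ k <= nu * S0 ^+ k' by rewrite ler_wpM2l// (le_trans sk).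
    have b3 : 0 <= c * s ^+ k' by rewrite mulr_ge0 ?exprn_ge0// ltW.
    have b4 := le_trans s1k b1.
    move: b2 b3 b4; rewrite /K; clear; lra.
  have K0 : 0 <= K by rewrite /K mulr_ge0 ?addr_ge0// exprn_ge0// (le_trans _ S1).
  apply: le_trans K0.
  have b2 : nu * s ^+ k <= nu * s ^+ k'.-1 by rewrite ler_wpM2l.
  have b3 : (nu + 2) * s ^+ k'.-1 <= c * s ^+ k'.
    rewrite ek mulrA ler_wpM2r ?exprn_ge0//; have := ler_wpM2r (ltW c0) (ltW sS).
    rewrite /S0 mulrDl divfK ?gt_eqF// [s * c]mulrC; move: c0; clear; lra.
  move: b2 b3 s1k; rewrite mulrDl; clear; lra.
have h1 := pow_le_exp N (ltr01 : (0 : R) < 1) s0.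
apply: (@le_trans _ _ (B * expR (1 * s) * expR (K - 2 * s))).
  apply: ler_pM; rewrite ?exprn_ge0 ?expR_ge0//.
  by rewrite ler_expR; move: key; clear; lra.
rewrite -!mulrA ler_wpM2l// -!expRD ler_expR; clear; lra.
Qed.

Lemma exp_pow_le (c x : R) (k : nat) : 0 <= c -> 0 <= x -> (0 < k)%N ->
  expR (- (c * x ^+ k)) <= expR c * expR (- (c * x)).
Proof.
move=> c0 x0 k0; rewrite -expRD ler_expR.
suff : x - 1 <= x ^+ k.
  move=> /(ler_wpM2l c0); rewrite mulrBr mulr1; clear; lra.
have [x1|x1] := leP x 1.
  have : 0 <= x ^+ k by rewrite exprn_ge0.
  move: x1; clear; lra.
have : x <= x ^+ k by rewrite -[X in X <= _]expr1 ler_weXn2l// ltW.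
clear; lra.
Qed.

(** A polynomial in i m costs an arbitrarily small part [c] of the exponential decay in m. This is
    why the decay rates below are lowered in small steps between beta and beta'. *)
Lemma poly_growth (P : {poly R[i]}) (c : R) : 0 < c ->
  exists2 A : R, 0 <= A & forall m : R, normc (P.['i%C * m%:C] : Cx R) <= A * expR (c * `|m|).
Proof.
move=> c0.
exists (\sum_(i < size P) normc (P`_i) * (i.+1%:R / c) ^+ i).
  by apply: sumr_ge0 => i _; rewrite mulr_ge0 ?normc_ge0// exprn_ge0// divr_ge0// ltW.
move=> m; rewrite horner_coef mulr_suml.
apply: le_trans (normc_sum _ _ _) _; apply: ler_sum => i _.
rewrite normcM -mulrA ler_wpM2l ?normc_ge0//.
rewrite (_ : normc ((_ : Cx R) ^+ i) = `|m| ^+ i); last first.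
  by rewrite normcX normcM normc_i mul1r normc_real.
exact: pow_le_exp.
Qed.

End Growth.

(** * Determinations of the argument *)

Section Arguments.
Variable R : realType.
Local Notation C := (Cx R).
Implicit Types (T : C).

Lemma arg_inj T (a b : R) : T != 0 -> is_arg T a -> is_arg T b ->
  exists n : int, a = b + 2 * pi * n%:~R.
Proof.
move=> T0 Ta Tb; apply: expi_inj.
have n0 : ((normc T)%:C : C) != 0.
  apply/eqP => h; have := normc_gt0 T0; have := congr1 (@normc R) h.
  by rewrite normc_real normc0 ger0_norm ?normc_ge0// => ->; rewrite ltxx.
by apply: (mulfI n0); rewrite -Ta -Tb.
Qed.

(** Writing T = T0 w with w close to 1, the angle atan (Im w / Re w) is small and is added to the
    given argument of T0; no branch of the argument has to be chosen globally. *)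
Lemma arg_near T0 (a eta : R) : T0 != 0 -> is_arg T0 a -> 0 < eta ->
  exists2 r, 0 < r & forall T, normc (T - T0) < r -> exists2 b, is_arg T b & `|b - a| < eta.
Proof.
move=> T00 Ta eta0.
have n0 := normc_gt0 T00.
have ca : atan x @[x --> (0 : R)] --> (0 : R).
  by rewrite -[X in _ --> X](@atan0 R); exact: (@continuous_atan R 0).
have [d d0 Hd] : exists2 d : R, 0 < d & forall x : R, `|x| < d -> `|atan x| < eta.
  have /cvgrPdist_lt/(_ _ eta0) [d /= d0 Hd] := ca.
  exists d => // x xd; have := Hd x; rewrite /= !sub0r !normrN; exact.
(* The first bound forces Re w > 1/2; then |Im w| < d / 2 gives |Im w / Re w| < d. *)
exists (normc T0 * Num.min 2^-1 (d / 2)).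
  by rewrite mulr_gt0// lt_min invr_gt0 ltr0Sn divr_gt0.
move=> T; have [w Tw] : exists w, T = T0 * w by exists (T / T0); rewrite mulrC divfK.
rewrite {1}Tw -[X in _ - X]mulr1 -mulrBr normcM ltr_pM2l// lt_min => /andP[w1 w2].
pose x := complex.Re w; pose y := complex.Im w.
have x1 : 2^-1 < x.
  have := le_lt_trans (le_Re_normc _) w1; rewrite cReB /= -/x ltr_norml => /andP[]; lra.
have x0 : 0 < x by apply: lt_trans x1; rewrite invr_gt0.
have yd : `|y / x| < d.
  rewrite normrM normfV (gtr0_norm x0) ltr_pdivrMr//.
  have := le_lt_trans (le_Im_normc _) w2; rewrite cImB /= subr0 -/y => h.
  apply: lt_trans h _; rewrite ltr_pM2l//.
exists (a + atan (y / x)); last by rewrite [a + _]addrC addrK; exact: Hd.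
have nw : normc w = x * Num.sqrt (1 + (y / x) ^+ 2).
  rewrite -[X in X * _](ger0_norm (ltW x0)) -sqrtr_sqr -sqrtrM ?sqr_ge0//.
  have -> : x ^+ 2 * (1 + (y / x) ^+ 2) = x ^+ 2 + y ^+ 2 by field; rewrite gt_eqF.
  by rewrite /x /y; case: (w).
have s0 : 0 < Num.sqrt (1 + (y / x) ^+ 2) by rewrite sqrtr_gt0 ltr_pwDl// sqr_ge0.
rewrite /is_arg expiD {1}Tw {1}Ta Tw normcM real_complexM'.
have -> : (normc T0)%:C * (normc w)%:C * (expi a * expi (atan (y / x))) =
   (normc T0)%:C * expi a * ((normc w)%:C * expi (atan (y / x))) :> C by ring.
congr (_ * _); rewrite nw; apply: eq_C; rewrite ?cReM ?cImM /= mul0r.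
  by rewrite subr0 cos_atan mulfK ?gt_eqF.
rewrite addr0 -[sin _](divfK (_ : cos (atan (y / x)) != 0)) -/(tan (atan (y / x))).
  by rewrite atanK cos_atan -/y; field; rewrite !gt_eqF.
by rewrite cos_atan invr_eq0 gt_eqF.
Qed.

End Arguments.

(** * Directions of integration *)

Section Directions.
Variable R : realType.
Local Notation C := (Cx R).
Implicit Types (p : problem R) (T u : C).

Lemma sin_lt_cos (x delta : R) : 0 <= delta -> `|x| < pi / 2 - delta -> sin delta < cos x.
Proof.
move=> d0 xd; have p0 := pi_gt0 R.
have -> : cos x = cos `|x| by have [//|h] := ger0P x; rewrite cosN.
rewrite -cosBpihalf -cosN opprB.
have := normr_ge0 x.
by move=> x0; rewrite ltr_cos// in_itv/=; apply/andP; split; move: xd d0 p0 x0; clear; lra.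
Qed.

(** The number (e^(i xi) / T)^k has modulus |T|^(-k) and argument k xi - k arg T, which is closer to
    0 than pi / 2 - delta; its cosine therefore exceeds sin delta. *)
Lemma decay_Re p (delta : R) T1 T2 (xi : R) : 0 <= delta -> T1 != 0 -> T2 != 0 ->
  decay_direction p delta T1 T2 xi ->
  sin delta / normc T1 ^+ k1 p < complex.Re ((expi xi / T1) ^+ k1 p) /\
  sin delta / normc T2 ^+ k2 p < complex.Re ((expi xi / T2) ^+ k2 p).
Proof.
move=> d0 T10 T20 [t1 [t2 [a1 a2 h1 h2]]].
have H T (t : R) (k : nat) : T != 0 -> is_arg T t -> `|k%:R * xi - k%:R * t| < pi / 2 - delta ->
    sin delta / normc T ^+ k < complex.Re ((expi xi / T) ^+ k).
  move=> T0 Tt kt; have n0 := normc_gt0 T0.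
  have nk0 : 0 < normc T ^+ k by rewrite exprn_gt0.
  have -> : (expi xi / T) ^+ k = (normc T ^- k)%:C * expi (k%:R * xi - k%:R * t).
    rewrite [in LHS]Tt invfM mulrCA -expiN -expiD exprMn expiX mulrBr.
    congr (_ * _).
    by rewrite -[X in (X ^+ k)%R = _]fmorphV -rmorphXn /= exprVn.
  rewrite cReM /= mul0r subr0 mulrC ltr_pM2l ?invr_gt0//.
  exact: sin_lt_cos.
by split; [exact: (H _ t1)|exact: (H _ t2)].
Qed.

Lemma decay_delta p (delta : R) T1 T2 (xi : R) : decay_direction p delta T1 T2 xi ->
  delta < pi / 2.
Proof.
by move=> [t1 [t2 [_ _ h1 _]]]; have := le_lt_trans (normr_ge0 _) h1; rewrite subr_gt0.
Qed.

Lemma decay_sin p (delta : R) T1 T2 (xi : R) : 0 < delta -> decay_direction p delta T1 T2 xi ->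
  0 < sin delta.
Proof.
move=> d0 /decay_delta h; apply: sin_gt0_pi; rewrite d0 /=.
have := pi_gt0 R; move: h; clear; lra.
Qed.

Lemma decayW p (delta delta' : R) T1 T2 (xi : R) : delta' <= delta ->
  decay_direction p delta T1 T2 xi -> decay_direction p delta' T1 T2 xi.
Proof.
move=> dd [t1 [t2 [a1 a2 h1 h2]]]; exists t1, t2; split=> //.
  by apply: lt_le_trans h1 _; rewrite lerD2l lerN2.
by apply: lt_le_trans h2 _; rewrite lerD2l lerN2.
Qed.

(** The defining inequalities are strict, and half of the remaining gap serves as margin. This is
    needed for [forcing_direction], which is chosen with margin 0 only. *)
Lemma decay_open p T1 T2 (xi : R) : decay_direction p 0 T1 T2 xi ->
  exists2 delta : R, 0 < delta & decay_direction p delta T1 T2 xi.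
Proof.
move=> [t1 [t2 [a1 a2 h1 h2]]]; rewrite subr0 in h1 h2.
pose m := Num.max `|(k1 p)%:R * xi - (k1 p)%:R * t1| `|(k2 p)%:R * xi - (k2 p)%:R * t2|.
have mp : m < pi / 2 by rewrite gt_max h1.
have m1 : `|(k1 p)%:R * xi - (k1 p)%:R * t1| <= m by rewrite le_max lexx.
have m2 : `|(k2 p)%:R * xi - (k2 p)%:R * t2| <= m by rewrite le_max lexx orbT.
exists ((pi / 2 - m) / 2); first by rewrite divr_gt0// subr_gt0.
exists t1, t2; split=> //.
  by apply: le_lt_trans m1 _; move: mp; clear; lra.
by apply: le_lt_trans m2 _; move: mp; clear; lra.
Qed.

Lemma decay_near p (delta delta' : R) T1 T2 (xi : R) : delta' < delta -> T1 != 0 -> T2 != 0 ->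
  decay_direction p delta T1 T2 xi ->
  exists2 r : R, 0 < r & forall T1' T2' : C, normc (T1' - T1) < r -> normc (T2' - T2) < r ->
    decay_direction p delta' T1' T2' xi.
Proof.
move=> dd T10 T20 [t1 [t2 [a1 a2 h1 h2]]].
(* The arguments may move by this much: multiplied by k it stays below delta - delta'. The successor
   avoids a division by 0. *)
have e0 (k : nat) : 0 < (delta - delta') / k.+1%:R by rewrite divr_gt0// subr_gt0.
have [r1 r10 H1] := arg_near T10 a1 (e0 (k1 p)).
have [r2 r20 H2] := arg_near T20 a2 (e0 (k2 p)).
exists (Num.min r1 r2); first by rewrite lt_min r10.
move=> T1' T2'; rewrite !lt_min => /andP[/H1 [b1 ab1 c1] _] /andP[_ /H2 [b2 ab2 c2]].
exists b1, b2.
have K (k : nat) (t b : R) : `|k%:R * xi - k%:R * t| < pi / 2 - delta ->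
    `|b - t| < (delta - delta') / k.+1%:R -> `|k%:R * xi - k%:R * b| < pi / 2 - delta'.
  move=> x1 x2.
  have -> : k%:R * xi - k%:R * b = (k%:R * xi - k%:R * t) - k%:R * (b - t) by ring.
  apply: le_lt_trans (ler_normB _ _) _.
  have : `|k%:R * (b - t)| <= delta - delta'.
    rewrite normrM ger0_norm//; move: x2; rewrite ltr_pdivlMr ?ltr0n// mulrC => /ltW.
    by apply: le_trans; rewrite ler_wpM2r// ler_nat.
  by move: x1; clear; lra.
by split=> //; [exact: K h1 c1|exact: K h2 c2].
Qed.

(* The arguments of T1 and T2 used for xi and for xi' may differ by multiples
   of 2 pi.  The multiples are the same for T1 and T2 because k2 >= 2, and
   xi'' is xi' shifted by this common multiple. *)
Lemma arc_between p (delta : R) T1 T2 (xi xi' : R) : (1 <= k1 p)%N -> (2 <= k2 p)%N ->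
  0 <= delta -> T1 != 0 -> T2 != 0 ->
  decay_direction p delta T1 T2 xi -> decay_direction p delta T1 T2 xi' ->
  exists xi'' : R, [/\ expi xi'' = expi xi' :> C, `|xi - xi''| < pi / (k2 p)%:R &
    forall zeta, Num.min xi xi'' <= zeta <= Num.max xi xi'' ->
      decay_direction p delta T1 T2 zeta].
Proof.
move=> hk1 hk2 d0 T10 T20 [t1 [t2 [a1 a2 h1 h2]]] [s1 [s2 [b1 b2 g1 g2]]].
have p0 := pi_gt0 R.
have [n1 e1] := arg_inj T10 b1 a1; have [n2 e2] := arg_inj T20 b2 a2.
pose xi'' := xi' + 2 * pi * (- n2)%:~R.
have k1p : 0 < (k1 p)%:R :> R by rewrite ltr0n.
have k2p : 0 < (k2 p)%:R :> R by rewrite ltr0n (leq_trans _ hk2).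
have k1g : 1 <= (k1 p)%:R :> R by rewrite ler1n.
have k2g : 2 <= (k2 p)%:R :> R by rewrite ler_nat.
have D (k : R) (x y : R) : 0 < k -> `|k * x - k * y| < pi / 2 - delta -> `|x - y| < pi / 2 / k.
  move=> k0; rewrite -mulrBr normrM gtr0_norm// ltr_pdivlMr// mulrC => h.
  by apply: lt_le_trans h _; rewrite lerBlDr lerDl.
have x1 := D _ _ _ k1p h1; have x2 := D _ _ _ k2p h2.
have y1 := D _ _ _ k1p g1; have y2 := D _ _ _ k2p g2.
have q1 : pi / 2 / (k1 p)%:R <= pi / 2 :> R by rewrite ler_pdivrMr// ler_peMr// divr_ge0// ltW.
have q2 : pi / 2 / (k2 p)%:R <= pi / 4 :> R.
  rewrite ler_pdivrMr//; apply: le_trans (_ : pi / 4 * 2 <= _); first by move: p0; clear; lra.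
  by rewrite ler_wpM2l// divr_ge0// ltW.
have x12 : xi'' - t2 = xi' - s2 by rewrite /xi'' e2 rmorphN /=; ring.
(* 2 pi (n1 - n2) is a combination of four offsets: two smaller than pi / 4, as k2 >= 2, and two
   smaller than pi / 2. Their sum is below 2 pi, so the integer n1 - n2 is 0. *)
have nn : n1 = n2.
  apply/eqP; rewrite -subr_eq0; apply: contrapT => /negP/= nn0.
  have : 1 <= `|(n1 - n2)%:~R : R|.
    rewrite -intr_norm -[1]/(1%:~R) ler_int; move: nn0; rewrite -normr_gt0; exact.
  have E : 2 * pi * (n1 - n2)%:~R = (xi'' - t2) - (xi - t2) + (xi - t1) - (xi' - s1) :> R.
    by rewrite /xi'' e1 rmorphB rmorphN /=; ring.
  have : `|2 * pi * (n1 - n2)%:~R : R| < 2 * pi.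
    rewrite E x12; have := lt_le_trans x1 q1; have := lt_le_trans y1 q1.
    have := lt_le_trans x2 q2; have := lt_le_trans y2 q2.
    rewrite !ltr_norml; move: p0; clear; lra.
  rewrite normrM gtr0_norm ?mulr_gt0// -[X in _ < X]mulr1 ltr_pM2l ?mulr_gt0//.
  by move=> u v; have := lt_le_trans u v; rewrite ltxx.
have x11 : xi'' - t1 = xi' - s1 by rewrite /xi'' e1 nn rmorphN /=; ring.
exists xi''; split.
- by rewrite /xi'' expi_periodZ.
- have -> : xi - xi'' = (xi - t2) - (xi'' - t2) by ring.
  rewrite x12; apply: le_lt_trans (ler_normB _ _) _.
  have -> : pi / (k2 p)%:R = pi / 2 / (k2 p)%:R + pi / 2 / (k2 p)%:R :> R.
    by field; rewrite gt_eqF.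
  exact: ltrD.
- move=> zeta hz; exists t1, t2; split=> //.
    have g1' : `|(k1 p)%:R * xi'' - (k1 p)%:R * t1| < pi / 2 - delta.
      by rewrite -mulrBr x11 mulrBr.
    move: h1 g1' hz; rewrite -!mulrBr !normrM !(gtr0_norm k1p) -!ltr_pdivlMl// !ltr_norml.
    have [_|_] := leP xi xi''; clear; lra.
  have g2' : `|(k2 p)%:R * xi'' - (k2 p)%:R * t2| < pi / 2 - delta.
    by rewrite -mulrBr x12 mulrBr.
  move: h2 g2' hz; rewrite -!mulrBr !normrM !(gtr0_norm k2p) -!ltr_pdivlMl// !ltr_norml.
  have [_|_] := leP xi xi''; clear; lra.
Qed.

Lemma sector_unbounded_polar (d a s t : R) : 0 < s -> sector d a +oo (expi t) ->
  sector d a +oo (polar s t).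
Proof.
move=> s0 [s' [t' [s'0 _ td e]]]; exists s, t'; split=> //; first exact: ltry.
have : s' = 1.
  by have := congr1 (@normc R) e; rewrite normc_expi normcM normc_real normc_expi mulr1 gtr0_norm.
by move=> s'1; rewrite /polar e s'1 mul1r.
Qed.

(** Angles in the sector are known modulo 2 pi only. If the multiples used for [xi] and [xi'']
    differed, 2 pi would be smaller than w + a, against a <= 2 pi - w; with equal multiples the arc
    lies in the sector by convexity of the angle interval. *)
Lemma arc_sector (d a w xi xi'' : R) : 0 < w -> a <= 2 * pi - w -> `|xi - xi''| < w ->
  sector d a +oo (expi xi) -> sector d a +oo (expi xi'') ->
  forall s zeta, 0 < s -> Num.min xi xi'' <= zeta <= Num.max xi xi'' ->
    sector d a +oo (polar s zeta).
Proof.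
move=> w0 aw xx [s1 [t1 [s10 _ t1d e1]]] [s2 [t2 [s20 _ t2d e2]]] s zeta s0 hz.
have p0 := pi_gt0 R.
have E (s' x t : R) : 0 < s' -> expi x = s'%:C * expi t :> C -> expi x = expi t :> C.
  move=> s'0 e; have : s' = 1.
    by have := congr1 (@normc R) e; rewrite normc_expi normcM normc_real normc_expi mulr1 gtr0_norm.
  by move=> s'1; rewrite e s'1 mul1r.
have [n1 f1] := expi_inj (E _ _ _ s10 e1); have [n2 f2] := expi_inj (E _ _ _ s20 e2).
have nn : n1 = n2.
  apply/eqP; rewrite -subr_eq0; apply: contrapT => /negP/= nn0.
  have : 1 <= `|(n1 - n2)%:~R : R|.
    rewrite -intr_norm -[1]/(1%:~R) ler_int; move: nn0; rewrite -normr_gt0; exact.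
  have F : 2 * pi * (n1 - n2)%:~R = (xi - xi'') - (t1 - d) + (t2 - d) :> R.
    by rewrite f1 f2 rmorphB /=; ring.
  have : `|2 * pi * (n1 - n2)%:~R : R| < 2 * pi.
    rewrite F; move: xx t1d t2d aw; rewrite !ltr_norml; move: p0; clear; lra.
  rewrite normrM gtr0_norm ?mulr_gt0// -[X in _ < X]mulr1 ltr_pM2l ?mulr_gt0//.
  by move=> u v; have := lt_le_trans u v; rewrite ltxx.
exists s, (zeta - 2 * pi * n1%:~R); split=> //; first exact: ltry.
  move: hz t1d t2d; rewrite f1 f2 -nn; move: (2 * pi * n1%:~R) => c; rewrite !ltr_norml.
  have [_|_] := leP (t1 + c) (t2 + c); clear; lra.
by rewrite /polar -[in LHS](subrK (2 * pi * n1%:~R) zeta) expi_periodZ.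
Qed.

Lemma sector_neq0 (d a : R) (r : \bar R) T : sector d a r T -> T != 0.
Proof.
by move=> [s [t [s0 _ _ ->]]]; rewrite -[_ * _]/(polar s t) polar_neq0.
Qed.

Lemma sector_open (d a : R) (r : \bar R) T : sector d a r T ->
  exists2 e : R, 0 < e & forall T', normc (T' - T) < e -> sector d a r T'.
Proof.
move=> ST; have T0 := sector_neq0 ST; case: ST => s [t [s0 sr td e]].
have n0 := normc_gt0 T0.
have Ts : normc T = s by rewrite e -[_ * _]/(polar s t) normc_polar// ltW.
have Tt : is_arg T t by rewrite /is_arg Ts.
have [|e1 e10 H1] := arg_near T0 Tt (eta := a / 2 - `|t - d|); first by rewrite subr_gt0.
have [e2 e20 H2] : exists2 e2 : R, 0 < e2 & forall x : R, x < s + e2 -> (x%:E < r)%E.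
  case: r sr => [r sr|_|//].
    exists (r - s); first by rewrite subr_gt0 -lte_fin.
    by move=> x; rewrite addrC subrK lte_fin.
  by exists 1 => // x _; exact: ltry.
exists (Num.min (Num.min e1 e2) s); first by rewrite !lt_min e10 e20.
move=> T'; rewrite !lt_min => /andP[/andP[/H1 [b Tb bt] h2] h3].
exists (normc T'), b; split=> //.
- rewrite normc_gt0//; apply/eqP => T'0; move: h3.
  by rewrite T'0 sub0r normcN Ts ltxx.
- apply: H2; have := normc_tri T' T 0; rewrite !subr0 Ts => h.
  by apply: le_lt_trans h _; rewrite addrC ltrD2l.
- have -> : b - d = (b - t) + (t - d) by ring.
  by apply: le_lt_trans (ler_normD _ _) _; move: bt; clear; lra.
Qed.

(** The two factors have different tasks: the [T1] factor of the kernel must not grow, while the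
    [T2] factor decays at the rate [c] that is compared with the growth of order k' < k2. *)
Definition kernel_ok p (c : R) T1 T2 (xi : R) :=
  [/\ T1 != 0, T2 != 0, 0 <= complex.Re ((expi xi / T1) ^+ k1 p) &
      c <= complex.Re ((expi xi / T2) ^+ k2 p)].

Lemma normc_expkernel p T1 T2 (s xi : R) :
  normc (expkernel p T1 T2 (polar s xi)) =
  expR (- (s ^+ k1 p * complex.Re ((expi xi / T1) ^+ k1 p))
        - s ^+ k2 p * complex.Re ((expi xi / T2) ^+ k2 p)).
Proof.
rewrite normc_cexp cReB cReN /polar -!mulrA !exprMn -!rmorphXn /=.
by rewrite !(cReM _%:C) /= !mul0r !subr0.
Qed.

Lemma kernel_ok_bound p (c : R) T1 T2 (s xi : R) : 0 <= s -> kernel_ok p c T1 T2 xi ->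
  normc (expkernel p T1 T2 (polar s xi)) <= expR (- (c * s ^+ k2 p)).
Proof.
move=> s0 [_ _ h1 h2]; rewrite normc_expkernel ler_expR.
have a1 : 0 <= s ^+ k1 p * complex.Re ((expi xi / T1) ^+ k1 p) by rewrite mulr_ge0// exprn_ge0.
have a2 : c * s ^+ k2 p <= s ^+ k2 p * complex.Re ((expi xi / T2) ^+ k2 p).
  by rewrite mulrC ler_wpM2l// exprn_ge0.
by move: a1 a2; clear; lra.
Qed.

(** The rate depends on T2 only through an upper bound [a] of |T2|. This is where the restriction of
    t2 to a disc is used: the rate becomes uniform. *)
Lemma decay_kernel_ok p (delta a : R) T1 T2 (xi : R) : 0 < delta -> T1 != 0 -> T2 != 0 ->
  normc T2 <= a -> decay_direction p delta T1 T2 xi ->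
  kernel_ok p (sin delta / a ^+ k2 p) T1 T2 xi /\ 0 < sin delta / a ^+ k2 p.
Proof.
move=> d0 T10 T20 Ta dd; have s0 := decay_sin d0 dd.
have [h1 h2] := decay_Re (ltW d0) T10 T20 dd.
have n1 := normc_gt0 T10; have n2 := normc_gt0 T20.
have a0 : 0 < a := lt_le_trans n2 Ta.
split; last by rewrite divr_gt0// exprn_gt0.
split=> //; first by apply/ltW/(lt_trans _ h1); rewrite divr_gt0// exprn_gt0.
apply: le_trans (ltW h2); rewrite ler_pM2l// lef_pV2 ?posrE ?exprn_gt0//.
by rewrite lerXn2r// nnegrE ltW.
Qed.

End Directions.

(** * The Borel-Laplace-Fourier transform *)

Section BorelLaplace.
Variable R : realType.
Local Notation C := (Cx R).
Implicit Types (p : problem R) (T u Z : C) (g : C -> R -> C).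

(* As 0^-1 = 0, the integrand vanishes at u = 0. *)
Definition lint p g T1 T2 Z (m : R) u : C :=
  g u m * expkernel p T1 T2 u * cexp ('i%C * Z * m%:C) / u.

(** Laplace transform in u with two kernels, followed by the inverse Fourier integral in m, without
    the constant [fourier_cst]. *)
Definition Lap p g (xi : R) T1 T2 Z : C :=
  Cintegral [set: R] (fun m => ray_integral xi (lint p g T1 T2 Z m)).

Lemma normc_cexp_strip Z (B m : R) : `|complex.Im Z| <= B ->
  normc (cexp ('i%C * Z * m%:C)) <= expR (B * `|m|).
Proof.
move=> ZB; rewrite normc_cexp ler_expR !(cReM, cImM) /= !(mul0r, mulr0, mul1r, sub0r, subr0, add0r).
apply: le_trans (ler_norm _) _; rewrite mulNr normrN normrM.
by rewrite ler_wpM2r.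
Qed.

(** The factor |u| in the bound on [g] cancels the denominator of du / u, [A'] comes from [growth],
    and |Im Z| <= B lowers the decay rate in m from [b] to [b - B]. *)
Lemma lint_bound p g (k' : nat) (A A' nu b c B xi : R) T1 T2 Z :
  0 <= A -> 0 <= A' -> kernel_ok p c T1 T2 xi -> `|complex.Im Z| <= B ->
  (forall s, 0 <= s -> expR (nu * s ^+ k' - c * s ^+ k2 p) <= A' * expR (- s)) ->
  (forall s m, 0 < s ->
     normc (g (polar s xi) m) <= A * s * expR (nu * s ^+ k') * expR (- (b * `|m|))) ->
  forall s m, 0 <= s -> normc (lint p g T1 T2 Z m (polar s xi)) <=
    A * A' * expR (- ((b - B) * `|m|)) * expR (- s).
Proof.
move=> A0 A'0 kok ZB HA gA s m; rewrite le_eqVlt => /predU1P[<-|s0].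
  have -> : polar 0 xi = 0 :> C by rewrite /polar mul0r.
  by rewrite /lint invr0 mulr0 normc0 !mulr_ge0 ?expR_ge0.
rewrite /lint normcM normcV (normc_polar _ (ltW s0)) 2!normcM ler_pdivrMr//.
have h1 := gA s m s0; have h2 := kernel_ok_bound (ltW s0) kok.
have h3 := normc_cexp_strip m ZB; have h4 := HA s (ltW s0).
apply: (@le_trans _ _ ((A * s * expR (nu * s ^+ k') * expR (- (b * `|m|))) *
    expR (- (c * s ^+ k2 p)) * expR (B * `|m|))).
  apply: ler_pM => //; rewrite ?mulr_ge0 ?normc_ge0//.
  by apply: ler_pM => //; rewrite ?normc_ge0.
have -> : A * s * expR (nu * s ^+ k') * expR (- (b * `|m|)) * expR (- (c * s ^+ k2 p)) * expR (B * `|m|)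
   = A * s * (expR (nu * s ^+ k' - c * s ^+ k2 p) * expR (- ((b - B) * `|m|))).
  have -> : - ((b - B) * `|m|) = - (b * `|m|) + B * `|m| by ring.
  by rewrite [in RHS]expRD [expR (- _ + _)]expRD; ring.
have -> : A * A' * expR (- ((b - B) * `|m|)) * expR (- s) * s =
   A * s * (A' * expR (- s) * expR (- ((b - B) * `|m|))) by ring.
apply: ler_wpM2l; first by rewrite mulr_ge0// ltW.
by rewrite ler_wpM2r// expR_ge0.
Qed.

(** The regularized functions are continuous and converge everywhere; at s = 0 they vanish, in
    agreement with the convention 0^-1 = 0. *)
Lemma measurable_invr_abs : measurable_fun [set: R] (fun s : R => `|s|^-1).
Proof.
apply: (@measurable_fun_cvg _ _ R setT (fun n (s : R) => `|s| / (`|s| ^+ 2 + n.+1%:R^-1))).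
  move=> n; apply: continuous_measurable_fun => s.
  have n0 : 0 < n.+1%:R^-1 :> R by rewrite invr_gt0 ltr0n.
  apply: cvgM; first exact: norm_continuous.
  apply: cvgV.
    by rewrite gt_eqF// ltr_wpDl// exprn_ge0.
  apply: cvgD; last exact: cvg_cst.
  by under eq_fun do rewrite expr2; rewrite expr2; apply: cvgM; exact: norm_continuous.
move=> s _; have [->|s0] := eqVneq s 0.
  rewrite normr0 invr0; under eq_fun do rewrite mul0r; exact: cvg_cst.
have n0 : 0 < `|s| by rewrite normr_gt0.
have -> : `|s|^-1 = `|s| / (`|s| ^+ 2 + 0) by rewrite addr0; field; rewrite gt_eqF.
apply: cvgM; first exact: cvg_cst.
apply: cvgV; first by rewrite addr0 expf_neq0// gt_eqF.
by apply: cvgD; [exact: cvg_cst|exact: cvg_harmonic].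
Qed.

Lemma measC_polar2 (xi : R) : measC [set: R * R] (fun z : R * R => polar `|z.2| xi).
Proof.
apply: measCM; last exact: measC_cst.
apply: measC_real; apply: measurableT_comp; last exact: measurable_snd.
by apply: continuous_measurable_fun; exact: norm_continuous.
Qed.

Lemma measC_lint p g (xi : R) T1 T2 Z :
  measC [set: R * R] (fun z : R * R => g (polar `|z.2| xi) z.1) ->
  measC [set: R * R] (fun z : R * R => lint p g T1 T2 Z z.1 (polar `|z.2| xi)).
Proof.
move=> mg; have mp := measC_polar2 xi.
apply: measCM; last first.
  have -> : (fun z : R * R => (polar `|z.2| xi)^-1) = (fun z : R * R => (`|z.2|^-1)%:C * (expi xi)^-1).
    apply/funext => z; rewrite /polar invfM; congr (_ * _).
    by rewrite -[LHS]fmorphV.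
  apply: measCM; last exact: measC_cst.
  apply: measC_real.
  exact: (measurableT_comp (f := fun s : R => `|s|^-1) measurable_invr_abs measurable_snd).
apply: measCM.
  apply: measCM => //; apply: measC_cexp.
  apply: measCD; apply: measCN; apply: measCX; apply: measCM => //; exact: measC_cst.
apply: measC_cexp; apply: measCM; first exact: measC_cst.
by apply: measC_real; exact: measurable_fst.
Qed.

Lemma differentiable_mul (V : normedModType R[i]) (f h : V -> C) x :
  differentiable f x -> differentiable h x -> differentiable (fun y => f y * h y) x.
Proof. exact: differentiableM. Qed.
Lemma differentiable_add (V : normedModType R[i]) (f h : V -> C) x :
  differentiable f x -> differentiable h x -> differentiable (fun y => f y + h y) x.
Proof. exact: differentiableD. Qed.
Lemma differentiable_opp (V : normedModType R[i]) (f : V -> C) x :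
  differentiable f x -> differentiable (fun y => - f y) x.
Proof. exact: differentiableN. Qed.
Lemma differentiable_pow (V : normedModType R[i]) (f : V -> C) x n :
  differentiable f x -> differentiable (fun y => f y ^+ n) x.
Proof.
move=> df; elim: n => [|n IH]; first exact: differentiable_cst.
have -> : (fun y => f y ^+ n.+1) = (fun y => f y * f y ^+ n) by apply/funext => y; exact: exprS.
exact: differentiable_mul.
Qed.
Lemma differentiable_inv (V : normedModType R[i]) (f : V -> C) x :
  f x != 0 -> differentiable f x -> differentiable (fun y => (f y)^-1) x.
Proof. by move=> f0 df; exact: differentiableV. Qed.
Lemma differentiable_const (V : normedModType R[i]) (c : C) (x : V) :
  differentiable (fun=> c) x.
Proof. exact: differentiable_cst. Qed.
Lemma differentiable_idC (x : C) : differentiable (fun y : C => y) x.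
Proof.
apply: (has_diff_C (l := 1) _).1 => e e0; exists 1 => // h _.
have -> : x + h - x - 1 * h = 0 by ring.
by rewrite normc0 mulr_ge0 ?nv_ge0// ltW.
Qed.

Lemma differentiable_lint (V : normedModType R[i]) p (gx : V -> C) (U T1 T2 Z : V -> C) (m : R) x :
  differentiable gx x -> differentiable U x -> differentiable T1 x -> differentiable T2 x ->
  differentiable Z x -> U x != 0 -> T1 x != 0 -> T2 x != 0 ->
  differentiable (fun y => gx y * expkernel p (T1 y) (T2 y) (U y) * cexp ('i%C * Z y * m%:C) / U y) x.
Proof.
move=> dg dU d1 d2 dZ U0 T10 T20.
apply: differentiable_mul; last exact: differentiable_inv.
apply: differentiable_mul.
  apply: differentiable_mul; [exact: dg|apply: differentiable_cexp].
  by apply: differentiable_add; apply: differentiable_opp; apply: differentiable_pow;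
    (apply: differentiable_mul; [exact: dU|exact: differentiable_inv]).
apply: differentiable_cexp; apply: differentiable_mul; last exact: differentiable_const.
by apply: differentiable_mul; [exact: differentiable_const|exact: dZ].
Qed.

Lemma near_eq_differentiable (V : normedModType R[i]) (f h : V -> C) x (r : R) : 0 < r ->
  (forall y, nv (y - x) < r -> f y = h y) -> differentiable f x ->
  differentiable h x /\ forall k, 'd h x k = 'd f x k.
Proof.
move=> r0 fh df.
have [K K0 HK] := linear_lipschitz (diff_continuous df).
have KR : (complex.Re K)%:C = K by rewrite RRe_real// gtr0_real.
have [||d1 d2] := @has_diff_differentiable R V h x ('d f x) (complex.Re K).
- by move=> k; have := HK k; rewrite [X in X <= _]nvE nvE -KR -rmorphM lecR.
- move=> e e0; have [d d0 Hd] := differentiable_has_diff df e0.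
  exists (Num.min d r); first by rewrite lt_min d0.
  move=> k; rewrite lt_min => /andP[kd kr].
  rewrite -!fh ?subrr ?nv0//; first exact: Hd.
  by rewrite addrC addKr.
- split; [exact: d1|move=> k]; exact: (congr1 (fun q : V -> C => q k) d2).
Qed.

Lemma diff_mulcE (V : normedModType R[i]) (f : V -> C) (k : C) (x h : V) : differentiable f x ->
  'd (fun y => k * f y) x h = k * 'd f x h.
Proof.
move=> df; have E := @diffZ R[i] V C f k x df.
exact: (congr1 (fun q : V -> C => q h) E).
Qed.

(** The direction is constant here. [hol_int2] applies with the product majorant of [lint_bound], a
    multiple of exp (- (b - B) |m|) times exp (- s). *)
Lemma Lap_diff (V : normedModType R[i]) p (k' : nat) (xi A nu b c B r : R) (x0 : V)
    (G : V -> C -> R -> C) (T1 T2 Z : V -> C) :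
  (k' < k2 p)%N -> (1 < k2 p)%N -> 0 < c -> 0 <= nu -> B < b -> 0 <= A -> 0 < r ->
  (forall y, nv (y - x0) < r ->
     [/\ differentiable T1 y, differentiable T2 y & differentiable Z y]) ->
  (forall y, nv (y - x0) < r -> kernel_ok p c (T1 y) (T2 y) xi /\ `|complex.Im (Z y)| <= B) ->
  (forall y s m, nv (y - x0) < r -> 0 < s -> differentiable (fun y => G y (polar s xi) m) y) ->
  (forall y s m, nv (y - x0) < r -> 0 < s ->
     normc (G y (polar s xi) m) <= A * s * expR (nu * s ^+ k') * expR (- (b * `|m|))) ->
  (forall y, nv (y - x0) < r -> measC [set: R * R] (fun z : R * R => G y (polar `|z.2| xi) z.1)) ->
  let F y := Lap p (G y) xi (T1 y) (T2 y) (Z y) in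
  let dF h m u := 'd (fun y => lint p (G y) (T1 y) (T2 y) (Z y) m u) x0 h in
  [/\ differentiable F x0,
      forall h m, ray_integrable xi (dF h m),
      forall h, Cintegrable [set: R] (fun m => ray_integral xi (dF h m)) &
      forall h, 'd F x0 h = Cintegral [set: R] (fun m => ray_integral xi (dF h m))].
Proof.
move=> kk k1 c0 nu0 Bb A0 r0 dT kok dG GA mG F dF.
have [A' A'0 HA'] := growth 0 c0 kk k1 nu0.
have {}HA' s : 0 <= s -> expR (nu * s ^+ k' - c * s ^+ k2 p) <= A' * expR (- s).
  by move=> /HA'; rewrite expr0 mul1r.
pose f (y : V) (m s : R) : C := lint p (G y) (T1 y) (T2 y) (Z y) m (polar `|s| xi) * expi xi.
pose a (m : R) := A * A' * expR (- ((b - B) * `|m|)).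
have Bb' : 0 < b - B by rewrite subr_gt0.
have D s : `[(0 : R), +oo[%classic s -> 0 <= s by rewrite /= in_itv/= andbT.
have fE y m s : 0 <= s -> f y m s = ray_integrand xi (lint p (G y) (T1 y) (T2 y) (Z y) m) s.
  by move=> s0; rewrite /f ger0_norm.
have x0r : nv (x0 - x0) < r by rewrite subrr nv0.
have [| | | | | | | | |h1 h2 h3 h4] := @hol_int2 R V `[(0 : R), +oo[%classic f x0 r a (fun s => expR (- (1 * s))).
- exact: measurable_itv.
- exact: r0.
- by apply: RintegrableZ => //; exact: integrable_exp_abs.
- exact: integrable_exp_tail.
- by move=> m; rewrite !mulr_ge0 ?expR_ge0.
- by move=> s _; exact: expR_ge0.
(* At s = 0 the integrand is identically 0, because polar 0 xi = 0 and 0^-1 = 0. *)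
- move=> y m s yr /D; rewrite le_eqVlt => /predU1P[<-|s0].
    have -> : (fun y => f y m 0) = (fun=> 0 : C).
      by apply/funext => y'; rewrite /f normr0 /polar mul0r /lint invr0 mulr0 mul0r.
    exact: differentiable_const.
  have [d1 d2 d3] := dT y yr; have [[k1' k2' _ _] _] := kok y yr.
  apply: differentiable_mul; last exact: differentiable_const.
  rewrite gtr0_norm//; apply: differentiable_lint; [exact: dG|exact: differentiable_const|
    exact: d1|exact: d2|exact: d3|exact: polar_neq0|exact: k1'|exact: k2'].
- move=> y m s yr /D s0; rewrite /f normcM normc_expi mulr1 ger0_norm// mul1r.
  have [ko ZB] := kok y yr.
  by apply: (lint_bound A0 A'0 ko ZB HA') => // s' m' s'0; exact: GA.
- move=> y yr; apply: measCM; last exact: measC_cst.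
  by apply: measC_lint; exact: mG.
have FE : F = (fun y => Cintegral [set: R] (fun m => Cintegral `[0, +oo[ (f y m))).
  apply/funext => y; apply: eq_Cintegral => m _; apply: eq_Cintegral => s /D s0.
  by rewrite fE.
have dE h m s : 0 <= s -> 'd (fun y => f y m s) x0 h = ray_integrand xi (dF h m) s.
  move=> s0; have [s00|s1] := eqVneq s 0.
    have -> : (fun y => f y m s) = (fun=> 0 : C).
      by apply/funext => y'; rewrite /f s00 normr0 /polar mul0r /lint invr0 mulr0 mul0r.
    rewrite /dF /ray_integrand.
    have -> : (fun y => lint p (G y) (T1 y) (T2 y) (Z y) m (s%:C * expi xi)) = (fun=> 0 : C).
      by apply/funext => y'; rewrite /f s00 mul0r /lint invr0 mulr0.
    by rewrite diff_cst /= mul0r.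
  have s2 : 0 < s by rewrite lt_neqAle eq_sym s1.
  have [d1 d2 d3] := dT x0 x0r; have [[k1' k2' _ _] _] := kok x0 x0r.
  have dl : differentiable (fun y => lint p (G y) (T1 y) (T2 y) (Z y) m (polar s xi)) x0.
    apply: differentiable_lint; [exact: dG|exact: differentiable_const|
      exact: d1|exact: d2|exact: d3|exact: polar_neq0|exact: k1'|exact: k2'].
  have -> : (fun y => f y m s) = (fun y => (expi xi : C) * lint p (G y) (T1 y) (T2 y) (Z y) m (polar s xi)).
    by apply/funext => y; rewrite /f (ger0_norm s0); exact: mulrC.
  pose d : C := dF h m (polar s xi).
  have E1 := @diff_mulcE V _ (expi xi) x0 h dl.
  have E2 : d * expi xi = ray_integrand xi (dF h m) s by exact: erefl.
  exact: etrans E1 (etrans (mulrC _ d) E2).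
have RE h m : ray_integral xi (dF h m) = Cintegral `[0, +oo[ (fun s => 'd (fun y => f y m s) x0 h).
  by apply: eq_Cintegral => s /D s0; rewrite dE.
have RE' h : (fun m => ray_integral xi (dF h m)) =
   (fun m => Cintegral `[0, +oo[ (fun s => 'd (fun y => f y m s) x0 h)) by apply/funext.
split.
- by rewrite FE; exact: h1.
- move=> h m; apply: (eq_Cintegrable _ _ (h2 h m)); first exact: measurable_itv.
  by move=> s /D s0; rewrite dE.
- by move=> h; rewrite RE'; exact: h3.
- by move=> h; rewrite RE' FE; exact: h4.
Qed.

End BorelLaplace.

(** * Admissible functions on the Borel plane and their transforms *)

Section Admissible.
Variable R : realType.
Local Notation C := (Cx R).
Implicit Types (p : problem R) (T u Z : C) (g : C -> R -> C) (S : set C).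

(** The only geometric property of the domain that rotations of the ray need: two directions closer
    than [w] are joined inside [S]. Sectors of restricted opening have it and so does the whole
    plane, which covers both omega and psi. *)
Definition arcdom S (w : R) := forall (xi xi'' s zeta : R), `|xi - xi''| < w ->
  S (expi xi) -> S (expi xi'') -> 0 < s -> Num.min xi xi'' <= zeta <= Num.max xi xi'' ->
  S (polar s zeta).

(* The absolute value makes [s |-> g (polar `|s| xi) m] a function on the whole
   line, as Fubini's theorem is used with globally measurable functions. *)
Definition admg S (k' : nat) (A nu b : R) g :=
  [/\ 0 <= A, 0 <= nu,
      forall m tau, S tau -> differentiable (g^~ m) tau,
      forall tau m, S tau -> tau != 0 ->
        normc (g tau m) <= A * normc tau * expR (nu * normc tau ^+ k') * expR (- (b * `|m|)) &
      forall xi, S (expi xi) -> measC [set: R * R] (fun z : R * R => g (polar `|z.2| xi) z.1)].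

Definition LapOk p g (xi : R) T1 T2 Z :=
  (forall m, ray_integrable xi (lint p g T1 T2 Z m)) /\
  Cintegrable [set: R] (fun m => ray_integral xi (lint p g T1 T2 Z m)).

Lemma arcdom_polar S w (xi s : R) : 0 < w -> arcdom S w -> S (expi xi) -> 0 < s -> S (polar s xi).
Proof.
move=> w0 aS Sx s0; apply: (aS xi xi) => //; first by rewrite subrr normr0.
by rewrite minxx maxxx lexx.
Qed.

Lemma differentiable_lint_u p g T1 T2 Z m u : T1 != 0 -> T2 != 0 -> u != 0 ->
  differentiable (g ^~ m) u -> differentiable (lint p g T1 T2 Z m) u.
Proof.
move=> T10 T20 u0 dg.
exact: (differentiable_lint p m dg (differentiable_idC u) (differentiable_const T1 u)
  (differentiable_const T2 u) (differentiable_const Z u) u0 T10 T20).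
Qed.

(** Fubini's theorem is used for one of its by-products, the measurability in m of the ray
    integrals. The constant 4 is one factor 2 for each of the two integrations. *)
Lemma LapOk_bound p g (xi A0 b : R) T1 T2 Z : 0 < b ->
  (forall s m, 0 < s -> differentiable (lint p g T1 T2 Z m) (polar s xi)) ->
  measC [set: R * R] (fun z : R * R => g (polar `|z.2| xi) z.1) ->
  (forall s m, 0 <= s -> normc (lint p g T1 T2 Z m (polar s xi)) <= A0 * expR (- (b * `|m|)) * expR (- s)) ->
  [/\ LapOk p g xi T1 T2 Z,
      (forall m, normc (ray_integral xi (lint p g T1 T2 Z m)) <= 2 * A0 * expR (- (b * `|m|))) &
      normc (Lap p g xi T1 T2 Z) <= 4 * A0 * Rintegral (@lebesgue_measure R) [set: R] (fun m : R => expR (- (b * `|m|)))].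
Proof.
move=> b0 dl mg bl.
have cl s m : 0 < s -> {for polar s xi, continuous (lint p g T1 T2 Z m)}.
  by move=> s0; apply: differentiable_continuous; exact: dl.
have bl' m s : 0 <= s -> normc (lint p g T1 T2 Z m (polar s xi)) <= A0 * expR (- (b * `|m|)) * expR (- (1 * s)).
  by rewrite mul1r; exact: bl.
have D s : `[(0 : R), +oo[%classic s -> 0 <= s by rewrite /= in_itv/= andbT.
have A00 : 0 <= A0.
  have := bl 0 0 (lexx _); rewrite normr0 mulr0 oppr0 expR0 !mulr1; apply: le_trans; exact: normc_ge0.
have rb m : normc (ray_integral xi (lint p g T1 T2 Z m)) <= 2 * A0 * expR (- (b * `|m|)).
  rewrite -mulrA; have := @le_ray_integral R _ xi (A0 * expR (- (b * `|m|))) 1 ltr01 _ (bl' m).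
  by rewrite divr1; apply=> s; exact: cl.
have [h1 _ _] : [/\ Cintegrable [set: R] (fun m => Cintegral `[0, +oo[ (fun s => lint p g T1 T2 Z m (polar `|s| xi) * expi xi)),
  Cintegrable `[0, +oo[ (fun s => Cintegral [set: R] (fun m => lint p g T1 T2 Z m (polar `|s| xi) * expi xi)) &
  Cintegral [set: R] (fun m => Cintegral `[0, +oo[ (fun s => lint p g T1 T2 Z m (polar `|s| xi) * expi xi)) =
  Cintegral `[0, +oo[ (fun s => Cintegral [set: R] (fun m => lint p g T1 T2 Z m (polar `|s| xi) * expi xi))].
  apply: (@CfubiniD R (fun m s => lint p g T1 T2 Z m (polar `|s| xi) * expi xi) `[0, +oo[
    (fun m => A0 * expR (- (b * `|m|))) (fun s => expR (- (1 * s)))).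
  - exact: measurable_itv.
  - by apply: measCM; [exact: measC_lint|exact: measC_cst].
  - by apply: RintegrableZ => //; exact: integrable_exp_abs.
  - exact: integrable_exp_tail.
  - by move=> m; rewrite mulr_ge0 ?expR_ge0.
  - by move=> s _; exact: expR_ge0.
  - by move=> m s /D s0; rewrite normcM normc_expi mulr1 ger0_norm//; exact: bl'.
have fE m : Cintegral `[0, +oo[ (fun s => lint p g T1 T2 Z m (polar `|s| xi) * expi xi) =
   ray_integral xi (lint p g T1 T2 Z m).
  by apply: eq_Cintegral => s /D s0; rewrite (ger0_norm s0).
have iL : Cintegrable [set: R] (fun m => ray_integral xi (lint p g T1 T2 Z m)).
  apply: (eq_Cintegrable _ _ h1) => [|m _]; [exact: measurableT|exact: fE].
split=> //.
- split=> // m; apply: (@ray_integrable_exp _ _ _ (A0 * expR (- (b * `|m|))) 1 ltr01); last exact: bl'.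
  by move=> s s0; exact: cl.
- have -> : 4 * A0 * Rintegral (@lebesgue_measure R) [set: R] (fun m : R => expR (- (b * `|m|))) =
    2 * Rintegral (@lebesgue_measure R) [set: R] (fun m : R => 2 * A0 * expR (- (b * `|m|))).
    rewrite (@RintegralZl _ _ R lebesgue_measure)//; last exact: integrable_exp_abs.
    by rewrite !mulrA -natrM.
  apply: le_Cintegral => //.
  + by apply: Cintegrable_measC => //.
  + by apply: RintegrableZ => //; exact: integrable_exp_abs.
Qed.

(** [A0] is chosen before the direction and the point, so the bound is uniform along an arc of
    directions. *)
Lemma lint_decay p S (k' : nat) (A nu b c B : R) g : (k' < k2 p)%N -> (1 < k2 p)%N ->
  0 < c -> admg S k' A nu b g ->
  exists2 A0 : R, 0 <= A0 & forall (xi : R) T1 T2 Z, kernel_ok p c T1 T2 xi ->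
    (forall s : R, 0 < s -> S (polar s xi)) -> `|complex.Im Z| <= B ->
    forall (s m : R), 0 <= s ->
    normc (lint p g T1 T2 Z m (polar s xi)) <= A0 * expR (- ((b - B) * `|m|)) * expR (- s).
Proof.
move=> kk k1 c0 [A0 nu0 dg bg mg].
have [A' A'0 HA'] := growth 0 c0 kk k1 nu0.
exists (A * A'); first by rewrite mulr_ge0.
move=> xi T1 T2 Z ko Sp ZB s m s0; apply: (@lint_bound R p g k' A A' nu b c B) => //.
  by move=> t /HA'; rewrite expr0 mul1r.
move=> t m' t0; have := bg (polar t xi) m' (Sp t t0) (polar_neq0 _ t0).
by rewrite (normc_polar _ (ltW t0)).
Qed.

Lemma admg_LapOk p S w (k' : nat) (A nu b c B xi : R) g T1 T2 Z : (k' < k2 p)%N -> (1 < k2 p)%N ->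
  0 < c -> B < b -> admg S k' A nu b g -> 0 < w -> arcdom S w -> S (expi xi) ->
  kernel_ok p c T1 T2 xi -> `|complex.Im Z| <= B -> LapOk p g xi T1 T2 Z.
Proof.
move=> kk k1 c0 Bb ag w0 aS Sx ko ZB.
have [A0 A00 H] := lint_decay B kk k1 c0 ag.
have Sp s : 0 < s -> S (polar s xi) by exact: (arcdom_polar w0 aS Sx).
have [_ _ dg _ mg] := ag; have [T10 T20 _ _] := ko.
have Bb' : 0 < b - B by rewrite subr_gt0.
have [] := @LapOk_bound p g xi A0 (b - B) T1 T2 Z Bb' => //.
- move=> s m s0; apply: differentiable_lint_u; [exact: T10|exact: T20|exact: polar_neq0|].
  by apply: dg; exact: Sp.
- exact: mg.
- by move=> s m s0; exact: H.
Qed.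

(** [arc_between] replaces [xi'] by an angle with the same unit vector, joined to [xi] by an arc of
    decay directions shorter than pi / k2; this arc lies over [S], and [ray_rotate] applies along
    it. *)
Lemma Lap_indep p S (k' : nat) (A nu b B delta xi xi' : R) g T1 T2 Z : (1 <= k1 p)%N ->
  (k' < k2 p)%N -> (1 < k2 p)%N -> 0 < delta -> admg S k' A nu b g ->
  arcdom S (pi / (k2 p)%:R) -> S (expi xi) -> S (expi xi') -> T1 != 0 -> T2 != 0 ->
  decay_direction p delta T1 T2 xi -> decay_direction p delta T1 T2 xi' ->
  forall m, ray_integral xi (lint p g T1 T2 Z m) = ray_integral xi' (lint p g T1 T2 Z m).
Proof.
move=> k11 kk k21 d0 ag aS Sx Sx' T10 T20 dx dx' m.
have [x2 [e2 h2 hz]] := arc_between k11 k21 (ltW d0) T10 T20 dx dx'.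
have -> : ray_integral xi' (lint p g T1 T2 Z m) = ray_integral x2 (lint p g T1 T2 Z m).
  by rewrite /ray_integral /ray_integrand e2.
have Sz s zeta : 0 < s -> Num.min xi x2 <= zeta <= Num.max xi x2 -> S (polar s zeta).
  by apply: aS => //; rewrite e2.
have [_ c0] := decay_kernel_ok d0 T10 T20 (lexx (normc T2)) dx.
have [A0 A00 H] := lint_decay `|complex.Im Z| kk k21 c0 ag.
have [_ _ dg _ mg] := ag.
apply: (@ray_rotate R _ _ _ (A0 * expR (- ((b - `|complex.Im Z|) * `|m|)))).
  move=> s t s0 ht; apply: differentiable_lint_u; [exact: T10|exact: T20|exact: polar_neq0|].
  by apply: dg; exact: Sz.
move=> s t s0 ht; apply: H => //; last by move=> r r0; exact: Sz.
by have [] := decay_kernel_ok d0 T10 T20 (lexx (normc T2)) (hz t ht).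
Qed.

Lemma Lap_indepE p S (k' : nat) (A nu b delta xi xi' : R) g T1 T2 Z : (1 <= k1 p)%N ->
  (k' < k2 p)%N -> (1 < k2 p)%N -> 0 < delta -> admg S k' A nu b g ->
  arcdom S (pi / (k2 p)%:R) -> S (expi xi) -> S (expi xi') -> T1 != 0 -> T2 != 0 ->
  decay_direction p delta T1 T2 xi -> decay_direction p delta T1 T2 xi' ->
  Lap p g xi T1 T2 Z = Lap p g xi' T1 T2 Z.
Proof.
move=> k11 kk k21 d0 ag aS Sx Sx' T10 T20 dx dx'; apply: eq_Cintegral => m _.
exact: (Lap_indep 0 Z k11 kk k21 d0 ag aS Sx Sx' T10 T20 dx dx').
Qed.

Lemma Lap_lin p g h (xi : R) (a c : C) T1 T2 Z : LapOk p g xi T1 T2 Z -> LapOk p h xi T1 T2 Z ->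
  LapOk p (fun u m => a * g u m + c * h u m) xi T1 T2 Z /\
  Lap p (fun u m => a * g u m + c * h u m) xi T1 T2 Z = a * Lap p g xi T1 T2 Z + c * Lap p h xi T1 T2 Z.
Proof.
move=> [g1 g2] [h1 h2].
have E m : ray_integrand xi (lint p (fun u m => a * g u m + c * h u m) T1 T2 Z m) =
  (fun s => a * ray_integrand xi (lint p g T1 T2 Z m) s + c * ray_integrand xi (lint p h T1 T2 Z m) s).
  by apply/funext => s; rewrite /ray_integrand /lint; ring.
have mD : measurable `[(0 : R), +oo[%classic by exact: measurable_itv.
have E2 m : ray_integral xi (lint p (fun u m => a * g u m + c * h u m) T1 T2 Z m) =
  a * ray_integral xi (lint p g T1 T2 Z m) + c * ray_integral xi (lint p h T1 T2 Z m).
  rewrite /ray_integral E CintegralD//; [rewrite !CintegralZ//; [exact: h1|exact: g1]|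
    exact: CintegrableZ mD (g1 m)|exact: CintegrableZ mD (h1 m)].
have F : (fun m => ray_integral xi (lint p (fun u m => a * g u m + c * h u m) T1 T2 Z m)) =
  (fun m => a * ray_integral xi (lint p g T1 T2 Z m) + c * ray_integral xi (lint p h T1 T2 Z m)).
  by apply/funext.
split; first split.
- move=> m; rewrite /ray_integrable E; apply: CintegrableD => //;
   [exact: CintegrableZ mD (g1 m)|exact: CintegrableZ mD (h1 m)].
- by rewrite F; apply: CintegrableD => //; apply: CintegrableZ.
- rewrite /Lap F CintegralD//; [by rewrite !CintegralZ//|exact: CintegrableZ|exact: CintegrableZ].
Qed.

(** Equality on the open ray suffices, since both integrands vanish at the origin. *)
Lemma eq_lint_Lap p g h (xi : R) T1 T2 Z :
  (forall s m, 0 < s -> g (polar s xi) m = h (polar s xi) m) ->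
  (LapOk p g xi T1 T2 Z -> LapOk p h xi T1 T2 Z) /\ Lap p g xi T1 T2 Z = Lap p h xi T1 T2 Z.
Proof.
move=> gh.
have E m s : `[(0 : R), +oo[%classic s ->
  ray_integrand xi (lint p g T1 T2 Z m) s = ray_integrand xi (lint p h T1 T2 Z m) s.
  rewrite /= in_itv/= andbT le_eqVlt => /predU1P[<-|s0].
    by rewrite /ray_integrand mul0r /lint invr0 !mulr0.
  by rewrite /ray_integrand /lint -[_%:C * _]/(polar s xi) gh.
have F : (fun m => ray_integral xi (lint p g T1 T2 Z m)) = (fun m => ray_integral xi (lint p h T1 T2 Z m)).
  by apply/funext => m; apply: eq_Cintegral => s; exact: E.
split; last by rewrite /Lap F.
move=> [g1 g2]; split; last by rewrite -F.
move=> m; apply: (eq_Cintegrable _ (E m) (g1 m)); exact: measurable_itv.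
Qed.

Lemma LapOk0 p (xi : R) T1 T2 Z : LapOk p (fun _ _ => 0) xi T1 T2 Z /\ Lap p (fun _ _ => 0) xi T1 T2 Z = 0.
Proof.
have i0 (D : set R) : measurable D -> Cintegrable D (fun=> 0 : C).
  by move=> mD; split=> /=; exact: integrable0.
have e0 (D : set R) : measurable D -> Cintegral D (fun=> 0 : C) = 0.
  move=> mD; have h := CintegralZ 0 mD (i0 D mD); rewrite mul0r in h.
  by rewrite h mul0r.
have E m : ray_integrand xi (lint p (fun _ _ => 0) T1 T2 Z m) = (fun=> 0).
  by apply/funext => s; rewrite /ray_integrand /lint !mul0r.
have mD : measurable `[(0 : R), +oo[%classic by exact: measurable_itv.
have F : (fun m => ray_integral xi (lint p (fun _ _ => 0) T1 T2 Z m)) = (fun=> 0).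
  by apply/funext => m; rewrite /ray_integral E e0.
split; last by rewrite /Lap F e0.
split; last by rewrite F; exact: i0.
by move=> m; rewrite /ray_integrable E; exact: i0.
Qed.

Lemma Lap_sum p (xi : R) T1 T2 Z (I : Type) (r : seq I) (P : pred I) (g : I -> C -> R -> C) (v : I -> C) :
  (forall i, P i -> LapOk p (g i) xi T1 T2 Z /\ Lap p (g i) xi T1 T2 Z = v i) ->
  LapOk p (fun u m => \sum_(i <- r | P i) g i u m) xi T1 T2 Z /\
  Lap p (fun u m => \sum_(i <- r | P i) g i u m) xi T1 T2 Z = \sum_(i <- r | P i) v i.
Proof.
move=> H; elim: r => [|i r [IH1 IH2]].
  have -> : (fun (u : C) m => \sum_(i <- [::] | P i) g i u m) = (fun _ _ => 0).
    by apply/funext => u; apply/funext => m; rewrite big_nil.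
  by rewrite big_nil; exact: LapOk0.
have [Pi|nPi] := boolP (P i); last first.
  have -> : (fun (u : C) m => \sum_(i <- i :: r | P i) g i u m) = (fun u m => \sum_(i <- r | P i) g i u m).
    by apply/funext => u; apply/funext => m; rewrite big_cons (negPf nPi).
  by rewrite big_cons (negPf nPi).
have [h1 h2] := H i Pi.
have -> : (fun (u : C) m => \sum_(i <- i :: r | P i) g i u m) =
  (fun u m => 1 * g i u m + 1 * \sum_(i <- r | P i) g i u m).
  by apply/funext => u; apply/funext => m; rewrite big_cons Pi !mul1r.
have [l1 l2] := Lap_lin 1 1 h1 IH1.
by split=> //; rewrite l2 h2 IH2 big_cons Pi !mul1r.
Qed.

End Admissible.

(** * Derivatives of the transform in its variables *)

Section LapDerivatives.
Variable R : realType.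
Local Notation C := (Cx R).
Implicit Types (p : problem R) (T u Z : C) (g : C -> R -> C) (S : set C).

Lemma differentiable_near (V : normedModType R[i]) (f : V -> C) x (e : R) : 0 < e ->
  differentiable f x -> exists2 d, 0 < d & forall y, nv (y - x) < d -> normc (f y - f x) < e.
Proof.
move=> e0 df; have Hn : nbhs x [set y | normc (f y - f x) < e].
  exact: ((cvgCP _ _ _).1 (differentiable_continuous df) e e0).
have [d d0 H] := (nbhsVP _ _).1 Hn; exists d; first exact: d0.
by move=> y yd; exact: (H y yd).
Qed.

(** The selection [xi] may jump from point to point. The direction at [x0] keeps a margin delta / 2
    at nearby points, where the transform along it agrees with the one along the selected direction;
    so [F] coincides near [x0] with a transform of fixed direction. *)
Lemma Lap_diff_dir (V : normedModType R[i]) p S (k' : nat) (A nu b B delta r a : R) (x0 : V)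
    (G : V -> C -> R -> C) (T1 T2 Z : V -> C) (xi : V -> R) :
  (1 <= k1 p)%N -> (k' < k2 p)%N -> (1 < k2 p)%N -> B < b -> 0 < delta -> 0 < r ->
  arcdom S (pi / (k2 p)%:R) ->
  (forall y, nv (y - x0) < r ->
     [/\ differentiable T1 y, differentiable T2 y & differentiable Z y]) ->
  (forall y, nv (y - x0) < r ->
     [/\ T1 y != 0, T2 y != 0, normc (T2 y) <= a & `|complex.Im (Z y)| <= B]) ->
  (forall y, nv (y - x0) < r ->
     S (expi (xi y)) /\ decay_direction p delta (T1 y) (T2 y) (xi y)) ->
  (forall y, nv (y - x0) < r -> admg S k' A nu b (G y)) ->
  (forall y tau m, nv (y - x0) < r -> S tau -> differentiable (fun y => G y tau m) y) ->
  let F y := Lap p (G y) (xi y) (T1 y) (T2 y) (Z y) in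
  let dF h m u := 'd (fun y => lint p (G y) (T1 y) (T2 y) (Z y) m u) x0 h in
  [/\ differentiable F x0,
      forall h m, ray_integrable (xi x0) (dF h m),
      forall h, Cintegrable [set: R] (fun m => ray_integral (xi x0) (dF h m)) &
      forall h, 'd F x0 h = Cintegral [set: R] (fun m => ray_integral (xi x0) (dF h m))].
Proof.
move=> k11 kk k21 Bb d0 r0 aS dT T0 dx aG dG F dF.
have x0r : nv (x0 - x0) < r by rewrite subrr nv0.
have [d1 d2 d3] := dT x0 x0r; have [T10 T20 _ _] := T0 x0 x0r.
have [Sx0 dx0] := dx x0 x0r; have [A0 nu0 _ _ _] := aG x0 x0r.
have d20 : 0 < delta / 2 by rewrite divr_gt0.
have d2d : delta / 2 < delta by rewrite ltr_pdivrMr// ltr_pMr// ltr1n.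
have [e e0 He] := decay_near d2d T10 T20 dx0.
have [r1 r10 H1] := differentiable_near e0 d1.
have [r2 r20 H2] := differentiable_near e0 d2.
(* Inside this radius T1 and T2 have moved by less than [e], so [xi x0] is still a decay direction
   with margin delta / 2. *)
pose q := Num.min r (Num.min r1 r2).
have q0 : 0 < q by rewrite !lt_min r0 r10.
have qr y : nv (y - x0) < q -> nv (y - x0) < r by rewrite lt_min => /andP[].
have dq y : nv (y - x0) < q -> decay_direction p (delta / 2) (T1 y) (T2 y) (xi x0).
  by rewrite !lt_min => /and3P[_ h1 h2]; apply: He; [exact: H1|exact: H2].
have w0 : 0 < pi / (k2 p)%:R :> R.
  by rewrite divr_gt0 ?pi_gt0// ltr0n; apply: leq_trans k21.
have ko y : nv (y - x0) < q -> kernel_ok p (sin (delta / 2) / a ^+ k2 p) (T1 y) (T2 y) (xi x0) /\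
    0 < sin (delta / 2) / a ^+ k2 p.
  move=> yq; have [h1 h2 h3 h4] := T0 y (qr y yq).
  by apply: decay_kernel_ok => //; exact: dq.
have x0q : nv (x0 - x0) < q by rewrite subrr nv0.
have [l1 l2 l3 l4] := @Lap_diff R V p k' (xi x0) A nu b (sin (delta / 2) / a ^+ k2 p) B q x0 G T1 T2 Z
  kk k21 (ko x0 x0q).2 nu0 Bb A0 q0
  (fun y yq => dT y (qr y yq))
  (fun y yq => conj (ko y yq).1 (let: And4 _ _ _ h := T0 y (qr y yq) in h))
  (fun y s m yq s0 => dG y _ m (qr y yq) (arcdom_polar w0 aS Sx0 s0))
  (fun y s m yq s0 => ltac:(
     have [_ _ _ bg _] := aG y (qr y yq);
     have := bg (polar s (xi x0)) m (arcdom_polar w0 aS Sx0 s0) (polar_neq0 _ s0);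
     rewrite (normc_polar _ (ltW s0)); exact: id))
  (fun y yq => let: And5 _ _ _ _ h := aG y (qr y yq) in h (xi x0) Sx0).
(* Both directions have margin delta / 2 at y, which is the common margin needed to compare them. *)
have E y : nv (y - x0) < q -> Lap p (G y) (xi x0) (T1 y) (T2 y) (Z y) = F y.
  move=> yq; have yr := qr y yq; have [h1 h2 h3 h4] := T0 y yr; have [Sy dy] := dx y yr.
  apply: (@Lap_indepE R p S k' A nu b (delta / 2) _ _ _ _ _ _ k11 kk k21 d20 (aG y yr) aS Sx0 Sy h1 h2).
    exact: dq.
  by apply: decayW dy; exact: ltW.
have [m1 m2] := near_eq_differentiable q0 E l1.
split; [exact: m1|exact: l2|exact: l3|move=> h].
exact: etrans (m2 h) (l4 h).
Qed.

Lemma diff_mulE (V : normedModType R[i]) (f h : V -> C) (x v : V) :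
  differentiable f x -> differentiable h x ->
  'd (fun y => f y * h y) x v = f x * 'd h x v + h x * 'd f x v.
Proof.
move=> df dh; have E := @diffM R[i] V f h x df dh.
exact: (congr1 (fun q : V -> C => q v) E).
Qed.

Lemma dC_mulc (f : C -> C) (k x : C) : differentiable f x -> dC (fun y => k * f y) x = k * dC f x.
Proof. by move=> df; exact: diff_mulcE. Qed.

Lemma dC_id (x : C) : dC (fun y : C => y) x = 1.
Proof.
apply: (has_diff_C (l := 1) _).2 => e e0; exists 1 => // h _.
have -> : x + h - x - 1 * h = 0 by ring.
by rewrite normc0 mulr_ge0 ?nv_ge0// ltW.
Qed.

Lemma dC_inv (x : C) : x != 0 -> dC (fun y : C => y^-1) x = - (x^-1 ^+ 2).
Proof.
move=> x0; have E := @diffV R[i] C (fun y : C => y) x (differentiable_idC x) x0.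
have {E} := congr1 (fun q : C -> C => q 1) E => E.
have E1 : dC (fun y : C => y^-1) x = - x ^- 2 * dC (fun y : C => y) x by exact: E.
by rewrite E1 dC_id mulr1 exprVn.
Qed.

Lemma dC_invX (x : C) (k : nat) : x != 0 ->
  differentiable (fun y : C => y^-1 ^+ k) x /\
  dC (fun y : C => y^-1 ^+ k) x = - (k%:R * x^-1 ^+ k.+1).
Proof.
move=> x0; have di : differentiable (fun y : C => y^-1) x.
  by apply: differentiable_inv; [exact: x0|exact: differentiable_idC].
have dp n : differentiable (fun y : C => y^-1 ^+ n) x by exact: differentiable_pow.
split; first exact: dp.
elim: k => [|k IH].
  rewrite mul0r oppr0; have -> : (fun y : C => y^-1 ^+ 0) = (fun=> 1) by [].
  by rewrite /dC diff_cst.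
have -> : (fun y : C => y^-1 ^+ k.+1) = (fun y => y^-1 * y^-1 ^+ k) by apply/funext => y; exact: exprS.
have E := @diff_mulE C (fun y : C => y^-1) (fun y : C => y^-1 ^+ k) x 1 di (dp k).
have E1 : dC (fun y : C => y^-1 * y^-1 ^+ k) x =
   x^-1 * dC (fun y : C => y^-1 ^+ k) x + x^-1 ^+ k * dC (fun y : C => y^-1) x by exact: E.
by rewrite E1 IH dC_inv// -natr1 !exprS; ring.
Qed.

Lemma dC_cexp_comp (f : C -> C) x : differentiable f x ->
  dC (fun y => cexp (f y)) x = cexp (f x) * dC f x.
Proof. exact: diff_cexp_comp. Qed.

Lemma dC_addc (f : C -> C) (c x : C) : differentiable f x ->
  differentiable (fun y => f y + c) x /\ dC (fun y => f y + c) x = dC f x.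
Proof.
move=> df; apply: has_diff_C => e e0; have [d d0 H] := has_diff_dC df e0.
exists d => // h hd; have -> : f (x + h) + c - (f x + c) - dC f x * h = f (x + h) - f x - dC f x * h by ring.
exact: H.
Qed.

(** In the applications a = - (u / e)^k, so the minus sign produced by the derivative of y^(-k)
    disappears and the factor k u^k is left. *)
Lemma dC_cexp_invX (a c K x : C) (k : nat) : x != 0 ->
  dC (fun y => K * cexp (a * y^-1 ^+ k + c)) x =
  x^-1 ^+ k.+1 * (- (k%:R * a) * (K * cexp (a * x^-1 ^+ k + c))).
Proof.
move=> x0; have [d1 d2] := dC_invX k x0.
have d3 : differentiable (fun y : C => a * y^-1 ^+ k) x.
  by apply: differentiable_mul; [exact: differentiable_const|exact: d1].
have [d4 d5] := dC_addc c d3.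
rewrite dC_mulc; last exact: differentiable_cexp.
rewrite dC_cexp_comp; last exact: d4.
rewrite d5 dC_mulc; last exact: d1.
rewrite d2; ring.
Qed.

(** Only one factor of the kernel depends on y, and its exponent is a constant times y^(-k1). The
    factor x^(-(k1 + 1)) will be cancelled by the Euler operator, and e^(-k1) becomes a negative
    power of eps. *)
Lemma dC_lint1 p g (e x T2 Z u : C) (m : R) : x != 0 ->
  dC (fun y => lint p g (e * y) T2 Z m u) x =
  x^-1 ^+ (k1 p).+1 * ((e^-1) ^+ k1 p *
    lint p (fun u m => (k1 p)%:R * u ^+ k1 p * g u m) (e * x) T2 Z m u).
Proof.
move=> x0.
have E y : lint p g (e * y) T2 Z m u = (g u m * cexp ('i%C * Z * m%:C) / u) *
   cexp (- ((u / e) ^+ k1 p) * y^-1 ^+ k1 p + - (u / T2) ^+ k2 p).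
  have K : - (u / (e * y)) ^+ k1 p - (u / T2) ^+ k2 p = - ((u / e) ^+ k1 p) * y^-1 ^+ k1 p + - (u / T2) ^+ k2 p.
    by rewrite invfM mulrA exprMn mulNr.
  rewrite /lint /expkernel K; move: (cexp _) (cexp _) => a b; ring.
rewrite (funext E).
rewrite dC_cexp_invX// -E /lint exprMn; move: (cexp _) (expkernel _ _ _ _) => a b; ring.
Qed.

Lemma dC_lint2 p g (e x T1 Z u : C) (m : R) : x != 0 ->
  dC (fun y => lint p g T1 (e * y) Z m u) x =
  x^-1 ^+ (k2 p).+1 * ((e^-1) ^+ k2 p *
    lint p (fun u m => (k2 p)%:R * u ^+ k2 p * g u m) T1 (e * x) Z m u).
Proof.
move=> x0.
have E y : lint p g T1 (e * y) Z m u = (g u m * cexp ('i%C * Z * m%:C) / u) *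
   cexp (- ((u / e) ^+ k2 p) * y^-1 ^+ k2 p + - (u / T1) ^+ k1 p).
  have K : - (u / T1) ^+ k1 p - (u / (e * y)) ^+ k2 p = - ((u / e) ^+ k2 p) * y^-1 ^+ k2 p + - (u / T1) ^+ k1 p.
    by rewrite addrC invfM mulrA exprMn mulNr.
  rewrite /lint /expkernel K; move: (cexp _) (cexp _) => a b; ring.
rewrite (funext E).
rewrite dC_cexp_invX// -E /lint exprMn; move: (cexp _) (expkernel _ _ _ _) => a b; ring.
Qed.

Lemma dC_lintz p g (x T1 T2 u : C) (m : R) :
  dC (fun y => lint p g T1 T2 y m u) x =
    lint p (fun u m => 'i%C * m%:C * g u m) T1 T2 x m u.
Proof.
have E y : lint p g T1 T2 y m u = (g u m * expkernel p T1 T2 u / u) *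
   cexp (('i%C * m%:C) * y).
  rewrite /lint; have -> : 'i%C * y * m%:C = 'i%C * m%:C * y :> C by ring.
  move: (cexp _) (expkernel _ _ _ _) => a b; ring.
rewrite (funext E).
have d1 : differentiable (fun y : C => ('i%C * m%:C * y : C)) x.
  by apply: differentiable_mul; [exact: differentiable_const|exact: differentiable_idC].
rewrite dC_mulc; last exact: differentiable_cexp.
rewrite dC_cexp_comp; last exact: d1.
rewrite dC_mulc; last exact: differentiable_idC.
rewrite dC_id /lint; have -> : 'i%C * x * m%:C = 'i%C * m%:C * x :> C by ring.
move: (cexp _) (expkernel _ _ _ _) => a b; ring.
Qed.

Lemma derive1_dC (f : C -> C) x : differentiable f x -> derive1 f x = dC f x.
Proof. by move=> df; apply: etrans (derive1E _ _) (deriveE _ df). Qed.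

Lemma derive1_near (f h : C -> C) x (r : R) : 0 < r ->
  (forall y : C, normc (y - x) < r -> f y = h y) -> differentiable f x ->
  derive1 h x = dC f x.
Proof.
move=> r0 fh df.
have [d1 d2] : differentiable h x /\ dC h x = dC f x.
  apply: has_diff_C => e e0; have [d d0 Hd] := has_diff_dC df e0.
  exists (Num.min d r); first by rewrite lt_min d0.
  move=> k; rewrite lt_min => /andP[kd kr]; rewrite -!fh; first exact: Hd.
    by rewrite subrr normc0.
  by rewrite addrC addKr -nvC.
have E := derive1_dC d1.
rewrite E; exact: d2.
Qed.

End LapDerivatives.

(** * Differential operators as multipliers on the Borel side *)

Section Operators.
Variable R : realType.
Local Notation C := (Cx R).
Implicit Types (T u Z z : C) (g : C -> R -> C) (S : set C).

Lemma exists_between (x y : R) : x < y -> exists2 z : R, x < z & z < y.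
Proof. by move=> xy; exists ((x + y) / 2); move: xy; clear; lra. Qed.

(** [A] and [nu] are hidden because powers of u increase them. The rate [b] stays visible, as it
    decides in which strip of z the transform converges. *)
Definition exadm S (k' : nat) (b : R) g := exists A nu : R, admg S k' A nu b g.

(** |u|^n is at most a constant times exp (|u|^k'), so [nu] grows by 1; the decay in m is
    untouched. *)
Lemma exadm_pow S k' b g (c : C) (n : nat) : (0 < k')%N -> exadm S k' b g ->
  exadm S k' b (fun u m => c * u ^+ n * g u m).
Proof.
move=> k0 [A [nu [A0 nu0 dg bg mg]]].
pose K := (n.+1%:R / 1) ^+ n * expR 1 : R.
have K0 : 0 <= K by rewrite mulr_ge0 ?expR_ge0// exprn_ge0// divr_ge0.
have HK (x : R) : 0 <= x -> x ^+ n <= K * expR (x ^+ k').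
  move=> x0; apply: le_trans (pow_le_exp n ltr01 x0) _.
  rewrite /K -mulrA; apply: ler_wpM2l; first by rewrite exprn_ge0// divr_ge0.
  rewrite -expRD ler_expR mul1r.
  have [x1|x1] := leP x 1; first by rewrite ler_wpDr// exprn_ge0.
  rewrite ler_wpDl// -[X in X <= _]expr1 ler_weXn2l// ltW//.
exists (normc c * K * A), (nu + 1); split.
- by rewrite !mulr_ge0 ?normc_ge0.
- by rewrite addr_ge0.
- move=> m tau St; apply: differentiable_mul; last exact: dg.
  apply: differentiable_mul; first exact: differentiable_const.
  by apply: differentiable_pow; exact: differentiable_idC.
- move=> tau m St t0; rewrite !normcM normcX.
  set x := normc tau; have x0 : 0 <= x by exact: normc_ge0.
  have -> : normc c * K * A * x * expR ((nu + 1) * x ^+ k') * expR (- (b * `|m|)) =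
     (normc c * (K * expR (x ^+ k'))) * (A * x * expR (nu * x ^+ k') * expR (- (b * `|m|))).
    by rewrite mulrDl mul1r expRD; ring.
  apply: ler_pM; rewrite ?mulr_ge0 ?normc_ge0 ?exprn_ge0//; last exact: bg.
  by rewrite ler_wpM2l ?normc_ge0//; exact: HK.
- move=> xi Sx; apply: measCM; last exact: mg.
  by apply: measCM; [exact: measC_cst|apply: measCX; exact: measC_polar2].
Qed.

(** The polynomial is absorbed by exp ((b - b') |m|); the strict inequality is what makes this
    possible. *)
Lemma exadm_poly S k' (b b' : R) g (P : {poly R[i]}) : b' < b -> exadm S k' b g ->
  exadm S k' b' (fun u m => (P.['i%C * m%:C] : C) * g u m).
Proof.
move=> bb [A [nu [A0 nu0 dg bg mg]]].
have bb0 : 0 < b - b' by rewrite subr_gt0.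
have [K K0 HK] := poly_growth P bb0.
exists (K * A), nu; split.
- by rewrite mulr_ge0.
- by [].
- move=> m tau St; apply: differentiable_mul; last exact: dg.
  exact: differentiable_const.
- move=> tau m St t0; rewrite normcM.
  set x := normc tau.
  have -> : K * A * x * expR (nu * x ^+ k') * expR (- (b' * `|m|)) =
     (K * expR ((b - b') * `|m|)) * (A * x * expR (nu * x ^+ k') * expR (- (b * `|m|))).
    have -> : - (b' * `|m|) = (b - b') * `|m| + - (b * `|m|) by ring.
    by rewrite expRD; ring.
  by apply: ler_pM; rewrite ?normc_ge0//; exact: bg.
- move=> xi Sx; apply: measCM; last exact: mg.
  apply: measC_poly; apply: measCM; first exact: measC_cst.
  by apply: measC_real; exact: measurable_fst.
Qed.

Lemma Lap_scale p g (xi : R) (c : C) T1 T2 Z : LapOk p g xi T1 T2 Z ->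
  LapOk p (fun u m => c * g u m) xi T1 T2 Z /\
  Lap p (fun u m => c * g u m) xi T1 T2 Z = c * Lap p g xi T1 T2 Z.
Proof.
move=> h; have [h0 h1] := LapOk0 p xi T1 T2 Z; have [l1 l2] := Lap_lin c 0 h h0.
have E : (fun u m => c * g u m + 0 * 0) = (fun (u : C) (m : R) => c * g u m).
  by apply/funext => u; apply/funext => m; rewrite mul0r addr0.
by rewrite E in l1 l2; split=> //; rewrite l2 h1 mulr0 addr0.
Qed.

Variables (p : problem R) (S : set C) (k' : nat) (T1s T2s : set C) (eps : C) (delta B a : R).
Variable xi : C -> C -> R.
Let e1 := eps ^+ lam1 p.
Let e2 := eps ^+ lam2 p.
Hypotheses (k11 : (1 <= k1 p)%N) (kk : (k' < k2 p)%N) (k21 : (1 < k2 p)%N) (k'0 : (0 < k')%N).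
Hypotheses (d0 : 0 < delta) (aS : arcdom S (pi / (k2 p)%:R)).
Hypothesis T1o : forall t, T1s t -> exists2 r : R, 0 < r & forall t', normc (t' - t) < r -> T1s t'.
Hypothesis T2o : forall t, T2s t -> exists2 r : R, 0 < r & forall t', normc (t' - t) < r -> T2s t'.
Hypothesis T1n : forall t, T1s t -> t != 0.
Hypothesis T2n : forall t, T2s t -> t != 0.
Hypothesis e0 : eps != 0.
Hypothesis T2b : forall t, T2s t -> normc (e2 * t) <= a.
Hypothesis Hxi : forall t1 t2, T1s t1 -> T2s t2 -> S (expi (xi t1 t2)) /\
  decay_direction p delta (e1 * t1) (e2 * t2) (xi t1 t2).

Definition LX g t1 t2 z := Lap p g (xi t1 t2) (e1 * t1) (e2 * t2) z.

Let e10 : e1 != 0. Proof. by rewrite expf_neq0. Qed.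
Let e20 : e2 != 0. Proof. by rewrite expf_neq0. Qed.
Let w0 : 0 < pi / (k2 p)%:R :> R.
Proof. by rewrite divr_gt0 ?pi_gt0// ltr0n; apply: leq_trans k21. Qed.

Lemma exadm_LapOk b g t1 t2 z : B < b -> exadm S k' b g -> T1s t1 -> T2s t2 ->
  `|complex.Im z| < B -> LapOk p g (xi t1 t2) (e1 * t1) (e2 * t2) z.
Proof.
move=> Bb [A [nu ag]] h1 h2 h3; have [Sx dx] := Hxi h1 h2.
have n1 : e1 * t1 != 0 by rewrite mulf_neq0// T1n.
have n2 : e2 * t2 != 0 by rewrite mulf_neq0// T2n.
have [ko c0] := decay_kernel_ok d0 n1 n2 (T2b h2) dx.
apply: (@admg_LapOk R p S (pi / (k2 p)%:R) k' A nu b (sin delta / a ^+ k2 p) B) => //; exact: ltW.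
Qed.

Lemma Lap_scale_raw g (c : C) (x : R) T1 T2 Z : LapOk p g x T1 T2 Z ->
  Cintegral [set: R] (fun m => ray_integral x (fun u => c * lint p g T1 T2 Z m u)) =
  c * Lap p g x T1 T2 Z.
Proof.
move=> [g1 g2]; rewrite /Lap -CintegralZ//; apply: eq_Cintegral => m _.
rewrite /ray_integral -CintegralZ; [|exact: measurable_itv|exact: g1].
by apply: eq_Cintegral => s _; rewrite /ray_integrand mulrA.
Qed.

Lemma LX_d1 b g t1 t2 z : B < b -> exadm S k' b g -> T1s t1 -> T2s t2 ->
  `|complex.Im z| < B ->
  differentiable (fun t => LX g t t2 z) t1 /\
  t1 ^+ (k1 p).+1 * dC (fun t => LX g t t2 z) t1 =
  (e1^-1) ^+ k1 p * LX (fun u m => (k1 p)%:R * u ^+ k1 p * g u m) t1 t2 z.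
Proof.
move=> Bb ag h1 h2 h3; have [r r0 Hr] := T1o h1.
have ag' := exadm_pow (k1 p)%:R (k1 p) k'0 ag.
have ok := exadm_LapOk Bb ag' h1 h2 h3.
have [A [nu {}ag]] := ag.
have Tr (y : C) : nv (y - t1) < r -> T1s y by rewrite nvC; exact: Hr.
have [|||||l1 l2 l3 l4] := @Lap_diff_dir R C p S k' A nu b B delta r a t1 (fun=> g) (fun y => e1 * y)
  (fun=> e2 * t2) (fun=> z) (fun y => xi y t2) k11 kk k21 Bb d0 r0 aS.
- move=> y _; split; last exact: differentiable_const.
    by apply: differentiable_mul; [exact: differentiable_const|exact: differentiable_idC].
  exact: differentiable_const.
- move=> y yr; split; [|by rewrite mulf_neq0// T2n|exact: T2b|exact: ltW].
  by rewrite mulf_neq0// T1n//; exact: Tr.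
- by move=> y yr; apply: Hxi => //; exact: Tr.
- by [].
- by move=> y tau m _ _; exact: differentiable_const.
split; first exact: l1.
have E : dC (fun t => LX g t t2 z) t1 = t1^-1 ^+ (k1 p).+1 * (e1^-1) ^+ k1 p *
   LX (fun u m => (k1 p)%:R * u ^+ k1 p * g u m) t1 t2 z.
  rewrite -(Lap_scale_raw _ ok); apply: etrans (l4 1) _.
  apply: eq_Cintegral => m _; congr (ray_integral _ _); apply/funext => u.
  by rewrite -mulrA; exact: dC_lint1 (T1n h1).
by rewrite E !mulrA exprVn mulfV ?mul1r// expf_neq0// T1n.
Qed.

Lemma LX_d2 b g t1 t2 z : B < b -> exadm S k' b g -> T1s t1 -> T2s t2 ->
  `|complex.Im z| < B ->
  differentiable (fun t => LX g t1 t z) t2 /\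
  t2 ^+ (k2 p).+1 * dC (fun t => LX g t1 t z) t2 =
  (e2^-1) ^+ k2 p * LX (fun u m => (k2 p)%:R * u ^+ k2 p * g u m) t1 t2 z.
Proof.
move=> Bb ag h1 h2 h3; have [r r0 Hr] := T2o h2.
have ag' := exadm_pow (k2 p)%:R (k2 p) k'0 ag.
have ok := exadm_LapOk Bb ag' h1 h2 h3.
have [A [nu {}ag]] := ag.
have Tr (y : C) : nv (y - t2) < r -> T2s y by rewrite nvC; exact: Hr.
have [|||||l1 l2 l3 l4] := @Lap_diff_dir R C p S k' A nu b B delta r a t2 (fun=> g) (fun=> e1 * t1)
  (fun y => e2 * y) (fun=> z) (fun y => xi t1 y) k11 kk k21 Bb d0 r0 aS.
- move=> y _; split; [exact: differentiable_const| |exact: differentiable_const].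
  by apply: differentiable_mul; [exact: differentiable_const|exact: differentiable_idC].
- move=> y yr; split; [by rewrite mulf_neq0// T1n| |by apply: T2b; exact: Tr|exact: ltW].
  by rewrite mulf_neq0// T2n//; exact: Tr.
- by move=> y yr; apply: Hxi => //; exact: Tr.
- by [].
- by move=> y tau m _ _; exact: differentiable_const.
split; first exact: l1.
have E : dC (fun t => LX g t1 t z) t2 = t2^-1 ^+ (k2 p).+1 * (e2^-1) ^+ k2 p *
   LX (fun u m => (k2 p)%:R * u ^+ k2 p * g u m) t1 t2 z.
  rewrite -(Lap_scale_raw _ ok); apply: etrans (l4 1) _.
  apply: eq_Cintegral => m _; congr (ray_integral _ _); apply/funext => u.
  by rewrite -mulrA; exact: dC_lint2 (T2n h2).
by rewrite E !mulrA exprVn mulfV ?mul1r// expf_neq0// T2n.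
Qed.

Lemma LX_dz b g t1 t2 z : B < b -> exadm S k' b g -> T1s t1 -> T2s t2 ->
  `|complex.Im z| < B ->
  differentiable (fun t => LX g t1 t2 t) z /\
  dC (fun t => LX g t1 t2 t) z = LX (fun u m => 'i%C * m%:C * g u m) t1 t2 z.
Proof.
move=> Bb ag h1 h2 h3.
have r0 : 0 < B - `|complex.Im z| by rewrite subr_gt0.
have [A [nu {}ag]] := ag.
have Tr (y : C) : nv (y - z) < B - `|complex.Im z| -> `|complex.Im y| <= B.
  rewrite nvC => hy; have -> : complex.Im y = complex.Im (y - z) + complex.Im z by rewrite cImB subrK.
  apply: le_trans (ler_normD _ _) _; rewrite -lerBrDr; apply: le_trans (ltW hy); exact: le_Im_normc.
have [|||||l1 l2 l3 l4] := @Lap_diff_dir R C p S k' A nu b B delta _ a z (fun=> g) (fun=> e1 * t1)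
  (fun=> e2 * t2) (fun y => y) (fun=> xi t1 t2) k11 kk k21 Bb d0 r0 aS.
- move=> y _; split; [exact: differentiable_const|exact: differentiable_const|exact: differentiable_idC].
- by move=> y yr; split; [rewrite mulf_neq0// T1n|rewrite mulf_neq0// T2n|exact: T2b|exact: Tr].
- by move=> y yr; apply: Hxi.
- by [].
- by move=> y tau m _ _; exact: differentiable_const.
split; first exact: l1.
apply: etrans (l4 1) _.
apply: eq_Cintegral => m _; congr (ray_integral _ _); apply/funext => u.
exact: dC_lintz.
Qed.

(* [eps] is fixed, since no operator of the equation acts on it. *)
Definition rep (kappa : C -> C) g (U : Cfun4 R) := forall t1 t2 z, T1s t1 -> T2s t2 ->
  `|complex.Im z| < B -> U t1 t2 z eps = kappa z * LX g t1 t2 z.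

(** The representation holds for all t near t1, since the domain is open, so the derivative of [U]
    may be computed on the transform; kappa depends on z only and passes through. *)
Lemma euler1_rep b kappa g U : B < b -> exadm S k' b g -> rep kappa g U ->
  rep (fun z => kappa z * (e1^-1) ^+ k1 p) (fun u m => (k1 p)%:R * u ^+ k1 p * g u m) (euler1 (k1 p) U).
Proof.
move=> Bb ag HU t1 t2 z h1 h2 h3; have [d1 d2] := LX_d1 Bb ag h1 h2 h3.
have [r r0 Hr] := T1o h1.
have dk : differentiable (fun t => kappa z * LX g t t2 z) t1.
  by apply: differentiable_mul; [exact: differentiable_const|exact: d1].
rewrite /euler1 (@derive1_near R (fun t => kappa z * LX g t t2 z) _ t1 r r0 _ dk); last first.
  by move=> y yr; exact: esym (HU _ _ _ (Hr y yr) h2 h3).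
rewrite (dC_mulc _ d1) mulrCA d2; exact: mulrA.
Qed.

Lemma euler2_rep b kappa g U : B < b -> exadm S k' b g -> rep kappa g U ->
  rep (fun z => kappa z * (e2^-1) ^+ k2 p) (fun u m => (k2 p)%:R * u ^+ k2 p * g u m) (euler2 (k2 p) U).
Proof.
move=> Bb ag HU t1 t2 z h1 h2 h3; have [d1 d2] := LX_d2 Bb ag h1 h2 h3.
have [r r0 Hr] := T2o h2.
have dk : differentiable (fun t => kappa z * LX g t1 t z) t2.
  by apply: differentiable_mul; [exact: differentiable_const|exact: d1].
rewrite /euler2 (@derive1_near R (fun t => kappa z * LX g t1 t z) _ t2 r r0 _ dk); last first.
  by move=> y yr; exact: esym (HU _ _ _ h1 (Hr y yr) h3).
rewrite (dC_mulc _ d1) mulrCA d2; exact: mulrA.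
Qed.

(** Here kappa must be constant. The z-dependent coefficients c_(l1 l2) cause no difficulty, because
    in the equation they multiply R_(l1 l2)(d/dz) u from outside. *)
Lemma partial_z_rep b (kappa : C) g U : B < b -> exadm S k' b g -> rep (fun=> kappa) g U ->
  rep (fun=> kappa) (fun u m => 'i%C * m%:C * g u m) (@partial_z R U).
Proof.
move=> Bb ag HU t1 t2 z h1 h2 h3; have [d1 d2] := LX_dz Bb ag h1 h2 h3.
have r0 : 0 < B - `|complex.Im z| by rewrite subr_gt0.
have dk : differentiable (fun t => kappa * LX g t1 t2 t) z.
  by apply: differentiable_mul; [exact: differentiable_const|exact: d1].
rewrite /partial_z (@derive1_near R (fun t => kappa * LX g t1 t2 t) _ z _ r0 _ dk); last first.
  move=> y yr; apply: esym; apply: (HU _ _ _ h1 h2).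
  have -> : complex.Im y = complex.Im (y - z) + complex.Im z by rewrite cImB subrK.
  apply: le_lt_trans (ler_normD _ _) _; rewrite -ltrBrDr; apply: le_lt_trans yr; exact: le_Im_normc.
by rewrite (dC_mulc _ d1) d2.
Qed.

Lemma iter_euler1_rep b kappa g U n : B < b -> exadm S k' b g -> rep kappa g U ->
  rep (fun z => kappa z * (e1^-1) ^+ (k1 p * n)) (fun u m => ((k1 p)%:R * u ^+ k1 p) ^+ n * g u m)
    (iter n (@euler1 R (k1 p)) U) /\
  exadm S k' b (fun u m => ((k1 p)%:R * u ^+ k1 p) ^+ n * g u m).
Proof.
move=> Bb ag HU; elim: n => [|n [IH1 IH2]].
  have -> : (fun u m => ((k1 p)%:R * u ^+ k1 p) ^+ 0 * g u m) = g.
    by apply/funext => u; apply/funext => m; rewrite mul1r.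
  by split=> // t1 t2 z h1 h2 h3; rewrite muln0 mulr1; exact: HU.
have E : (fun u m => ((k1 p)%:R * u ^+ k1 p) ^+ n.+1 * g u m) =
  (fun u m => (k1 p)%:R * u ^+ k1 p * (((k1 p)%:R * u ^+ k1 p) ^+ n * g u m)).
  by apply/funext => u; apply/funext => m; rewrite exprS mulrA.
rewrite E; split; last exact: exadm_pow.
move=> t1 t2 z h1 h2 h3; rewrite iterS (euler1_rep Bb IH2 IH1 h1 h2 h3); congr (_ * _).
by rewrite -mulrA -exprD mulnS addnC.
Qed.

Lemma iter_euler2_rep b kappa g U n : B < b -> exadm S k' b g -> rep kappa g U ->
  rep (fun z => kappa z * (e2^-1) ^+ (k2 p * n)) (fun u m => ((k2 p)%:R * u ^+ k2 p) ^+ n * g u m)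
    (iter n (@euler2 R (k2 p)) U) /\
  exadm S k' b (fun u m => ((k2 p)%:R * u ^+ k2 p) ^+ n * g u m).
Proof.
move=> Bb ag HU; elim: n => [|n [IH1 IH2]].
  have -> : (fun u m => ((k2 p)%:R * u ^+ k2 p) ^+ 0 * g u m) = g.
    by apply/funext => u; apply/funext => m; rewrite mul1r.
  by split=> // t1 t2 z h1 h2 h3; rewrite muln0 mulr1; exact: HU.
have E : (fun u m => ((k2 p)%:R * u ^+ k2 p) ^+ n.+1 * g u m) =
  (fun u m => (k2 p)%:R * u ^+ k2 p * (((k2 p)%:R * u ^+ k2 p) ^+ n * g u m)).
  by apply/funext => u; apply/funext => m; rewrite exprS mulrA.
rewrite E; split; last exact: exadm_pow.
move=> t1 t2 z h1 h2 h3; rewrite iterS (euler2_rep Bb IH2 IH1 h1 h2 h3); congr (_ * _).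
by rewrite -mulrA -exprD mulnS addnC.
Qed.

(** One intermediate rate [b'] serves every n: (i m)^k g is obtained from [g] in a single step, so
    the losses of decay do not accumulate along the induction. *)
Lemma iter_partial_z_rep b (kappa : C) g U n : B < b -> exadm S k' b g -> rep (fun=> kappa) g U ->
  rep (fun=> kappa) (fun u m => ('i%C * m%:C) ^+ n * g u m) (iter n (@partial_z R) U).
Proof.
move=> Bb ag HU.
have [b' Bb' bb'] : exists2 b' : R, B < b' & b' < b.
  exact: exists_between.
have ad k : exadm S k' b' (fun u m => ('i%C * m%:C) ^+ k * g u m).
  have := exadm_poly 'X^k bb' ag; congr (exadm _ _ _ _).
  by apply/funext => u; apply/funext => m; rewrite hornerXn.
elim: n => [|n IH].
  have -> : (fun (u : C) (m : R) => ('i%C * m%:C) ^+ 0 * g u m) = g.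
    by apply/funext => u; apply/funext => m; exact: mul1r.
  exact: HU.
have E : (fun u m => ('i%C * m%:C) ^+ n.+1 * g u m) = (fun u m => 'i%C * m%:C * (('i%C * m%:C) ^+ n * g u m)).
  by apply/funext => u; apply/funext => m; rewrite exprS mulrA.
by rewrite E iterS; exact: partial_z_rep Bb' (ad n) IH.
Qed.

Lemma poly_dz_rep b (kappa : C) g U (P : {poly R[i]}) : B < b -> exadm S k' b g ->
  rep (fun=> kappa) g U ->
  rep (fun=> kappa) (fun u m => (P.['i%C * m%:C] : C) * g u m) (poly_dz P U).
Proof.
move=> Bb ag HU t1 t2 z h1 h2 h3; rewrite /poly_dz.
have [b' Bb' bb'] : exists2 b' : R, B < b' & b' < b.
  exact: exists_between.
have ad k : exadm S k' b' (fun u m => ('i%C * m%:C) ^+ k * g u m).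
  have := exadm_poly 'X^k bb' ag; congr (exadm _ _ _ _).
  by apply/funext => u; apply/funext => m; rewrite hornerXn.
have ok k := exadm_LapOk Bb' (ad k) h1 h2 h3.
have E : (fun u m => (P.['i%C * m%:C] : C) * g u m) =
   (fun (u : C) (m : R) => \sum_(i < size P) P`_i * (('i%C * m%:C) ^+ i * g u m)).
  apply/funext => u; apply/funext => m; rewrite horner_coef mulr_suml; apply: eq_bigr => i _.
  by rewrite mulrA.
have [|_ h] := @Lap_sum R p (xi t1 t2) (e1 * t1) (e2 * t2) z _ (index_enum 'I_(size P)) xpredT
  (fun i u m => P`_i * (('i%C * m%:C) ^+ i * g u m))
  (fun i => P`_i * LX (fun u m => ('i%C * m%:C) ^+ i * g u m) t1 t2 z).
  by move=> i _; exact: Lap_scale.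
rewrite /LX E h mulr_sumr; apply: eq_bigr => i _.
rewrite (iter_partial_z_rep i Bb ag HU h1 h2 h3); exact: mulrCA.
Qed.

End Operators.

(** * From the norms to pointwise bounds; the fixed-point identity *)

Section SpaceBounds.
Variable R : realType.
Local Notation C := (Cx R).
Implicit Types (T u Z z tau : C) (g w : C -> R -> C) (S : set C).

Lemma ler_wt (mu x : R) : 0 < mu -> 0 <= x -> 1 <= (1 + x) `^ mu.
Proof.
move=> mu0 x0; have x1 : 1 <= 1 + x by rewrite lerDl.
have h1 : 1 `^ mu = 1 :> R by rewrite powR1.
rewrite -[X in X <= _]h1.
by rewrite ge0_ler_powR ?nnegrE ?ler01 ?(ltW mu0)// (le_trans ler01)//.
Qed.

(** The weight (1 + |m|)^mu is at least 1 and is dropped: only the exponential decay is used in the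
    sequel. *)
Lemma E_norm_bound (beta mu K : R) (h : R -> C) : 0 < mu -> (E_norm beta mu h <= K%:E)%E ->
  forall m, normc (h m) <= K * expR (- (beta * `|m|)).
Proof.
move=> mu0 hK m.
have H : (1 + `|m|) `^ mu * expR (beta * `|m|) * normc (h m) <= K.
  rewrite -lee_fin; apply: le_trans hK; apply: ereal_sup_ubound; by exists m.
rewrite expRN ler_pdivlMr ?expR_gt0// mulrC; apply: le_trans H.
rewrite -mulrA ler_peMl ?mulr_ge0 ?expR_ge0 ?normc_ge0//.
exact: ler_wt.
Qed.

Lemma Exp_norm_bound S (rho nu beta mu K : R) (k : nat) w : 0 < mu ->
  (Exp_norm S rho nu beta mu k w <= K%:E)%E ->
  forall tau m, (S `|` cdisc rho) tau -> tau != 0 ->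
  normc (w tau m) <= K * normc tau * expR (nu * normc tau ^+ k) * expR (- (beta * `|m|)).
Proof.
move=> mu0 hK tau m St t0.
have H : (1 + `|m|) `^ mu * expR (beta * `|m|) * expR (- nu * normc tau ^+ k)
          * (normc tau)^-1 * normc (w tau m) <= K.
  rewrite -lee_fin; apply: le_trans hK; apply: ereal_sup_ubound; by exists tau, m.
have n0 := normc_gt0 t0.
have -> : K * normc tau * expR (nu * normc tau ^+ k) * expR (- (beta * `|m|)) =
  K / (expR (beta * `|m|) * expR (- nu * normc tau ^+ k) / normc tau).
  by rewrite expRN mulNr expRN; field; rewrite !gt_eqF ?expR_gt0.
rewrite ler_pdivlMr; last by rewrite divr_gt0// mulr_gt0 ?expR_gt0.
apply: le_trans H.
have -> : (1 + `|m|) `^ mu * expR (beta * `|m|) * expR (- nu * normc tau ^+ k) / normc tau * normc (w tau m)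
  = (1 + `|m|) `^ mu * (normc (w tau m) * (expR (beta * `|m|) * expR (- nu * normc tau ^+ k) / normc tau)).
  by ring.
rewrite ler_peMl ?ler_wt// mulr_ge0 ?normc_ge0// divr_ge0 ?normc_ge0//.
Qed.

Lemma continuous_within_comp (T U V : topologicalType) (D : set U) (f : U -> V) (q : T -> U) :
  (forall x, D (q x)) -> continuous q -> {within D, continuous f} -> continuous (fun x => f (q x)).
Proof.
move=> Dq cq /subspace_continuousP cf x.
apply: (@cvg_comp _ _ _ q f _ (within D (nbhs (q x)))); last exact: cf.
move=> A hA; have := cq x _ hA; rewrite /nbhs /= => hB.
by apply: filterS hB => y; apply; exact: Dq.
Qed.

Lemma continuous_polar_abs (xi : R) : continuous (fun s : R => polar `|s| xi : C).
Proof.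
move=> s; apply: (@cvg_comp _ _ _ (fun s : R => `|s|) (fun s : R => polar s xi) _ (nbhs `|s|)).
  exact: norm_continuous.
exact: continuous_polar1.
Qed.

(** Along s |-> polar |s| xi the points lie in S for s != 0 and in the closed disc at s = 0, so the
    continuity built into the space gives continuity in s and in m. *)
Lemma Exp_space_measC S (rho nu beta mu : R) (k : nat) w (xi : R) : 0 < rho ->
  (forall s, 0 < s -> S (polar s xi)) -> Exp_space S rho nu beta mu k w ->
  measC [set: R * R] (fun z : R * R => w (polar `|z.2| xi) z.1).
Proof.
move=> rho0 Sp [cw _ _].
have D (s : R) : (S `|` cdisc rho) (polar `|s| xi).
  have [s0|s0] := eqVneq s 0; last by left; apply: Sp; rewrite normr_gt0.
  have -> : polar `|s| xi = 0 :> C by rewrite s0 normr0 /polar mul0r.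
  by right; rewrite /cdisc /= [X in X <= _]normc0 ltW.
apply: (measC_caratheodory (h := fun m s => w (polar `|s| xi) m)) => [s|m].
  apply: (@continuous_within_comp _ _ _ _ (fun x : C * R => w x.1 x.2) (fun m => (polar `|s| xi, m)) _ _ cw).
    by move=> m; split; [exact: D|].
  move=> m; suff : (fun m : R => (polar `|s| xi, m)) @ m --> (polar `|s| xi, m) by [].
  exact: (@cvg_pair R C R (nbhs m) (nbhs (polar `|s| xi)) (nbhs m) _ _ _ (fun=> polar `|s| xi) (fun m => m) (cvg_cst _) cvg_id).
apply: continuous_measC.
apply: (@continuous_within_comp _ _ _ _ (fun x : C * R => w x.1 x.2) (fun s : R => (polar `|s| xi, m)) _ _ cw).
  by move=> s; split; [exact: D|].
move=> s; suff : (fun s : R => (polar `|s| xi : C, m)) @ s --> (polar `|s| xi : C, m) by [].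
exact: (@cvg_pair R C R (nbhs s) (nbhs (polar `|s| xi)) (nbhs m) _ _ _ (fun s : R => polar `|s| xi) (fun=> m) (@continuous_polar_abs xi s) (cvg_cst _)).
Qed.

Lemma Exp_ball_admg (d a rho nu beta mu K : R) (k : nat) w :
  0 < mu -> 0 <= K -> 0 <= nu -> 0 < rho ->
  Exp_ball (sector d a +oo) rho nu beta mu k K w ->
  admg (sector d a +oo) k K nu beta w.
Proof.
move=> mu0 K0 nu0 rho0 [sw bw]; have [_ hw _] := sw; split=> //.
- by move=> m tau St; apply: hw; left.
- by move=> tau m St t0; apply: Exp_norm_bound bw _ _ _ _ => //; left.
- move=> xi Sx; apply: Exp_space_measC sw => // s s0.
  exact: sector_unbounded_polar.
Qed.

(** Psi is continuous in tau and in m separately, so joint measurability comes from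
    [measC_caratheodory]. Being entire, it is admissible on the whole plane. *)
Lemma psi_admg (p : problem R) (Cpsi nu beta mu : R) (k' : nat) (eps : C) :
  0 < mu -> 0 <= Cpsi -> 0 <= nu ->
  (forall m : R, holomorphic_on [set: C] (fun tau : C => psi p tau m eps)) ->
  (forall tau : C, continuous (fun m : R => psi p tau m eps)) ->
  (forall tau m, normc (psi p tau m eps) <=
       Cpsi * (1 + `|m|) `^ (- mu) * expR (- beta * `|m|)
       * expR (nu * normc tau ^+ k') * normc tau) ->
  admg setT k' Cpsi nu beta (fun tau m => psi p tau m eps).
Proof.
move=> mu0 K0 nu0 dp cp bp; split; [exact: K0|exact: nu0| | |].
- by move=> m tau _; exact: (dp m tau I).
- move=> tau m _ _; apply: le_trans (bp tau m) _.
  have h : (1 + `|m|) `^ (- mu) <= 1.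
    by rewrite powRN invf_le1 ?ler_wt// (lt_le_trans ltr01)// ler_wt.
  rewrite mulNr.
  have -> : Cpsi * (1 + `|m|) `^ (- mu) * expR (- (beta * `|m|)) * expR (nu * normc tau ^+ k') * normc tau
    = (1 + `|m|) `^ (- mu) * (Cpsi * normc tau * expR (nu * normc tau ^+ k') * expR (- (beta * `|m|))) by ring.
  by rewrite ler_piMl// !mulr_ge0 ?expR_ge0 ?normc_ge0.
- move=> xi _; apply: (measC_caratheodory (h := fun m s => psi p (polar `|s| xi) m eps)) => [s|m].
    exact: cp.
  apply: continuous_measC => s.
  apply: (@cvg_comp _ _ _ (fun s : R => polar `|s| xi) (fun tau => psi p tau m eps) _ (nbhs (polar `|s| xi))).
    exact: continuous_polar_abs.
  exact: (differentiable_continuous (dp m (polar `|s| xi) I)).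
Qed.

(** On the sector a root would be at distance 0 from itself, against suitability. On the closed
    disc, whose boundary suitability leaves out, the bound 2 rho <= |q| excludes roots. *)
Lemma Pm_neq0 (p : problem R) (U S : set C) (rho : R) : 0 < rho -> suitable p U rho S ->
  (forall (m : R) q, root (Pm p m) q -> 2 * rho <= normc q) ->
  forall m tau, (S `|` cdisc rho) tau -> (Pm p m).[tau] != 0.
Proof.
move=> rho0 [_ [mm mm0 H]] hr m tau St; apply/negP => /eqP P0.
have rt : root (Pm p m) tau by apply/rootP.
case: St => [St|]; last first.
  rewrite /cdisc /= => tr; have := le_trans (hr m tau rt) tr.
  by rewrite mulr_natl mulr2n -subr_ge0 opprD addrA subrr sub0r oppr_ge0 leNgt rho0.
have := H m tau tau rt (or_introl St); rewrite subrr normc0 leNgt.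
by rewrite mulr_gt0// ltr_pwDl// normc_ge0.
Qed.

(** Multiplying the fixed-point equation by the nonzero P_m(tau) and moving the term of degree
    [Npow p] to the other side gives the Borel image of (E). *)
Lemma hfix_eq (p : problem R) (S : set C) (rho nu beta mu varpi : R) (k : nat) (eps : C) w tau m :
  is_Hfixpoint p S rho nu beta mu k varpi eps w -> (S `|` cdisc rho) tau ->
  (Pm p m).[tau] != 0 ->
  (Q p).['i%C * m%:C] * w tau m =
  (k1 p)%:R ^+ dl1 p (D1 p) * (k2 p)%:R ^+ dl2 p (D2 p) * (Rl p (D1 p) (D2 p)).['i%C * m%:C]
    * tau ^+ Npow p * w tau m
  + (\sum_(1 <= l1 < D1 p) \sum_(1 <= l2 < D2 p)
       eps ^+ (Dl p l1 l2 - lam1 p * k1 p * dl1 p l1 - lam2 p * k2 p * dl2 p l2)%N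
       * ((k1 p)%:R * tau ^+ k1 p) ^+ dl1 p l1
       * ((k2 p)%:R * tau ^+ k2 p) ^+ dl2 p l2
       * (fourier_cst R * Cintegral setT (fun m1 : R =>
            Cl p l1 l2 (m - m1) eps * (Rl p l1 l2).['i * m1%:C] * w tau m1))
     + psi p tau m eps).
Proof.
move=> [_ fx] St P0; set X := (_ + psi _ _ _ _).
have E : w tau m = ((Pm p m).[tau])^-1 * X by rewrite -(fx tau m St).
have PE : (Pm p m).[tau] = (Q p).['i%C * m%:C] -
  (k1 p)%:R ^+ dl1 p (D1 p) * (k2 p)%:R ^+ dl2 p (D2 p) * (Rl p (D1 p) (D2 p)).['i%C * m%:C] * tau ^+ Npow p.
  by rewrite /Pm !hornerE.
have -> : (Q p).['i%C * m%:C] = (Pm p m).[tau] +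
  (k1 p)%:R ^+ dl1 p (D1 p) * (k2 p)%:R ^+ dl2 p (D2 p) * (Rl p (D1 p) (D2 p)).['i%C * m%:C] * tau ^+ Npow p.
  by rewrite PE subrK.
rewrite mulrDl addrC; congr (_ + _).
by rewrite E mulrA mulfV// mul1r.
Qed.

End SpaceBounds.

(** * Convolution in m as multiplication by a Fourier integral *)

Section Convolution.
Variable R : realType.
Local Notation C := (Cx R).
Local Notation mu := (@lebesgue_measure R).
Implicit Types (T u Z z tau : C) (g w : C -> R -> C) (S : set C).

Lemma lint_Z p g T1 T2 Z (m : R) u :
  lint p g T1 T2 Z m u = lint p g T1 T2 0 m u * cexp ('i%C * Z * m%:C).
Proof.
rewrite /lint; have -> : 'i%C * 0 * m%:C = 0 :> C by rewrite mulr0 mul0r.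
by rewrite cexp0 mulr1 mulrAC.
Qed.

Lemma ray_lint_Z p g T1 T2 Z (m xi : R) : ray_integrable xi (lint p g T1 T2 0 m) ->
  ray_integral xi (lint p g T1 T2 Z m) =
  ray_integral xi (lint p g T1 T2 0 m) * cexp ('i%C * Z * m%:C).
Proof.
move=> ig; rewrite /ray_integral -CintegralZr; [|exact: measurable_itv|exact: ig].
by apply: eq_Cintegral => s _; rewrite /ray_integrand lint_Z mulrAC.
Qed.

Lemma expR_shift (b x y : R) : 0 <= b ->
  expR (- (b * `|x - y|)) <= expR (- (b * `|x|)) * expR (b * `|y|).
Proof.
move=> b0; rewrite -expRD ler_expR.
have : `|x| <= `|x - y| + `|y| by rewrite -{1}(subrK y x) ler_normD.
by move=> /(ler_wpM2l b0); rewrite mulrDr; clear; lra.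
Qed.

Lemma measC_diff (h : R -> C) : measC [set: R] h ->
  measC [set: R * R] (fun z : R * R => h (z.1 - z.2)).
Proof.
move=> mh; apply: (measC_comp (p := fun z : R * R => z.1 - z.2)); first exact: mh.
by apply: measurable_funB; [exact: measurable_fst|exact: measurable_snd].
Qed.

Lemma measC_cexp_i Z : measC [set: R] (fun m : R => cexp ('i%C * Z * m%:C)).
Proof.
apply: measC_cexp; apply: measCM; first exact: measC_cst.
exact: measC_real.
Qed.

Lemma continuous_cexp_i Z : continuous (fun m : R => cexp ('i%C * Z * m%:C)).
Proof.
move=> m; have c1 : {for m, continuous (fun m : R => 'i%C * Z * m%:C : C)}.
  apply: contC_M; first exact: contC_cst.
  by apply: cvgC_real; exact: cvg_id.
have c2 : {for 'i%C * Z * m%:C : C, continuous (@cexp R)}.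
  exact: (differentiable_continuous (diff_cexp _).1).
exact: (@continuous_comp _ _ _ (fun m : R => 'i%C * Z * m%:C : C) (@cexp R) m c1 c2).
Qed.

Lemma fourier_shift (h : R -> C) (b B K m1 : R) Z : 0 < b -> B < b -> `|complex.Im Z| <= B ->
  continuous h -> (forall m, normc (h m) <= K * expR (- (b * `|m|))) ->
  Cintegral [set: R] (fun m => h (m - m1) * cexp ('i%C * Z * m%:C)) =
  Cintegral [set: R] (fun m => h m * cexp ('i%C * Z * m%:C)) * cexp ('i%C * Z * m1%:C) /\
  Cintegrable [set: R] (fun m => h (m - m1) * cexp ('i%C * Z * m%:C)).
Proof.
move=> b0 Bb ZB ch hK.
pose f (y m : R) := h (m - y) * cexp ('i%C * Z * m%:C).
have K0 : 0 <= K.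
  have := hK 0; rewrite normr0 mulr0 oppr0 expR0 mulr1; apply: le_trans; exact: normc_ge0.
have fi y : Cintegrable [set: R] (f y).
  apply: (@Cintegrable_dom _ _ _ (fun m => K * expR (b * `|y|) * expR (- ((b - B) * `|m|)))).
  - exact: measurableT.
  - apply: measCM; last exact: measC_cexp_i.
    apply: continuous_measC => m.
    apply: (@cvg_comp _ _ _ (fun m : R => m - y) h _ (nbhs (m - y))); last exact: ch.
    by apply: cvgB; [exact: cvg_id|exact: cvg_cst].
  - by apply: RintegrableZ => //; apply: integrable_exp_abs; rewrite subr_gt0.
  - move=> m _; rewrite /f normcM.
    have h1 := le_trans (hK (m - y)) (ler_wpM2l K0 (expR_shift m y (ltW b0))).
    have h2 := normc_cexp_strip m ZB.
    apply: le_trans (ler_pM (normc_ge0 _) (normc_ge0 _) h1 h2) _.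
    have -> : - ((b - B) * `|m|) = - (b * `|m|) + B * `|m| by ring.
    by rewrite expRD le_eqVlt; apply/orP; left; apply/eqP; ring.
have i0 : Cintegrable [set: R] (fun m => h m * cexp ('i%C * Z * m%:C)).
  by apply: (eq_Cintegrable _ _ (fi 0)) => // m _; rewrite /f subr0.
split; last exact: fi.
have cf : continuous (f m1).
  move=> m; apply: cvgC_M; last exact: continuous_cexp_i.
  apply: (@cvg_comp _ _ _ (fun m : R => m - m1) h _ (nbhs (m - m1))); last exact: ch.
  by apply: cvgB; [exact: cvg_id|exact: cvg_cst].
have := @Cintegral_affine R (f m1) 1 m1 ltr01 cf (fi m1); rewrite mul1r => ->.
rewrite -CintegralZr//; apply: eq_Cintegral => m _.
by rewrite /f mul1r addrK rmorphD mulrDr cexpD mulrA.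
Qed.

(** Two exchanges of integrals. For fixed m, the convolution is moved out of the ray integral,
    leaving the convolution of [h] with the ray integrals [KK]. Then the integrals in m and m1 are
    exchanged, and the translation m = m' + m1 splits exp (i Z m) into two factors. *)
Lemma conv_Lap p S (w : R) (k' : nat) (A nu b B c K xi : R) g (h : R -> C) T1 T2 Z :
  (k' < k2 p)%N -> (1 < k2 p)%N -> 0 < c -> 0 <= B -> B < b -> admg S k' A nu b g ->
  0 < w -> arcdom S w -> S (expi xi) -> kernel_ok p c T1 T2 xi -> `|complex.Im Z| <= B ->
  continuous h -> (forall m, normc (h m) <= K * expR (- (b * `|m|))) ->
  LapOk p (fun tau m => Cintegral [set: R] (fun m1 => h (m - m1) * g tau m1)) xi T1 T2 Z /\
  Lap p (fun tau m => Cintegral [set: R] (fun m1 => h (m - m1) * g tau m1)) xi T1 T2 Z =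
  Cintegral [set: R] (fun m => h m * cexp ('i%C * Z * m%:C)) * Lap p g xi T1 T2 Z.
Proof.
move=> kk k21 c0 B0 Bb ag w0 aS Sx ko ZB ch hK.
have b0 : 0 < b by exact: le_lt_trans Bb.
have K0 : 0 <= K.
  have := hK 0; rewrite normr0 mulr0 oppr0 expR0 mulr1; apply: le_trans; exact: normc_ge0.
(* Working at Z = 0 keeps the full rate [b] for the ray integrals; the factor exp (i Z m) does not
   depend on u and is restored afterwards. *)
have [A0 A00 H] := lint_decay 0 kk k21 c0 ag.
have Sp s : 0 < s -> S (polar s xi) by exact: (arcdom_polar w0 aS Sx).
have [_ _ dg bg mg] := ag; have [T10 T20 _ _] := ko.
have Hb s m : 0 <= s -> normc (lint p g T1 T2 0 m (polar s xi)) <= A0 * expR (- (b * `|m|)) * expR (- s).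
  move=> s0; have := H xi T1 T2 0 ko Sp _ s m s0; rewrite subr0; apply.
  by rewrite /= normr0.
have dl s m : 0 < s -> differentiable (lint p g T1 T2 0 m) (polar s xi).
  move=> s0; apply: differentiable_lint_u; [exact: T10|exact: T20|exact: polar_neq0|].
  by apply: dg; exact: Sp.
have [[l1 l2] lK _] := @LapOk_bound R p g xi A0 b T1 T2 0 b0 dl (mg xi Sx) Hb.
pose k (m1 s : R) := lint p g T1 T2 0 m1 (polar `|s| xi) * expi xi.
pose KK m1 := ray_integral xi (lint p g T1 T2 0 m1).
have D s : `[(0 : R), +oo[%classic s -> 0 <= s by rewrite /= in_itv/= andbT.
have mh : measC [set: R] h by exact: continuous_measC.
have hK' m : normc (h m) <= K.
  apply: le_trans (hK m) _; rewrite ler_piMr// -expR0 ler_expR oppr_le0 mulr_ge0//.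
  exact: ltW.
have mk : measC [set: R * R] (fun z : R * R => k z.1 z.2).
  by apply: measCM; [exact: measC_lint (mg xi Sx)|exact: measC_cst].
have kb m1 s : 0 <= s -> normc (k m1 s) <= A0 * expR (- (b * `|m1|)) * expR (- s).
  by move=> s0; rewrite /k normcM normc_expi mulr1 (ger0_norm s0); exact: Hb.
have kE m1 : Cintegral `[0, +oo[ (k m1) = KK m1.
  by apply: eq_Cintegral => s /D s0; rewrite /k (ger0_norm s0).
have ki m1 : Cintegrable `[0, +oo[ (k m1).
  apply: (eq_Cintegrable _ _ (l1 m1)) => [|s /D s0]; first exact: measurable_itv.
  by rewrite /k (ger0_norm s0).
(* First exchange, between m1 and the radius s, at fixed m. *)
have S1 m : Cintegrable `[0, +oo[ (fun s => Cintegral [set: R] (fun m1 => h (m - m1) * k m1 s)) /\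
  Cintegral `[0, +oo[ (fun s => Cintegral [set: R] (fun m1 => h (m - m1) * k m1 s)) =
  Cintegral [set: R] (fun m1 => h (m - m1) * KK m1).
  have [||||||_ f2 f3] := @CfubiniD R (fun m1 s => h (m - m1) * k m1 s) `[0, +oo[
    (fun m1 => K * A0 * expR (- (b * `|m1|))) (fun s => expR (- (1 * s))) (measurable_itv _).
  - apply: measCM mk; apply: (measC_comp (p := fun z : R * R => m - z.1)); first exact: mh.
    by apply: measurable_funB; [exact: measurable_cst|exact: measurable_fst].
  - by apply: RintegrableZ => //; exact: integrable_exp_abs.
  - exact: integrable_exp_tail.
  - by move=> x; rewrite !mulr_ge0 ?expR_ge0.
  - by move=> y _; exact: expR_ge0.
  - move=> x y /D y0; rewrite normcM mul1r -2!mulrA; apply: ler_pM; rewrite ?normc_ge0//.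
    by rewrite mulrA; exact: kb.
  split; first exact: f2.
  rewrite -f3; apply: eq_Cintegral => m1 _.
  by rewrite CintegralZ ?kE.
pose conv := (fun tau (m : R) => Cintegral [set: R] (fun m1 => h (m - m1) * g tau m1)).
have mg1 s : 0 < s -> measC [set: R] (fun m1 : R => g (polar s xi) m1).
  move=> s0; have := measC_comp (p := fun m1 : R => (m1, s)) (mg xi Sx).
  rewrite /= gtr0_norm//; apply.
  by apply: measurable_fun_pair; [exact: measurable_id|exact: measurable_cst].
have gi m s : 0 < s -> Cintegrable [set: R] (fun m1 => h (m - m1) * g (polar s xi) m1).
  move=> s0.
  apply: (@Cintegrable_dom _ _ _ (fun m1 => K * (A * s * expR (nu * s ^+ k')) * expR (- (b * `|m1|)))).
  - exact: measurableT.
  - apply: measCM; last exact: mg1.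
    apply: (measC_comp (p := fun m1 : R => m - m1)); first exact: mh.
    by apply: measurable_funB; [exact: measurable_cst|exact: measurable_id].
  - by apply: RintegrableZ => //; exact: integrable_exp_abs.
  - move=> m1 _; rewrite normcM -mulrA; apply: ler_pM; rewrite ?normc_ge0//.
    by have := bg (polar s xi) m1 (Sp s s0) (polar_neq0 _ s0); rewrite (normc_polar _ (ltW s0)).
have cE m s : 0 <= s -> ray_integrand xi (lint p conv T1 T2 Z m) s =
   Cintegral [set: R] (fun m1 => h (m - m1) * k m1 s) * cexp ('i%C * Z * m%:C).
  rewrite le_eqVlt => /predU1P[<-|s0].
    have -> : (fun m1 => h (m - m1) * k m1 0) = (fun=> 0 * 0).
      by apply/funext => m1; rewrite /k normr0 /polar mul0r /lint invr0 !(mulr0, mul0r).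
    have -> : Cintegral [set: R] (fun=> 0 * 0 : C) = 0.
      by rewrite (@CintegralZ R [set: R] (fun=> 0) 0 measurableT) ?mul0r//; split; exact: integrable0.
    rewrite /ray_integrand; have -> : (0 : R)%:C * expi xi = 0 :> C by rewrite mul0r.
    by rewrite /lint invr0 mulr0 !mul0r.
  rewrite /ray_integrand -[_%:C * _]/(polar s xi) lint_Z.
  have E m1 : h (m - m1) * k m1 s = h (m - m1) * g (polar s xi) m1 *
     (expkernel p T1 T2 (polar s xi) / polar s xi * expi xi).
    rewrite /k (gtr0_norm s0) /lint; have -> : 'i%C * 0 * m1%:C = 0 :> C by rewrite mulr0 mul0r.
    by rewrite cexp0 mulr1 !mulrA.
  rewrite (funext E) CintegralZr//; last exact: gi.
  rewrite /lint; have -> : 'i%C * 0 * m%:C = 0 :> C by rewrite mulr0 mul0r.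
  rewrite cexp0 mulr1 /conv; move: (Cintegral _ _) (cexp _) (expkernel _ _ _ _) (expi _) (_^-1) => x1 x2 x3 x4 x5.
  by ring.
have cR m : ray_integral xi (lint p conv T1 T2 Z m) =
   Cintegral [set: R] (fun m1 => h (m - m1) * KK m1) * cexp ('i%C * Z * m%:C).
  have [s1 s2] := S1 m.
  rewrite -s2 -CintegralZr; [|exact: measurable_itv|exact: s1].
  by apply: eq_Cintegral => s /D s0; rewrite cE.
have cI m : ray_integrable xi (lint p conv T1 T2 Z m).
  have [s1 s2] := S1 m.
  apply: (eq_Cintegrable _ _ (CintegrableZr (cexp ('i%C * Z * m%:C)) (measurable_itv _) s1)).
    exact: measurable_itv.
  by move=> s /D s0; rewrite cE.
have mKK : measC [set: R] KK by exact: Cintegrable_measC.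
have iKK m : Cintegrable [set: R] (fun m1 => h (m - m1) * KK m1).
  apply: (@Cintegrable_dom _ _ _ (fun m1 => K * (2 * A0) * expR (- (b * `|m1|)))).
  - exact: measurableT.
  - apply: measCM; last exact: mKK.
    apply: (measC_comp (p := fun m1 : R => m - m1)); first exact: mh.
    by apply: measurable_funB; [exact: measurable_cst|exact: measurable_id].
  - by apply: RintegrableZ => //; exact: integrable_exp_abs.
  - by move=> m1 _; rewrite normcM -mulrA; apply: ler_pM; rewrite ?normc_ge0//; exact: lK.
(* The rate [b] is shared between the two variables: in the second exchange, m keeps b' - B after
   the loss due to exp (i Z m), and m1 keeps b - b'. *)
have [b' Bb' bb'] := exists_between Bb.
have b'0 : 0 <= b' by exact: le_trans (ltW Bb').
pose f (m m1 : R) := h (m - m1) * KK m1 * cexp ('i%C * Z * m%:C).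
have [||||||f1 f2 f3] := @Cfubini R f (fun m => K * (2 * A0) * expR (- ((b' - B) * `|m|)))
   (fun m1 => expR (- ((b - b') * `|m1|))).
- apply: measCM.
    apply: measCM; first exact: measC_diff.
    exact: (measC_comp (p := snd) mKK measurable_snd).
  exact: (measC_comp (p := fst) (measC_cexp_i Z) measurable_fst).
- by apply: RintegrableZ => //; apply: integrable_exp_abs; rewrite subr_gt0.
- by apply: integrable_exp_abs; rewrite subr_gt0.
- by move=> x; rewrite !mulr_ge0 ?expR_ge0.
- by move=> x; exact: expR_ge0.
- move=> m m1; rewrite /f 2!normcM.
  have h1 : normc (h (m - m1)) <= K * (expR (- (b' * `|m|)) * expR (b' * `|m1|)).
    apply: le_trans (hK _) _; apply: ler_wpM2l => //.
    apply: le_trans (expR_shift m m1 b'0).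
    by rewrite ler_expR lerN2; apply: ler_wpM2r => //; exact: ltW.
  have h2 := lK m1; have h3 := normc_cexp_strip m ZB.
  apply: le_trans (ler_pM _ (normc_ge0 _) (ler_pM (normc_ge0 _) (normc_ge0 _) h1 h2) h3) _.
    by rewrite mulr_ge0 ?normc_ge0.
  have -> : - ((b' - B) * `|m|) = - (b' * `|m|) + B * `|m| by ring.
  have -> : - ((b - b') * `|m1|) = - (b * `|m1|) + b' * `|m1| by ring.
  by rewrite !expRD le_eqVlt; apply/orP; left; apply/eqP; ring.
have fE m : Cintegral [set: R] (f m) = ray_integral xi (lint p conv T1 T2 Z m).
  by rewrite cR -CintegralZr.
split; first split.
- exact: cI.
- by apply: (eq_Cintegrable _ _ f1) => // m _; rewrite fE.
- have -> : Lap p conv xi T1 T2 Z = Cintegral [set: R] (fun m => Cintegral [set: R] (f m)).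
    by apply: eq_Cintegral => m _; rewrite fE.
  rewrite f3.
  have -> : Lap p g xi T1 T2 Z = Cintegral [set: R] (fun m1 => KK m1 * cexp ('i%C * Z * m1%:C)).
    by apply: eq_Cintegral => m1 _; rewrite (ray_lint_Z _ (l1 m1)).
  rewrite -CintegralZ; [|exact: measurableT|]; last first.
    apply: (@Cintegrable_dom _ _ _ (fun m1 => 2 * A0 * expR (- ((b - B) * `|m1|)))).
    - exact: measurableT.
    - by apply: measCM; [exact: mKK|exact: measC_cexp_i].
    - apply: RintegrableZ; first exact: measurableT.
      by apply: integrable_exp_abs; rewrite subr_gt0; exact: Bb.
    - move=> m1 _.
      have h1 := ler_pM (normc_ge0 _) (normc_ge0 _) (lK m1) (normc_cexp_strip m1 ZB).
      rewrite -[X in X <= _]normcM in h1.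
      apply: le_trans h1 _.
      have -> : - ((b - B) * `|m1|) = - (b * `|m1|) + B * `|m1| by ring.
      by rewrite expRD mulrA.
  apply: eq_Cintegral => m1 _.
  have [sh ish] := fourier_shift m1 b0 Bb ZB ch hK.
  rewrite [in RHS]mulrCA -sh.
  have -> : (f^~ m1) = (fun m => KK m1 * (h (m - m1) * cexp ('i%C * Z * m%:C))).
    by apply/funext => m; rewrite /f; move: (cexp _) => q; ring.
  by rewrite CintegralZ.
Qed.

End Convolution.

(** * The outer solutions satisfy the equation *)

Section OuterEquation.
Variable R : realType.
Local Notation C := (Cx R).
Implicit Types (T u Z z tau : C) (g w : C -> R -> C) (S : set C).

(** The direction hidden in the definition of the forcing term and the given [xi] are compared with
    their common margin; psi is admissible on the whole plane, so the sector imposes no constraint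
    on the rotation. *)
Lemma forcing_Lap (p : problem R) (k' : nat) (A nu b delta : R) (xi : R) (t1 t2 z eps : C) :
  (1 <= k1 p)%N -> (k' < k2 p)%N -> (1 < k2 p)%N -> 0 < b ->
  admg setT k' A nu b (fun tau m => psi p tau m eps) -> 0 < delta ->
  eps ^+ lam1 p * t1 != 0 -> eps ^+ lam2 p * t2 != 0 ->
  decay_direction p delta (eps ^+ lam1 p * t1) (eps ^+ lam2 p * t2) xi ->
  forcing p t1 t2 z eps = fourier_cst R *
    Lap p (fun tau m => psi p tau m eps) xi (eps ^+ lam1 p * t1) (eps ^+ lam2 p * t2) z.
Proof.
move=> k11 kk k21 b0 ag d0 T10 T20 dx.
set X1 := eps ^+ lam1 p * t1 in T10 dx *; set X2 := eps ^+ lam2 p * t2 in T20 dx *.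
pose gam := forcing_direction p X1 X2.
(* The set from which the direction is chosen is not empty, as it contains [xi], so the default
   value 0 of [xget] is not what is returned. *)
have dg0 : decay_direction p 0 X1 X2 gam.
  by apply: (xgetPex 0); exists xi; exact: decayW (ltW d0) dx.
have [d1 d10 dg1] := decay_open dg0.
have d2 : 0 < Num.min delta d1 by rewrite lt_min d0.
have dx' : decay_direction p (Num.min delta d1) X1 X2 xi.
  by apply: decayW dx; rewrite ge_min lexx.
have dg' : decay_direction p (Num.min delta d1) X1 X2 gam.
  by apply: decayW dg1; rewrite ge_min lexx orbT.
have aT : arcdom [set: C] (pi / (k2 p)%:R) by [].
rewrite (@Lap_indepE R p [set: C] k' A nu b _ _ gam _ _ _ _ k11 kk k21 d2 ag aT I I T10 T20 dx' dg').
have [ko c0] := decay_kernel_ok d2 T10 T20 (lexx (normc X2)) dg'.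
have w0 : 0 < pi / (k2 p)%:R :> R.
  by rewrite divr_gt0 ?pi_gt0// ltr0n; apply: leq_trans k21.
have Z0 : `|complex.Im (0 : C)| <= 0 by rewrite /= normr0.
have [ig _] := @admg_LapOk R p [set: C] _ k' A nu b _ 0 gam _ X1 X2 0 kk k21 c0 b0 ag w0 aT I ko Z0.
congr (_ * _); apply: eq_Cintegral => m _.
rewrite (ray_lint_Z _ (ig m)); congr (_ * _).
apply: eq_Cintegral => s _; rewrite /ray_integrand /lint.
have -> : 'i%C * 0 * m%:C = 0 :> C by rewrite mulr0 mul0r.
by rewrite cexp0 mulr1.
Qed.

Lemma admg_conv_int S (k' : nat) (A nu b K xi s m : R) g (h : R -> C) : 0 < b ->
  admg S k' A nu b g -> S (expi xi) -> S (polar s xi) -> 0 < s ->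
  continuous h -> (forall m, normc (h m) <= K) ->
  Cintegrable [set: R] (fun m1 => h (m - m1) * g (polar s xi) m1).
Proof.
move=> b0 [_ _ dg bg mg] Sx Sp s0 ch hK.
apply: (@Cintegrable_dom _ _ _ (fun m1 => K * (A * s * expR (nu * s ^+ k')) * expR (- (b * `|m1|)))).
- exact: measurableT.
- apply: measCM.
    apply: (measC_comp (p := fun m1 : R => m - m1)); first exact: continuous_measC.
    by apply: measurable_funB; [exact: measurable_cst|exact: measurable_id].
  have := measC_comp (p := fun m1 : R => (m1, s)) (mg xi Sx).
  rewrite /= gtr0_norm//; apply.
  by apply: measurable_fun_pair; [exact: measurable_id|exact: measurable_cst].
- by apply: RintegrableZ; [exact: measurableT|exact: integrable_exp_abs].
- move=> m1 _; rewrite normcM -mulrA; apply: ler_pM; rewrite ?normc_ge0//.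
  by have := bg (polar s xi) m1 Sp (polar_neq0 _ s0); rewrite (normc_polar _ (ltW s0)).
Qed.

(** Applying t_j^(k_j + 1) d/dt_j to a function of eps^(lam_j) t_j brings out (eps^(lam_j))^(-k_j).
    [n] is the excess of the exponent Delta over what these negative powers consume. *)
Lemma eps_pow_cancel (eps : C) (l1 l2 k1 k2 d1 d2 n : nat) : eps != 0 ->
  eps ^+ (l1 * k1 * d1 + l2 * k2 * d2 + n) *
  ((eps ^+ l1)^-1 ^+ (k1 * d1) * (eps ^+ l2)^-1 ^+ (k2 * d2)) = eps ^+ n.
Proof.
move=> e0; rewrite !exprVn -!exprM !mulnA exprD [in X in X * _]exprD.
have h1 := expf_neq0 (l1 * k1 * d1) e0; have h2 := expf_neq0 (l2 * k2 * d2) e0.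
move: (eps ^+ (l1 * k1 * d1)) (eps ^+ (l2 * k2 * d2)) (eps ^+ n) h1 h2 => a b c a0 b0.
by field; rewrite a0 b0.
Qed.

(** Recording the range as a condition makes the bounds on the index available when terms are
    treated one by one. *)
Lemma sum_nat_cond (m n : nat) (F : nat -> C) :
  \sum_(m <= i < n) F i = \sum_(m <= i < n | (m <= i < n)%N) F i.
Proof. exact: big_nat. Qed.

(** At fixed eps and a fixed point, every term of the equation is turned into a transform [Lap] at
    the same point and along the same direction; the equation then reduces to [hfix_eq] under the
    integral. *)
Lemma outer_pde (p : problem R) S (k' : nat) (T1s T2s : set C) (eps : C) (delta B a rho nu beta mu varpi Cpsi : R)
    (Cb : nat -> nat -> R) (xi : C -> C -> R) w (u : Cfun4 R) :
  (1 <= k1 p)%N -> (k' < k2 p)%N -> (1 < k2 p)%N -> (0 < k')%N -> 0 < delta ->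
  arcdom S (pi / (k2 p)%:R) ->
  (forall t, T1s t -> exists2 r : R, 0 < r & forall t', normc (t' - t) < r -> T1s t') ->
  (forall t, T2s t -> exists2 r : R, 0 < r & forall t', normc (t' - t) < r -> T2s t') ->
  (forall t, T1s t -> t != 0) -> (forall t, T2s t -> t != 0) -> eps != 0 ->
  (forall t, T2s t -> normc (eps ^+ lam2 p * t) <= a) ->
  (forall t1 t2, T1s t1 -> T2s t2 -> S (expi (xi t1 t2)) /\
     decay_direction p delta (eps ^+ lam1 p * t1) (eps ^+ lam2 p * t2) (xi t1 t2)) ->
  Dl p (D1 p) (D2 p) = (lam1 p * k1 p * dl1 p (D1 p) + lam2 p * k2 p * dl2 p (D2 p))%N ->
  (forall l1 l2 : nat, (1 <= l1 < D1 p)%N -> (1 <= l2 < D2 p)%N ->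
     (lam1 p * k1 p * dl1 p l1 + lam2 p * k2 p * dl2 p l2 <= Dl p l1 l2)%N) ->
  (forall l1 l2 : nat, (1 <= l1 < D1 p)%N -> (1 <= l2 < D2 p)%N ->
     continuous (fun m => Cl p l1 l2 m eps) /\
     forall m, normc (Cl p l1 l2 m eps) <= Cb l1 l2 * expR (- (beta * `|m|))) ->
  0 < B -> B < beta -> 
  admg setT k' Cpsi nu beta (fun tau m => psi p tau m eps) ->
  exadm S k' beta w ->
  is_Hfixpoint p S rho nu beta mu k' varpi eps w ->
  (forall m tau, S tau -> (Pm p m).[tau] != 0) ->
  rep p T1s T2s eps B xi (fun=> fourier_cst R) w u ->
  forall t1 t2 z, T1s t1 -> T2s t2 -> `|complex.Im z| < B -> solves_at p u t1 t2 z eps.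
Proof.
move=> k11 kk k21 k'0 d0 aS T1o T2o T1n T2n e0 T2b Hxi hD hDl hC B0 Bb apsi aw fw P0 hu t1 t2 z h1 h2 h3.
have w0 : 0 < pi / (k2 p)%:R :> R.
  by rewrite divr_gt0 ?pi_gt0// ltr0n; apply: leq_trans k21.
have b0 : 0 < beta by exact: lt_trans Bb.
(* The polynomials in i m consume beta - b1; all functions then share the rate b1, still larger than
   [B]. *)
have [b1 Bb1 b1b] := exists_between Bb.
have b10 : 0 < b1 by exact: lt_trans Bb1.
have [Sx dx] := Hxi t1 t2 h1 h2.
set X1 := eps ^+ lam1 p * t1 in dx; set X2 := eps ^+ lam2 p * t2 in dx; set x0 := xi t1 t2 in Sx dx.
have n1 : X1 != 0 by rewrite mulf_neq0 ?expf_neq0// T1n.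
have n2 : X2 != 0 by rewrite mulf_neq0 ?expf_neq0// T2n.
have [ko c0] := decay_kernel_ok d0 n1 n2 (T2b _ h2) dx.
set c := _ / _ in ko c0.
have Sp s : 0 < s -> S (polar s x0) by exact: (arcdom_polar w0 aS Sx).
have ZB : `|complex.Im z| <= B by exact: ltW.
have ok g : exadm S k' b1 g -> LapOk p g x0 X1 X2 z.
  by move=> [A [n ag]]; exact: (@admg_LapOk R p S _ k' A n b1 c B x0 g X1 X2 z kk k21 c0 Bb1 ag w0 aS Sx ko ZB).
have aP (P : {poly R[i]}) : exadm S k' b1 (fun u m => (P.['i%C * m%:C] : C) * w u m).
  exact: exadm_poly b1b aw.
have rP (P : {poly R[i]}) : rep p T1s T2s eps B xi (fun=> fourier_cst R)
   (fun u m => (P.['i%C * m%:C] : C) * w u m) (poly_dz P u).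
  exact: (poly_dz_rep k11 kk k21 d0 aS T1n T2n e0 T2b Hxi P Bb aw hu).
(* Borel image of P(d/dz) u after both iterated Euler operators, without the powers of eps, which
   are kept apart in [rG]. *)
pose G (l1 l2 : nat) (P : {poly R[i]}) := fun (u : C) (m : R) => ((k1 p)%:R * u ^+ k1 p) ^+ dl1 p l1 *
  (((k2 p)%:R * u ^+ k2 p) ^+ dl2 p l2 * ((P.['i%C * m%:C] : C) * w u m)).
have rG kappa l1 l2 (P : {poly R[i]}) (V : Cfun4 R) :
    rep p T1s T2s eps B xi kappa (fun u m => (P.['i%C * m%:C] : C) * w u m) V ->
    iter (dl1 p l1) (@euler1 R (k1 p)) (iter (dl2 p l2) (@euler2 R (k2 p)) V) t1 t2 z eps =
    kappa z * ((eps ^+ lam1 p)^-1 ^+ (k1 p * dl1 p l1) * (eps ^+ lam2 p)^-1 ^+ (k2 p * dl2 p l2)) *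
      Lap p (G l1 l2 P) x0 X1 X2 z /\ exadm S k' b1 (G l1 l2 P).
  move=> hV.
  have [r1 a1] := iter_euler2_rep k11 kk k21 k'0 d0 aS T2o T1n T2n e0 T2b Hxi (dl2 p l2) Bb1 (aP P) hV.
  have [r2 a2] := iter_euler1_rep k11 kk k21 k'0 d0 aS T1o T1n T2n e0 T2b Hxi (dl1 p l1) Bb1 a1 r1.
  split; last exact: a2.
  rewrite (r2 t1 t2 z h1 h2 h3) /LX; congr (_ * _).
  by rewrite -mulrA [in LHS](mulrC (_ ^+ (k2 p * _))).
pose HL l1 l2 := fun (tau : C) (m : R) => eps ^+ (Dl p l1 l2 - lam1 p * k1 p * dl1 p l1 - lam2 p * k2 p * dl2 p l2)%N
       * ((k1 p)%:R * tau ^+ k1 p) ^+ dl1 p l1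
       * ((k2 p)%:R * tau ^+ k2 p) ^+ dl2 p l2
       * (fourier_cst R * Cintegral setT (fun m1 : R =>
            Cl p l1 l2 (m - m1) eps * (Rl p l1 l2).['i%C * m1%:C] * w tau m1)).
(* The powers of tau in [HL] do not depend on m1, so they can be moved inside the convolution: [HL]
   is a multiple of the convolution of C_(l1 l2) with [G], and [conv_Lap] turns it into a
   multiplication by the coefficient. *)
have HLP l1 l2 : (1 <= l1 < D1 p)%N -> (1 <= l2 < D2 p)%N ->
  LapOk p (HL l1 l2) x0 X1 X2 z /\
  Lap p (HL l1 l2) x0 X1 X2 z =
   eps ^+ (Dl p l1 l2 - lam1 p * k1 p * dl1 p l1 - lam2 p * k2 p * dl2 p l2)%N *
   (ccoef p l1 l2 z eps * Lap p (G l1 l2 (Rl p l1 l2)) x0 X1 X2 z).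
  move=> hl1 hl2; have [cC bC] := hC l1 l2 hl1 hl2.
  have [_ [A [n aG]]] := rG _ l1 l2 _ _ (rP (Rl p l1 l2)).
  have [A' [n' aR]] := aP (Rl p l1 l2).
  have Cb0 : 0 <= Cb l1 l2.
    have := bC 0; rewrite normr0 mulr0 oppr0 expR0 mulr1; apply: le_trans; exact: normc_ge0.
  have bC1 m : normc (Cl p l1 l2 m eps) <= Cb l1 l2 * expR (- (b1 * `|m|)).
    apply: le_trans (bC m) _; apply: ler_wpM2l => //.
    by rewrite ler_expR lerN2; apply: ler_wpM2r => //; exact: ltW.
  have bC2 m : normc (Cl p l1 l2 m eps) <= Cb l1 l2.
    apply: le_trans (bC m) _; rewrite ler_piMr// -expR0 ler_expR oppr_le0 mulr_ge0//.
    exact: ltW.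
  have [c1 c2] := conv_Lap kk k21 c0 (ltW B0) Bb1 aG w0 aS Sx ko ZB cC bC1.
  have [s1 s2] := Lap_scale (eps ^+ (Dl p l1 l2 - lam1 p * k1 p * dl1 p l1 - lam2 p * k2 p * dl2 p l2)%N *
     fourier_cst R) c1.
  have E s m : 0 < s -> eps ^+ (Dl p l1 l2 - lam1 p * k1 p * dl1 p l1 - lam2 p * k2 p * dl2 p l2)%N *
     fourier_cst R * Cintegral [set: R] (fun m1 => Cl p l1 l2 (m - m1) eps * G l1 l2 (Rl p l1 l2) (polar s x0) m1)
     = HL l1 l2 (polar s x0) m.
    move=> s0; rewrite /HL.
    have E1 : (fun m1 : R => Cl p l1 l2 (m - m1) eps * (Rl p l1 l2).['i%C * m1%:C] * w (polar s x0) m1) =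
      (fun m1 : R => Cl p l1 l2 (m - m1) eps * ((Rl p l1 l2).['i%C * m1%:C] * w (polar s x0) m1)).
      by apply/funext => m1; exact: esym (mulrA _ _ _).
    have E2 : (fun m1 : R => Cl p l1 l2 (m - m1) eps * G l1 l2 (Rl p l1 l2) (polar s x0) m1) =
      (fun m1 : R => (((k1 p)%:R * polar s x0 ^+ k1 p) ^+ dl1 p l1 * ((k2 p)%:R * polar s x0 ^+ k2 p) ^+ dl2 p l2)
         * (Cl p l1 l2 (m - m1) eps * ((Rl p l1 l2).['i%C * m1%:C] * w (polar s x0) m1))).
      apply/funext => m1; rewrite /G; move: (Cl _ _ _ _ _) (_ * w _ _) (_ ^+ dl1 _ _) (_ ^+ dl2 _ _) => q1 q2 q3 q4.
      by ring.
    have ci := admg_conv_int m b10 aR Sx (Sp s s0) s0 cC bC2.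
    rewrite E1 E2 CintegralZ; [|exact: measurableT|exact: ci].
    move: (Cintegral _ _) (_ ^+ dl1 _ _) (_ ^+ dl2 _ _) (fourier_cst _) (eps ^+ _) => q1 q2 q3 q4 q5.
    by ring.
  have [e1 e2] := @eq_lint_Lap R p (fun u m => eps ^+ (Dl p l1 l2 - lam1 p * k1 p * dl1 p l1 - lam2 p * k2 p * dl2 p l2)%N *
     fourier_cst R * Cintegral [set: R] (fun m1 => Cl p l1 l2 (m - m1) eps * G l1 l2 (Rl p l1 l2) u m1))
     (HL l1 l2) x0 X1 X2 z E.
  split; first exact: e1.
  apply: etrans (esym e2) _; apply: etrans s2 _; apply: etrans (congr1 _ c2) _.
  apply: etrans (esym (mulrA _ _ _)) _; apply: congr1; exact: (mulrA (fourier_cst R)).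
have aQ := rP (Q p) t1 t2 z h1 h2 h3.
have [r0 aG0] := rG _ (D1 p) (D2 p) _ _ (rP (Rl p (D1 p) (D2 p))).
have Fpsi := forcing_Lap z k11 kk k21 b0 apsi d0 n1 n2 dx.
have aT : arcdom [set: C] (pi / (k2 p)%:R) by [].
have okpsi : LapOk p (fun tau m => psi p tau m eps) x0 X1 X2 z.
  exact: (@admg_LapOk R p [set: C] _ k' Cpsi nu beta c B x0 _ X1 X2 z kk k21 c0 Bb apsi w0 aT I ko ZB).
have sumOk := @Lap_sum R p x0 X1 X2 z nat (index_iota 1 (D1 p)) (fun l1 => (1 <= l1 < D1 p)%N)
  (fun l1 u m => \sum_(1 <= l2 < D2 p | (1 <= l2 < D2 p)%N) HL l1 l2 u m)
  (fun l1 => \sum_(1 <= l2 < D2 p | (1 <= l2 < D2 p)%N) Lap p (HL l1 l2) x0 X1 X2 z).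
have [|so sE] := sumOk.
  move=> l1 hl1; apply: Lap_sum => l2 hl2.
  by have [q1 _] := HLP l1 l2 hl1 hl2.
pose SUM := fun (u : C) (m : R) => \sum_(1 <= l1 < D1 p | (1 <= l1 < D1 p)%N) \sum_(1 <= l2 < D2 p | (1 <= l2 < D2 p)%N) HL l1 l2 u m.
have [L1 L2] := Lap_lin 1 1 so okpsi.
have [M1 M2] := Lap_lin 1 1 (ok _ aG0) L1.
(* The fixed-point identity, transformed. The factors 1 only match the shape of [Lap_lin]. *)
have fixE : Lap p (fun u m => ((Q p).['i%C * m%:C] : C) * w u m) x0 X1 X2 z =
   Lap p (G (D1 p) (D2 p) (Rl p (D1 p) (D2 p))) x0 X1 X2 z +
   (\sum_(1 <= l1 < D1 p | (1 <= l1 < D1 p)%N) \sum_(1 <= l2 < D2 p | (1 <= l2 < D2 p)%N) Lap p (HL l1 l2) x0 X1 X2 z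
    + Lap p (fun tau m => psi p tau m eps) x0 X1 X2 z).
  rewrite -sE.
  transitivity (1 * Lap p (G (D1 p) (D2 p) (Rl p (D1 p) (D2 p))) x0 X1 X2 z +
     1 * Lap p (fun u m => 1 * SUM u m + 1 * psi p u m eps) x0 X1 X2 z); last first.
    apply: (f_equal2 +%R); first exact: mul1r.
    apply: etrans (mul1r _) _; apply: etrans L2 _; apply: (f_equal2 +%R); exact: mul1r.
  rewrite -M2.
  apply: (proj2 (@eq_lint_Lap R p (fun u m => ((Q p).['i%C * m%:C] : C) * w u m)
    (fun u m => 1 * G (D1 p) (D2 p) (Rl p (D1 p) (D2 p)) u m + 1 * (1 * SUM u m + 1 * psi p u m eps)) x0 X1 X2 z _)).
  move=> s m s0.
  have hf := hfix_eq fw (or_introl (Sp s s0)) (P0 m _ (Sp s s0)).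
  apply: etrans hf _; rewrite !mul1r; congr (_ + (_ + _)).
    rewrite /G; move: (horner _ _) => q1; move: (w _ _) => q2; move: (polar _ _) => q3.
    by rewrite !exprMn -!exprM /Npow exprD; ring.
  by rewrite sum_nat_cond; apply: eq_bigr => l1 _; rewrite sum_nat_cond.
rewrite /solves_at aQ /LX fixE r0 Fpsi !mulrDr addrA; congr (_ + _ + _).
  rewrite mulrA; congr (_ * _).
  (* For the leading term the excess is 0: [hD] makes the powers of eps cancel exactly. *)
  have cE := eps_pow_cancel (lam1 p) (lam2 p) (k1 p) (k2 p) (dl1 p (D1 p)) (dl2 p (D2 p)) 0 e0.
  rewrite addn0 -hD expr0 in cE.
  by rewrite mulrCA cE mulr1.
rewrite [in RHS]sum_nat_cond mulr_sumr; apply: eq_bigr => l1 hl1.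
rewrite [in RHS]sum_nat_cond mulr_sumr; apply: eq_bigr => l2 hl2.
(* The coefficient c_(l1 l2) enters kappa here; afterwards only Euler operators act, and they do not
   see z. *)
have hV : rep p T1s T2s eps B xi (fun z => ccoef p l1 l2 z eps * fourier_cst R)
    (fun u m => ((Rl p l1 l2).['i%C * m%:C] : C) * w u m)
    (fun s1 s2 x e => ccoef p l1 l2 x e * poly_dz (Rl p l1 l2) u s1 s2 x e).
  move=> s1 s2 x g1 g2 g3.
  apply: etrans (congr1 (fun q => ccoef p l1 l2 x eps * q) (rP (Rl p l1 l2) s1 s2 x g1 g2 g3)) _.
  exact: mulrA.
have [r3 _] := rG _ l1 l2 _ _ hV.
rewrite r3 (HLP l1 l2 hl1 hl2).2.
(* The excess left over is the exponent of eps in [Hmap]; the subtraction on natural numbers is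
   exact by [hDl]. *)
have := eps_pow_cancel (lam1 p) (lam2 p) (k1 p) (k2 p) (dl1 p l1) (dl2 p l2)
   (Dl p l1 l2 - lam1 p * k1 p * dl1 p l1 - lam2 p * k2 p * dl2 p l2)%N e0.
rewrite -subnDA subnKC; last exact: hDl.
move=> <-; move: (Lap _ _ _ _ _ _) (ccoef _ _ _ _ _) (fourier_cst _) (eps ^+ Dl _ _ _) (_ ^+ (k1 p * _)) (_ ^+ (k2 p * _)) => q1 q2 q3 q4 q5 q6.
by ring.
Qed.

End OuterEquation.

(** * Holomorphy in the parameter *)

Section FourierHolomorphy.
Variable R : realType.
Local Notation C := (Cx R).
Local Notation mu := (@lebesgue_measure R).

(** The Poisson kernel 2 a / (a^2 + (m - m0)^2) in the variable y = (m - m0) / a, including the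
    factor a of dm. Its total mass is 2 pi. *)
Let P (y : R) : R := 2 / (1 + y ^+ 2).

Let P_ge0 y : 0 <= P y.
Proof. by rewrite divr_ge0// addr_ge0// sqr_ge0. Qed.

Let continuous_P : continuous P.
Proof.
move=> y; apply: cvgM; first exact: cvg_cst.
exact: (@continuous_oneDsqrV R).
Qed.

Lemma integral_cauchy_kernel : Rintegrable [set: R] P /\ Rintegral mu [set: R] P = 2 * pi.
Proof.
have E : (\int[mu]_y (P y)%:E = (2 * pi)%:E)%E.
  rewrite ge0_symfun_integralT.
  - have -> : (\int[mu]_(y in [set y : R | (0 <= y)%R]) (P y)%:E = pi%:E)%E.
      have E0 : (\int[mu]_(y in `[0%R, +oo[) ((1 + y ^+ 2)^-1)%:E = (pi / 2)%:E)%E.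
        exact: integral0y_oneDsqr.
      have -> : [set y : R | (0 <= y)%R] = `[(0 : R), +oo[%classic.
        by apply/seteqP; split => y /=; rewrite in_itv/= andbT.
      under eq_integral do rewrite EFinM.
      rewrite ge0_integralZl//.
      + by rewrite E0 -EFinM; congr (_%:E); field.
      + apply/measurable_EFinP; apply: measurable_funTS; apply: continuous_measurable_fun.
        exact: (@continuous_oneDsqrV R).
      + by move=> y _; rewrite lee_fin invr_ge0 addr_ge0// sqr_ge0.
    by rewrite -EFinM.
  - exact: P_ge0.
  - exact: continuous_P.
  - by move=> x; rewrite /P /= sqrrN.
split; last by rewrite /Rintegral E.
apply/integrableP; split.
  by apply/measurable_EFinP; apply: continuous_measurable_fun; exact: continuous_P.
under eq_integral do rewrite /= ger0_norm ?P_ge0//.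
by rewrite E ltry.
Qed.

(** The fundamental theorem on [0, N] and the exponential tail beyond N leave an error at most a
    constant times exp (- a N), for every N. *)
Lemma Cintegral_cexp_half (q : C) : complex.Re q < 0 ->
  Cintegrable `[(0 : R), +oo[ (fun x => cexp (x%:C * q)) /\
  Cintegral `[(0 : R), +oo[ (fun x => cexp (x%:C * q)) = - q^-1.
Proof.
move=> q0; set a := - complex.Re q; have a0 : 0 < a by rewrite oppr_gt0.
have qn : q != 0 by apply: contraTneq q0 => ->; rewrite ltxx.
pose f (x : R) : C := cexp (x%:C * q).
have nf x : normc (f x) = expR (- (a * x)).
  by rewrite /f normc_cexp cReM /= mul0r subr0 /a mulNr opprK mulrC.
have df x : pderiv (fun x => q^-1 * f x) x (f x).
  have d1 := @pderiv_segment R (@cexp R) 0 q x (diff_cexp _).1.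
  have E : (fun t : R => cexp (0 + t%:C * q)) = f by apply/funext => t; rewrite add0r.
  rewrite E (diff_cexp _).2 add0r in d1.
  apply: pderiv_eq (pderivM (pderiv_cst x q^-1) d1).
  by rewrite mul0r add0r mulrCA mulVf// mulr1.
have cf : continuous f.
  have E : f = (fun x => q * (q^-1 * f x)) by apply/funext => x; rewrite mulVKf.
  by rewrite E; apply: pderiv_continuous => x; exact: pderivM (pderiv_cst x q) (df x).
have mf (D : set R) : measurable D -> measC D f.
  by move=> mD; apply: (measC_sub (D := setT)) => //; exact: continuous_measC.
have fi (c : R) : Cintegrable `[c, +oo[ f.
  apply: (@Cintegrable_dom _ _ _ (fun s => expR (- (a * s)))).
  - exact: measurable_itv.
  - by apply: mf; exact: measurable_itv.
  - exact: integrable_exp_tail.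
  - by move=> x _; rewrite nf.
split; first exact: fi.
apply/subr0_eq/eq0_normc/eqP; rewrite eq_le normc_ge0 andbT.
set X := normc _.
have H (N : R) : 0 <= N -> X <= (normc q^-1 + 2 * a^-1) * expR (- (a * N)).
  move=> N0.
  rewrite /X (Cintegral_itvy_split N0 (fi 0)) (Cintegral_FTC N0 df cf).
  have -> : q^-1 * f N - q^-1 * f 0 + Cintegral `[N, +oo[ f - - q^-1 = q^-1 * f N + Cintegral `[N, +oo[ f.
    by rewrite {2}/f mul0r cexp0; ring.
  apply: le_trans (le_normcD _ _) _; rewrite mulrDl; apply: lerD.
    by rewrite normcM nf.
  rewrite -mulrA [a^-1 * _]mulrC -(Rintegral_exp_tail N a0); apply: le_Cintegral.
  - exact: measurable_itv.
  - by apply: mf; exact: measurable_itv.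
  - exact: integrable_exp_tail.
  - by move=> x _; rewrite nf.
have X0 : 0 <= X by exact: normc_ge0.
have K0 : 0 <= normc q^-1 + 2 * a^-1 by rewrite addr_ge0 ?normc_ge0// mulr_ge0// invr_ge0 ltW.
rewrite leNgt; apply/negP => Xp.
set K := normc q^-1 + 2 * a^-1 in H K0.
(* For this N, exp (a N) >= 1 + K / X > K / X, so a positive error [X] would be strictly smaller
   than itself. *)
have N0 : 0 <= K / (X * a) by rewrite divr_ge0// mulr_ge0// ltW.
have := H _ N0.
have e1 := expR_ge1Dx (a * (K / (X * a))).
rewrite leNgt => /negP; apply.
rewrite expRN -ltr_pdivlMr ?invr_gt0 ?expR_gt0// invrK mulrC.
rewrite -ltr_pdivrMr//; apply: lt_le_trans e1.
have -> : a * (K / (X * a)) = K / X by field; rewrite !gt_eqF.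
by rewrite ltrDr.
Qed.

Lemma continuous_rational_kernel (a m0 : R) : 0 < a ->
  continuous (fun m : R => 2 * a / (a ^+ 2 + (m - m0) ^+ 2)).
Proof.
move=> a0 m; apply: cvgM; first exact: cvg_cst.
have c0 : 0 < a ^+ 2 + (m - m0) ^+ 2 by rewrite ltr_pwDl ?exprn_gt0// sqr_ge0.
apply: cvgV; first by rewrite gt_eqF.
apply: cvgD; first exact: cvg_cst.
under eq_fun do rewrite expr2; rewrite expr2.
by apply: cvgM; apply: cvgB; [exact: cvg_id|exact: cvg_cst|exact: cvg_id|exact: cvg_cst].
Qed.

Lemma averaged_integrable (h : R -> C) (K m0 a : R) : 0 < a -> continuous h ->
  (forall m, normc (h m) <= K) ->
  Cintegrable [set: R] (fun y => h (a * y + m0) * (P y)%:C) /\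
  normc (Cintegral [set: R] (fun y => h (a * y + m0) * (P y)%:C)) <= 2 * (K * (2 * pi)).
Proof.
move=> a0 ch hK; have [iP EP] := integral_cauchy_kernel.
have mhP : measC [set: R] (fun y => h (a * y + m0) * (P y)%:C).
  apply: measCM.
    apply: continuous_measC => y.
    apply: (@cvg_comp _ _ _ (fun y : R => a * y + m0) h _ (nbhs (a * y + m0))); last exact: ch.
    by apply: cvgD; [apply: cvgM; [exact: cvg_cst|exact: cvg_id]|exact: cvg_cst].
  by apply: measC_real; apply: continuous_measurable_fun; exact: continuous_P.
have iKP : Rintegrable [set: R] (fun y => K * P y).
  by apply: RintegrableZ; [exact: measurableT|exact: iP].
have bhP y : normc (h (a * y + m0) * (P y)%:C) <= K * P y.
  rewrite normcM normc_real ger0_norm ?P_ge0//.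
  by apply: ler_wpM2r; [exact: P_ge0|exact: hK].
split.
  by apply: (@Cintegrable_dom _ _ _ (fun y => K * P y)) => // y _; exact: bhP.
have -> : K * (2 * pi) = Rintegral mu [set: R] (fun y => K * P y).
  by rewrite (@RintegralZl _ _ R mu)// EP.
by apply: le_Cintegral => // y _; exact: bhP.
Qed.

Lemma kernel_rescale (h : R -> C) (K m0 a : R) : 0 < a -> continuous h ->
  (forall m, normc (h m) <= K) ->
  Cintegrable [set: R] (fun m => h m * (2 * a / (a ^+ 2 + (m - m0) ^+ 2))%:C) ->
  Cintegral [set: R] (fun m => h m * (2 * a / (a ^+ 2 + (m - m0) ^+ 2))%:C) =
  Cintegral [set: R] (fun y => h (a * y + m0) * (P y)%:C).
Proof.
move=> a0 ch hK ik; have [ihP _] := averaged_integrable m0 a0 ch hK.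
pose k (m : R) : C := h m * (2 * a / (a ^+ 2 + (m - m0) ^+ 2))%:C.
have ck : continuous k.
  move=> m; apply: cvgC_M; first exact: ch.
  by apply: cvgC_real; exact: continuous_rational_kernel.
have kE y : k (a * y + m0) = (a^-1)%:C * (h (a * y + m0) * (P y)%:C).
  rewrite /k addrK mulrCA; congr (_ * _).
  rewrite -rmorphM; congr (_%:C); rewrite /P exprMn.
  have y0 : 0 < 1 + y ^+ 2 by rewrite ltr_pwDl// sqr_ge0.
  have a2 : a ^+ 2 + a ^+ 2 * y ^+ 2 = a ^+ 2 * (1 + y ^+ 2) by ring.
  by rewrite a2; field; rewrite !gt_eqF// exprn_gt0.
apply: etrans (@Cintegral_affine R k a m0 a0 ck ik) _.
rewrite (eq_Cintegral (g := fun y => (a^-1)%:C * (h (a * y + m0) * (P y)%:C))); last by move=> y _; exact: kE.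
by rewrite CintegralZ// mulrA -rmorphM mulfV ?gt_eqF// mul1r.
Qed.

(** The real line in x is folded onto the half-line. After Fubini, the inner integral in x is - 1 /
    q - 1 / q', which is the Poisson kernel at m. *)
Lemma poisson_fourier (h : R -> C) (K b m0 a : R) : 0 < b -> 0 < a -> continuous h ->
  (forall m, normc (h m) <= K * expR (- (b * `|m|))) ->
  let F (x : R) := Cintegral [set: R] (fun m => h m * cexp ('i%C * x%:C * m%:C)) in
  Cintegral `[(0 : R), +oo[ (fun x => F x * cexp (x%:C * (- ('i%C * m0%:C) - a%:C)) +
     F (- x) * cexp (x%:C * ('i%C * m0%:C - a%:C))) =
  Cintegral [set: R] (fun y => h (a * y + m0) * (P y)%:C) /\
  normc (Cintegral [set: R] (fun y => h (a * y + m0) * (P y)%:C)) <= 2 * (K * (2 * pi)).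
Proof.
move=> b0 a0 ch hK F.
have K0 : 0 <= K.
  have := hK 0; rewrite normr0 mulr0 oppr0 expR0 mulr1; apply: le_trans; exact: normc_ge0.
have hK' m : normc (h m) <= K.
  apply: le_trans (hK m) _; rewrite ler_piMr// -expR0 ler_expR oppr_le0 mulr_ge0//.
  exact: ltW.
have [iP EP] := integral_cauchy_kernel.
(* The exponents on the two half-lines; their common real part - a provides the decay in x that
   Fubini needs. *)
pose q (m : R) : C := 'i%C * (m - m0)%:C - a%:C.
pose q' (m : R) : C := - ('i%C * (m - m0)%:C) - a%:C.
have rq m : complex.Re (q m) = - a.
  by rewrite /q cReB cReM /= !(mul0r, mulr0) subrr sub0r.
have rq' m : complex.Re (q' m) = - a.
  by rewrite /q' cReB cReN cReM /= !(mul0r, mulr0) subrr oppr0 sub0r.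
have qlt m : complex.Re (q m) < 0 by rewrite rq oppr_lt0.
have q'lt m : complex.Re (q' m) < 0 by rewrite rq' oppr_lt0.
pose f (m x : R) := h m * cexp (x%:C * q m) + h m * cexp (x%:C * q' m).
have hi (x : R) : Cintegrable [set: R] (fun m => h m * cexp ('i%C * x%:C * m%:C)).
  apply: (@Cintegrable_dom _ _ _ (fun m => K * expR (- (b * `|m|)))).
  - exact: measurableT.
  - by apply: measCM; [exact: continuous_measC|exact: measC_cexp_i].
  - by apply: RintegrableZ; [exact: measurableT|exact: integrable_exp_abs].
  - move=> m _; rewrite normcM (_ : normc (cexp _) = 1) ?mulr1//.
    by rewrite normc_cexp !(cReM, cImM) /= !(mul0r, mulr0, mul1r, subr0, sub0r, addr0, oppr0) expR0.
have ncx (x : R) (z : C) : complex.Re z = - a -> normc (cexp (x%:C * z)) = expR (- (a * x)).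
  by move=> hz; rewrite normc_cexp cReM /= mul0r subr0 hz mulrN mulrC.
have D s : `[(0 : R), +oo[%classic s -> 0 <= s by rewrite /= in_itv/= andbT.
have mh : measC [set: R] h by exact: continuous_measC.
have mcq (z : R -> C) : measC [set: R] z -> measC [set: R * R] (fun w : R * R => cexp (w.2%:C * z w.1)).
  move=> mz; apply: measC_cexp; apply: measCM.
    by apply: measC_real; exact: measurable_snd.
  exact: (measC_comp (p := fst) mz measurable_fst).
have mq : measC [set: R] q.
  apply: measCD; last by apply: measCN; exact: measC_cst.
  apply: measCM; first exact: measC_cst.
  by apply: measC_real; apply: measurable_funB; [exact: measurable_id|exact: measurable_cst].
have mq' : measC [set: R] q'.
  apply: measCD; last by apply: measCN; exact: measC_cst.
  apply: measCN; apply: measCM; first exact: measC_cst.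
  by apply: measC_real; apply: measurable_funB; [exact: measurable_id|exact: measurable_cst].
have [||||||f1 f2 f3] := @CfubiniD R f `[(0 : R), +oo[ (fun m => 2 * K * expR (- (b * `|m|)))
   (fun x => expR (- (a * x))) (measurable_itv _).
- have mh1 : measC [set: R * R] (fun w : R * R => h w.1).
    exact: (measC_comp (p := fst) mh measurable_fst).
  by apply: measCD; apply: measCM; [exact: mh1|exact: mcq|exact: mh1|exact: mcq].
- by apply: RintegrableZ; [exact: measurableT|exact: integrable_exp_abs].
- exact: integrable_exp_tail.
- by move=> x; rewrite !mulr_ge0 ?expR_ge0.
- by move=> y _; exact: expR_ge0.
- move=> m x _; apply: le_trans (le_normcD _ _) _.
  have e1 : normc (h m * cexp (x%:C * q m)) = normc (h m) * expR (- (a * x)).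
    by rewrite normcM (ncx x _ (rq m)).
  have e2 : normc (h m * cexp (x%:C * q' m)) = normc (h m) * expR (- (a * x)).
    by rewrite normcM (ncx x _ (rq' m)).
  rewrite e1 e2 -mulrDl ler_wpM2r ?expR_ge0//.
  by rewrite -mulrA mulr_natl mulr2n lerD.
have FE x : Cintegral [set: R] (f^~ x) = F x * cexp (x%:C * (- ('i%C * m0%:C) - a%:C)) +
     F (- x) * cexp (x%:C * ('i%C * m0%:C - a%:C)).
  rewrite -(CintegralZr _ measurableT (hi x)) -(CintegralZr _ measurableT (hi (- x))).
  rewrite -(CintegralD measurableT (CintegrableZr _ measurableT (hi x)) (CintegrableZr _ measurableT (hi (- x)))).
  apply: eq_Cintegral => m _.
  have e1 : cexp (x%:C * q m) = cexp ('i%C * x%:C * m%:C) * cexp (x%:C * (- ('i%C * m0%:C) - a%:C)).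
    by rewrite -cexpD; congr cexp; rewrite /q rmorphB /=; ring.
  have e2 : cexp (x%:C * q' m) = cexp ('i%C * (- x)%:C * m%:C) * cexp (x%:C * ('i%C * m0%:C - a%:C)).
    by rewrite -cexpD; congr cexp; rewrite /q' rmorphB rmorphN /=; ring.
  rewrite /f e1 e2; exact: (f_equal2 +%R (mulrA _ _ _) (mulrA _ _ _)).
have -> : Cintegral `[(0 : R), +oo[ (fun x => F x * cexp (x%:C * (- ('i%C * m0%:C) - a%:C)) +
     F (- x) * cexp (x%:C * ('i%C * m0%:C - a%:C))) = Cintegral [set: R] (fun m => Cintegral `[0, +oo[ (f m)).
  by rewrite f3; apply: eq_Cintegral => x _; rewrite FE.
pose k (m : R) : C := h m * (2 * a / (a ^+ 2 + (m - m0) ^+ 2))%:C.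
have fE m : Cintegral `[0, +oo[ (f m) = k m.
  have [i1 E1] := Cintegral_cexp_half (qlt m); have [i2 E2] := Cintegral_cexp_half (q'lt m).
  have mD : measurable `[(0 : R), +oo[%classic by exact: measurable_itv.
  rewrite /f (CintegralD mD (CintegrableZ _ mD i1) (CintegrableZ _ mD i2)).
  rewrite (CintegralZ _ mD i1) (CintegralZ _ mD i2) E1 E2 -mulrDr /k; congr (_ * _).
  have qn : q m != 0 by apply: contraTneq (qlt m) => ->; rewrite ltxx.
  have q'n : q' m != 0 by apply: contraTneq (q'lt m) => ->; rewrite ltxx.
  (* The product and the sum of the two exponents are the denominator of the Poisson kernel and the
     opposite of its numerator. *)
  have qq : q m * q' m = (a ^+ 2 + (m - m0) ^+ 2)%:C.
    apply: eq_C; rewrite /q /q' !(cReM, cImM, cReB, cImB, cReN, cImN) /=; ring.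
  have qs : q m + q' m = - (2 * a)%:C.
    apply: eq_C; rewrite /q /q' !(cReD, cImD, cReM, cImM, cReB, cImB, cReN, cImN) /=; ring.
  rewrite -opprD; have -> : (q m)^-1 + (q' m)^-1 = (q m + q' m) / (q m * q' m) by field; rewrite qn q'n.
  rewrite qs qq mulNr opprK [RHS]rmorphM; congr (_ * _).
  by rewrite -[LHS]fmorphV.
have ik : Cintegrable [set: R] k.
  apply: (eq_Cintegrable measurableT _ f1) => m _; exact: fE.
have [_ bP] := averaged_integrable m0 a0 ch hK'.
split; last exact: bP.
rewrite -(kernel_rescale a0 ch hK' ik); apply: eq_Cintegral => m _; exact: fE.
Qed.

(* Integrating F x e against exp (- i m0 x - a |x|) gives a holomorphic function
   of e; by Fubini it is the mean of h _ e against the Poisson kernel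
   2 a / (a ^ 2 + (m - m0) ^ 2), and it tends to 2 pi h m0 e as a tends to 0. *)
Lemma fourier_hol (h : R -> C -> C) (K b r : R) (e0 : C) : 0 < b -> 0 < r ->
  (forall e, normc (e - e0) < r -> continuous (h ^~ e) /\
     forall m, normc (h m e) <= K * expR (- (b * `|m|))) ->
  let F (z e : C) := Cintegral [set: R] (fun m => h m e * cexp ('i%C * z * m%:C)) in
  (forall (x : R) e, normc (e - e0) < r -> differentiable (fun z => F z e) (x%:C : C) /\
     differentiable (fun e => F x%:C e) e) ->
  forall m0, differentiable (h m0) e0.
Proof.
move=> b0 r0 hh F dF m0.
have [iP EP] := integral_cauchy_kernel.
have K0 : 0 <= K.
  have e0r : normc (e0 - e0) < r by rewrite subrr normc0.
  have := (hh e0 e0r).2 0; rewrite normr0 mulr0 oppr0 expR0 mulr1; apply: le_trans; exact: normc_ge0.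
pose an (n : nat) : R := n.+1%:R^-1.
have an0 n : 0 < an n by rewrite invr_gt0.
pose Psi n e := Cintegral `[(0 : R), +oo[ (fun x => F x%:C e * cexp (x%:C * (- ('i%C * m0%:C) - (an n)%:C)) +
     F (- x)%:C e * cexp (x%:C * ('i%C * m0%:C - (an n)%:C))).
have PsiE n e : normc (e - e0) < r ->
  Psi n e = Cintegral [set: R] (fun y => h (an n * y + m0) e * (P y)%:C) /\
  normc (Psi n e) <= 2 * (K * (2 * pi)).
  move=> er; have [c1 c2] := hh e er.
  have [p1 p2] := poisson_fourier m0 b0 (an0 n) c1 c2.
  by split; [exact: p1|rewrite /Psi p1].
pose I := Rintegral mu [set: R] (fun m : R => K * expR (- (b * `|m|))).
have FI (x : R) e : normc (e - e0) < r -> normc (F x%:C e) <= 2 * I.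
  move=> er; have [c1 c2] := hh e er; apply: le_Cintegral.
  - exact: measurableT.
  - by apply: measCM; [exact: continuous_measC|exact: measC_cexp_i].
  - by apply: RintegrableZ; [exact: measurableT|exact: integrable_exp_abs].
  - move=> m _; rewrite normcM (_ : normc (cexp _) = 1) ?mulr1//.
    by rewrite normc_cexp !(cReM, cImM) /= !(mul0r, mulr0, mul1r, subr0, sub0r, addr0, oppr0) expR0.
have D s : `[(0 : R), +oo[%classic s -> 0 <= s by rewrite /= in_itv/= andbT.
have cF e : normc (e - e0) < r -> continuous (fun x : R => F x%:C e).
  move=> er x; apply: (@continuous_comp _ _ _ (fun x : R => x%:C : C) (fun z => F z e)).
    by apply: cvgC_real; exact: cvg_id.
  exact: (differentiable_continuous (dF x e er).1).
have ccx (q : C) : continuous (fun x : R => cexp (x%:C * q)).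
  move=> x; apply: (@continuous_comp _ _ _ (fun x : R => x%:C * q : C) (@cexp R)).
    by apply: cvgC_M; [apply: cvgC_real; exact: cvg_id|exact: cvg_cst].
  exact: (differentiable_continuous (diff_cexp _).1).
have dPsi n e : normc (e - e0) < r -> differentiable (Psi n) e.
  move=> er; have rr : 0 < r - normc (e - e0) by rewrite subr_gt0.
  have near y : nv (y - e) < r - normc (e - e0) -> normc (y - e0) < r.
    rewrite nvC => yr; have -> : y - e0 = (y - e) + (e - e0) by ring.
    by apply: le_lt_trans (le_normcD _ _) _; rewrite -ltrBrDr.
  apply: (proj1 (@hol_int R C `[(0 : R), +oo[%classic (measurable_itv _)
    (fun e x => F x%:C e * cexp (x%:C * (- ('i%C * m0%:C) - (an n)%:C)) +
     F (- x)%:C e * cexp (x%:C * ('i%C * m0%:C - (an n)%:C))) e _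
     (fun x => 4 * I * expR (- (an n * x))) rr _ _ _ _)).
  - by apply: RintegrableZ; [exact: measurable_itv|exact: integrable_exp_tail].
  - move=> y x yr _; apply: differentiable_add; apply: differentiable_mul; try exact: differentiable_const.
      exact: (dF x y (near y yr)).2.
    exact: (dF (- x) y (near y yr)).2.
  - move=> y x yr _; apply: le_trans (le_normcD _ _) _.
    have ncx (z : C) : complex.Re z = - an n -> normc (cexp (x%:C * z)) = expR (- (an n * x)).
      by move=> hz; rewrite normc_cexp cReM /= mul0r subr0 hz mulrN mulrC.
    have e1 : normc (F x%:C y * cexp (x%:C * (- ('i%C * m0%:C) - (an n)%:C))) <= 2 * I * expR (- (an n * x)).
      rewrite normcM ncx; first by rewrite ler_wpM2r ?expR_ge0//; apply: FI; exact: near.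
      by rewrite cReB cReN cReM /= !(mul0r, mulr0) subrr oppr0 sub0r.
    have e2 : normc (F (- x)%:C y * cexp (x%:C * ('i%C * m0%:C - (an n)%:C))) <= 2 * I * expR (- (an n * x)).
      rewrite normcM ncx; first by rewrite ler_wpM2r ?expR_ge0//; apply: FI; exact: near.
      by rewrite cReB cReM /= !(mul0r, mulr0) subrr sub0r.
    apply: le_trans (lerD e1 e2) _; rewrite -mulrDl ler_wpM2r ?expR_ge0//.
    by rewrite -mulrDl -natrD.
  - move=> y yr; apply: (measC_sub (D := setT)) => //; apply: continuous_measC => x.
    apply: cvgC_D; apply: cvgC_M; try exact: ccx.
      exact: (cF y (near y yr)).
    apply: (@continuous_comp _ _ _ (fun x : R => - x) (fun x => F x%:C y)).
      exact: opp_continuous.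
    exact: (cF y (near y yr)).
pose kap : C := (2 * pi)%:C.
have kap0 : kap != 0.
  have p0 := pi_gt0 R; apply/eqP => /(congr1 (@normc R)).
  have k0 : 0 < 2 * pi :> R by rewrite mulr_gt0.
  by rewrite /kap normc_real normc0 gtr0_norm// => h0; move: k0; rewrite h0 ltxx.
(* The means are bounded independently of n and converge pointwise in e, which is what [hol_lim]
   requires; dividing by 2 pi normalizes the kernel. *)
apply: (@hol_lim R (fun n e => kap^-1 * Psi n e) (h m0) e0 r (normc kap^-1 * (2 * (K * (2 * pi)))) r0).
- by move=> n w wr; apply: differentiable_mul; [exact: differentiable_const|exact: dPsi].
- by move=> n w wr; rewrite normcM ler_wpM2l ?normc_ge0//; exact: (PsiE n w wr).2.
- move=> w wr; have [c1 c2] := hh w wr.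
  (* After rescaling, the kernel no longer depends on n, and dominated convergence only uses the
     continuity of [h] at m0. *)
  have lim : (fun n => Cintegral [set: R] (fun y => h (an n * y + m0) w * (P y)%:C)) @ \oo -->
     Cintegral [set: R] (fun y => h m0 w * (P y)%:C).
    apply: (@Cintegral_dominated_cvg _ _ _ _ (fun y => K * P y)).
    - exact: measurableT.
    - move=> n; apply: measCM.
        apply: continuous_measC => y.
        apply: (@cvg_comp _ _ _ (fun y : R => an n * y + m0) (h^~ w) _ (nbhs (an n * y + m0))); last exact: c1.
        by apply: cvgD; [apply: cvgM; [exact: cvg_cst|exact: cvg_id]|exact: cvg_cst].
      by apply: measC_real; apply: continuous_measurable_fun; exact: continuous_P.
    - by apply: RintegrableZ; [exact: measurableT|exact: iP].
    - move=> n y _; rewrite normcM normc_real ger0_norm ?P_ge0// ler_wpM2r ?P_ge0//.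
      apply: le_trans (c2 _) _; rewrite ler_piMr// -expR0 ler_expR oppr_le0 mulr_ge0//.
      exact: ltW.
    - move=> y _; apply: cvgC_M; last exact: cvg_cst.
      have la : (fun n : nat => an n * y + m0) @ \oo --> 0 * y + m0.
        by apply: cvgD; [apply: cvgM; [exact: cvg_harmonic|exact: cvg_cst]|exact: cvg_cst].
      rewrite mul0r add0r in la.
      exact: (cvg_comp _ _ la (c1 m0)).
  have iPC : Cintegrable [set: R] (fun y => (P y)%:C).
    by split=> /=; [exact: iP|exact: integrable0].
  have EPC : Cintegral [set: R] (fun y => (P y)%:C) = kap.
    by apply: eq_C; rewrite /kap /=; [exact: EP|rewrite /Rintegral integral0].
  rewrite (CintegralZ _ measurableT iPC) EPC in lim.
  have E : (fun n => kap^-1 * Psi n w) =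
     (fun n => kap^-1 * Cintegral [set: R] (fun y => h (an n * y + m0) w * (P y)%:C)).
    by apply/funext => n; rewrite (PsiE n w wr).1.
  have hE : h m0 w = kap^-1 * (h m0 w * kap) by rewrite mulrCA (mulVf kap0) mulr1.
  rewrite E hE.
  by apply: cvgC_M; [exact: cvg_cst|exact: lim].
Qed.

End FourierHolomorphy.

(** * Iterates of the contraction and dependence on eps *)

Section FixedPoint.
Variable R : realType.
Local Notation C := (Cx R).
Implicit Types (tau : C) (w : C -> R -> C) (S : set C).

Lemma eq_Exp_norm S (rho nu beta mu : R) k w w' :
  (forall tau m, (S `|` cdisc rho) tau -> w tau m = w' tau m) ->
  Exp_norm S rho nu beta mu k w = Exp_norm S rho nu beta mu k w'.
Proof.
move=> ww; congr (ereal_sup _); apply/seteqP; split=> _ [tau [m [St t0 ->]]]; exists tau, m; split=> //.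
  by rewrite ww.
by rewrite ww.
Qed.

Lemma Exp_ball0 S (rho nu beta mu varpi : R) k : 0 <= varpi ->
  Exp_ball S rho nu beta mu k varpi (fun _ _ => 0).
Proof.
move=> v0; have H : (Exp_norm S rho nu beta mu k (fun _ _ => 0%R) <= varpi%:E)%E.
  by apply: ge_ereal_sup => _ [tau [m [_ _ ->]]]; rewrite normc0 mulr0 lee_fin.
split; last exact: H.
split.
- by apply: continuous_subspaceT => x; exact: cst_continuous.
- by move=> m tau _; exact: differentiable_const.
- exact: le_lt_trans H (ltry _).
Qed.

Definition Hiter (p : problem R) (eps : C) (n : nat) : C -> R -> C :=
  iter n (Hmap p eps) (fun _ _ => 0).

Lemma Hiter_ball p S (rho nu beta mu varpi : R) k eps n : 0 <= varpi ->
  half_contraction p S rho nu beta mu k varpi eps ->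
  Exp_ball S rho nu beta mu k varpi (Hiter p eps n).
Proof.
move=> v0 [H _]; elim: n => [|n IH]; first exact: Exp_ball0.
exact: H.
Qed.

(** At n = 0 the distance is the norm of [w], at most varpi, and each step halves it. The iterates
    stay in the ball, where the contraction estimate is valid. *)
Lemma Hiter_bound p S (rho nu beta mu varpi : R) k eps w n : 0 < mu -> 0 <= varpi ->
  half_contraction p S rho nu beta mu k varpi eps ->
  is_Hfixpoint p S rho nu beta mu k varpi eps w ->
  (Exp_norm S rho nu beta mu k (fun tau m => (Hiter p eps n tau m - w tau m)%R) <=
    (2^-1 ^+ n * varpi)%:E)%E.
Proof.
move=> mu0 v0 hc [bw fw]; elim: n => [|n IH].
  have [_ hw] := bw; rewrite expr0 mul1r; apply: le_trans hw.
  apply: ge_ereal_sup => _ [tau [m [St t0 ->]]]; apply: ereal_sup_ubound.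
  by exists tau, m; split=> //; rewrite /= sub0r normcN.
rewrite (@eq_Exp_norm _ _ _ _ _ _ _ (fun tau m => Hmap p eps (Hiter p eps n) tau m - Hmap p eps w tau m)); last first.
  by move=> tau m St; rewrite (fw _ _ St).
have [_ H] := hc; have bn := Hiter_ball n v0 hc.
apply: le_trans (H _ _ bn bw) _.
have -> : (2^-1 ^+ n.+1 * varpi)%:E = ((2^-1)%:E * (2^-1 ^+ n * varpi)%:E)%E :> \bar R.
  by rewrite -EFinM exprS mulrA.
by apply: lee_wpmul2l; rewrite ?lee_fin ?invr_ge0.
Qed.

Lemma Hiter_cvg p S (rho nu beta mu varpi : R) k eps w tau m : 0 < mu -> 0 <= varpi ->
  half_contraction p S rho nu beta mu k varpi eps ->
  is_Hfixpoint p S rho nu beta mu k varpi eps w ->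
  (S `|` cdisc rho) tau -> tau != 0 ->
  (fun n => Hiter p eps n tau m) @ \oo --> w tau m.
Proof.
move=> mu0 v0 hc fw St t0.
pose A := varpi * normc tau * expR (nu * normc tau ^+ k) * expR (- (beta * `|m|)).
have H n : normc (Hiter p eps n tau m - w tau m) <= 2^-1 ^+ n * A.
  have := Exp_norm_bound mu0 (Hiter_bound n mu0 v0 hc fw) m St t0.
  by rewrite /A !mulrA.
have A0 : 0 <= A by rewrite !mulr_ge0 ?normc_ge0 ?expR_ge0.
apply/cvgCP => e e0.
have lim : (fun n => 2^-1 ^+ n * A : R) @ \oo --> (0 : R).
  rewrite -[X in _ --> X](mul0r A); apply: cvgM; last exact: cvg_cst.
  by apply: cvg_expr; rewrite ger0_norm ?invr_ge0// invf_lt1// ltr1n.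
move/cvgrPdist_lt: lim => /(_ e e0).
apply: filterS => n; rewrite sub0r normrN ger0_norm; last by rewrite mulr_ge0// exprn_ge0.
exact: le_lt_trans (H n).
Qed.

(* The iterates from 0 do not depend on the set S. *)
Lemma Hfixpoint_agree p S S' (rho nu beta mu varpi : R) k eps w w' tau m : 0 < mu -> 0 <= varpi ->
  half_contraction p S rho nu beta mu k varpi eps ->
  is_Hfixpoint p S rho nu beta mu k varpi eps w ->
  half_contraction p S' rho nu beta mu k varpi eps ->
  is_Hfixpoint p S' rho nu beta mu k varpi eps w' ->
  (S `|` cdisc rho) tau -> (S' `|` cdisc rho) tau -> tau != 0 -> w tau m = w' tau m.
Proof.
move=> mu0 v0 h1 f1 h2 f2 St St' t0.
have c1 := @Hiter_cvg p S rho nu beta mu varpi k eps w tau m mu0 v0 h1 f1 St t0.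
have c2 := @Hiter_cvg p S' rho nu beta mu varpi k eps w' tau m mu0 v0 h2 f2 St' t0.
exact: cvgC_unique c1 c2.
Qed.

Lemma differentiable_sumC (V : normedModType R[i]) (I : Type) (r : seq I) (P : pred I) (f : I -> V -> C) x :
  (forall i, P i -> differentiable (f i) x) -> differentiable (fun y => \sum_(i <- r | P i) f i y) x.
Proof.
move=> df; elim: r => [|i r IH].
  have -> : (fun y => \sum_(i <- [::] | P i) f i y) = (fun=> 0).
    by apply/funext => y; rewrite big_nil.
  exact: differentiable_const.
have [Pi|nPi] := boolP (P i).
  have -> : (fun y => \sum_(i <- i :: r | P i) f i y) = (fun y => f i y + \sum_(i <- r | P i) f i y).
    by apply/funext => y; rewrite big_cons Pi.
  by apply: differentiable_add; [exact: df|exact: IH].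
have -> : (fun y => \sum_(i <- i :: r | P i) f i y) = (fun y => \sum_(i <- r | P i) f i y).
  by apply/funext => y; rewrite big_cons (negPf nPi).
exact: IH.
Qed.

Lemma disc_ball (e0 : R) (e y : C) : normc (y - e) < e0 - normc e -> disc e0 y.
Proof.
move=> h; rewrite /disc /=; have -> : y = (y - e) + e by rewrite subrK.
by apply: le_lt_trans (le_normcD _ _) _; rewrite -ltrBrDr.
Qed.

(** The induction must carry all m at once, because the next iterate at m is a convolution over all
    m1. The bound on the iterates needed for the parameter integral is the radius of the ball, the
    same for every eps. *)
Lemma Hiter_hol p S (rho nu beta mu varpi eps0 : R) (Cb : nat -> nat -> R) k n tau : 0 < mu -> 0 <= varpi -> 0 < beta ->
  (forall eps, disc eps0 eps -> half_contraction p S rho nu beta mu k varpi eps) ->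
  (forall l1 l2 : nat, (1 <= l1 < D1 p)%N -> (1 <= l2 < D2 p)%N -> forall eps, disc eps0 eps ->
     continuous (fun m => Cl p l1 l2 m eps) /\
     forall m, normc (Cl p l1 l2 m eps) <= Cb l1 l2 * expR (- (beta * `|m|))) ->
  (forall l1 l2 : nat, (1 <= l1 < D1 p)%N -> (1 <= l2 < D2 p)%N -> forall eps, disc eps0 eps ->
     forall m, differentiable (Cl p l1 l2 m) eps) ->
  (forall m eps, disc eps0 eps -> differentiable (fun e => psi p tau m e) eps) ->
  (S `|` cdisc rho) tau -> tau != 0 ->
  forall m eps, disc eps0 eps -> differentiable (fun e => Hiter p e n tau m) eps.
Proof.
move=> mu0 v0 b0 hc hC dC dpsi St t0; elim: n => [|n IH] m eps de.
  exact: differentiable_const.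
have Bn e m' : disc eps0 e -> normc (Hiter p e n tau m') <=
    varpi * normc tau * expR (nu * normc tau ^+ k) * expR (- (beta * `|m'|)).
  by move=> /hc h; have [_ hb] := Hiter_ball n v0 h; exact: Exp_norm_bound mu0 hb _ _ St t0.
set A := varpi * normc tau * expR (nu * normc tau ^+ k) in Bn.
have A0 : 0 <= A by rewrite !mulr_ge0 ?normc_ge0 ?expR_ge0.
have rr : 0 < eps0 - normc eps by rewrite subr_gt0.
have near y : nv (y - eps) < eps0 - normc eps -> disc eps0 y by rewrite nvC; exact: disc_ball.
have mw e : disc eps0 e -> measC [set: R] (Hiter p e n tau).
  move=> /hc h; have [[cw _ _] _] := Hiter_ball n v0 h.
  apply: continuous_measC.
  apply: (@continuous_within_comp _ _ _ _ (fun x : C * R => Hiter p e n x.1 x.2) (fun m => (tau, m)) _ _ cw).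
    by move=> m'; split; [exact: St|].
  move=> m'; exact: (@cvg_pair R C R (nbhs m') (nbhs tau) (nbhs m') _ _ _ (fun=> tau) (fun m => m) (cvg_cst _) cvg_id).
have dI l1 l2 : (1 <= l1 < D1 p)%N -> (1 <= l2 < D2 p)%N ->
   differentiable (fun e => Cintegral setT (fun m1 : R =>
            Cl p l1 l2 (m - m1) e * (Rl p l1 l2).['i * m1%:C] * Hiter p e n tau m1)) eps.
  move=> hl1 hl2; have [K K0 HK] := poly_growth (Rl p l1 l2) (divr_gt0 b0 (ltr0n R 2)).
  have Cb0 : 0 <= Cb l1 l2.
    have := (hC l1 l2 hl1 hl2 eps de).2 0; rewrite normr0 mulr0 oppr0 expR0 mulr1; apply: le_trans; exact: normc_ge0.
  apply: (proj1 (@hol_int R C [set: R] measurableT (fun e m1 =>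
     Cl p l1 l2 (m - m1) e * (Rl p l1 l2).['i * m1%:C] * Hiter p e n tau m1) eps _
     (* Half of the decay rate beta of the iterate is spent on the polynomial R_(l1 l2)(i m1). *)
     (fun m1 => Cb l1 l2 * K * A * expR (- (beta / 2 * `|m1|))) rr _ _ _ _)).
  - by apply: RintegrableZ; [exact: measurableT|apply: integrable_exp_abs; rewrite divr_gt0].
  - move=> y m1 yr _; have dy := near y yr.
    apply: differentiable_mul; last exact: IH.
    by apply: differentiable_mul; [exact: dC|exact: differentiable_const].
  - move=> y m1 yr _; have dy := near y yr; have [_ bC] := hC l1 l2 hl1 hl2 y dy.
    rewrite 2!normcM.
    have h1 : normc (Cl p l1 l2 (m - m1) y) <= Cb l1 l2.
      apply: le_trans (bC _) _; rewrite ler_piMr// -expR0 ler_expR oppr_le0 mulr_ge0//.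
      exact: ltW.
    have h2 := HK m1; have h3 := Bn y m1 dy.
    apply: le_trans (ler_pM (mulr_ge0 (normc_ge0 _) (normc_ge0 _)) (normc_ge0 _) (ler_pM (normc_ge0 _) (normc_ge0 _) h1 h2) h3) _.
    have -> : - (beta / 2 * `|m1|) = beta / 2 * `|m1| + - (beta * `|m1|) by field.
    by rewrite expRD le_eqVlt; apply/orP; left; apply/eqP; ring.
  - move=> y yr; have dy := near y yr; have [cC _] := hC l1 l2 hl1 hl2 y dy.
    apply: measCM; last exact: mw.
    apply: measCM.
      apply: (measC_comp (h := fun m : R => Cl p l1 l2 m y) (p := fun m1 : R => m - m1)); first exact: continuous_measC.
      by apply: measurable_funB; [exact: measurable_cst|exact: measurable_id].
    apply: measC_poly; apply: measCM; first exact: measC_cst.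
    by apply: measC_real; exact: measurable_id.
have -> : (fun e => Hiter p e n.+1 tau m) = (fun e => ((Pm p m).[tau])^-1 *
    (\sum_(1 <= l1 < D1 p | (1 <= l1 < D1 p)%N) \sum_(1 <= l2 < D2 p | (1 <= l2 < D2 p)%N)
       e ^+ (Dl p l1 l2 - lam1 p * k1 p * dl1 p l1 - lam2 p * k2 p * dl2 p l2)%N
       * ((k1 p)%:R * tau ^+ k1 p) ^+ dl1 p l1
       * ((k2 p)%:R * tau ^+ k2 p) ^+ dl2 p l2
       * (fourier_cst R * Cintegral setT (fun m1 : R =>
            Cl p l1 l2 (m - m1) e * (Rl p l1 l2).['i * m1%:C] * Hiter p e n tau m1))
     + psi p tau m e)).
  apply/funext => e; rewrite /Hiter iterS /Hmap -/(Hiter p e n); congr (_ * (_ + _)).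
  by rewrite sum_nat_cond; apply: eq_bigr => l1 _; rewrite sum_nat_cond.
apply: differentiable_mul; first exact: differentiable_const.
apply: differentiable_add; last exact: dpsi.
apply: differentiable_sumC => l1 hl1; apply: differentiable_sumC => l2 hl2.
apply: differentiable_mul.
  apply: differentiable_mul; last exact: differentiable_const.
  apply: differentiable_mul; last exact: differentiable_const.
  by apply: differentiable_pow; exact: differentiable_idC.
by apply: differentiable_mul; [exact: differentiable_const|exact: dI].
Qed.

(** [hol_lim] at fixed tau and m: the radius of the ball bounds all iterates uniformly in n and
    eps. *)
Lemma Hfixpoint_hol p S (rho nu beta mu varpi eps0 : R) (Cb : nat -> nat -> R) k tau
    (omega : C -> R -> C -> C) : 0 < mu -> 0 <= varpi -> 0 < beta ->
  (forall eps, disc eps0 eps -> half_contraction p S rho nu beta mu k varpi eps) ->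
  (forall eps, disc eps0 eps -> is_Hfixpoint p S rho nu beta mu k varpi eps (fun tau m => omega tau m eps)) ->
  (forall l1 l2 : nat, (1 <= l1 < D1 p)%N -> (1 <= l2 < D2 p)%N -> forall eps, disc eps0 eps ->
     continuous (fun m => Cl p l1 l2 m eps) /\
     forall m, normc (Cl p l1 l2 m eps) <= Cb l1 l2 * expR (- (beta * `|m|))) ->
  (forall l1 l2 : nat, (1 <= l1 < D1 p)%N -> (1 <= l2 < D2 p)%N -> forall eps, disc eps0 eps ->
     forall m, differentiable (Cl p l1 l2 m) eps) ->
  (forall m eps, disc eps0 eps -> differentiable (fun e => psi p tau m e) eps) ->
  (S `|` cdisc rho) tau -> tau != 0 ->
  forall m eps, disc eps0 eps -> differentiable (fun e => omega tau m e) eps.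
Proof.
move=> mu0 v0 b0 hc hf hC dC dpsi St t0 m eps de.
have rr : 0 < eps0 - normc eps by rewrite subr_gt0.
apply: (@hol_lim R (fun n e => Hiter p e n tau m) _ eps _
  (varpi * normc tau * expR (nu * normc tau ^+ k) * expR (- (beta * `|m|))) rr).
- move=> n w wr; have dw := disc_ball wr.
  exact: (Hiter_hol n mu0 v0 b0 hc hC dC dpsi St t0 m dw).
- move=> n w wr; have dw := disc_ball wr.
  by have [_ hb] := Hiter_ball n v0 (hc w dw); exact: Exp_norm_bound mu0 hb _ _ St t0.
- move=> w wr; have dw := disc_ball wr.
  exact: (@Hiter_cvg p S rho nu beta mu varpi k w (fun tau m => omega tau m w) tau m mu0 v0 (hc w dw) (hf w dw) St t0).
Qed.

Lemma ccoef_slices p l1 l2 (beta eps0 : R) : 0 < beta ->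
  holomorphic_on (strip beta `*` disc eps0) (fun x : C * C => ccoef p l1 l2 x.1 x.2) ->
  forall (x : R) e, disc eps0 e ->
  let F (z e : C) := Cintegral [set: R] (fun m => Cl p l1 l2 m e * cexp ('i%C * z * m%:C)) in
  differentiable (fun z => F z e) (x%:C : C) /\ differentiable (fun e => F x%:C e) e.
Proof.
move=> b0 hol x e de F.
have fc0 : fourier_cst R != 0.
  apply/eqP => /(congr1 (@normc R)); rewrite /fourier_cst normc_real normc0.
  have k0 : 0 < (Num.sqrt (2 * pi))^-1 :> R by rewrite invr_gt0 sqrtr_gt0 mulr_gt0// pi_gt0.
  by rewrite gtr0_norm// => h0; move: k0; rewrite h0 ltxx.
have FE z e' : F z e' = (fourier_cst R)^-1 * ccoef p l1 l2 z e' by rewrite mulKf.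
have d : differentiable (fun x : C * C => ccoef p l1 l2 x.1 x.2) ((x%:C : C), e).
  by apply: hol; split; [rewrite /strip /= normr0|].
split.
- have -> : (fun z => F z e) = (fun z => (fourier_cst R)^-1 * ccoef p l1 l2 z e) by apply/funext.
  apply: differentiable_mul; first exact: differentiable_const.
  have dp : differentiable (fun z : C => (z, e)) (x%:C : C).
    by apply: differentiable_pair; [exact: differentiable_idC|exact: differentiable_const].
  exact: (differentiable_comp dp d).
- have -> : (fun e => F x%:C e) = (fun e => (fourier_cst R)^-1 * ccoef p l1 l2 x%:C e) by apply/funext.
  apply: differentiable_mul; first exact: differentiable_const.
  have dp : differentiable (fun e : C => ((x%:C : C), e)) e.
    by apply: differentiable_pair; [exact: differentiable_const|exact: differentiable_idC].
  exact: (differentiable_comp dp d).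
Qed.

End FixedPoint.

(** * Bounds and the flat difference of two outer solutions *)

Section OuterBounds.
Variable R : realType.
Local Notation C := (Cx R).
Local Notation mu := (@lebesgue_measure R).
Implicit Types (T u Z : C) (g : C -> R -> C) (S : set C).

(** Unlike [lint_bound], the exponent keeps both kernel factors with the actual |T1| and |T2|, so
    that they can be split according to the use made of them. *)
Lemma lint_le p g (k' : nat) (A nu b B delta s m xi : R) T1 T2 Z :
  0 <= A -> 0 < delta -> T1 != 0 -> T2 != 0 -> decay_direction p delta T1 T2 xi ->
  `|complex.Im Z| <= B -> 0 < s ->
  normc (g (polar s xi) m) <= A * s * expR (nu * s ^+ k') * expR (- (b * `|m|)) ->
  normc (lint p g T1 T2 Z m (polar s xi)) <= A * expR (- ((b - B) * `|m|)) *
    expR (nu * s ^+ k' - sin delta * (s / normc T2) ^+ k2 p - sin delta * (s / normc T1) ^+ k1 p).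
Proof.
move=> A0 d0 T10 T20 dx ZB s0 gA.
have [h1 h2] := decay_Re (ltW d0) T10 T20 dx.
have n1 := normc_gt0 T10; have n2 := normc_gt0 T20.
have hk : normc (expkernel p T1 T2 (polar s xi)) <=
    expR (- (sin delta * (s / normc T2) ^+ k2 p) - sin delta * (s / normc T1) ^+ k1 p).
  rewrite normc_expkernel ler_expR.
  have e1 : sin delta * (s / normc T1) ^+ k1 p <= s ^+ k1 p * complex.Re ((expi xi / T1) ^+ k1 p).
    rewrite expr_div_n mulrCA; apply: ler_wpM2l; [by rewrite exprn_ge0// ltW|exact: ltW].
  have e2 : sin delta * (s / normc T2) ^+ k2 p <= s ^+ k2 p * complex.Re ((expi xi / T2) ^+ k2 p).
    rewrite expr_div_n mulrCA; apply: ler_wpM2l; [by rewrite exprn_ge0// ltW|exact: ltW].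
  by move: e1 e2; clear; lra.
rewrite /lint normcM normcV (normc_polar _ (ltW s0)) 2!normcM ler_pdivrMr//.
have hz := normc_cexp_strip m ZB.
apply: le_trans (ler_pM (mulr_ge0 (normc_ge0 _) (normc_ge0 _)) (normc_ge0 _) (ler_pM (normc_ge0 _) (normc_ge0 _) gA hk) hz) _.
have -> : - ((b - B) * `|m|) = - (b * `|m|) + B * `|m| by ring.
have -> : nu * s ^+ k' - sin delta * (s / normc T2) ^+ k2 p - sin delta * (s / normc T1) ^+ k1 p =
  nu * s ^+ k' + (- (sin delta * (s / normc T2) ^+ k2 p) - sin delta * (s / normc T1) ^+ k1 p) by ring.
by rewrite !expRD le_eqVlt; apply/orP; left; apply/eqP; ring.
Qed.

Lemma lint0 p g T1 T2 Z (m xi : R) : lint p g T1 T2 Z m (polar 0 xi) = 0.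
Proof.
have -> : polar 0 xi = 0 :> C by rewrite /polar mul0r.
by rewrite /lint invr0 mulr0.
Qed.

Lemma pow_div_le (s x a : R) (k : nat) : 0 <= s -> 0 < x -> x <= a ->
  s ^+ k / a ^+ k <= (s / x) ^+ k.
Proof.
move=> s0 x0 xa; have a0 : 0 < a by exact: lt_le_trans xa.
rewrite expr_div_n; apply: ler_wpM2l; first by rewrite exprn_ge0.
rewrite lef_pV2 ?posrE ?exprn_gt0//.
by apply: lerXn2r => //; rewrite nnegrE ltW.
Qed.

(** The integral of exp (- c s / |T|) over the half-line is |T| / c, hence bounds linear in |T1| and
    in |T2|. They give at once the boundedness of the outer solutions and their zero initial
    data. *)
Lemma Lap_le p S (k' : nat) (A nu b B delta a : R) : (1 <= k1 p)%N -> (k' < k2 p)%N -> (1 < k2 p)%N ->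
  B < b -> 0 < delta -> delta < pi / 2 -> 0 < a -> 0 <= nu -> 0 <= A -> arcdom S (pi / (k2 p)%:R) ->
  exists2 K : R, 0 <= K & forall g (xi : R) T1 T2 Z, admg S k' A nu b g -> S (expi xi) ->
    T1 != 0 -> T2 != 0 -> normc T2 <= a -> decay_direction p delta T1 T2 xi -> `|complex.Im Z| <= B ->
    normc (Lap p g xi T1 T2 Z) <= K * normc T1 /\ normc (Lap p g xi T1 T2 Z) <= K * normc T2.
Proof.
move=> k11 kk k21 Bb d0 d2 a0 nu0 A0 aS.
have sd : 0 < sin delta.
  by apply: sin_gt0_pi; rewrite d0 /=; have := pi_gt0 R; move: d2; clear; lra.
pose c := sin delta / 2; have c0 : 0 < c by rewrite divr_gt0.
have ca0 : 0 < c / a ^+ k2 p by rewrite divr_gt0// exprn_gt0.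
have [A' A'0 HA'] := growth 0 ca0 kk k21 nu0.
have w0 : 0 < pi / (k2 p)%:R :> R.
  by rewrite divr_gt0 ?pi_gt0// ltr0n; apply: leq_trans k21.
have Bb' : 0 < b - B by rewrite subr_gt0.
pose I := Rintegral mu [set: R] (fun m : R => expR (- ((b - B) * `|m|))).
have I0 : 0 <= I by apply: Rintegral_ge0 => // x _; exact: expR_ge0.
(* [A'] bounds the growth absorbed by half of the [T2] factor; [expR c] is the price of replacing
   the power of s / |T| by its first power in [exp_pow_le]. *)
pose M := A * A' * expR c.
have M0 : 0 <= M by rewrite !mulr_ge0 ?expR_ge0.
pose K := 4 * (M / c) * I.
exists K; first by apply: mulr_ge0 => //; apply: mulr_ge0 => //; apply: divr_ge0 => //; exact: ltW.
move=> g xi T1 T2 Z ag Sx T10 T20 Ta dx ZB.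
have n1 := normc_gt0 T10; have n2 := normc_gt0 T20.
have [_ _ dg bg mg] := ag.
have Sp (s : R) : 0 < s -> S (polar s xi) by exact: (arcdom_polar w0 aS Sx).
have [ko ck0] := decay_kernel_ok d0 T10 T20 Ta dx.
have [okr okm] := @admg_LapOk R p S _ k' A nu b _ B xi g T1 T2 Z kk k21 ck0 Bb ag w0 aS Sx ko ZB.
have kkp j : (0 < j)%N -> forall x : R, 0 <= x -> expR (- (c * x ^+ j)) <= expR c * expR (- (c * x)).
  by move=> j0 x x0; apply: exp_pow_le => //; exact: ltW.
have base s m : 0 < s -> normc (lint p g T1 T2 Z m (polar s xi)) <= A * expR (- ((b - B) * `|m|)) *
    expR (nu * s ^+ k' - sin delta * (s / normc T2) ^+ k2 p - sin delta * (s / normc T1) ^+ k1 p).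
  move=> s0; apply: lint_le => //.
  by have := bg (polar s xi) m (Sp s s0) (polar_neq0 _ s0); rewrite (normc_polar _ (ltW s0)).
have sT2 s : 0 < s -> s ^+ k2 p / a ^+ k2 p <= (s / normc T2) ^+ k2 p.
  by move=> s0; apply: pow_div_le => //; exact: ltW.
have gr s : 0 < s -> expR (nu * s ^+ k' - c * (s / normc T2) ^+ k2 p) <= A'.
  move=> s0; have := HA' s (ltW s0); rewrite expr0 mul1r => h.
  have h1 : A' * expR (- s) <= A' by rewrite ler_piMr// -expR0 ler_expR oppr_le0 ltW.
  apply: le_trans (le_trans h h1); rewrite ler_expR lerD2l lerN2 -mulrA.
  apply: ler_wpM2l (ltW c0) _ _ _; rewrite mulrC; exact: sT2.
have x0 T s : 0 < normc T -> 0 < s -> 0 <= s / normc T by move=> n s0; rewrite divr_ge0// ltW.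
have main T : 0 < normc T -> (T = T1 \/ T = T2) -> forall s m, 0 <= s ->
   normc (lint p g T1 T2 Z m (polar s xi)) <= M * expR (- ((b - B) * `|m|)) * expR (- (c / normc T * s)).
  move=> n TT s m; rewrite le_eqVlt => /predU1P[<-|s0].
    by rewrite lint0 normc0 !mulr_ge0 ?expR_ge0.
  apply: le_trans (base s m s0) _.
  have -> : M * expR (- ((b - B) * `|m|)) * expR (- (c / normc T * s)) =
     A * expR (- ((b - B) * `|m|)) * (A' * (expR c * expR (- (c * (s / normc T))))).
    have -> : c / normc T * s = c * (s / normc T) by rewrite mulrAC mulrA.
    by rewrite /M; ring.
  apply: ler_wpM2l; first by rewrite mulr_ge0 ?expR_ge0.
  have p1 : 0 <= (s / normc T1) ^+ k1 p by rewrite exprn_ge0// x0.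
  have p2 : 0 <= (s / normc T2) ^+ k2 p by rewrite exprn_ge0// x0.
  have sc : sin delta = c + c by rewrite /c; field.
  (* Half of the [T2] exponent absorbs the growth in both cases. The decay in s / |T| comes from the
     [T1] factor in the first case, and from the other half of the [T2] factor in the second. *)
  case: TT => TE.
    have e : nu * s ^+ k' - sin delta * (s / normc T2) ^+ k2 p - sin delta * (s / normc T1) ^+ k1 p <=
      (nu * s ^+ k' - c * (s / normc T2) ^+ k2 p) + (- (c * (s / normc T1) ^+ k1 p)).
      rewrite sc; have := mulr_ge0 (ltW c0) p1; have := mulr_ge0 (ltW c0) p2.
      by move: (_ ^+ k1 p) (_ ^+ k2 p) (s ^+ k') => y1 y2 y3; clear; lra.
    rewrite -ler_expR [in X in _ <= X]expRD in e; apply: le_trans e _.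
    by rewrite TE; apply: ler_pM; rewrite ?expR_ge0//; [exact: gr|apply: kkp => //; exact: x0].
  have e : nu * s ^+ k' - sin delta * (s / normc T2) ^+ k2 p - sin delta * (s / normc T1) ^+ k1 p <=
    (nu * s ^+ k' - c * (s / normc T2) ^+ k2 p) + (- (c * (s / normc T2) ^+ k2 p)).
    rewrite sc; have := mulr_ge0 (ltW c0) p1; have := mulr_ge0 (ltW c0) p2.
    by move: (_ ^+ k1 p) (_ ^+ k2 p) (s ^+ k') => y1 y2 y3; clear; lra.
  rewrite -ler_expR [in X in _ <= X]expRD in e; apply: le_trans e _.
  rewrite TE; apply: ler_pM; rewrite ?expR_ge0//; [exact: gr|apply: kkp; [exact: ltnW|exact: x0]].
have fin T : 0 < normc T -> (T = T1 \/ T = T2) -> normc (Lap p g xi T1 T2 Z) <= K * normc T.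
  move=> n TT; have cT : 0 < c / normc T by rewrite divr_gt0.
  have -> : K * normc T = 2 * Rintegral mu [set: R] (fun m : R => 2 * (M / (c / normc T)) * expR (- ((b - B) * `|m|))).
    rewrite (@RintegralZl _ _ R mu)//; last exact: integrable_exp_abs.
    by rewrite -/I /K; field; rewrite !gt_eqF.
  apply: le_Cintegral.
  - exact: measurableT.
  - by apply: Cintegrable_measC; [exact: measurableT|exact: okm].
  - by apply: RintegrableZ; [exact: measurableT|exact: integrable_exp_abs].
  - move=> m _.
    have -> : 2 * (M / (c / normc T)) * expR (- ((b - B) * `|m|)) = 2 * (M * expR (- ((b - B) * `|m|)) / (c / normc T)).
      by rewrite -[LHS]mulrA; congr (_ * _); exact: mulrAC.
    apply: le_ray_integral; first exact: cT.
      move=> s s0; apply: differentiable_continuous; apply: differentiable_lint_u;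
        [exact: T10|exact: T20|exact: polar_neq0|by apply: dg; exact: Sp].
    by move=> s s0; exact: main.
by split; apply: fin => //; [left|right].
Qed.

(* For |u| >= r, half of the decay of exp (- (u / T2) ^ k2) gives the flat
   factor and the other half absorbs the growth of g and g'. *)
Lemma Lap_flat p S S' (k' : nat) (A nu b B delta r rho rho2 emax : R) :
  (1 <= k1 p)%N -> (k' < k2 p)%N -> (1 < k2 p)%N ->
  B < b -> 0 < delta -> delta < pi / 2 -> 0 < r -> r < rho -> 0 < rho2 -> 0 < emax ->
  0 <= nu -> 0 <= A -> arcdom S (pi / (k2 p)%:R) -> arcdom S' (pi / (k2 p)%:R) ->
  exists K D : R, [/\ 0 <= K, 0 < D & forall g g' (xi xi' : R) T1 T2 Z (eps : C),
    admg S k' A nu b g -> admg S' k' A nu b g' -> S (expi xi) -> S' (expi xi') ->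
    (forall m (tau : C), normc tau < rho -> differentiable (g ^~ m) tau) ->
    (forall m (tau : C), normc tau <= rho -> tau != 0 -> g tau m = g' tau m /\
       normc (g tau m) <= A * normc tau * expR (nu * normc tau ^+ k') * expR (- (b * `|m|))) ->
    T1 != 0 -> T2 != 0 -> eps != 0 -> normc eps <= emax -> normc T2 <= normc eps ^+ lam2 p * rho2 ->
    decay_direction p delta T1 T2 xi -> decay_direction p delta T1 T2 xi' -> `|complex.Im Z| <= B ->
    normc (Lap p g xi T1 T2 Z - Lap p g' xi' T1 T2 Z) <=
      K * expR (- (D / normc eps ^+ (lam2 p * k2 p)))].
Proof.
move=> k11 kk k21 Bb d0 d2 r0 rrho r20 em0 nu0 A0 aS aS'.
have sd : 0 < sin delta.
  by apply: sin_gt0_pi; rewrite d0 /=; have := pi_gt0 R; move: d2; clear; lra.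
pose c := sin delta / 2; have c0 : 0 < c by rewrite divr_gt0.
(* An upper bound for |T2|, which makes the growth constant [A'] independent of the point. *)
pose a := emax ^+ lam2 p * rho2; have a0 : 0 < a by rewrite mulr_gt0// exprn_gt0.
have ca0 : 0 < c / a ^+ k2 p by rewrite divr_gt0// exprn_gt0.
have [A' A'0 HA'] := growth 0 ca0 kk k21 nu0.
have w0 : 0 < pi / (k2 p)%:R :> R.
  by rewrite divr_gt0 ?pi_gt0// ltr0n; apply: leq_trans k21.
have wpi : pi / (k2 p)%:R <= pi :> R.
  by rewrite ler_piMr ?(ltW (pi_gt0 R))// invf_le1 ?ler1n ?ltr0n; exact: ltnW.
have Bb' : 0 < b - B by rewrite subr_gt0.
pose I := Rintegral mu [set: R] (fun m : R => expR (- ((b - B) * `|m|))).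
have I0 : 0 <= I by apply: Rintegral_ge0 => // x _; exact: expR_ge0.
(* For |u| >= r and |T2| <= |eps|^lam2 rho2 one has c (|u| / |T2|)^k2 >= D / |eps|^(lam2 k2). *)
pose D := c * r ^+ k2 p / rho2 ^+ k2 p.
have D0 : 0 < D by rewrite divr_gt0 ?exprn_gt0// mulr_gt0 ?exprn_gt0.
(* The first term is the arc of radius r, whose angle is at most pi / k2 <= pi; the second collects
   the two tails. *)
pose N := 2 * (A * A' * r * pi) + 4 * (A * A').
have N0 : 0 <= N by rewrite addr_ge0// !mulr_ge0// ltW// pi_gt0.
exists (2 * N * I), D; split; [by rewrite !mulr_ge0|exact: D0|].
move=> g g' xi xi' T1 T2 Z eps ag ag' Sx Sx' dg0 gg' T10 T20 e0 eem Te dx dx' ZB.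
have n1 := normc_gt0 T10; have n2 := normc_gt0 T20; have ne := normc_gt0 e0.
set flat := expR _.
have Ta : normc T2 <= a.
  apply: le_trans Te _; apply: ler_wpM2r; first exact: ltW.
  by apply: lerXn2r => //; rewrite nnegrE; exact: ltW.
have [_ _ dg bg mg] := ag; have [_ _ dg' bg' mg'] := ag'.
have Sp (s : R) : 0 < s -> S (polar s xi) by exact: (arcdom_polar w0 aS Sx).
have Sp' (s : R) : 0 < s -> S' (polar s xi') by exact: (arcdom_polar w0 aS' Sx').
have [ko ck0] := decay_kernel_ok d0 T10 T20 Ta dx.
have [ko' ck0'] := decay_kernel_ok d0 T10 T20 Ta dx'.
have [okr okm] := @admg_LapOk R p S _ k' A nu b _ B xi g T1 T2 Z kk k21 ck0 Bb ag w0 aS Sx ko ZB.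
have [okr' okm'] := @admg_LapOk R p S' _ k' A nu b _ B xi' g' T1 T2 Z kk k21 ck0' Bb ag' w0 aS' Sx' ko' ZB.
have [x2 [e2 h2 hz]] := arc_between k11 k21 (ltW d0) T10 T20 dx dx'.
have sT2 s : 0 < s -> s ^+ k2 p / a ^+ k2 p <= (s / normc T2) ^+ k2 p.
  by move=> s0; apply: pow_div_le => //; exact: ltW.
have gr s : 0 < s -> expR (nu * s ^+ k' - c * (s / normc T2) ^+ k2 p) <= A' * expR (- s).
  move=> s0; have := HA' s (ltW s0); rewrite expr0 mul1r => h.
  apply: le_trans h; rewrite ler_expR lerD2l lerN2 -mulrA.
  apply: ler_wpM2l (ltW c0) _ _ _; rewrite mulrC; exact: sT2.
have gb f s t m : 0 < s -> decay_direction p delta T1 T2 t ->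
   normc (f (polar s t) m) <= A * normc (polar s t : C) * expR (nu * normc (polar s t : C) ^+ k') * expR (- (b * `|m|)) ->
   normc (lint p f T1 T2 Z m (polar s t)) <= A * expR (- ((b - B) * `|m|)) *
     ((A' * expR (- s)) * expR (- (c * (s / normc T2) ^+ k2 p))).
  move=> s0 dt; rewrite (normc_polar _ (ltW s0)) => hf.
  apply: le_trans (lint_le A0 d0 T10 T20 dt ZB s0 hf) _.
  apply: ler_wpM2l; first by rewrite mulr_ge0 ?expR_ge0.
  have p1 : 0 <= (s / normc T1) ^+ k1 p by rewrite exprn_ge0// divr_ge0// ltW.
  have sc : sin delta = c + c by rewrite /c; field.
  have e : nu * s ^+ k' - sin delta * (s / normc T2) ^+ k2 p - sin delta * (s / normc T1) ^+ k1 p <=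
      (nu * s ^+ k' - c * (s / normc T2) ^+ k2 p) + (- (c * (s / normc T2) ^+ k2 p)).
    rewrite sc; have := mulr_ge0 (ltW c0) p1.
    by move: (_ ^+ k1 p) (_ ^+ k2 p) (s ^+ k') => y1 y2 y3; clear; lra.
  rewrite -ler_expR [in X in _ <= X]expRD in e; apply: le_trans e _.
  by apply: ler_wpM2r; [exact: expR_ge0|exact: gr].
have fl s : r <= s -> expR (- (c * (s / normc T2) ^+ k2 p)) <= flat.
  move=> rs; rewrite /flat ler_expR lerN2 /D exprM -mulrA -mulrA.
  apply: ler_wpM2l (ltW c0) _ _ _.
  have q0 : 0 < normc eps ^+ lam2 p * rho2 by rewrite mulr_gt0// exprn_gt0.
  have -> : r ^+ k2 p * (rho2 ^- k2 p / normc eps ^+ lam2 p ^+ k2 p) = (r / (normc eps ^+ lam2 p * rho2)) ^+ k2 p.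
    by rewrite expr_div_n exprMn invfM; congr (_ * _); exact: mulrC.
  have q1 : r / (normc eps ^+ lam2 p * rho2) <= s / normc T2.
    apply: ler_pM => //; first exact: ltW.
      by rewrite invr_ge0 ltW.
    by rewrite lef_pV2 ?posrE.
  apply: lerXn2r => //; rewrite nnegrE; apply: divr_ge0 => //; try exact: ltW.
  exact: le_trans (ltW r0) rs.
have fl0 : 0 <= flat by exact: expR_ge0.
(* The second ray is described by the shifted angle [x2], which has the same unit vector as xi' and
   is joined to [xi] by a short arc of decay directions. *)
have E2 m : ray_integral xi' (lint p g' T1 T2 Z m) = ray_integral x2 (lint p g' T1 T2 Z m).
  by rewrite /ray_integral /ray_integrand e2.
have p2 (s : R) : polar s x2 = polar s xi' :> C by rewrite /polar e2.
have jump m : normc (ray_integral xi (lint p g T1 T2 Z m) - ray_integral xi' (lint p g' T1 T2 Z m)) <=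
   N * flat * expR (- ((b - B) * `|m|)).
  rewrite E2; set Em := expR (- _).
  have Em0 : 0 <= Em by exact: expR_ge0.
  have e1 s : 0 <= s -> expR (- s) <= 1 by move=> s0; rewrite -expR0 ler_expR oppr_le0.
  have cr (s t : R) : 0 < s <= r -> normc (polar s t : C) <= rho.
    by move=> /andP[s0 sr]; rewrite (normc_polar _ (ltW s0)) (le_trans sr)// ltW.
  have bnd1 s t : 0 < s <= r -> Num.min xi x2 <= t <= Num.max xi x2 ->
     normc (lint p g T1 T2 Z m (polar s t)) <= A * Em * ((A' * expR (- s)) * expR (- (c * (s / normc T2) ^+ k2 p))).
    move=> sr ht; have /andP[s0 _] := sr; apply: gb => //; first exact: hz.
    exact: (gg' m _ (cr s t sr) (polar_neq0 _ s0)).2.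
  have le1 s : 0 <= s -> expR (- (c * (s / normc T2) ^+ k2 p)) <= 1.
    by move=> s0; rewrite -expR0 ler_expR oppr_le0 mulr_ge0 ?(ltW c0)// exprn_ge0// divr_ge0// ltW.
  have := @ray_jump R (lint p g T1 T2 Z m) (lint p g' T1 T2 Z m) r xi x2 (A * Em * A') (A * Em * A' * flat)
    (A * Em * A' * flat) r0.
  have H1 : forall s t, 0 < s <= r -> Num.min xi x2 <= t <= Num.max xi x2 ->
     differentiable (lint p g T1 T2 Z m) (polar s t).
    move=> s t sr ht; have /andP[s0 sr'] := sr.
    apply: differentiable_lint_u; [exact: T10|exact: T20|exact: polar_neq0|].
    by apply: dg0; rewrite (normc_polar _ (ltW s0)) (le_lt_trans sr').
  have H2 : forall s t, 0 <= s <= r -> Num.min xi x2 <= t <= Num.max xi x2 ->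
     lint p g T1 T2 Z m (polar s t) = lint p g' T1 T2 Z m (polar s t).
    move=> s t /andP[]; rewrite le_eqVlt => /predU1P[<-|s0] sr ht; first by rewrite !lint0.
    have sr' : 0 < s <= r by rewrite s0.
    by rewrite /lint (gg' m _ (cr s t sr') (polar_neq0 _ s0)).1.
  have H3 : forall s t, 0 <= s <= r -> Num.min xi x2 <= t <= Num.max xi x2 ->
     normc (lint p g T1 T2 Z m (polar s t)) <= A * Em * A'.
    move=> s t /andP[]; rewrite le_eqVlt => /predU1P[<-|s0] sr ht; first by rewrite lint0 normc0 !mulr_ge0.
    have sr' : 0 < s <= r by rewrite s0.
    apply: le_trans (bnd1 s t sr' ht) _; apply: ler_wpM2l; first by rewrite mulr_ge0.
    rewrite -[X in _ <= X]mulr1; apply: ler_pM; rewrite ?mulr_ge0 ?expR_ge0//; last by apply: le1; exact: ltW.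
    by rewrite ler_piMr//; apply: e1; exact: ltW.
  have H4 : forall t, Num.min xi x2 <= t <= Num.max xi x2 ->
     normc (lint p g T1 T2 Z m (polar r t)) <= A * Em * A' * flat.
    move=> t ht; have rr : 0 < r <= r by rewrite r0 lexx.
    apply: le_trans (bnd1 r t rr ht) _; rewrite -[X in _ <= X]mulrA; apply: ler_wpM2l; first by rewrite mulr_ge0.
    apply: ler_pM; rewrite ?mulr_ge0 ?expR_ge0//; last exact: fl.
    by rewrite ler_piMr//; apply: e1; exact: ltW.
  have T5 f t s : r <= s -> decay_direction p delta T1 T2 t ->
     normc (f (polar s t) m) <= A * normc (polar s t : C) * expR (nu * normc (polar s t : C) ^+ k') * expR (- (b * `|m|)) ->
     normc (lint p f T1 T2 Z m (polar s t)) <= A * Em * A' * flat * expR (- s).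
    move=> rs dt hf; have s0 : 0 < s by exact: lt_le_trans rs.
    apply: le_trans (gb f s t m s0 dt hf) _.
    have -> : A * Em * A' * flat * expR (- s) = A * Em * ((A' * expR (- s)) * flat) by ring.
    apply: ler_wpM2l; first by rewrite mulr_ge0.
    by apply: ler_wpM2l; [rewrite mulr_ge0 ?expR_ge0|exact: fl].
  have H5 : forall s, r <= s -> normc (lint p g T1 T2 Z m (polar s xi)) <= A * Em * A' * flat * expR (- s).
    move=> s rs; have s0 : 0 < s by exact: lt_le_trans rs.
    by apply: T5 => //; apply: bg; [exact: Sp|exact: polar_neq0].
  have H6 : forall s, r <= s -> normc (lint p g' T1 T2 Z m (polar s x2)) <= A * Em * A' * flat * expR (- s).
    move=> s rs; have s0 : 0 < s by exact: lt_le_trans rs.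
    by rewrite p2; apply: T5 => //; apply: bg'; [exact: Sp'|exact: polar_neq0].
  have H7 : ray_integrable x2 (lint p g' T1 T2 Z m).
    by have := okr' m; rewrite /ray_integrable /ray_integrand e2.
  move=> /(_ H1 H2 H3 H4 H5 H6 (okr m) H7) H; apply: le_trans H _.
  have x2pi : `|x2 - xi| <= pi by rewrite distrC; apply: le_trans (ltW h2) wpi.
  have -> : N * flat * Em = 2 * (A * Em * A' * flat * r * pi) + 4 * (A * Em * A' * flat) by rewrite /N; ring.
  have q0 : 0 <= A * Em * A' * flat by rewrite !mulr_ge0.
  apply: lerD; apply: ler_wpM2l => //.
    by apply: ler_wpM2l => //; rewrite mulr_ge0// ltW.
  by rewrite ler_piMr//; apply: e1; exact: ltW.
rewrite /Lap -CintegralB; [|exact: measurableT|exact: okm|exact: okm'].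
have -> : 2 * N * I * flat = 2 * Rintegral mu [set: R] (fun m : R => N * flat * expR (- ((b - B) * `|m|))).
  rewrite (@RintegralZl _ _ R mu)//; last exact: integrable_exp_abs.
  by rewrite -/I; ring.
apply: le_Cintegral.
- exact: measurableT.
- apply: Cintegrable_measC; first exact: measurableT.
  by apply: CintegrableB; [exact: measurableT|exact: okm|exact: okm'].
- by apply: RintegrableZ; [exact: measurableT|exact: integrable_exp_abs].
- by move=> m _; exact: jump.
Qed.

End OuterBounds.

(** * The space of the four variables; limits at the vertex *)

Section ProductSpaces.
Variable R : realType.
Local Notation C := (Cx R).

Lemma nv_prod (V W : normedModType R[i]) (x : V * W) : nv x = Num.max (nv x.1) (nv x.2).
Proof.
rewrite {1}/nv prod_normE !nvE /Order.max ltcR.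
by case: ifP.
Qed.

Lemma differentiable_lin (V : normedModType R[i]) (f : V -> C) (x : V) :
  linear f -> (forall v, normc (f v) <= nv v) -> differentiable f x.
Proof.
move=> lf fb; pose L : {linear V -> C} := HB.pack f (GRing.isLinear.Build _ _ _ _ f lf).
have [||d _] := @has_diff_differentiable R V f x L 1.
- by move=> h; rewrite mul1r; exact: fb.
- move=> e e0; exists 1 => // h _; rewrite /= (_ : f (x + h) = f x + f h).
    have -> : f x + f h - f x - f h = 0 by ring.
    by rewrite normc0 mulr_ge0 ?nv_ge0// ltW.
  by have := lf 1 x h; rewrite !scale1r.
- exact: d.
Qed.

Local Notation V4 := (C * C * C * C)%type.

Lemma nv_proj4 (v : V4) :
  [/\ normc v.1.1.1 <= nv v, normc v.1.1.2 <= nv v, normc v.1.2 <= nv v & normc v.2 <= nv v].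
Proof.
have := nv_prod v; have := nv_prod v.1; have := nv_prod v.1.1; rewrite !nvC => e1 e2 e3.
have a1 : nv v.1 <= nv v by rewrite e3 le_max lexx.
have a2 : nv v.1.1 <= nv v.1 by rewrite e2 le_max lexx.
have a3 := le_trans a2 a1.
split.
- by apply: le_trans a3; rewrite e1 le_max lexx.
- by apply: le_trans a3; rewrite e1 le_max lexx orbT.
- by apply: le_trans a1; rewrite e2 le_max lexx orbT.
- by rewrite e3 le_max lexx orbT.
Qed.

Lemma differentiable_proj4 (x : V4) :
  [/\ differentiable (fun y : V4 => y.1.1.1) x, differentiable (fun y : V4 => y.1.1.2) x,
      differentiable (fun y : V4 => y.1.2) x & differentiable (fun y : V4 => y.2) x].
Proof.
split; apply: differentiable_lin; try by [].
- by move=> v; have [] := nv_proj4 v.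
- by move=> v; have [] := nv_proj4 v.
- by move=> v; have [] := nv_proj4 v.
- by move=> v; have [] := nv_proj4 v.
Qed.

Lemma within_nbhs0 (D : set C) (f : C -> C) (K : R) : 0 <= K ->
  (forall t, D t -> normc (f t) <= K * normc t) -> f @ within D (nbhs (0 : C)) --> (0 : C).
Proof.
move=> K0 fK; apply/cvgCP => e e0.
have K1 : 0 < K + 1 by rewrite ltr_wpDl.
have H : nbhs (0 : C) [set t | D t -> normc (f t - 0) < e].
  apply/nbhsVP; exists (e / (K + 1)); first by rewrite divr_gt0.
  move=> t; rewrite nvC subr0 ltr_pdivlMr// => te Dt; rewrite subr0.
  apply: le_lt_trans (fK t Dt) _; apply: le_lt_trans te.
  by rewrite mulrC; apply: ler_wpM2l; [exact: normc_ge0|rewrite lerDl].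
exact: H.
Qed.

End ProductSpaces.

Theorem theorem2 (R : realType) (p : problem R)
  (hk1 : (1 <= k1 p)%N) (hk12 : (k1 p < k2 p)%N)
  (hD1 : (2 <= D1 p)%N) (hD2 : (2 <= D2 p)%N)
  (hlam1 : (1 <= lam1 p)%N) (hlam2 : (1 <= lam2 p)%N)
  (hlamk : (lam1 p * k1 p < lam2 p * k2 p)%N)
  (hDelta : Dl p (D1 p) (D2 p) =
     (lam1 p * k1 p * dl1 p (D1 p) + lam2 p * k2 p * dl2 p (D2 p))%N)
  (hDl : forall l1 l2 : nat, (1 <= l1 < D1 p)%N -> (1 <= l2 < D2 p)%N ->
     (lam1 p * k1 p * dl1 p l1 + lam2 p * k2 p * dl2 p l2 < Dl p l1 l2)%N)
  (hdl : forall l1 l2 : nat, (1 <= l1 < D1 p)%N -> (1 <= l2 < D2 p)%N ->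
     (k1 p * dl1 p l1 + k2 p * dl2 p l2 <=
      k1 p * dl1 p (D1 p) + k2 p * dl2 p (D2 p))%N)
  (hdeg : forall l1 l2 : nat, (1 <= l1 < D1 p)%N -> (1 <= l2 < D2 p)%N ->
     (size (Rl p l1 l2) <= size (Rl p (D1 p) (D2 p)))%N)
  (hRnz : forall m : R, (Rl p (D1 p) (D2 p)).['i * m%:C] != 0)
  (rA1 rA2 alpha alpha' : R)
  (hr12 : 0 < rA1 < rA2) (halpha : alpha < alpha')
  (hA : forall m : R,
     let w : Cx R := (Q p).['i * m%:C] / (Rl p (D1 p) (D2 p)).['i * m%:C] in
     rA1 <= normc w <= rA2 /\
     exists theta : R, alpha < theta < alpha' /\ is_arg w theta)
  (beta nu mu eps0 : R) (k' : nat)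
  (hbeta : 0 < beta) (hnu : 0 < nu) (hmu1 : 1 < mu)
  (hmu : forall l1 l2 : nat, (1 <= l1 < D1 p)%N -> (1 <= l2 < D2 p)%N ->
     1 + ((size (Rl p l1 l2)).-1)%:R < mu)
  (hk' : (k1 p < k' < k2 p)%N)
  (heps0 : 0 < eps0)
  (Cbound : nat -> nat -> R)
  (hC : forall l1 l2 : nat, (1 <= l1 < D1 p)%N -> (1 <= l2 < D2 p)%N ->
     forall eps : Cx R, disc eps0 eps ->
       E_space beta mu (fun m => Cl p l1 l2 m eps) /\
       (E_norm beta mu (fun m => Cl p l1 l2 m eps) <= (Cbound l1 l2)%:E)%E)
  (hc : forall l1 l2 : nat, (1 <= l1 < D1 p)%N -> (1 <= l2 < D2 p)%N ->
     holomorphic_on (strip beta `*` disc eps0)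
       (fun x : Cx R * Cx R => ccoef p l1 l2 x.1 x.2))
  (Cpsi : R) (hCpsi : 0 < Cpsi)
  (hpsi_tau : forall (m : R) (eps : Cx R), disc eps0 eps ->
     holomorphic_on [set: Cx R] (fun tau : Cx R => psi p tau m eps))
  (hpsi_m : forall tau eps : Cx R, disc eps0 eps ->
     continuous (fun m : R => psi p tau m eps))
  (hpsi_eps : forall (tau : Cx R) (m : R),
     holomorphic_on (disc eps0) (fun eps : Cx R => psi p tau m eps))
  (hpsi : forall (tau : Cx R) (m : R) (eps : Cx R), disc eps0 eps ->
     normc (psi p tau m eps) <=
       Cpsi * (1 + `|m|) `^ (- mu) * expR (- beta * `|m|)
       * expR (nu * normc tau ^+ k') * normc tau)
  (U : set (Cx R)) (rho : R)
  (hU : union_of_unbounded_sectors U)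
  (hUnot : ~ exists2 r : R, 0 < r & [set z | 0 < normc z < r] `<=` U)
  (hUroot : forall (m : R) (q : Cx R), root (Pm p m) q -> U q)
  (hrho : 0 < rho)
  (hrhoroot : forall (m : R) (q : Cx R), root (Pm p m) q -> 2 * rho <= normc q)
  (iota1 : nat) (hiota1 : (2 <= iota1)%N)
  (E : 'I_iota1 -> set (Cx R))
  (hE : good_covering eps0 (pi / (lam2 p * k2 p)%:R) E)
  (T1 T2 : set (Cx R))
  (hT1 : bounded_sector T1) (hT2 : unbounded_sector T2)
  (d aS : 'I_iota1 -> R)
  (* An opening at most 2 pi - pi / k2 (automatic when P_m has degree >= 2)
     makes the directions allowed at a given point form a single arc. *)
  (haS : forall h, 0 < aS h <= 2 * pi - pi / (k2 p)%:R)
  (hS : forall h, suitable p U rho (sector (d h) (aS h) +oo%E))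
  (varpi : R) (hvarpi : 0 < varpi)
  (hcontr : forall (h : 'I_iota1) (eps : Cx R), disc eps0 eps ->
     half_contraction p (sector (d h) (aS h) +oo%E) rho nu beta mu k' varpi eps)
  (omega : 'I_iota1 -> Cx R -> R -> Cx R -> Cx R)
  (homega : forall (h : 'I_iota1) (eps : Cx R), disc eps0 eps ->
     is_Hfixpoint p (sector (d h) (aS h) +oo%E) rho nu beta mu k' varpi eps
       (fun tau m => omega h tau m eps))
  (xi : 'I_iota1 -> Cx R -> Cx R -> Cx R -> R)
  (hadm : admissible p T1 T2 E (fun h => sector (d h) (aS h) +oo%E) xi)
  (rho2 beta' : R) (hrho2 : 0 < rho2) (hbeta' : 0 < beta' < beta) :
  let u (h : 'I_iota1) : Cfun4 R := outer_solution p (omega h) (xi h) in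
  let T2' : set (Cx R) := T2 `&` disc rho2 in
  (forall h : 'I_iota1,
     [/\ forall t1 t2 z eps : Cx R, T1 t1 -> T2' t2 -> strip beta' z -> E h eps ->
           outer_defined p (omega h) (xi h) t1 t2 z eps,
         holomorphic_on (T1 `*` T2' `*` strip beta' `*` E h)
           (fun x : Cx R * Cx R * Cx R * Cx R => u h x.1.1.1 x.1.1.2 x.1.2 x.2),
         exists M : R, forall t1 t2 z eps : Cx R,
           T1 t1 -> T2' t2 -> strip beta' z -> E h eps ->
           normc (u h t1 t2 z eps) <= M,
         forall t1 t2 z eps : Cx R, T1 t1 -> T2' t2 -> strip beta' z -> E h eps ->
           solves_at p (u h) t1 t2 z eps &
         (* the initial data, as boundary values at t1 = 0 and at t2 = 0 *)
         (forall t2 z eps : Cx R, T2' t2 -> strip beta' z -> E h eps ->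
            (fun t1 : Cx R => u h t1 t2 z eps) @ within T1 (nbhs (0 : Cx R))
              --> (0 : Cx R)) /\
         (forall t1 z eps : Cx R, T1 t1 -> strip beta' z -> E h eps ->
            (fun t2 : Cx R => u h t1 t2 z eps) @ within T2' (nbhs (0 : Cx R))
              --> (0 : Cx R))]) /\
  (forall h : 'I_iota1, exists Chat Dhat : R,
     [/\ 0 < Chat, 0 < Dhat &
       forall eps : Cx R, (E h `&` E (ordS h)) eps ->
         (ereal_sup [set x | exists t1 t2 z : Cx R,
            [/\ T1 t1, T2' t2, strip beta' z &
             x = (normc (u (ordS h) t1 t2 z eps - u h t1 t2 z eps))%:E]]
          <= (Chat * expR (- (Dhat / normc eps ^+ (lam2 p * k2 p))))%:E)%E]).
Proof.
move=> u T2'.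
have [delta' d'0 ad'] := hadm.
(* The cap at pi / 4 ensures delta < pi / 2 without exhibiting a point of the sectors; a smaller
   margin is still admissible. *)
pose delta := Num.min delta' (pi / 4).
have d0 : 0 < delta by rewrite lt_min d'0 divr_gt0// pi_gt0.
have d2 : delta < pi / 2.
  by rewrite gt_min; apply/orP; right; have := pi_gt0 R; clear; lra.
pose S h : set (Cx R) := sector (d h) (aS h) +oo%E.
have ad h (t1 t2 eps : Cx R) : T1 t1 -> T2 t2 -> E h eps -> S h (expi (xi h t1 t2 eps)) /\
    decay_direction p delta (eps ^+ lam1 p * t1) (eps ^+ lam2 p * t2) (xi h t1 t2 eps).
  move=> h1 h2 h3; have [s1 s2] := ad' h t1 t2 eps h1 h2 h3; split; first exact: s1.
  by apply: decayW s2; rewrite ge_min lexx.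
have /andP[hk'1 kk] := hk'.
have k21 : (1 < k2 p)%N by exact: leq_ltn_trans hk1 hk12.
have k'0 : (0 < k')%N by exact: leq_ltn_trans hk'1.
have /andP[B0 Bb] := hbeta'.
have mu0 : 0 < mu by exact: lt_trans ltr01 hmu1.
have v0 : 0 <= varpi by exact: ltW.
have nu0 : 0 <= nu by exact: ltW.
have w0 : 0 < pi / (k2 p)%:R :> R.
  by rewrite divr_gt0 ?pi_gt0// ltr0n; exact: ltn_trans k21.
(* The bound [haS] on the openings enters here, with w = pi / k2, the length allowed by
   [arc_between]. *)
have aSd h : arcdom (S h) (pi / (k2 p)%:R).
  move=> x x'' s zeta xx Sx Sx'' s0 hz; have /andP[_ ha] := haS h.
  exact: (arc_sector w0 ha xx Sx Sx'' s0 hz).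
have [hEs hEd hEn _ _] := hE.
have E0 h eps : E h eps -> eps != 0.
  by have [c [a [r [_ _ _ ->]]]] := hEs h; exact: sector_neq0.
have Eo h (eps : Cx R) : E h eps -> exists2 r : R, 0 < r & forall y : Cx R, normc (y - eps) < r -> E h y.
  by have [c [a [r [_ _ _ ->]]]] := hEs h; exact: sector_open.
have T10 t : T1 t -> t != 0.
  by have [c [a [r [_ _ _ ->]]]] := hT1; exact: sector_neq0.
have T1o (t : Cx R) : T1 t -> exists2 r : R, 0 < r & forall y : Cx R, normc (y - t) < r -> T1 y.
  by have [c [a [r [_ _ _ ->]]]] := hT1; exact: sector_open.
have T20 t : T2' t -> t != 0.
  by move=> [+ _]; have [c [a [_ _ ->]]] := hT2; exact: sector_neq0.
have T2o (t : Cx R) : T2' t -> exists2 r : R, 0 < r & forall y : Cx R, normc (y - t) < r -> T2' y.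
  move=> [T2t dt].
  have [r r0 Hr] : exists2 r : R, 0 < r & forall y : Cx R, normc (y - t) < r -> T2 y.
    by move: T2t; have [c [a [_ _ ->]]] := hT2; exact: sector_open.
  have q0 : 0 < rho2 - normc t by rewrite subr_gt0.
  exists (Num.min r (rho2 - normc t)); first by rewrite lt_min r0.
  by move=> y; rewrite lt_min => /andP[y1 y2]; split; [exact: Hr|exact: disc_ball y2].
(* Uniform bound for |eps^lam2 t2|: eps is bounded by the covering and t2 by the disc of radius
   rho2. *)
pose a := eps0 ^+ lam2 p * rho2.
have a0 : 0 < a by apply: mulr_gt0; [exact: exprn_gt0|exact: hrho2].
have T2b h (eps t : Cx R) : E h eps -> T2' t -> normc (eps ^+ lam2 p * t) <= normc eps ^+ lam2 p * rho2.
  move=> he [_ dt]; rewrite normcM normcX; apply: ler_wpM2l; first by rewrite exprn_ge0// normc_ge0.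
  exact: ltW.
have ea h (eps : Cx R) : E h eps -> normc eps ^+ lam2 p * rho2 <= a.
  move=> he; apply: ler_wpM2r; first exact: ltW.
  by apply: lerXn2r; rewrite ?nnegrE ?normc_ge0 ?(ltW heps0)//; apply: ltW; exact: hEd he.
have T2a h (eps t : Cx R) : E h eps -> T2' t -> normc (eps ^+ lam2 p * t) <= a.
  by move=> he ht; exact: le_trans (T2b h eps t he ht) (ea h eps he).
have X0 h (eps t : Cx R) n : E h eps -> t != 0 -> eps ^+ n * t != 0.
  by move=> he t0; rewrite mulf_neq0// expf_neq0// (E0 h).
have hCb (l1 l2 : nat) : (1 <= l1 < D1 p)%N -> (1 <= l2 < D2 p)%N -> forall eps : Cx R, disc eps0 eps ->
    continuous (fun m => Cl p l1 l2 m eps) /\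
    forall m, normc (Cl p l1 l2 m eps) <= Cbound l1 l2 * expR (- (beta * `|m|)).
  move=> h1 h2 eps de; have [[cC _] bC] := hC l1 l2 h1 h2 eps de.
  by split; [exact: cC|exact: E_norm_bound mu0 bC].
have dC (l1 l2 : nat) : (1 <= l1 < D1 p)%N -> (1 <= l2 < D2 p)%N -> forall eps : Cx R, disc eps0 eps ->
    forall m, differentiable (Cl p l1 l2 m) eps.
  move=> h1 h2 eps de m; have rr : 0 < eps0 - normc eps by rewrite subr_gt0.
  apply: (@fourier_hol R (Cl p l1 l2) (Cbound l1 l2) beta _ eps hbeta rr).
    by move=> e er; apply: hCb => //; exact: disc_ball er.
  by move=> x e er; apply: (ccoef_slices hbeta (hc l1 l2 h1 h2)); exact: disc_ball er.
have dpsi (tau : Cx R) m (eps : Cx R) : disc eps0 eps -> differentiable (fun e => psi p tau m e) eps.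
  by move=> de; exact: hpsi_eps.
have apsi (eps : Cx R) : disc eps0 eps -> admg setT k' Cpsi nu beta (fun tau m => psi p tau m eps).
  move=> de; apply: (psi_admg mu0 (ltW hCpsi) nu0) => [m|tau|tau m]; [exact: hpsi_tau|exact: hpsi_m|exact: hpsi].
have aom h (eps : Cx R) : disc eps0 eps -> admg (S h) k' varpi nu beta (fun tau m => omega h tau m eps).
  by move=> de; apply: Exp_ball_admg mu0 v0 nu0 hrho (homega h eps de).1.
have dom h (tau : Cx R) : S h tau -> forall m (eps : Cx R), disc eps0 eps ->
    differentiable (fun e => omega h tau m e) eps.
  move=> St; apply: (@Hfixpoint_hol R p (S h) rho nu beta mu varpi eps0 Cbound k' tau (omega h) mu0 v0 hbeta).
  - exact: hcontr.
  - exact: homega.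
  - exact: hCb.
  - exact: dC.
  - by move=> m eps; exact: dpsi.
  - by left.
  - exact: sector_neq0 St.
have Hxi h (eps : Cx R) : E h eps -> forall t1 t2, T1 t1 -> T2' t2 -> S h (expi (xi h t1 t2 eps)) /\
    decay_direction p delta (eps ^+ lam1 p * t1) (eps ^+ lam2 p * t2) (xi h t1 t2 eps).
  by move=> he t1 t2 h1 [h2 _]; exact: ad.
pose fc := normc (fourier_cst R).
have fc0 : 0 <= fc by exact: normc_ge0.
have uE h t1 t2 z eps : u h t1 t2 z eps = fourier_cst R *
    Lap p (fun tau m => omega h tau m eps) (xi h t1 t2 eps) (eps ^+ lam1 p * t1) (eps ^+ lam2 p * t2) z.
  by [].
(* Both linear bounds are kept: the one in t1 and the one in t2 give the two initial conditions, and
   the latter also gives boundedness. *)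
have bnd h : exists2 K : R, 0 <= K & forall t1 t2 z eps : Cx R, T1 t1 -> T2' t2 -> strip beta' z -> E h eps ->
    normc (u h t1 t2 z eps) <= K * normc (eps ^+ lam1 p * t1) /\
    normc (u h t1 t2 z eps) <= K * normc (eps ^+ lam2 p * t2).
  have [K K0 HK] := @Lap_le R p (S h) k' varpi nu beta beta' delta a hk1 kk k21 Bb d0 d2 a0 nu0 v0 (aSd h).
  exists (fc * K); first exact: mulr_ge0.
  move=> t1 t2 z eps h1 h2 h3 h4; have [Sx dx] := Hxi h eps h4 t1 t2 h1 h2.
  have [l1 l2] := HK _ _ _ _ z (aom h eps (hEd h eps h4)) Sx (X0 h eps t1 _ h4 (T10 t1 h1))
    (X0 h eps t2 _ h4 (T20 t2 h2)) (T2a h eps t2 h4 h2) dx (ltW h3).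
  rewrite uE [normc _]normcM -/fc -!mulrA; split; exact: ler_wpM2l.
split.
- move=> h; split.
  + move=> t1 t2 z eps h1 h2 h3 h4.
    have ex : exadm (S h) k' beta (fun tau m => omega h tau m eps).
      by exists varpi, nu; exact: aom (hEd h eps h4).
    exact: (exadm_LapOk kk k21 d0 (aSd h) T10 T20 (E0 h eps h4) (fun t => T2a h eps t h4)
      (Hxi h eps h4) Bb ex h1 h2 h3).
  + move=> x [[[h1 h2] h3] h4].
    have [r1 r10 H1] := T1o _ h1; have [r2 r20 H2] := T2o _ h2; have [r4 r40 H4] := Eo h _ h4.
    have r30 : 0 < beta' - `|complex.Im x.1.2| by rewrite subr_gt0.
    pose r := Num.min (Num.min r1 r2) (Num.min (beta' - `|complex.Im x.1.2|) r4).
    have r0 : 0 < r by rewrite !lt_min r10 r20 r30.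
    have near (y : Cx R * Cx R * Cx R * Cx R) : nv (y - x) < r ->
       [/\ T1 y.1.1.1, T2' y.1.1.2, `|complex.Im y.1.2| < beta' & E h y.2].
      move=> yx; have [p1 p2 p3 p4] := nv_proj4 (y - x).
      move: yx; rewrite !lt_min => /andP[/andP[q1 q2] /andP[q3 q4]]; split.
      - by apply: H1; exact: le_lt_trans p1 q1.
      - by apply: H2; exact: le_lt_trans p2 q2.
      - have -> : complex.Im y.1.2 = complex.Im (y.1.2 - x.1.2) + complex.Im x.1.2 by rewrite cImB subrK.
        apply: le_lt_trans (ler_normD _ _) _; rewrite -ltrBrDr; apply: le_lt_trans q3.
        by apply: le_trans p3; exact: le_Im_normc.
      - by apply: H4; exact: le_lt_trans p4 q4.
    (* The normed space is the product of four copies of C, so joint holomorphy is obtained directly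
       and not variable by variable; omega depends on y through eps only. *)
    have [|||||dL _ _ _] := @Lap_diff_dir R _ p (S h) k' varpi nu beta beta' delta r a x
      (fun y tau m => omega h tau m y.2) (fun y => y.2 ^+ lam1 p * y.1.1.1) (fun y => y.2 ^+ lam2 p * y.1.1.2)
      (fun y => y.1.2) (fun y => xi h y.1.1.1 y.1.1.2 y.2) hk1 kk k21 Bb d0 r0 (aSd h).
    * move=> y _; have [p1 p2 p3 p4] := differentiable_proj4 y.
      split; [|exact: (differentiable_mul (differentiable_pow _ p4) p2)|exact: p3].
      exact: (differentiable_mul (differentiable_pow _ p4) p1).
    * move=> y yr; have [y1 y2 y3 y4] := near y yr.
      split; [exact: X0 y4 (T10 _ y1)|exact: X0 y4 (T20 _ y2)|exact: T2a y4 y2|exact: ltW].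
    * by move=> y yr; have [y1 y2 y3 y4] := near y yr; exact: Hxi.
    * by move=> y yr; have [y1 y2 y3 y4] := near y yr; exact: aom (hEd h _ y4).
    * move=> y tau m yr St; have [y1 y2 y3 y4] := near y yr; have [_ _ _ p4] := differentiable_proj4 y.
      exact: (differentiable_comp p4 (dom h tau St m _ (hEd h _ y4))).
    * exact: (differentiable_mul (differentiable_const _ x) dL).
  + have [K K0 HK] := bnd h; exists (K * a) => t1 t2 z eps h1 h2 h3 h4.
    apply: le_trans (HK t1 t2 z eps h1 h2 h3 h4).2 _.
    by apply: ler_wpM2l; [exact: K0|exact: T2a h4 h2].
  + move=> t1 t2 z eps h1 h2 h3 h4; have de := hEd h eps h4.
    have ex : exadm (S h) k' beta (fun tau m => omega h tau m eps).
      by exists varpi, nu; exact: aom.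
    have P0 m tau : S h tau -> (Pm p m).[tau] != 0.
      by move=> St; apply: (Pm_neq0 hrho (hS h) hrhoroot); left.
    apply: (@outer_pde R p (S h) k' T1 T2' eps delta beta' a rho nu beta mu varpi Cpsi Cbound
      (fun t1 t2 => xi h t1 t2 eps) (fun tau m => omega h tau m eps) (u h) hk1 kk k21 k'0 d0 (aSd h)
      T1o T2o T10 T20 (E0 h eps h4) (fun t => T2a h eps t h4) (Hxi h eps h4) hDelta _ _ B0 Bb (apsi eps de)
      ex (homega h eps de) P0 _ t1 t2 z h1 h2 h3).
    * by move=> l1 l2 g1 g2; apply: ltnW; exact: hDl.
    * by move=> l1 l2 g1 g2; exact: hCb.
    * by move=> s1 s2 x g1 g2 g3; exact: uE.
  + have [K K0 HK] := bnd h; split.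
    * move=> t2 z eps h2 h3 h4; apply: (@within_nbhs0 R T1 _ (K * normc (eps ^+ lam1 p))).
        by rewrite mulr_ge0 ?normc_ge0.
      by move=> t1 h1; rewrite -mulrA -normcM; exact: (HK t1 t2 z eps h1 h2 h3 h4).1.
    * move=> t1 z eps h1 h3 h4; apply: (@within_nbhs0 R T2' _ (K * normc (eps ^+ lam2 p))).
        by rewrite mulr_ge0 ?normc_ge0.
      by move=> t2 h2; rewrite -mulrA -normcM; exact: (HK t1 t2 z eps h1 h2 h3 h4).2.
- move=> h; set h' := ordS h.
  have r0 : 0 < rho / 2 by rewrite divr_gt0.
  have rr : rho / 2 < rho by rewrite ltr_pdivrMr// ltr_pMr// ltr1n.
  (* The arc has radius rho / 2, strictly inside the disc where omega is holomorphic. The sector of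
     [h'] comes first because the difference is u_(h') - u_h. *)
  have [K [D [K0 D0 HK]]] := @Lap_flat R p (S h') (S h) k' varpi nu beta beta' delta (rho / 2) rho rho2 eps0
    hk1 kk k21 Bb d0 d2 r0 rr hrho2 heps0 nu0 v0 (aSd h') (aSd h).
  (* The added 1 makes the constant positive even if [K] is 0. *)
  exists (fc * K + 1), D; split; [by rewrite ltr_wpDl// mulr_ge0|exact: D0|].
  move=> eps [he he']; have de := hEd h eps he.
  apply: ge_ereal_sup => _ [t1 [t2 [z [h1 h2 h3 ->]]]]; rewrite lee_fin.
  have [Sx dx] := Hxi h eps he t1 t2 h1 h2; have [Sx' dx'] := Hxi h' eps he' t1 t2 h1 h2.
  rewrite !uE -mulrBr normcM -/fc.
  set fl := expR _; have fl0 : 0 <= fl by exact: expR_ge0.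
  apply: (@le_trans _ _ (fc * (K * fl))); last by rewrite mulrA; apply: ler_wpM2r => //; rewrite lerDl.
  apply: ler_wpM2l => //.
  apply: (HK _ _ _ _ _ _ z eps (aom h' eps de) (aom h eps de) Sx' Sx) => //.
  + move=> m tau tr; have [[[_ hol _] _] _] := homega h' eps de.
    by apply: hol; right.
  (* On the closed disc of radius rho, which belongs to both domains, the two fixed points coincide;
     the point 0 is excluded, as the norms do not see it. *)
  + move=> m tau tr t0; split.
      by apply: (Hfixpoint_agree m mu0 v0 (hcontr h' eps de) (homega h' eps de) (hcontr h eps de) (homega h eps de));
        [right|right|].
    have [[_ hb] _] := homega h' eps de.
    by apply: (Exp_norm_bound mu0 hb) => //; right.
  + exact: X0 he (T10 _ h1).
  + exact: X0 he (T20 _ h2).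
  + exact: E0 he.
  + exact: ltW.
  + exact: T2b he h2.
  + exact: ltW.
Qed.
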